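(* One has $u_\infty(x)\le K_\infty(x)$ for all $x\in\overline\Omega$. Equality $u_\infty=K_\infty$ holds in $\overline\Omega$ if, and only if, $K_\infty$ is infinity harmonic outside of its coincidence set, i.e. in $\Omega\setminus\{K_\infty=\Psi\}$.
   Context: Setting: $\Omega\subset\mathbb{R}^d$ is a bounded smooth domain, $F$ is a Lipschitz function on $\partial\Omega$, and $\Psi:\overline\Omega\to\mathbb{R}$ is a continuous obstacle with $\sup_{\partial\Omega}\Psi<\inf_{\partial\Omega}F$. For $1<p<\infty$, $u_p$ denotes the unique minimizer of $\int_\Omega|Dv|^p\,dx$ among all $v\in W^{1,p}(\Omega)$ with trace $F$ on $\partial\Omega$ and $v\ge\Psi$ in $\Omega$. The function $u_\infty$ denotes the limit of $u_p$ (along a subsequence) as $p\to\infty$, the convergence being locally uniform in $\overline\Omega$ and weak in $W^{1,q}(\Omega)$ for every finite $q>1$ (such a limit exists and does not depend on the subsequence). For $y\in\partial\Omega$ and $b=(b_1,b_2)\in\mathbb{R}^2$ with $b_1\ge0$, let $K_y^b(x)=b_1|x-y|+b_2$. Let $\mathcal{K}$ be the family of all such cones $K_y^b$ (over all $y\in\partial\Omega$ and all such $b$) which satisfy $K_y^b(x)\ge F(x)$ for all $x\in\partial\Omega$ and $K_y^b(x)\ge\Psi(x)$ for all $x\in\Omega$. Define $K_\infty(x)=\inf_{K_y^b\in\mathcal{K}}K_y^b(x)$ for $x\in\overline\Omega$. The infinity Laplacian is $\Delta_\infty u=\sum_{i,j=1}^d u_{x_i}u_{x_j}u_{x_ix_j}$.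 A continuous function is infinity harmonic in an open set if it satisfies $\Delta_\infty u=0$ there in the viscosity sense. *)

(* Defs.v *)
From HB Require Import structures.
From mathcomp Require Import all_boot all_order all_algebra.
From mathcomp Require Import all_classical all_reals all_analysis.

Set Implicit Arguments.
Unset Strict Implicit.
Unset Printing Implicit Defensive.

Import Order.TTheory GRing.Theory Num.Theory.
Import numFieldNormedType.Exports.

Local Open Scope classical_set_scope.
Local Open Scope ring_scope.

(* The norm instance `|x| of 'rV[R]_d is the sup norm; the Euclidean one is
   needed for cones, gradients and diameters. *)
Definition enorm (R : realType) (d : nat) (x : 'rV[R]_d) : R :=
  Num.sqrt (\sum_(i < d) x ord0 i ^+ 2).

Definition boundary (T : topologicalType) (A : set T) : set T :=
  closure A `\` A°.

Definition rV_display : measure_display. Proof. exact. Qed.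

Section measurable_rV.
Variables (R : realType) (d : nat).

Let coord (i : 'I_d) (x : 'rV[R]_d) : measurableTypeR R := x ord0 i.

Let rV_set0 : g_sigma_preimage coord set0.
Proof. exact: sigma_algebra0. Qed.

Let rV_setC A : g_sigma_preimage coord A -> g_sigma_preimage coord (~` A).
Proof. exact: sigma_algebraC. Qed.

Let rV_bigcup (F : (set 'rV[R]_d)^nat) :
  (forall i, g_sigma_preimage coord (F i)) ->
  g_sigma_preimage coord (\bigcup_i (F i)).
Proof. exact: sigma_algebra_bigcup. Qed.

(* The product (= Borel) sigma-algebra, generated by the coordinates. *)
HB.instance Definition _ := @isMeasurable.Build rV_display 'rV[R]_d
  (g_sigma_preimage coord) rV_set0 rV_setC rV_bigcup.

End measurable_rV.

Lemma measurable_fun_rV d (T : measurableType d) (R : realType) (n : nat)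
    (f : T -> 'rV[R]_n) :
  (forall i, measurable_fun [set: T] (fun x => f x ord0 i)) ->
  measurable_fun [set: T] f.
Proof.
move=> mf _ A mA; rewrite setTI.
pose S := [set B : set 'rV[R]_n | measurable (f @^-1` B)].
suff : @measurable _ 'rV[R]_n `<=` S by apply.
apply: smallest_sub.
  split => [|B SB|F SF].
  - by rewrite /S/= preimage_set0.
  - by rewrite /S/= setTD preimage_setC; exact: measurableC.
  - by rewrite /S/= preimage_bigcup; exact: bigcupT_measurable.
case: n => [|n] in f mf S {A mA} *; first by rewrite big_ord0; exact: sub0set.
rewrite -bigcup_mkord_ord; apply: bigcup_sub => i Ii B [C mC <-].
by rewrite /S/= setTI -[X in measurable X]setTI; exact: mf.
Qed.

Lemma measurable_coord (R : realType) (n : nat) (i : 'I_n) :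
  measurable_fun [set: 'rV[R]_n] (fun x : 'rV[R]_n => x ord0 i).
Proof.
move=> _ Y mY; rewrite setTI; apply: sub_sigma_algebra.
case: n i => [[]//|n] i.
rewrite -bigcup_mkord_ord; exists i; first exact: ltn_ord.
by exists Y => //; rewrite inord_val setTI.
Qed.

Definition rV_cons (R : realType) (n : nat)
    (z : 'rV[R]_n * measurableTypeR R) : 'rV[R]_n.+1 :=
  \row_i (if unlift ord0 i is Some j then z.1 ord0 j else z.2).

Lemma measurable_rV_cons (R : realType) (n : nat) :
  measurable_fun [set: 'rV[R]_n * measurableTypeR R] (@rV_cons R n).
Proof.
apply: measurable_fun_rV => i.
under eq_fun do rewrite mxE.
case: unliftP => [j|] _.
  apply: (measurableT_comp (measurable_coord j)); exact: measurable_fst.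
exact: measurable_snd.
Qed.

(* Iterated product of the one-dimensional Lebesgue measure. *)
Fixpoint lebesgue_rV (R : realType) (d : nat) :
    {measure set 'rV[R]_d -> \bar R} :=
  if d is n.+1 then
    measure_function_pushforward__canonical__measure_function_Measure
      (lebesgue_rV R n \x @lebesgue_measure R)%E (@measurable_rV_cons R n)
  else \d_(0 : 'rV[R]_0).

Section hausdorff.
Variables (R : realType) (d : nat).
Local Open Scope ereal_scope.
Implicit Types A : set 'rV[R]_d.

Definition diam A : \bar R :=
  ereal_sup [set (enorm (z.1 - z.2))%:E | z in A `*` A].

Definition hausdorff_gauge (s : nat) A : \bar R :=
  if A == set0 then 0 else diam A ^+ s.

Definition hausdorff_content (s : nat) (delta : R) A : \bar R :=
  ereal_inf [set \sum_(k <oo) hausdorff_gauge s (F k) | F in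
    [set F : (set 'rV[R]_d)^nat |
      (forall k, diam (F k) <= delta%:E) /\ A `<=` \bigcup_k F k]].

Definition hausdorff (s : nat) A : \bar R :=
  ereal_sup [set hausdorff_content s delta A | delta in [set e : R | (0 < e)%R]].

Lemma diam_set0 : diam set0 = -oo.
Proof.
by rewrite /diam (_ : _ `*` _ = set0) ?image_set0 ?ereal_sup0// -subset0 => -[? ?] [].
Qed.

Lemma hausdorff_gauge_ge0 s A : 0 <= hausdorff_gauge s A.
Proof.
rewrite /hausdorff_gauge; case: ifPn => // /set0P[x Ax].
apply: expe_ge0; apply: ereal_sup_ubound; exists (x, x) => //=.
rewrite subrr /enorm big1 ?sqrtr0// => i _.
by rewrite mxE expr0n.
Qed.

Lemma hausdorff_content_ge0 s e A : 0 <= hausdorff_content s e A.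
Proof.
apply: le_ereal_inf_tmp => x [F _ <-].
by apply: nneseries_ge0 => *; exact: hausdorff_gauge_ge0.
Qed.

Lemma hausdorff_content0 s e : hausdorff_content s e set0 = 0.
Proof.
apply/eqP; rewrite eq_le hausdorff_content_ge0 andbT.
apply: ereal_inf_lbound; exists (fun=> set0).
  by split => // k; rewrite diam_set0 leNye.
by apply: eseries0 => k _ _; rewrite /hausdorff_gauge eqxx.
Qed.

Lemma le_hausdorff_content s e A B :
  A `<=` B -> hausdorff_content s e A <= hausdorff_content s e B.
Proof.
move=> AB; apply/ereal_inf_le_tmp => x [F [Fe BF] <-]; exists F => //; split=> //.
exact: subset_trans BF.
Qed.

Lemma hausdorff_content_sigma_subadditive s e :
  sigma_subadditive (hausdorff_content s e).
Proof.
set mu := hausdorff_gauge s.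
move=> A; have [[i ioo]|] := pselect (exists i, hausdorff_content s e (A i) = +oo).
  rewrite (eseries_pinfty _ _ ioo) ?leey// => n _.
  by rewrite -ltNye (lt_le_trans _ (hausdorff_content_ge0 _ _ _)).
rewrite -forallNE => Aoo.
apply/lee_addgt0Pr => _/posnumP[r].
rewrite (le_trans _ (epsilon_trick _ _ _))//; last first.
  by move=> n; exact: hausdorff_content_ge0.
pose cover X (F : (set 'rV[R]_d)^nat) :=
  (forall k, diam (F k) <= e%:E) /\ X `<=` \bigcup_k F k.
pose P n B := cover (A n) B /\ \sum_(k <oo) mu (B k) <=
  hausdorff_content s e (A n) + (r%:num / (2 ^ n.+1)%:R)%:E.
have [G PG] : {G : ((set 'rV[R]_d)^nat)^nat & forall n, P n (G n)}.
  apply: (@choice _ _ P) => n; rewrite /P /hausdorff_content.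
  set S := (X in ereal_inf X); move infS : (ereal_inf S) => iS.
  case: iS infS => [t Sr|Soo|Soo].
  - have en1 : (0 < r%:num / (2 ^ n.+1)%:R)%R by [].
    have /(lb_ereal_inf_adherent en1) : ereal_inf S \is a fin_num by rewrite Sr.
    move=> [x [B [mB AnB] muBx] xS].
    by exists B; split => //; rewrite /mu muBx -Sr; exact/ltW.
  - by have := Aoo n; rewrite /hausdorff_content Soo.
  - by have := hausdorff_content_ge0 s e (A n); rewrite /hausdorff_content Soo.
have mu_ge0 X : 0 <= mu X by exact: hausdorff_gauge_ge0.
apply: (@le_trans _ _ (\esum_(i in setT) (mu \o uncurry G) i)).
  apply: ereal_inf_lbound => /=.
  have /card_esym/ppcard_eqP[f] := card_nat2.
  exists (uncurry G \o f).
    split => [i|]; first by rewrite /=; case: (f i) => a b; exact: (PG a).1.1.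
    move=> t [i _ /(PG i).1.2[j _ Gt]].
    by exists (f^-1%FUN (i, j)) => //=; rewrite invK ?inE.
  rewrite -(esum_pred_image (mu \o uncurry G) _ xpredT) ?[fun=> _]set_true//.
    by rewrite image_eq.
  by move=> n _; exact: mu_ge0.
rewrite (_ : esum _ _ = \sum_(i <oo) \sum_(j <oo ) mu (G i j)); last first.
  pose J : nat -> set (nat * nat) := fun i => [set (i, j) | j in setT].
  rewrite (_ : setT = \bigcup_k J k); last first.
    by rewrite predeqE => -[a b]; split => // _; exists a => //; exists b.
  rewrite esum_bigcupT /=; last 2 first.
    - apply/trivIsetP => i j _ _ ij.
      rewrite predeqE => -[n m] /=; split => //= -[] [_] _ [<-{n} _].
      by move=> [m' _] [] /esym/eqP; rewrite (negbTE ij).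
    - by move=> /= [n m].
  rewrite -(image_id [set: nat]) -fun_true esum_pred_image//; last first.
    by move=> n _; exact: esum_ge0.
  apply: eq_eseriesr => /= j _.
  rewrite -(esum_pred_image (mu \o uncurry G) (pair j) predT)//=; last first.
    by move=> ? ? _ _; exact: (@can_inj _ _ _ snd).
  by congr esum; rewrite predeqE => -[a b]; split; move=> [i _ <-]; exists i.
apply: lee_nneseries => [n _ _|n _]; first by apply: nneseries_ge0.
exact: (PG n).2.
Qed.

Lemma hausdorff_set0 s : hausdorff s set0 = 0.
Proof.
rewrite /hausdorff (_ : [set _ | _ in _] = [set 0]) ?ereal_sup1//.
apply/seteqP; split=> [x [e _ <-]|x ->]; first exact: hausdorff_content0.
by exists 1%R => //=; rewrite hausdorff_content0.
Qed.

Lemma hausdorff_ge0 s A : 0 <= hausdorff s A.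
Proof.
apply: le_trans (hausdorff_content_ge0 s 1%R A) _.
by apply: ereal_sup_ubound; exists 1%R => //=.
Qed.

Lemma le_hausdorff s : {homo hausdorff s : A B / A `<=` B >-> A <= B}.
Proof.
move=> A B AB; apply: ge_ereal_sup => _ [e e0 <-].
apply: le_trans (le_hausdorff_content s e AB) _.
by apply: ereal_sup_ubound; exists e.
Qed.

Lemma hausdorff_sigma_subadditive s : sigma_subadditive (hausdorff s).
Proof.
move=> F; apply: ge_ereal_sup => _ [e e0 <-].
apply: le_trans (hausdorff_content_sigma_subadditive s e F) _.
apply: lee_nneseries => [n _ _|n _]; first exact: hausdorff_content_ge0.
by apply: ereal_sup_ubound; exists e.
Qed.

HB.instance Definition _ (s : nat) := isOuterMeasure.Build R 'rV[R]_d
  (hausdorff s) (hausdorff_set0 s) (@hausdorff_ge0 s) (@le_hausdorff s)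
  (@hausdorff_sigma_subadditive s).

(* The s-dimensional Hausdorff measure, on the Caratheodory sigma-algebra and
   without the usual normalising constant. *)
Definition hausdorff_measure (s : nat) :
    {measure set (caratheodory_type (hausdorff s)) -> \bar R} :=
  [the {measure set (caratheodory_type (hausdorff s)) -> \bar R} of
    (hausdorff s : {outer_measure set 'rV[R]_d -> \bar R})
    : set (caratheodory_type (hausdorff s)) -> \bar R].

End hausdorff.

Section domains.
Variables (R : realType) (d : nat).
Local Notation E := 'rV[R]_d.
Implicit Types (U Omega : set E) (f phi : E -> R).

Definition partial (i : 'I_d) f : E -> R := 'D_(delta_mx ord0 i) f.

Fixpoint Ck (k : nat) U f : Prop :=
  {within U, continuous f} /\
  if k is k'.+1 then
    forall i, (forall x, U x -> derivable f x (delta_mx ord0 i)) /\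
              Ck k' U (partial i f)
  else True.

Definition smooth U f := forall k, Ck k U f.

(* The boundary is locally the zero level of a smooth function with nonvanishing
   gradient, the domain lying on one side of it. *)
Definition smooth_boundary Omega :=
  forall y, boundary Omega y -> exists U rho,
    [/\ open U, U y, smooth U rho, (exists i, partial i rho y != 0) &
        Omega `&` U = [set x | rho x < 0] `&` U].

Definition bounded_smooth_domain Omega :=
  [/\ Omega !=set0, open Omega, connected Omega, bounded_set Omega &
      smooth_boundary Omega].

Definition lipschitz_boundary Omega (F : E -> R) :=
  exists L : R, forall x y, boundary Omega x -> boundary Omega y ->
    `|F x - F y| <= L * enorm (x - y).

Definition test_function Omega phi :=
  [/\ smooth setT phi, compact (closure [set x | phi x != 0]) &
      closure [set x | phi x != 0] `<=` Omega].

Definition weak_gradient Omega (v : E -> R) (g : E -> E) :=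
  forall phi i, test_function Omega phi ->
    \int[lebesgue_rV R d]_(x in Omega) (v x * partial i phi x) =
    - \int[lebesgue_rV R d]_(x in Omega) (g x ord0 i * phi x).

Definition p_energy Omega (p : R) (g : E -> E) : \bar R :=
  (\int[lebesgue_rV R d]_(x in Omega) (enorm (g x) `^ p)%:E)%E.

Definition p_mass Omega (p : R) (v : E -> R) : \bar R :=
  (\int[lebesgue_rV R d]_(x in Omega) (`|v x| `^ p)%:E)%E.

(* v belongs to W^{1,p}(Omega) and g is (a representative of) its weak
   gradient. *)
Definition sobolev Omega (p : R) (v : E -> R) (g : E -> E) :=
  [/\ measurable_fun Omega v, measurable_fun Omega g,
      (p_mass Omega p v < +oo)%E, (p_energy Omega p g < +oo)%E &
      weak_gradient Omega v g].

Definition sobolev_norm Omega (p : R) (v : E -> R) (g : E -> E) : \bar R :=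
  ((p_mass Omega p v + p_energy Omega p g) `^ p^-1)%E.

(* v has trace F: F is the value at v of the extension by density, from
   W^{1,p}(Omega) to L^p of the boundary, of the restriction to the boundary of
   functions in W^{1,p}(Omega) continuous up to the boundary. *)
Definition has_trace Omega (p : R) (v : E -> R) (g : E -> E) (F : E -> R) :=
  exists (w : (E -> R)^nat) (h : (E -> E)^nat),
  [/\ forall k, {within closure Omega, continuous (w k)},
      forall k, sobolev Omega p (w k) (h k),
      (fun k => sobolev_norm Omega p (w k \- v) (h k \- g)) @ \oo --> 0%E &
      (fun k => \int[@hausdorff_measure R d d.-1]_(x in boundary Omega)
         (`|w k x - F x| `^ p)%:E)%E @ \oo --> 0%E].

Definition sobolev_dual Omega (q : R) (l : (E -> R) -> R) :=
  (forall (a : R) v w g h, sobolev Omega q v g -> sobolev Omega q w h ->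
    l (fun x => a * v x + w x) = a * l v + l w) /\
  exists C : R, forall v g, sobolev Omega q v g ->
    (`|l v|%:E <= C%:E * sobolev_norm Omega q v g)%E.

Definition sobolev_weak_cvg Omega (q : R) (v : (E -> R)^nat) (w : E -> R) :=
  (exists g, sobolev Omega q w g) /\
  forall l, sobolev_dual Omega q l -> l (v k) @[k --> \oo] --> l w.

Definition admissible Omega (F Psi : E -> R) (p : R) (v : E -> R)
    (g : E -> E) :=
  [/\ sobolev Omega p v g, has_trace Omega p v g F &
      {ae lebesgue_rV R d, forall x, Omega x -> Psi x <= v x}].

Definition obstacle_minimizer Omega (F Psi : E -> R) (p : R) (v : E -> R) :=
  exists g, admissible Omega F Psi p v g /\
    forall w h, admissible Omega F Psi p w h ->
      (p_energy Omega p g <= p_energy Omega p h)%E.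

Definition obstacle_limit Omega (u : R -> E -> R) (uinf : E -> R) :=
  exists p : R^nat,
  [/\ p k @[k --> \oo] --> +oo,
      forall K, compact K -> K `<=` closure Omega ->
        {uniform K, (fun k => u (p k)) @ \oo --> uinf} &
      forall q, 1 < q -> sobolev_weak_cvg Omega q (fun k => u (p k)) uinf].

Definition cone (y : E) (b : R * R) (x : E) : R := b.1 * enorm (x - y) + b.2.

Definition cone_family Omega (F Psi : E -> R) : set (E -> R) :=
  [set K | exists y b, [/\ K = cone y b, boundary Omega y, 0 <= b.1,
      forall x, boundary Omega x -> F x <= K x &
      forall x, Omega x -> Psi x <= K x]].

Definition Kinf Omega (F Psi : E -> R) (x : E) : R :=
  inf [set K x | K in cone_family Omega F Psi].

Definition infinity_laplacian f (x : E) : R :=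
  \sum_(i < d) \sum_(j < d)
    partial i f x * partial j f x * partial j (partial i f) x.

Definition C2_near (x : E) phi := exists2 U, open_nbhs x U & Ck 2 U phi.

Definition infinity_harmonic U (u : E -> R) :=
  [/\ {within U, continuous u},
      forall x phi, U x -> C2_near x phi ->
        (\forall z \near x, u z - phi z <= u x - phi x) ->
        0 <= infinity_laplacian phi x &
      forall x phi, U x -> C2_near x phi ->
        (\forall z \near x, u x - phi x <= u z - phi z) ->
        infinity_laplacian phi x <= 0].

End domains.

(* Main.v *)
Require Import Defs.
From HB Require Import structures.
From mathcomp Require Import all_boot all_order all_algebra.
From mathcomp Require Import all_classical all_reals all_analysis measurable_realfun.
From mathcomp Require Import ring lra.

Set Implicit Arguments.
Unset Strict Implicit.
Unset Printing Implicit Defensive.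

Import Order.TTheory GRing.Theory Num.Theory.
Import numFieldNormedType.Exports.

Local Open Scope classical_set_scope.
Local Open Scope ring_scope.

(** The minimizers [u p] satisfy a comparison principle against smooth strict sub- and
    supersolutions of the p-Laplace equation on small balls. Since the p-Laplacian, suitably
    normalized, tends to the infinity Laplacian, [uinf] is a viscosity supersolution of the
    infinity Laplace equation in [Omega] and a subsolution where it exceeds the obstacle. For
    [d < p] the function [u p] attains the values [F] on the boundary, hence so does [uinf]. A cone
    above [F] and [Psi], slightly bent to a strict supersolution, cannot touch [uinf] from
    above at a point where [uinf] exceeds it, so [uinf] lies below every cone of the family and below
    [Kinf]. Cones with vertex at a boundary point and large slope show that [Kinf] also equals
    [F] on the boundary. If [Kinf] is infinity harmonic where it differs from [Psi], the comparison
    principle for the infinity Laplace equation gives [Kinf <= uinf] there, and elsewhere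
    [Kinf = Psi <= uinf]. Conversely, if [Kinf = uinf] the viscosity inequalities of
    [uinf] are the assertion. *)

(** * Topology and Lebesgue measure on row vectors *)

(** Two steps shape the proof. The trace is prescribed through limits in W^{1,p} and in L^p of the
    boundary for the Hausdorff measure, so pointwise boundary values are extracted by testing in a
    thin layer inside [Omega]. The weight of the layer is the derivative of a cutoff; one
    integration by parts bounds its mass on a cube of side rho by a multiple of rho^(d-1), uniformly
    in the width, and this makes it comparable with the Hausdorff measure. The other step is
    comparison for the infinity Laplacian, which is degenerate: maxima over balls of radius e turn
    the viscosity inequalities into midpoint inequalities, for which an extremal point suffices. The
    bending of cones rests on one formula. For a radial profile f(s), s the distance to the vertex,
    the infinity Laplacian is f'^2 f''; it vanishes for a cone, and f(s) = b s - t s^2 makes it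
    negative as long as b > 2 t s. The vertices of the family lie on the boundary, so these profiles
    are smooth in [Omega]. Minimizers are continuous but only weakly differentiable, hence
    truncations are C^1 with Lipschitz derivative and are differentiated by mollification. *)

Section rV_topology.
Variables (R : realType) (d : nat).
Local Notation E := 'rV[R]_d.
Implicit Types (A K O : set E) (f : E -> R).

Lemma nbhs_rVP (x : E) A :
  nbhs x A <-> exists2 e : R, 0 < e & forall y, `|x - y| < e -> A y.
Proof.
split=> [/nbhs_ballP[e e0 H]|[e e0 H]].
  by exists e => // y xy; apply: H; rewrite -ball_normE.
by apply/nbhs_ballP; exists e => // y; rewrite -ball_normE; exact: H.
Qed.

Lemma open_rVP O :
  open O <-> forall x, O x -> exists2 e : R, 0 < e & forall y, `|x - y| < e -> O y.
Proof. by rewrite openE; split=> H x /H /nbhs_rVP. Qed.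

Lemma continuous_rVP f x : {for x, continuous f} <->
  forall e : R, 0 < e -> exists2 r : R, 0 < r &
    forall y, `|x - y| < r -> `|f x - f y| < e.
Proof.
rewrite /prop_for /continuous_at; have FF := nbhs_filter x.
split=> [/cvgrPdist_lt H e e0|H].
  by have /nbhs_rVP := H e e0.
by apply/cvgrPdist_lt => e e0; apply/nbhs_rVP; exact: H.
Qed.

Lemma within_continuous_rVP A f : {within A, continuous f} <->
  forall x, A x -> forall e : R, 0 < e -> exists2 r : R, 0 < r &
    forall y, A y -> `|x - y| < r -> `|f x - f y| < e.
Proof.
rewrite subspace_continuousP; split=> H x Ax; have FF : Filter (within A (nbhs x)) := within_filter _ (nbhs_filter x).
  move=> e e0; have /cvgrPdist_lt/(_ e e0) := H x Ax.
  by move=> /nbhs_rVP[r r0 h]; exists r => // y Ay xy; exact: h.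
apply/cvgrPdist_lt => e e0; have [r r0 h] := H x Ax e e0.
by apply/nbhs_rVP; exists r => // y xy Ay; exact: h.
Qed.

Lemma within_open_continuousP O f : open O ->
  {within O, continuous f} <-> forall x, O x -> {for x, continuous f}.
Proof.
move=> oO; rewrite continuous_open_subspace//; split=> H x; first by move=> Ox; apply: H; rewrite inE.
by rewrite inE; exact: H.
Qed.

Lemma closure_rVP A (x : E) :
  closure A x <-> forall e : R, 0 < e -> exists2 y, A y & `|x - y| < e.
Proof.
split=> [H e e0|H B /nbhs_rVP[e e0 h]].
  have /H[y [Ay xy]] : nbhs x [set y | `|x - y| < e] by apply/nbhs_rVP; exists e.
  by exists y.
by have [y Ay xy] := H e e0; exists y; split => //; exact: h.
Qed.

(** Compactness in its near-covering form, with the right neighbourhoods of 0 as filter of scales.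
    Uniform continuity and a positive distance to the complement of an open set are instances, with
    [P r x] a statement about the ball of radius r. *)
Lemma compact_uniform K (P : R -> E -> Prop) : compact K ->
  (forall x, K x -> exists2 e : R, 0 < e &
     forall y r, `|x - y| < e -> 0 < r < e -> P r y) ->
  exists2 e : R, 0 < e & forall r, 0 < r < e -> forall x, K x -> P r x.
Proof.
move=> /compact_near_coveringP cK H.
have [x Kx|e /= e0 h] := cK R (nbhs 0^'+) P _.
  have [e e0 h] := H x Kx.
  exists (ball x e, [set r | 0 < r < e]).
    split; first exact: nbhsx_ballx.
    exists e => //= r /=; rewrite sub0r normrN => re r0.
    by rewrite r0 (le_lt_trans _ re)// ler_norm.
  by move=> [y r] /= [+ re]; rewrite -ball_normE => /h; exact.
exists e => // r /andP[r0 re] x Kx; apply: h => //.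
by rewrite /= sub0r normrN gtr0_norm.
Qed.

Lemma compact_unif_continuous K f : compact K -> {within K, continuous f} ->
  forall e : R, 0 < e -> exists2 r : R, 0 < r & forall x y, K x -> K y ->
    `|x - y| < r -> `|f x - f y| < e.
Proof.
move=> cK /within_continuous_rVP fc e e0.
have [x Kx|r r0 H] := @compact_uniform K
  (fun r x => K x -> forall y, K y -> `|x - y| < r -> `|f x - f y| < e) cK.
  have [r r0 h] := fc x Kx (e / 2) ltac:(by lra).
  exists (r / 2); first lra.
  move=> y s xy /andP[s0 sr] Ky z Kz yz.
  have h1 := h y Ky ltac:(by lra).
  have h2 : `|f x - f z| < e / 2.
    apply: h => //; rewrite (_ : x - z = (x - y) + (y - z)); last by rewrite addrA subrK.
    by rewrite (le_lt_trans (ler_normD _ _))//; lra.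
  rewrite (_ : f y - f z = - (f x - f y) + (f x - f z)); last by lra.
  by rewrite (le_lt_trans (ler_normD _ _))// normrN; lra.
exists (r / 2); first lra.
by move=> x y Kx Ky xy; apply: (H (r / 2)) => //; lra.
Qed.

Lemma compact_open_dist K O : compact K -> open O -> K `<=` O ->
  exists2 e : R, 0 < e & forall x y, K x -> `|x - y| < e -> O y.
Proof.
move=> cK /open_rVP oO KO.
have [x Kx|r r0 H] := @compact_uniform K (fun r x => forall y, `|x - y| < r -> O y) cK.
  have [r r0 h] := oO x (KO x Kx).
  exists (r / 2); first lra.
  move=> y s xy /andP[s0 sr] z yz; apply: h.
  rewrite (_ : x - z = (x - y) + (y - z)); last by rewrite addrA subrK.
  by rewrite (le_lt_trans (ler_normD _ _))//; lra.
exists (r / 2); first lra.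
by move=> x y Kx xy; apply: (H (r / 2)) xy => //; lra.
Qed.

Lemma compact_continuous_bounded K f : compact K -> {within K, continuous f} ->
  exists2 M : R, 0 < M & forall x, K x -> `|f x| <= M.
Proof.
move=> cK fc.
have /ex_strict_bound_gt0[M M0 HM] : bounded_set (f @` K).
  by apply: compact_bounded; exact: continuous_compact.
by exists M => // x Kx; apply/ltW/HM; exists x.
Qed.

Lemma norm_rV_lt (x : E) (e : R) : 0 < e ->
  (`|x| < e) <-> forall i, `|x ord0 i| < e.
Proof.
move=> e0; have := @mx_norm_ball R 1 d => /(congr1 (fun h => h 0 e x)).
rewrite /ball_/= sub0r normrN => <-; split=> [[_ H] i|H].
  by have := H ord0 i; rewrite -ball_normE/= mxE sub0r normrN.
by split => // i j; rewrite -ball_normE/= mxE sub0r normrN (ord1 i).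
Qed.

Lemma norm_coord (x : E) i : `|x ord0 i| <= `|x|.
Proof.
apply/ler_addgt0Pr => e e0; apply/ltW.
have /norm_rV_lt : 0 < `|x| + e by rewrite ltr_wpDl.
by move=> H; apply H; rewrite ltrDl.
Qed.

Lemma norm_rV_le (x : E) (e : R) : 0 <= e ->
  (`|x| <= e) <-> forall i, `|x ord0 i| <= e.
Proof.
move=> e0; split=> [H i|H]; first exact: le_trans (norm_coord _ _) H.
apply/ler_addgt0Pr => r r0; apply/ltW/norm_rV_lt; first by rewrite ltr_wpDl.
by move=> i; rewrite (le_lt_trans (H i))// ltrDl.
Qed.

Lemma closed_ball_rV_compact (x : E) (r : R) : compact [set y | `|x - y| <= r].
Proof.
apply: bounded_closed_compact.
  exists (`|x| + r); split; first exact: num_real.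
  move=> M HM y /= xy; apply/ltW/(le_lt_trans _ HM).
  rewrite (_ : y = x - (x - y)); last by rewrite opprB addrC subrK.
  by rewrite (le_trans (ler_normB _ _))// lerD2l.
rewrite [X in closed X](_ : _ = (fun y => `|x - y|) @^-1` [set z | z <= r])//.
apply: closed_comp; last exact: closed_le.
move=> y _; apply: continuous_comp; last exact: norm_continuous.
by apply: continuousB; [exact: cst_continuous | exact: cvg_id].
Qed.

End rV_topology.

(** * Measurability of balls, open sets and continuous functions *)

Section rV_measure.
Variables (R : realType).
Local Notation mu := (lebesgue_rV R).
Local Notation leb := (@lebesgue_measure R).

Lemma measurable_ball_rV d (x : 'rV[R]_d) (r : R) : 0 < r ->
  measurable [set y | `|x - y| < r].
Proof.
move=> r0; rewrite [X in measurable X](_ : _ =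
    \bigcap_(i in [set: 'I_d])
      ([set: 'rV[R]_d] `&` (fun y : 'rV[R]_d => y ord0 i) @^-1` `]x ord0 i - r, x ord0 i + r[)).
  apply: fin_bigcap_measurable => [|i _]; first exact: finite_finset.
  exact: measurable_coord.
apply/seteqP; split=> [y /norm_rV_lt H i _|y H].
  by split => //=; have := H r0 i; rewrite !mxE in_itv/= ltr_distlC.
apply/norm_rV_lt => // i; have [_ /=] := H i I.
by rewrite !mxE in_itv/= ltr_distlC.
Qed.

Lemma measurable_closed_ball_rV d (x : 'rV[R]_d) (r : R) : 0 <= r ->
  measurable [set y | `|x - y| <= r].
Proof.
move=> r0; rewrite [X in measurable X](_ : _ =
    \bigcap_(i in [set: 'I_d])
      ([set: 'rV[R]_d] `&` (fun y : 'rV[R]_d => y ord0 i) @^-1` `[x ord0 i - r, x ord0 i + r])).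
  apply: fin_bigcap_measurable => [|i _]; first exact: finite_finset.
  exact: measurable_coord.
apply/seteqP; split=> [y /norm_rV_le H i _|y H].
  by split => //=; have := H r0 i; rewrite !mxE in_itv/= ler_distlC.
apply/norm_rV_le => // i; have [_ /=] := H i I.
by rewrite !mxE in_itv/= ler_distlC.
Qed.

Lemma rat_dense_rV d (x : 'rV[R]_d) (e : R) : 0 < e ->
  exists q : 'rV[rat]_d, `|map_mx ratr q - x| < e.
Proof.
move=> e0.
have H i : exists q : rat, `|ratr q - x ord0 i| < e.
  have [q] := rat_in_itvoo (ltac:(lra) : x ord0 i - e < x ord0 i + e).
  by rewrite in_itv/= -ltr_distlC distrC => ?; exists q.
exists (\row_i xget 0 [set q | `|ratr q - x ord0 i| < e]).
by apply/norm_rV_lt => // i; rewrite !mxE; case: xgetP => // /(_ _ _)/= K; have [q /K] := H i.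
Qed.

(** The sigma-algebra is generated by the coordinates, and balls belong to it as finite
    intersections of slabs. Writing an open set as a countable union of balls with rational centres
    is what makes it measurable. *)
Lemma open_rV_bigcup d (O : set 'rV[R]_d) : open O ->
  exists c : ('rV[R]_d)^nat, exists r : R^nat, (forall n, 0 < r n) /\
    exists S : set nat, O = \bigcup_(n in S) [set y | `|c n - y| < r n].
Proof.
move=> /open_rVP oO.
(* A number that encodes nothing gets the unit ball at 0; this is harmless, as the index set keeps
   only balls contained in [O]. *)
pose cr n : 'rV[R]_d * R := if unpickle n is Some (q, k) then
  (map_mx ratr (q : 'rV[rat]_d), k.+1%:R^-1) else (0, 1).
exists (fun n => (cr n).1), (fun n => (cr n).2); split.
  by move=> n; rewrite /cr; case: unpickle => [[q k]|] //=; rewrite invr_gt0.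
exists [set n | [set y | `|(cr n).1 - y| < (cr n).2] `<=` O].
apply/seteqP; split=> [x Ox|x [n /=]]; last exact.
have [e e0 H] := oO x Ox.
have [k _ /(_ k (leqnn _))/= ke] : \forall k \near \oo, (k.+1%:R^-1 : R) < e / 2.
  have /cvgrPdist_lt/(_ (e / 2) ltac:(by lra)) := @cvg_harmonic R.
  apply: filterS => n; rewrite sub0r normrN ger0_norm ?invr_ge0//.
have [q qx] := @rat_dense_rV d x k.+1%:R^-1 ltac:(by rewrite invr_gt0).
exists (pickle (q, k)); last by rewrite /= /cr pickleK.
rewrite /= /cr pickleK /= => y qy; apply: H.
rewrite (_ : x - y = - (map_mx ratr q - x) + (map_mx ratr q - y)); last first.
  by rewrite opprB addrA subrK.
rewrite (le_lt_trans (ler_normD _ _))// normrN.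
by have := ltrD qx qy; move=> /lt_trans; apply; have := ltrD ke ke; rewrite -splitr.
Qed.

Lemma open_measurable_rV d (O : set 'rV[R]_d) : open O -> measurable O.
Proof.
move=> /open_rV_bigcup[c [r [r0 [S ->]]]].
by apply: bigcup_measurable => n _; exact: measurable_ball_rV.
Qed.

Lemma within_continuous_measurable_rV d (O : set 'rV[R]_d) (f : 'rV[R]_d -> R) :
  measurable O -> {within O, continuous f} -> measurable_fun O f.
Proof.
move=> mO /continuousP cf; apply: (measurability _ (RGenOpens.measurableE R)).
move=> _ [_ [a [b ->] <-]].
have /open_subspaceP[V oV VO] : open ((f : subspace O -> R) @^-1` `]a, b[%classic).
  by apply: cf; exact: interval_open.
rewrite setIC -VO setIC; apply: measurableI => //.
exact: open_measurable_rV.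
Qed.

Lemma continuous_measurable_rV d (f : 'rV[R]_d -> R) :
  continuous f -> measurable_fun setT f.
Proof.
move=> cf; apply: within_continuous_measurable_rV => //.
exact: continuous_subspaceT.
Qed.

End rV_measure.

(** * Lebesgue measure of cubes and invariance under translation *)

Section lebesgue_rV_theory.
Variables (R : realType).
Local Notation mu := (lebesgue_rV R).
Local Notation leb := (@lebesgue_measure R).

Lemma lebesgue_measure_shift (a : R) (A : set (measurableTypeR R)) :
  measurable A ->
  leb ((fun x => x + a) @^-1` A) = leb A.
Proof.
move=> mA.
have mf : measurable_fun setT (fun x : measurableTypeR R => (x + a : measurableTypeR R)).
  apply: continuous_measurable_fun => x.
  by apply: continuousD; [exact: cvg_id | exact: cst_continuous].
rewrite [RHS](lebesgue_measure_unique (mu := pushforward leb (fun x : measurableTypeR R => (x + a : measurableTypeR R))))//.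
move=> _ [[x y]] _ <-.
transitivity (leb `]x - a, y - a]%classic); last first.
  congr (leb _); apply/seteqP; split=> z/=; rewrite !in_itv/= ltrBlDr lerBrDr//.
by rewrite !lebesgue_measure_itv/= !lte_fin ltrD2r -!EFinB; congr (if _ then _%:E else _); lra.
Qed.

(** The norm is the sup norm, so a closed ball is a cube and splits as a product in the induction on
    the dimension. *)
Lemma lebesgue_rV_closed_ball d (x : 'rV[R]_d) (r : R) : 0 <= r ->
  mu d [set y | `|x - y| <= r] = ((2 * r) ^+ d)%:E.
Proof.
move=> r0; elim: d x => [|d IH] x.
  rewrite /= diracE mem_set ?expr0//= subr0.
  by apply/norm_rV_le => // -[].
pose x' : 'rV[R]_d := \row_j x ord0 (lift ord0 j).
rewrite /= /pushforward (_ : _ @^-1` _ =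
    [set y | `|x' - y| <= r] `*` `[x ord0 ord0 - r, x ord0 ord0 + r]%classic); last first.
  apply/seteqP; split=> [[y t]/= /norm_rV_le H|[y t]/= [/norm_rV_le H]].
    split; first by apply/norm_rV_le => // i; have := H r0 (lift ord0 i); rewrite !mxE liftK.
    by have := H r0 ord0; rewrite !mxE unlift_none/= in_itv/= ler_distlC.
  rewrite in_itv/= -ler_distlC => tr; apply/norm_rV_le => // i.
  rewrite !mxE; case: unliftP => [j ->|-> //].
  by have := H r0 j; rewrite !mxE.
rewrite product_measure1E//=; last exact: measurable_closed_ball_rV.
rewrite lebesgue_measure_itv/= lte_fin IH exprSr.
case: ltP => xr; first by rewrite -EFinB -EFinM; congr (_ * _)%:E; lra.
by rewrite mule0 (_ : r = 0) ?mulr0//; lra.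
Qed.

Lemma sigma_finite_lebesgue_rV d : sigma_finite setT (mu d).
Proof.
exists (fun n => [set y : 'rV[R]_d | `|0 - y| <= n%:R]).
  apply/esym/seteqP; split=> // y _; exists (Num.bound `|y|) => //=.
  by rewrite sub0r normrN; apply/ltW/archi_boundP.
move=> n; split; first exact: measurable_closed_ball_rV.
by rewrite lebesgue_rV_closed_ball// ltry.
Qed.

(** A copy of the measure that carries the sigma-finite structure required by Fubini and by
    uniqueness of product measures; [integral_lebr] leads back. *)
Definition lebr d : set 'rV[R]_d -> \bar R := mu d.
Arguments lebr : clear implicits.

HB.instance Definition _ d := Measure.on (lebr d).
HB.instance Definition _ d := Measure_isSigmaFinite.Build _ _ _ (lebr d)
  (@sigma_finite_lebesgue_rV d).

Lemma measurable_shift_rV d (a : 'rV[R]_d) :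
  measurable_fun setT (fun x : 'rV[R]_d => x + a).
Proof.
apply: measurable_fun_rV => i; apply: continuous_measurable_rV => x.
under eq_fun do rewrite mxE.
by apply: continuousD; [exact: coord_continuous | exact: cst_continuous].
Qed.

(** The shifted product measure agrees with the original one on rectangles, by induction in the
    first factor and by the one-dimensional case in the last coordinate; rectangles determine a
    sigma-finite product. *)
Lemma lebesgue_rV_shift d (a : 'rV[R]_d) A : measurable A ->
  mu d ((fun x => x + a) @^-1` A) = mu d A.
Proof.
elim: d a A => [|d IH] a A mA.
  by congr (_ _); apply/seteqP; split=> x /=; rewrite (thinmx0 (x + a)) (thinmx0 x).
pose a' : 'rV[R]_d := \row_j a ord0 (lift ord0 j).
pose sh (z : 'rV[R]_d * measurableTypeR R) : 'rV[R]_d * measurableTypeR R :=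
  (z.1 + a', z.2 + a ord0 ord0).
have msh : measurable_fun setT sh.
  apply/measurable_fun_pair.
    by apply: (measurableT_comp (measurable_shift_rV a')); exact: measurable_fst.
  by apply: measurable_funD => //; exact: measurable_snd.
have mB : measurable (@rV_cons R d @^-1` A).
  by rewrite -[X in measurable X]setTI; exact: measurable_rV_cons.
rewrite /= /pushforward.
rewrite (_ : rV_cons (n:=d) @^-1` _ = sh @^-1` (@rV_cons R d @^-1` A)); last first.
  apply/seteqP; split=> -[y t] /=; rewrite (_ : rV_cons (y, t) + a = rV_cons (sh (y, t)))//;
  by apply/rowP => i; rewrite !mxE /=; case: unliftP => [j ->|->]//; rewrite !mxE.
transitivity ((lebr d \x leb)%E (@rV_cons R d @^-1` A)); last by [].
rewrite [RHS](@product_measure_unique _ _ _ _ _ (lebr d) leb (pushforward (lebr d \x leb)%E sh))//.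
move=> B C mB' mC.
transitivity ((lebr d \x leb)%E
  (((fun x => x + a') @^-1` B) `*` ((fun x => x + a ord0 ord0) @^-1` C))); first by [].
rewrite product_measure1E//.
- congr (_ * _)%E; first exact: IH.
  exact: lebesgue_measure_shift.
- by rewrite -[X in measurable X]setTI; exact: measurable_shift_rV.
- rewrite -[X in measurable X]setTI.
  apply: (@continuous_measurable_fun R (fun x => x + a ord0 ord0)) => // x.
  by apply: continuousD; [exact: cvg_id | exact: cst_continuous].
Qed.

Lemma integral_lebr d D (f : 'rV[R]_d -> \bar R) :
  (\int[@lebr d]_(x in D) f x = \int[mu d]_(x in D) f x)%E.
Proof. by apply: eq_measure_integral => A mA _. Qed.

End lebesgue_rV_theory.

(** * Directional derivatives and integration by parts *)

Section directional_derivatives.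
Variables (R : realType) (d : nat).
Local Notation E := 'rV[R]_d.
Implicit Types (f : E -> R) (x v : E).

(** Both difference quotients are the same function of h. This transfers the chain rule and the mean
    value theorem of one real variable to directional derivatives. *)
Lemma is_derive_line f x v (s df : R) :
  is_derive s 1 (fun t => f (x + t *: v)) df <-> is_derive (x + s *: v) v f df.
Proof.
have H : (fun h : R => h^-1 *: (((fun t => f (x + t *: v)) \o shift s) (h *: 1) - f (x + s *: v))) =
         (fun h : R => h^-1 *: ((f \o shift (x + s *: v)) (h *: v) - f (x + s *: v))).
  apply/funext => h /=; congr (_ *: (f _ - _)).
  by rewrite scalerDl addrCA -[h *: 1]/(h * 1) mulr1.
split=> -[D1 D2].
  apply: DeriveDef; first by rewrite /derivable -H.
  by rewrite /derive -H.
apply: DeriveDef; first by rewrite /derivable H.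
by rewrite /derive H.
Qed.

Lemma is_derive_line0 f x v (df : R) :
  is_derive (0 : R) 1 (fun t => f (x + t *: v)) df <-> is_derive x v f df.
Proof. by have := is_derive_line f x v 0 df; rewrite scale0r addr0. Qed.

Lemma is_derive_chain f x v (theta : R -> R) (df dth : R) :
  is_derive x v f df -> is_derive (f x) 1 theta dth ->
  is_derive x v (fun y => theta (f y)) (dth * df).
Proof.
move=> /is_derive_line0 Df Dth; apply/is_derive_line0.
have {}Dth : is_derive (f (x + (0 : R) *: v)) 1 theta dth by rewrite scale0r addr0.
have := @is_derive1_comp R theta (fun t => f (x + t *: v)) 0 dth df Dth Df.
by apply.
Qed.

Lemma is_derive_continuous1 (g : R -> R) (s dg : R) :
  is_derive s 1 g dg -> {for s, continuous g}.
Proof. by case=> + _; move=> /derivable1_diffP/differentiable_continuous. Qed.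

Lemma directional_MVT f x v (t : R) (df : E -> R) : 0 < t ->
  (forall s, 0 <= s <= t -> is_derive (x + s *: v) v f (df (x + s *: v))) ->
  exists2 s, 0 < s < t & f (x + t *: v) - f x = t * df (x + s *: v).
Proof.
move=> t0 H.
have [| |c] := @MVT R (fun s => f (x + s *: v)) (fun s => df (x + s *: v)) 0 t t0.
- move=> s; rewrite in_itv/= => /andP[s0 st]; apply/is_derive_line; apply: H.
  by rewrite !ltW.
- apply: derivable_within_continuous => s; rewrite in_itv/= => /H /is_derive_line[].
  by [].
rewrite in_itv/= => ct; rewrite scale0r addr0 subr0 => ->.
by exists c => //; rewrite mulrC.
Qed.

Lemma derive_local f g x v (U : set E) : open U -> U x ->
  (forall y, U y -> f y = g y) -> forall df : R, is_derive x v f df -> is_derive x v g df.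
Proof.
move=> oU Ux fg df Df.
have fgn : {near x, f =1 g}.
  by rewrite /prop_near1; have := open_nbhs_nbhs (conj oU Ux); exact: filterS.
by apply: near_eq_is_derive Df.
Qed.

End directional_derivatives.

(** * Integrability and the vanishing integral of a derivative *)

Section integration.
Variables (R : realType) (d : nat).
Local Notation E := 'rV[R]_d.
Local Notation mu := (lebesgue_rV R d).
Local Notation e_ i := (delta_mx ord0 i : E).
Implicit Types (f g h : E -> R) (D : set E).

Definition bounded_support f := exists M : R, forall x, M < `|x| -> f x = 0.

(** Regularity along a single coordinate direction, which is what one integration by parts in this
    direction consumes. *)
Definition C1dir (i : 'I_d) f := [/\ continuous f,
  forall x, derivable f x (e_ i) & continuous (partial i f)].

Lemma norm_delta_le (i : 'I_d) (t : R) : `|t *: e_ i| <= `|t|.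
Proof.
apply/norm_rV_le => // j; rewrite !mxE eqxx/=.
by case: eqP => _; rewrite ?mulr1 ?mulr0 ?normr0.
Qed.

Lemma Cc_unif_continuous f : continuous f -> bounded_support f ->
  forall e : R, 0 < e -> exists2 r : R, 0 < r & forall x y, `|x - y| < r -> `|f x - f y| < e.
Proof.
move=> cf [M HM] e e0.
have [r r0 H] := compact_unif_continuous (@closed_ball_rV_compact R d 0 (M + 1))
  (continuous_subspaceT cf) e0.
exists (Num.min r 1); first by rewrite lt_min r0 ltr01.
move=> x y; rewrite lt_min => /andP[xyr xy1].
have [xM|xM] := leP `|x| (M + 1); last first.
  rewrite !HM ?subrr ?normr0//; last lra.
  by have := lerB_dist x y; lra.
have [yM|yM] := leP `|y| (M + 1); last first.
  rewrite !HM ?subrr ?normr0//; first lra.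
  by have := lerB_dist y x; rewrite (distrC y x); lra.
by apply: H => //=; rewrite sub0r normrN.
Qed.

Lemma Cc_bounded f : continuous f -> bounded_support f ->
  exists2 M : R, 0 < M & forall x, `|f x| <= M.
Proof.
move=> cf [M HM].
have [B B0 H] := compact_continuous_bounded (@closed_ball_rV_compact R d 0 M)
  (continuous_subspaceT cf).
exists B => // x; have [xM|xM] := leP `|x| M; last by rewrite HM// normr0 ltW.
by apply: H => /=; rewrite sub0r normrN.
Qed.

Lemma integrableZ_fin D f (c : R) : measurable D -> mu.-integrable D (EFin \o f) ->
  mu.-integrable D (EFin \o (fun x => c * f x)).
Proof. by move=> mD If; exact: (integrableZl mD c If). Qed.

Lemma integrableD_fin D f g : measurable D -> mu.-integrable D (EFin \o f) ->
  mu.-integrable D (EFin \o g) -> mu.-integrable D (EFin \o (fun x => f x + g x)).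
Proof. by move=> mD If Ig; exact: (integrableD mD If Ig). Qed.

Lemma integrableB_fin D f g : measurable D -> mu.-integrable D (EFin \o f) ->
  mu.-integrable D (EFin \o g) -> mu.-integrable D (EFin \o (fun x => f x - g x)).
Proof. by move=> mD If Ig; exact: (integrableB mD If Ig). Qed.

Lemma integrable_norm_fin D f : mu.-integrable D (EFin \o f) ->
  mu.-integrable D (EFin \o (fun x => `|f x|)).
Proof. by move=> If; exact: integrable_norm. Qed.

Lemma integrable_le D f g : measurable D -> measurable_fun D f ->
  (forall x, D x -> `|f x| <= g x) -> mu.-integrable D (EFin \o g) ->
  mu.-integrable D (EFin \o f).
Proof.
move=> mD mf fg ig; apply: le_integrable ig => //; first exact/measurable_EFinP.
move=> x Dx /=; rewrite lee_fin (le_trans (fg x Dx))// ler_norm//.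
Qed.

Lemma integrable_mul_bounded D f h (M : R) : measurable D -> measurable_fun D h ->
  (forall x, D x -> `|h x| <= M) -> mu.-integrable D (EFin \o f) ->
  mu.-integrable D (EFin \o (fun x => f x * h x)).
Proof.
move=> mD mh hM If.
have mf : measurable_fun D f by apply/measurable_EFinP; exact: measurable_int If.
apply: (integrable_le (g := fun x => M * `|f x|)) => //.
- exact: measurable_funM.
- by move=> x Dx; rewrite normrM mulrC ler_wpM2r// hM.
- by apply: integrableZ_fin => //; exact: integrable_norm_fin.
Qed.

Lemma integrable_bounded_on D f (r M : R) : measurable D -> measurable_fun D f ->
  (forall x, D x -> `|x| <= r) -> (forall x, D x -> `|f x| <= M) ->
  mu.-integrable D (EFin \o f).
Proof.
move=> mD mf Dr fM; apply: measurable_bounded_integrable => //.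
  rewrite (@le_lt_trans _ _ (mu [set y | `|0 - y| <= `|r|]))//.
    apply: le_measure; rewrite ?inE//; first exact: measurable_closed_ball_rV.
    by move=> y Dy /=; rewrite sub0r normrN (le_trans (Dr y Dy))// ler_norm.
  by rewrite lebesgue_rV_closed_ball// ltry.
exists M; split; first exact: num_real.
by move=> z Mz x Dx; apply/ltW/(le_lt_trans _ Mz)/fM.
Qed.

Lemma integrable_Cc f : continuous f -> bounded_support f ->
  mu.-integrable setT (EFin \o f).
Proof.
move=> cf bf; have [B B0 fB] := Cc_bounded cf bf.
have [M HM] := bf.
have mB := @measurable_closed_ball_rV R d 0 `|M| (normr_ge0 _).
rewrite (_ : EFin \o f = (EFin \o f) \_ [set y | `|0 - y| <= `|M|]).
  apply/(integrable_mkcond _ mB); apply: (integrable_bounded_on (r := `|M|) (M := B)) => //.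
    by apply: measurable_funTS; exact: continuous_measurable_rV.
  by move=> x /=; rewrite sub0r normrN.
apply/funext => x; rewrite patchE; case: ifPn => //; rewrite notin_setE/= sub0r normrN => /negP.
by rewrite -ltNge => Mx; rewrite HM// (le_lt_trans (ler_norm _)).
Qed.

Lemma Rintegral_shift f (a : E) : mu.-integrable setT (EFin \o f) ->
  mu.-integrable setT (EFin \o (fun x => f (x + a))) /\
  \int[mu]_x f (x + a) = \int[mu]_x f x.
Proof.
move=> If.
have mf : measurable_fun setT (EFin \o f) by exact: measurable_int If.
have mfs : measurable_fun setT (EFin \o (fun x => f (x + a))).
  exact: (measurableT_comp mf (measurable_shift_rV a)).
have E1 (k : E -> \bar R) : measurable_fun setT k -> (forall x, 0 <= k x)%E ->
    (\int[mu]_x k (x + a)%R = \int[mu]_x k x)%E.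
  move=> mk k0; rewrite -[LHS](@ge0_integral_pushforward _ _ _ _ R (fun x : E => x + a)
    (measurable_shift_rV a) mu setT k)//.
  apply: eq_measure_integral => [|? A mA _]; [exact: measurable_shift_rV|exact: lebesgue_rV_shift].
have Is : mu.-integrable setT (EFin \o (fun x => f (x + a))).
  apply/integrableP; split => //.
  have /integrableP[_] := If; rewrite -(E1 (fun x => `|(EFin \o f) x|%E))//.
  exact: measurableT_comp.
split => //; rewrite /Rintegral; congr fine.
rewrite [LHS](_ : _ = \int[mu]_(x in (fun x => x + a)%R @^-1` setT) ((EFin \o f) \o (fun x => x + a)%R) x)%E//.
rewrite -(@integral_pushforward _ _ _ _ R (fun x : E => x + a) (measurable_shift_rV a) mu setT (EFin \o f))//.
apply: eq_measure_integral => [|? A mA _]; [exact: measurable_shift_rV|exact: lebesgue_rV_shift].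
Qed.

Lemma partial_locally0 (i : 'I_d) f (U : set E) : open U ->
  (forall x, U x -> f x = 0) -> forall x, U x -> partial i f x = 0.
Proof.
move=> oU f0 x Ux; rewrite /partial.
by have [_ ->//] := derive_local (g := f) (v := e_ i) oU Ux (fun y Uy => esym (f0 y Uy))
  (@is_derive_cst _ _ _ 0 x (e_ i)).
Qed.

Lemma open_norm_gt (M : R) : open [set y : E | M < `|y|].
Proof.
apply: (@open_comp _ _ (fun y : E => `|y|) [set z | M < z]); last exact: open_gt.
by move=> y _; exact: norm_continuous.
Qed.

Lemma partial_bounded_support (i : 'I_d) f (M : R) : (forall x, M < `|x| -> f x = 0) ->
  forall x, M < `|x| -> partial i f x = 0.
Proof.
move=> HM x Mx; have H := @partial_locally0 i f _ (@open_norm_gt M) HM.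
exact: H.
Qed.

(** By translation invariance the difference quotient [q] has integral 0; by the mean value theorem
    it is uniformly close to the derivative, on a fixed ball of volume [V]. *)
Lemma Rintegral_partial (i : 'I_d) f : C1dir i f -> bounded_support f ->
  \int[mu]_x partial i f x = 0.
Proof.
move=> [cf df cdf] bf.
have [M HM] := bf.
have bdf : bounded_support (partial i f).
  by exists M; exact: partial_bounded_support.
have If := integrable_Cc cf bf.
have Idf := integrable_Cc cdf bdf.
apply/eqP; rewrite -normr_le0; apply/ler_addgt0Pr => e e0; rewrite add0r.
pose V : R := (2 * (`|M| + 1)) ^+ d.
have V0 : 0 < V by rewrite exprn_gt0// mulr_gt0// ltr_wpDl.
have eV : 0 < e / V by rewrite divr_gt0.
have [r r0 Hr] := Cc_unif_continuous cdf bdf eV.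
(* The bound t <= 1 keeps the support of the quotient in the ball of radius |M| + 1, whatever e
   is. *)
pose t := Num.min (r / 2) 1.
have t0 : 0 < t by rewrite lt_min ltr01 andbT divr_gt0.
have tr : t < r by rewrite gt_min; apply/orP; left; lra.
have t1 : t <= 1 by rewrite ge_min lexx orbT.
have [Is Es] := @Rintegral_shift f (t *: e_ i) If.
pose q x := t^-1 * (f (x + t *: e_ i) - f x).
have Iq : mu.-integrable setT (EFin \o q).
  by apply: integrableZ_fin => //; exact: integrableB_fin.
have q0 : \int[mu]_x q x = 0.
  rewrite RintegralZl//; last exact: integrableB_fin.
  by rewrite RintegralB// Es subrr mulr0.
have -> : \int[mu]_x partial i f x = \int[mu]_x (partial i f x - q x).
  by rewrite RintegralB// q0 subr0.
have Idq : mu.-integrable setT (EFin \o (fun x => partial i f x - q x)).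
  exact: integrableB_fin.
have mB := @measurable_closed_ball_rV R d 0 (`|M| + 1) ltac:(by rewrite addr_ge0).
have E2 : (fun x => partial i f x - q x) =
   (fun x => partial i f x - q x) \_ [set y | `|0 - y| <= `|M| + 1].
  apply/funext => x; rewrite patchE; case: ifPn => //; rewrite notin_setE/= sub0r normrN => /negP.
  rewrite -ltNge => Mx; have hM := ler_norm M.
  rewrite /q (HM x); last lra.
  rewrite (HM (x + t *: e_ i)); last first.
    have := lerB_normD x (t *: e_ i); have := norm_delta_le i t; rewrite (gtr0_norm t0).
    lra.
  rewrite subrr mulr0 subr0.
  rewrite (partial_bounded_support i HM)//; lra.
rewrite E2 -Rintegral_mkcond.
have IdqB : mu.-integrable [set y | `|0 - y| <= `|M| + 1] (EFin \o (fun x => partial i f x - q x)).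
  by apply: integrableS Idq.
rewrite (le_trans (le_normr_Rintegral _ _))//.
have IeV : mu.-integrable [set y | `|0 - y| <= `|M| + 1] (EFin \o (fun=> e / V)).
  apply: (integrable_bounded_on (r := `|M| + 1) (M := e / V)) => //.
    by move=> x /=; rewrite sub0r normrN.
  by move=> x _; rewrite gtr0_norm.
rewrite (@le_trans _ _ (\int[mu]_(x in [set y | `|0 - y| <= `|M| + 1]) (e / V)))//.
  apply: le_Rintegral => //; first exact: integrable_norm.
  move=> x _.
  have [s /andP[s0 st] Es'] := @directional_MVT R d f x (e_ i) t (partial i f) t0
     (fun s _ => derivableP (df (x + s *: e_ i))).
  rewrite /q Es' mulrA mulVf ?gt_eqF// mul1r; apply/ltW/Hr.
  rewrite opprD addNKr normrN (le_lt_trans (norm_delta_le _ _))// gtr0_norm//.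
  exact: lt_trans tr.
rewrite Rintegral_cst// lebesgue_rV_closed_ball ?addr_ge0//= -/V.
by rewrite divfK ?gt_eqF.
Qed.

End integration.

(** * Calculus of C^k functions *)

Section Ck_theory.
Variables (R : realType) (d : nat).
Local Notation E := 'rV[R]_d.
Local Notation e_ i := (delta_mx ord0 i : E).
Implicit Types (f g : E -> R) (U : set E).

Lemma eq_partial U f g i x : open U -> (forall x, U x -> f x = g x) -> U x ->
  partial i f x = partial i g x.
Proof.
move=> oU fg Ux; apply: near_eq_derive.
by have := open_nbhs_nbhs (conj oU Ux); exact: filterS.
Qed.

Lemma eq_derivable U f g (v : E) x : open U -> (forall x, U x -> f x = g x) -> U x ->
  derivable f x v -> derivable g x v.
Proof.
move=> oU fg Ux; apply: near_eq_derivable.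
by have := open_nbhs_nbhs (conj oU Ux); exact: filterS.
Qed.

Lemma Ck_continuous k U f : Ck k U f -> {within U, continuous f}.
Proof. by case: k => [|k] []. Qed.

Lemma CkS k U f : Ck k.+1 U f -> Ck k U f.
Proof.
elim: k f => [|k IH] f [cf H]; split => // i.
by have [Hd Hc] := H i; split => //; exact: IH.
Qed.

Lemma eq_Ck k U f g : open U -> (forall x, U x -> f x = g x) -> Ck k U f -> Ck k U g.
Proof.
move=> oU; elim: k f g => [|k IH] f g fg [cf H]; split.
- by apply: subspace_eq_continuous cf => x; rewrite inE => /fg.
- by [].
- by apply: subspace_eq_continuous cf => x; rewrite inE => /fg.
move=> i; have [Hd Hc] := H i; split.
  by move=> x Ux; apply: (eq_derivable oU fg) => //; exact: Hd.
by apply: IH Hc => x Ux; exact: (eq_partial _ oU).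
Qed.

Lemma Ck_subset k U W f : U `<=` W -> Ck k W f -> Ck k U f.
Proof.
move=> UW; elim: k f => [|k IH] f [cf H]; split => //.
- exact: continuous_subspaceW cf.
- exact: continuous_subspaceW cf.
by move=> i; have [Hd Hc] := H i; split; [move=> x /UW; exact: Hd|exact: IH].
Qed.

Lemma within_continuousD U f g :
  {within U, continuous f} -> {within U, continuous g} ->
  {within U, continuous (fun x => f x + g x)}.
Proof. by move=> cf cg x; apply: continuousD; [exact: cf|exact: cg]. Qed.

Lemma within_continuousM U f g :
  {within U, continuous f} -> {within U, continuous g} ->
  {within U, continuous (fun x => f x * g x)}.
Proof. by move=> cf cg x; apply: continuousM; [exact: cf|exact: cg]. Qed.

Lemma within_continuousB U f g :
  {within U, continuous f} -> {within U, continuous g} ->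
  {within U, continuous (fun x => f x - g x)}.
Proof. by move=> cf cg x; apply: continuousB; [exact: cf|exact: cg]. Qed.

Lemma partialD f g i x : derivable f x (e_ i) -> derivable g x (e_ i) ->
  derivable (fun x => f x + g x) x (e_ i) /\
  partial i (fun x => f x + g x) x = partial i f x + partial i g x.
Proof. by move=> Df Dg; split; [exact: (derivableD Df Dg)|exact: (deriveD Df Dg)]. Qed.

Lemma partialM f g i x : derivable f x (e_ i) -> derivable g x (e_ i) ->
  derivable (fun x => f x * g x) x (e_ i) /\
  partial i (fun x => f x * g x) x = f x * partial i g x + g x * partial i f x.
Proof. by move=> Df Dg; split; [exact: (derivableM Df Dg)|exact: (deriveM Df Dg)]. Qed.

Lemma Ck_cst k U (c : R) : open U -> Ck k U (fun=> c).
Proof.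
move=> oU; elim: k c => [|k IH] c; split=> //; try by apply: continuous_subspaceT => x; exact: cst_continuous.
move=> i; split=> [x _|]; first exact: derivable_cst.
apply: (eq_Ck oU _ (IH 0)) => x _.
by rewrite /partial derive_cst.
Qed.

Lemma CkD k U f g : open U -> Ck k U f -> Ck k U g -> Ck k U (fun x => f x + g x).
Proof.
move=> oU; elim: k f g => [|k IH] f g [cf Hf] [cg Hg]; split => //; try exact: within_continuousD.
move=> i; have [Df Cf] := Hf i; have [Dg Cg] := Hg i; split=> [x Ux|].
  exact: (partialD (Df x Ux) (Dg x Ux)).1.
apply: (eq_Ck oU _ (IH _ _ Cf Cg)) => x Ux.
by rewrite (partialD (Df x Ux) (Dg x Ux)).2.
Qed.

Lemma CkM k U f g : open U -> Ck k U f -> Ck k U g -> Ck k U (fun x => f x * g x).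
Proof.
move=> oU; elim: k f g => [|k IH] f g; [move=> [cf _] [cg _]|move=> Kf Kg];
  split => //; try exact: within_continuousM.
  by apply: within_continuousM; apply: Ck_continuous; [exact: Kf|exact: Kg].
have [_ Hf] := Kf; have [_ Hg] := Kg.
move=> i; have [Df Cf] := Hf i; have [Dg Cg] := Hg i; split=> [x Ux|].
  exact: (partialM (Df x Ux) (Dg x Ux)).1.
have K1 := IH _ _ (CkS Kf) Cg; have K2 := IH _ _ (CkS Kg) Cf.
apply: (eq_Ck oU _ (CkD oU K1 K2)) => x Ux.
by rewrite (partialM (Df x Ux) (Dg x Ux)).2.
Qed.

Lemma CkN k U f : open U -> Ck k U f -> Ck k U (fun x => - f x).
Proof.
move=> oU Kf; apply: (eq_Ck oU _ (CkM oU (Ck_cst k (-1) oU) Kf)) => x _.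
by rewrite mulN1r.
Qed.

Lemma CkB k U f g : open U -> Ck k U f -> Ck k U g -> Ck k U (fun x => f x - g x).
Proof. by move=> oU Kf Kg; apply: CkD => //; exact: CkN. Qed.

Lemma Ck_prod k U I (s : seq I) (f : I -> E -> R) : open U ->
  (forall i, Ck k U (f i)) -> Ck k U (fun x => \prod_(i <- s) f i x).
Proof.
move=> oU Kf; elim: s => [|a s IH].
  by apply: (eq_Ck oU _ (Ck_cst k 1 oU)) => x _; rewrite big_nil.
by apply: (eq_Ck oU _ (CkM oU (Kf a) IH)) => x _; rewrite big_cons.
Qed.

Lemma Ck_sum k U I (s : seq I) (f : I -> E -> R) : open U ->
  (forall i, Ck k U (f i)) -> Ck k U (fun x => \sum_(i <- s) f i x).
Proof.
move=> oU Kf; elim: s => [|a s IH].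
  by apply: (eq_Ck oU _ (Ck_cst k 0 oU)) => x _; rewrite big_nil.
by apply: (eq_Ck oU _ (CkD oU (Kf a) IH)) => x _; rewrite big_cons.
Qed.

Lemma partial_comp (th : R -> R) (dth : R) f i x : derivable f x (e_ i) ->
  is_derive (f x) 1 th dth ->
  derivable (fun x => th (f x)) x (e_ i) /\
  partial i (fun x => th (f x)) x = dth * partial i f x.
Proof.
move=> /derivableP Df Dth; have [] := is_derive_chain Df Dth.
by [].
Qed.

(** The outer function comes with the whole sequence of its derivatives, required only at the values
    of [f]; the induction on k then just shifts the sequence. *)
Lemma Ck_comp k U f (th : nat -> R -> R) : open U -> Ck k U f ->
  (forall n x, (n <= k)%N -> U x -> is_derive (f x) 1 (th n) (th n.+1 (f x))) ->
  Ck k U (fun x => th 0%N (f x)).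
Proof.
move=> oU; elim: k f th => [|k IH] f th Kf Dth.
  split => //; case: Kf => /(within_open_continuousP _ oU) cf _.
  apply/within_open_continuousP => // x Ux; apply: continuous_comp; first exact: cf.
  exact: is_derive_continuous1 (Dth 0%N x isT Ux).
have cf := Ck_continuous Kf; have [_ Hf] := Kf.
split.
  have /(within_open_continuousP _ oU) cf' := cf.
  apply/within_open_continuousP => // x Ux; apply: continuous_comp; first exact: cf'.
  exact: is_derive_continuous1 (Dth 0%N x isT Ux).
move=> i; have [Df Cf] := Hf i; split=> [x Ux|].
  exact: (partial_comp (Df x Ux) (Dth 0%N x isT Ux)).1.
have K1 := IH f (fun n => th n.+1) (CkS Kf) (fun n x nk Ux => Dth n.+1 x nk Ux).
apply: (eq_Ck oU _ (CkM oU K1 Cf)) => x Ux.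
by rewrite (partial_comp (Df x Ux) (Dth 0%N x isT Ux)).2.
Qed.

Lemma partial_coord (i j : 'I_d) (x : E) :
  is_derive x (e_ j) (fun y : E => y ord0 i) ((i == j)%:R).
Proof.
apply/is_derive_line0.
rewrite (_ : (fun t : R => (x + t *: e_ j) ord0 i) = (fun t => x ord0 i + t * (i == j)%:R)); last first.
  by apply/funext => t; rewrite !mxE eqxx.
by apply: is_derive_eq; rewrite add0r mul1r scaler0 add0r -[LHS]/(_ * 1) mulr1.
Qed.

Lemma Ck_coord k U i : open U -> Ck k U (fun x : E => x ord0 i).
Proof.
move=> oU; have c : {within U, continuous (fun x : E => x ord0 i)}.
  by apply: continuous_subspaceT; exact: coord_continuous.
case: k => [|k]; split => // j; split.
  by move=> x _; have [] := partial_coord i j x.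
apply: (eq_Ck oU _ (Ck_cst k ((i == j)%:R) oU)) => x _.
by have [_] := partial_coord i j x; rewrite /partial => ->.
Qed.

End Ck_theory.

(** * The flat function and smooth kernels *)

Section one_dimensional_bump.
Variable (R : realType).

(** A quadratic remainder replaces the limit of difference quotients. It suits functions defined by
    cases, such as the flat function at 0 or the square of the positive part. *)
Lemma is_derive_quadratic (g : R -> R) (a D C : R) :
  (forall h, `|h| <= 1 -> `|g (a + h) - g a - D * h| <= C * h ^+ 2) ->
  is_derive a 1 g D.
Proof.
move=> H.
have lim : h^-1 *: (g (h *: 1 + a) - g a) @[h --> 0^'] --> D.
  apply/cvgrPdist_le => e e0.
  have C1 : 0 < `|C| + 1 by rewrite ltr_wpDl.
  exists (Num.min 1 (e / (`|C| + 1))).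
    by rewrite /= lt_min ltr01 divr_gt0.
  move=> h /=; rewrite sub0r normrN lt_min => /andP[h1 he] h0.
  have := H h (ltW h1); rewrite -[h *: 1]/(h * 1) mulr1 [a + h]addrC => Hh.
  rewrite -[h^-1 *: _]/(h^-1 * _).
  have -> : D - h^-1 * (g (h + a) - g a) = - (h^-1 * (g (h + a) - g a - D * h)).
    by field.
  rewrite normrN normrM normfV ler_pdivrMl ?normr_gt0//.
  rewrite (le_trans Hh)//.
  have -> : C * h ^+ 2 = (C * `|h|) * `|h|.
    by rewrite -mulrA -expr2 real_normK ?num_real.
  rewrite mulrC ler_wpM2l//.
  rewrite (@le_trans _ _ ((`|C| + 1) * `|h|))// ?ler_wpM2r//.
    by rewrite (le_trans (ler_norm C))// lerDl.
  by rewrite -ler_pdivlMl// mulrC ltW.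
apply: DeriveDef; first by apply/cvg_ex; exists D.
exact: cvg_lim lim.
Qed.

Lemma pow_le_expR n (s : R) : 0 <= s -> s ^+ n <= n`!%:R * expR s.
Proof.
move=> s0; have f0 : 0 < n`!%:R :> R by rewrite ltr0n fact_gt0.
case: n f0 => [|n] f0; first by rewrite expr0 fact0 mul1r (le_trans _ (expR_ge1Dx s))// lerDl.
rewrite -ler_pdivrMl//= mulrC (le_trans _ (expR_ge1Dxn n s0))// lerDr//.
Qed.

Lemma poly_le_expR (Q : {poly R}) : exists C : R, forall s, 0 <= s -> `|Q.[s]| <= C * expR s.
Proof.
exists (\sum_(i < size Q) `|Q`_i| * i`!%:R) => s s0.
rewrite horner_coef (le_trans (ler_norm_sum _ _ _))// mulr_suml ler_sum// => i _.
rewrite normrM -mulrA ler_wpM2l// ger0_norm ?exprn_ge0//.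
exact: pow_le_expR.
Qed.

(** With s = 1/t, the derivative in t of P(s) exp(-s) is s^2 (P(s) - P'(s)) exp(-s). *)
Fixpoint flat_poly (n : nat) : {poly R} :=
  if n is m.+1 then 'X^2 * (flat_poly m - (flat_poly m)^`()) else 1.

(* The n-th derivative of the function equal to exp(-1/t) for t > 0 and to 0
   for t <= 0. *)
Definition flat (n : nat) (t : R) : R :=
  if 0 < t then (flat_poly n).[t^-1] * expR (- t^-1) else 0.

Lemma flat_derive (n : nat) (t : R) : is_derive t 1 (flat n) (flat n.+1 t).
Proof.
have [t0|t0|->] := ltgtP t 0.
- have -> : flat n.+1 t = 0 by rewrite /flat ltNge (ltW t0).
  apply: (near_eq_is_derive (f := cst 0)).
  have := open_nbhs_nbhs (conj (@open_lt R 0) t0); apply: filterS => u /= u0.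
  by rewrite /flat ifF//; apply/negbTE; rewrite -leNgt ltW.
- have D : is_derive t 1 (fun u : R => (flat_poly n).[u^-1] * expR (- u^-1)) (flat n.+1 t).
    have tn0 : t != 0 by rewrite gt_eqF.
    have DV : is_derive t 1 (fun u : R => u^-1) (- t ^- 2).
      apply: DeriveDef; first by apply: (@derivableV _ _ id).
      rewrite (@deriveV _ _ id)// derive_id; exact: mulr1.
    have D1 := @is_derive1_comp R (horner (flat_poly n)) (fun u => u^-1) t _ _ (is_derive_poly (flat_poly n) t^-1) DV.
    have D2 : is_derive t 1 (fun u : R => expR (- u^-1)) (expR (- t^-1) * (t ^- 2)).
      have DN : is_derive t 1 (fun u : R => - u^-1) (t ^- 2).
        by have := is_deriveN DV; rewrite opprK.
      exact: (@is_derive1_comp R expR (fun u => - u^-1) t _ _ (is_derive_expR _) DN).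
    have D3 := is_deriveM D1 D2; apply: (is_derive_eq (df := _)) D3 _.
    rewrite /flat t0 /= !hornerE.
    by rewrite /GRing.scale/=; field.
  apply: near_eq_is_derive D.
  have := open_nbhs_nbhs (conj (@open_gt R 0) t0); apply: filterS => u /= u0.
  by rewrite /flat ifT.
have -> : flat n.+1 0 = 0 by rewrite /flat ltxx.
(* At 0 the exponential dominates s^2 P(s), which gives [flat n h] = O(h^2) and hence derivative
   0. *)
have [C HC] := poly_le_expR ('X^2 * flat_poly n).
apply: (@is_derive_quadratic _ _ _ `|C|) => h h1.
rewrite add0r mul0r subr0 /flat ltxx subr0.
case: ltP => h0; last by rewrite normr0 mulr_ge0 ?sqr_ge0.
have h0' : 0 <= h^-1 by rewrite invr_ge0 ltW.
have := HC _ h0'; rewrite hornerM hornerXn normrM => H.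
move: H; rewrite (ger0_norm (exprn_ge0 2 h0')) exprVn => H.
rewrite normrM (ger0_norm (expR_ge0 _)) expRN ler_pdivrMr ?expR_gt0//.
have h2 : 0 < h ^+ 2 by rewrite exprn_gt0.
rewrite (_ : `|C| * h ^+ 2 * expR h^-1 = h ^+ 2 * (`|C| * expR h^-1)); last by ring.
by rewrite -ler_pdivrMl// (le_trans H)// ler_wpM2r ?expR_ge0// ler_norm.
Qed.

Lemma flat0_gt0 t : 0 < t -> 0 < flat 0 t.
Proof. by move=> t0; rewrite /flat t0/= hornerC mul1r expR_gt0. Qed.

Lemma flat0_ge0 t : 0 <= flat 0 t.
Proof. by rewrite /flat; case: ifP => // t0; rewrite /= hornerC mul1r expR_ge0. Qed.

Lemma flat_eq0 n t : t <= 0 -> flat n t = 0.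
Proof. by move=> t0; rewrite /flat ltNge t0. Qed.

End one_dimensional_bump.

Section mollifier_kernel.
Variables (R : realType) (d : nat).
Local Notation E := 'rV[R]_d.
Local Notation mu := (lebesgue_rV R d).

Lemma Rintegral_gt0 (D : set E) (f : E -> R) (a : E) (r c : R) : measurable D ->
  mu.-integrable D (EFin \o f) -> (forall x, D x -> 0 <= f x) ->
  0 < r -> 0 < c -> (forall x, `|a - x| <= r -> D x /\ c <= f x) ->
  0 < \int[mu]_(x in D) f x.
Proof.
move=> mD If f0 r0 c0 H.
pose B := [set x | `|a - x| <= r].
have mB : measurable B by apply: measurable_closed_ball_rV; exact: ltW.
have BD : B `<=` D by move=> x /H[].
have E0 : D = B `|` (D `\` B) by rewrite setDUK.
have mDB : measurable (D `\` B) by exact: measurableD.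
rewrite E0 Rintegral_setU//; last 2 first.
- by rewrite -E0.
- by apply/disj_setPS => x [Bx [_ /(_ Bx)]].
rewrite ltr_pwDl//; last by apply: Rintegral_ge0 => x [Dx _]; exact: f0.
have Ic : mu.-integrable B (EFin \o (fun=> c)).
  apply: (integrable_bounded_on (r := `|a| + r) (M := c)) => //.
    move=> x /= ax; rewrite (_ : x = a - (a - x)); last by rewrite opprB addrC subrK.
    by rewrite (le_trans (ler_normB _ _))// lerD2l.
  by move=> x _; rewrite gtr0_norm.
apply: (@lt_le_trans _ _ (\int[mu]_(x in B) c)).
  rewrite Rintegral_cst// lebesgue_rV_closed_ball ?ltW//= mulr_gt0// exprn_gt0// mulr_gt0//.
apply: le_Rintegral => //.
  exact: integrableS If.
by move=> x /H[].
Qed.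

(** A product of flat functions of r + x_i and r - x_i. Evenness is recorded because a kernel moved
    by Fubini onto the other factor appears with its argument reversed. *)
Lemma smooth_bump (r : R) : 0 < r -> exists eta : E -> R,
  [/\ smooth setT eta, forall x, 0 <= eta x, forall x, r <= `|x| -> eta x = 0,
      forall x, eta (- x) = eta x & 0 < eta 0].
Proof.
move=> r0.
pose b (i : 'I_d) (x : E) : R := flat 0 (r + x ord0 i) * flat 0 (r - x ord0 i).
exists (fun x => \prod_(i < d) b i x); split.
- move=> k; apply: Ck_prod; first exact: openT.
  move=> i; apply: CkM; first exact: openT.
    apply: (@Ck_comp R d k setT (fun x => r + x ord0 i) (@flat R)); first exact: openT.
      by apply: CkD; [exact: openT|apply: Ck_cst; exact: openT|apply: Ck_coord; exact: openT].
    by move=> n x _ _; exact: flat_derive.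
  apply: (@Ck_comp R d k setT (fun x => r - x ord0 i) (@flat R)); first exact: openT.
    by apply: CkB; [exact: openT|apply: Ck_cst; exact: openT|apply: Ck_coord; exact: openT].
  by move=> n x _ _; exact: flat_derive.
- by move=> x; apply: prodr_ge0 => i _; rewrite mulr_ge0// flat0_ge0.
- move=> x; rewrite leNgt => /negP xr.
  have [i ri] : exists i, r <= `|x ord0 i|.
    apply: contrapT => H; apply: xr; apply/norm_rV_lt => // i.
    by rewrite ltNge; apply/negP => ri; apply: H; exists i.
  rewrite (bigD1 i)//= /b.
  have [x0|x0] := leP 0 (x ord0 i).
    by rewrite (flat_eq0 0 (t := r - _)) ?mulr0 ?mul0r// subr_le0 -(ger0_norm x0).
  rewrite (flat_eq0 0 (t := r + _)) ?mul0r//.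
  by move: ri; rewrite ltr0_norm//; lra.
- by move=> x; apply: eq_bigr => i _; rewrite /b !mxE opprK mulrC.
- by apply: prodr_gt0 => i _; rewrite /b !mxE addr0 subr0 mulr_gt0// flat0_gt0.
Qed.

Lemma smooth_continuous (f : E -> R) : smooth setT f -> continuous f.
Proof.
move=> /(_ 0%N)[cf _] x; have oT : open [set: E] by exact: openT.
by have /(within_open_continuousP _ oT) := cf; exact.
Qed.

Lemma smooth_kernel (r : R) : 0 < r -> exists eta : E -> R,
  [/\ smooth setT eta, forall x, 0 <= eta x, forall x, r <= `|x| -> eta x = 0,
      forall x, eta (- x) = eta x & \int[mu]_x eta x = 1].
Proof.
move=> r0; have [eta [s e0 er eN ep]] := smooth_bump r0.
have ce := smooth_continuous s.
have be : bounded_support eta by exists r => x /ltW; exact: er.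
have Ie := integrable_Cc ce be.
have [c c0 Hc] := (continuous_rVP _ _).1 (ce 0) (eta 0 / 2) ltac:(by rewrite divr_gt0).
have I0 : 0 < \int[mu]_x eta x.
  apply: (@Rintegral_gt0 setT eta 0 (c / 2) (eta 0 / 2)) => //; try by rewrite divr_gt0.
  move=> x xc; split => //; have := Hc x ltac:(lra); rewrite ltr_distlC; lra.
exists (fun x => (\int[mu]_y eta y)^-1 * eta x); split.
- by move=> k; apply: CkM; [exact: openT|apply: Ck_cst; exact: openT|exact: s].
- by move=> x; rewrite mulr_ge0// invr_ge0 ltW.
- by move=> x /er ->; rewrite mulr0.
- by move=> x; rewrite eN.
- by rewrite RintegralZl// mulVf// gt_eqF.
Qed.

End mollifier_kernel.

(** * Convolution with a kernel *)

Section mollification.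
Variables (R : realType) (d : nat).
Local Notation E := 'rV[R]_d.
Local Notation mu := (lebesgue_rV R d).
Local Notation e_ i := (delta_mx ord0 i : E).
Implicit Types (f g h eta : E -> R) (D : set E).

(** The kernel is taken at y - x, so that as a function of y it is a translate of [eta] and can
    serve as a test function; the price is a minus sign in the derivative with respect to x. *)
Definition convol D f eta (x : E) : R := \int[mu]_(y in D) (f y * eta (y - x)).

Lemma EFin_Rintegral D f : measurable D -> mu.-integrable D (EFin \o f) ->
  (\int[mu]_(x in D) f x)%:E = (\int[mu]_(x in D) (f x)%:E)%E.
Proof. by move=> mD If; rewrite fineK//; exact: integrable_fin_num. Qed.

Lemma restrictE D f x : (f \_ D) x = if x \in D then f x else 0.
Proof. by rewrite patchE. Qed.

Lemma shift_Cc eta (x : E) : continuous eta -> bounded_support eta ->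
  continuous (fun y : E => eta (y - x)) /\ bounded_support (fun y : E => eta (y - x)).
Proof.
move=> ce [M HM]; split.
  move=> y; apply: (@continuous_comp _ _ _ (fun z : E => z - x) eta); last exact: ce.
  by apply: continuousB; [exact: cvg_id|exact: cst_continuous].
exists (M + `|x|) => y My; apply: HM; have := lerB_dist y x; lra.
Qed.

Lemma integrable_conv D f eta (x : E) : measurable D -> continuous eta -> bounded_support eta ->
  mu.-integrable D (EFin \o f) -> mu.-integrable D (EFin \o (fun y => f y * eta (y - x))).
Proof.
move=> mD ce be If; have [cs bs] := shift_Cc x ce be.
have [M M0 HM] := Cc_bounded cs bs.
apply: (integrable_mul_bounded (M := M)) => //.
by apply: measurable_funTS; exact: continuous_measurable_rV.
Qed.

Lemma Fubini_convol D f H eta : measurable D -> mu.-integrable D (EFin \o f) ->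
  continuous H -> bounded_support H -> continuous eta -> bounded_support eta ->
  \int[mu]_x (H x * convol D f eta x) =
  \int[mu]_(y in D) (f y * \int[mu]_x (H x * eta (y - x))).
Proof.
move=> mD If cH bH ce be.
pose f1 := f \_ D.
have If1 : mu.-integrable setT (EFin \o f1).
  have := (integrable_mkcond (EFin \o f) mD).1 If; rewrite (_ : _ \_ _ = EFin \o f1)//.
  by apply/funext => x; rewrite /f1/= !patchE; case: ifP.
have mf1 : measurable_fun setT f1 by apply/measurable_EFinP; exact: measurable_int If1.
have IH := integrable_Cc cH bH.
have mH := continuous_measurable_rV cH.
have [M M0 HM] := Cc_bounded ce be.
pose F (z : E * E) : R := H z.1 * (f1 z.2 * eta (z.2 - z.1)).
have mF : measurable_fun setT F.
  apply: measurable_funM; first exact: (measurableT_comp mH measurable_fst).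
  apply: measurable_funM; first exact: (measurableT_comp mf1 measurable_snd).
  have md : measurable_fun setT (fun z : E * E => z.2 - z.1).
    apply: measurable_fun_rV => i; under eq_fun do rewrite !mxE.
    apply: measurable_funB.
      exact: (measurableT_comp (measurable_coord i) measurable_snd).
    exact: (measurableT_comp (measurable_coord i) measurable_fst).
  exact: (measurableT_comp (continuous_measurable_rV ce) md).
have Iy x : mu.-integrable setT (EFin \o (fun y => f1 y * eta (y - x))).
  by apply: integrable_conv.
have Ix y : mu.-integrable setT (EFin \o (fun x => H x * eta (y - x))).
  apply: (integrable_mul_bounded (M := M)) => //.
  apply: continuous_measurable_rV => x.
  apply: (@continuous_comp _ _ _ (fun z : E => y - z) eta); last exact: ce.
  by apply: continuousB; [exact: cst_continuous|exact: cvg_id].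
have IF : (@lebr R d \x @lebr R d)%E.-integrable setT (EFin \o F).
  apply/integrable12ltyP; first exact/measurable_EFinP.
  (* Integrability on the product by Tonelli: with |eta| <= M, the inner integral is at most |H x| M
     times the L^1 norm of f. *)
  apply: (@le_lt_trans _ _ (\int[mu]_x ((`|H x| * (M * \int[mu]_y `|f1 y|))%:E))%E).
    apply: ge0_le_integral => //.
    - by move=> x _; exact: integral_ge0.
    - have mF' : measurable_fun setT (EFin \o (fun z => `|F z|)).
        by apply/measurable_EFinP; exact: measurableT_comp.
      have := @measurable_fun_fubini_tonelli_F _ _ _ _ R (@lebr R d) (EFin \o (fun z => `|F z|)).
      by apply => // z; rewrite /= lee_fin.
    - apply/measurable_EFinP; apply: measurable_funM => //; exact: measurableT_comp.
    - move=> x _.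
      apply: (@le_trans _ _ (\int[mu]_y (`|H x| * (M * `|f1 y|))%:E)%E).
        apply: ge0_le_integral => //.
        + have mFx : measurable_fun setT (fun y => F (x, y)).
            apply/measurable_EFinP; apply: (measurable_int mu).
            exact: (integrableZ_fin (H x) measurableT (Iy x)).
          by apply/measurable_EFinP; exact: measurableT_comp.
        + apply/measurable_EFinP; apply: measurable_funM => //; apply: measurable_funM => //.
          exact: measurableT_comp.
        + move=> y _; rewrite /= lee_fin /F/= !normrM ler_wpM2l// mulrC ler_wpM2r//.
      have In := integrable_norm_fin If1.
      rewrite -EFin_Rintegral//; last by do 2 apply: integrableZ_fin => //.
      by rewrite RintegralZl//; [rewrite RintegralZl|exact: integrableZ_fin].
  rewrite -EFin_Rintegral ?ltry//.
  rewrite (_ : (fun x => _) = (fun x => (M * \int[mu]_y `|f1 y|) * `|H x|)).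
    by apply: integrableZ_fin => //; exact: integrable_norm_fin.
  by apply/funext => x; rewrite mulrC.
have IFx x : mu.-integrable setT (EFin \o (fun y => F (x, y))) by exact: (integrableZ_fin (H x) measurableT (Iy x)).
have IFy y : mu.-integrable setT (EFin \o (fun x => F (x, y))).
  rewrite (_ : (fun x => F (x, y)) = (fun x => f1 y * (H x * eta (y - x)))).
    exact: (integrableZ_fin (f1 y) measurableT (Ix y)).
  by apply/funext => x; rewrite /F/=; ring.
have EF : \int[mu]_x \int[mu]_y F (x, y) = \int[mu]_y \int[mu]_x F (x, y).
  transitivity (fine (\int[mu]_x \int[mu]_y (F (x, y))%:E)%E).
    by congr fine; apply: eq_integral => x _; rewrite EFin_Rintegral.
  transitivity (fine (\int[mu]_y \int[mu]_x (F (x, y))%:E)%E).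
    apply: (congr1 fine); rewrite -[LHS]integral_lebr -[RHS]integral_lebr.
    transitivity (\int[@lebr R d]_x \int[@lebr R d]_y (EFin \o F) (x, y))%E.
      by apply: eq_integral => x _; rewrite integral_lebr.
    rewrite (Fubini IF); apply: eq_integral => y _; rewrite integral_lebr//.
  by congr fine; apply: eq_integral => y _; rewrite EFin_Rintegral.
transitivity (\int[mu]_x \int[mu]_y F (x, y)).
  apply: eq_Rintegral => x _.
  have -> : \int[mu]_y F (x, y) = H x * \int[mu]_y (f1 y * eta (y - x)).
    exact: (RintegralZl (H x) measurableT (Iy x)).
  have -> // : convol D f eta x = \int[mu]_y (f1 y * eta (y - x)).
  rewrite /convol Rintegral_mkcond; apply: eq_Rintegral => y _.
  by rewrite /f1 !restrictE; case: ifP => _; [reflexivity|rewrite mul0r; reflexivity].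
rewrite [RHS]Rintegral_mkcond; transitivity (\int[mu]_y \int[mu]_x F (x, y)); first exact: EF.
apply: eq_Rintegral => y _.
transitivity (f1 y * \int[mu]_x (H x * eta (y - x))).
  rewrite -(RintegralZl (f1 y) measurableT (Ix y)).
  by apply: eq_Rintegral => x _; rewrite /F/=; ring.
by rewrite /f1 !restrictE; case: ifP => _; [reflexivity|rewrite mul0r; reflexivity].
Qed.

End mollification.

(** * Mollification and the chain rule for truncations *)

Section mollification_calculus.
Variables (R : realType) (d : nat).
Local Notation E := 'rV[R]_d.
Local Notation mu := (lebesgue_rV R d).
Local Notation e_ i := (delta_mx ord0 i : E).
Implicit Types (f g h k v eta : E -> R) (D : set E).

Lemma directional_quotient eta (i : 'I_d) (w : E) (h : R) :
  (forall x, derivable eta x (e_ i)) -> h != 0 ->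
  exists2 z, `|z - w| <= `|h| & eta (w - h *: e_ i) - eta w = - h * partial i eta z.
Proof.
move=> De h0.
have [hlt|hgt|h00] := ltgtP h 0; last by rewrite h00 eqxx in h0.
  have nh : 0 < - h by lra.
  have [s /andP[s0 sh] Es] := directional_MVT (x := w) (df := partial i eta) nh
    (fun s _ => derivableP (De (w + s *: e_ i))).
  exists (w + s *: e_ i).
    rewrite addrC addKr (le_trans (norm_delta_le _ _))// gtr0_norm//.
    by rewrite ltr0_norm// ltW.
  by rewrite -Es scaleNr.
have [s /andP[s0 sh] Es] := directional_MVT (x := w - h *: e_ i) (df := partial i eta) hgt
    (fun s _ => derivableP (De (w - h *: e_ i + s *: e_ i))).
exists (w - h *: e_ i + s *: e_ i).
  rewrite (addrC w) addrAC addrK addrC -scalerBl (le_trans (norm_delta_le _ _))//.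
  rewrite (gtr0_norm hgt) ler_norml; lra.
by rewrite mulNr -Es subrK opprB.
Qed.

Lemma conv_continuous D f k : measurable D -> mu.-integrable D (EFin \o f) ->
  continuous k -> bounded_support k -> continuous (convol D f k).
Proof.
move=> mD If ck bk x; apply/continuous_rVP => e e0.
have In := integrable_norm_fin If.
pose N : R := \int[mu]_(y in D) `|f y|.
have N0 : 0 <= N by exact: Rintegral_ge0.
have eN : 0 < e / (N + 1) by rewrite divr_gt0// ltr_wpDl.
have [r r0 Hr] := Cc_unif_continuous ck bk eN.
exists r => // x' xx'.
have I1 := integrable_conv (x) mD ck bk If; have I2 := integrable_conv (x') mD ck bk If.
rewrite /convol -RintegralB// (le_lt_trans (le_normr_Rintegral _ _))//.
  exact: integrableB_fin.
apply: (@le_lt_trans _ _ (\int[mu]_(y in D) (e / (N + 1) * `|f y|))).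
  apply: le_Rintegral => //.
  - by apply: integrable_norm_fin; exact: integrableB_fin.
  - exact: integrableZ_fin.
  move=> y Dy; rewrite -mulrBr normrM mulrC ler_wpM2r//; apply/ltW/Hr.
  rewrite (_ : y - x - (y - x') = x' - x); first by rewrite distrC.
  by rewrite opprB addrC addrA subrK.
rewrite RintegralZl// -/N mulrAC ltr_pdivrMr ?ltr_wpDl// ltr_pM2l//.
lra.
Qed.

Lemma conv_derive D f eta (i : 'I_d) (x : E) : measurable D -> mu.-integrable D (EFin \o f) ->
  C1dir i eta -> bounded_support eta ->
  is_derive x (e_ i) (convol D f eta) (- convol D f (partial i eta) x).
Proof.
move=> mD If [ce De cDe] be.
have [M HM] := be.
have bde : bounded_support (partial i eta) by exists M; exact: partial_bounded_support.
have In := integrable_norm_fin If.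
pose N : R := \int[mu]_(y in D) `|f y|.
have N0 : 0 <= N by exact: Rintegral_ge0.
have lim : h^-1 *: ((convol D f eta \o shift x) (h *: e_ i) - convol D f eta x) @[h --> 0^'] -->
    - convol D f (partial i eta) x.
  apply/cvgrPdist_lt => e e0.
  have eN : 0 < e / (N + 1) by rewrite divr_gt0// ltr_wpDl.
  have [r r0 Hr] := Cc_unif_continuous cDe bde eN.
  exists r => // h /=; rewrite sub0r normrN => hr h0.
  have I0 := integrable_conv (x) mD ce be If.
  have I1 := integrable_conv (h *: e_ i + x) mD ce be If.
  have I2 := integrable_conv (x) mD cDe bde If.
  have I3 := integrableZ_fin h^-1 mD (integrableB_fin mD I1 I0).
  have -> : - convol D f (partial i eta) x - h^-1 *: (convol D f eta (h *: e_ i + x) - convol D f eta x) =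
    - \int[mu]_(y in D) (f y * partial i eta (y - x) +
        h^-1 * (f y * eta (y - (h *: e_ i + x)) - f y * eta (y - x))).
    rewrite RintegralD// RintegralZl//; last exact: integrableB_fin.
    by rewrite RintegralB// opprD.
  rewrite normrN (le_lt_trans (le_normr_Rintegral _ _))//; first exact: integrableD_fin.
  apply: (@le_lt_trans _ _ (\int[mu]_(y in D) (e / (N + 1) * `|f y|))).
    apply: le_Rintegral => //.
    - by apply: integrable_norm_fin; exact: integrableD_fin.
    - exact: integrableZ_fin.
    move=> y Dy; have [z zw Ez] := directional_quotient (y - x) De h0.
    rewrite (_ : y - (h *: e_ i + x) = y - x - h *: e_ i); last first.
      by rewrite opprD addrCA addrC.
    rewrite -mulrBr Ez (_ : _ + _ = f y * (partial i eta (y - x) - partial i eta z)); last by field.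
    rewrite normrM mulrC ler_wpM2r//; apply/ltW/Hr.
    by rewrite distrC (le_lt_trans zw).
  rewrite RintegralZl// -/N mulrAC ltr_pdivrMr ?ltr_wpDl// ltr_pM2l//.
  lra.
apply: DeriveDef; first by apply/cvg_ex; exists (- convol D f (partial i eta) x).
exact: cvg_lim lim.
Qed.

Lemma Ck_shift (k : nat) eta (x : E) : Ck k setT eta -> Ck k setT (fun y : E => eta (y - x)).
Proof.
have H (f : E -> R) (i : 'I_d) (y : E) : derivable f (y - x) (e_ i) ->
    is_derive y (e_ i) (fun y : E => f (y - x)) (partial i f (y - x)).
  move=> /derivableP Df; apply/is_derive_line0.
  rewrite (_ : (fun t : R => _) = (fun t : R => f ((y - x) + t *: e_ i))); last first.
    by apply/funext => t; rewrite addrAC.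
  exact/is_derive_line0.
have C (f : E -> R) : {within setT, continuous f} ->
    {within setT, continuous (fun y : E => f (y - x))}.
  have oT : open [set: E] by exact: openT.
  move=> /(within_open_continuousP _ oT) cf; apply/(within_open_continuousP _ oT) => y _.
  apply: (@continuous_comp _ _ _ (fun z : E => z - x) f); last exact: cf.
  by apply: continuousB; [exact: cvg_id|exact: cst_continuous].
elim: k eta => [|k IH] eta [ce K]; split => //; try exact: C.
move=> i; have [De Ke] := K i; split.
  by move=> y _; have [] := H eta i y (De _ I).
apply: (eq_Ck (@openT _) _ (IH _ Ke)) => y _.
by have [_] := H eta i y (De _ I).
Qed.

Lemma partial_shift eta (i : 'I_d) (x y : E) : (forall z, derivable eta z (e_ i)) ->
  partial i (fun y : E => eta (y - x)) y = partial i eta (y - x).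
Proof.
move=> De; have Df := derivableP (De (y - x)).
have [_] : is_derive y (e_ i) (fun y : E => eta (y - x)) (partial i eta (y - x)); last by [].
apply/is_derive_line0.
rewrite (_ : (fun t : R => _) = (fun t : R => eta ((y - x) + t *: e_ i))); last first.
  by apply/funext => t; rewrite addrAC.
exact/is_derive_line0.
Qed.

Lemma smooth_C1dir eta i : smooth setT eta -> C1dir i eta.
Proof.
have oT : open [set: E] by exact: openT.
move=> /(_ 1%N) [ce /(_ i)[De [cde _]]]; split.
- by move=> x; have /(within_open_continuousP _ oT) := ce; exact.
- by move=> x; exact: De.
- by move=> x; have /(within_open_continuousP _ oT) := cde; exact.
Qed.

(** The translated kernel is a test function as soon as the ball of radius r around x lies in
    [Omega]; the definition of the weak gradient does the rest. *)
Lemma conv_weak_gradient (Omega : set E) v (g : E -> E) eta (i : 'I_d) (x : E) (r : R) : 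
  weak_gradient Omega v g -> smooth setT eta -> (forall y, r <= `|y| -> eta y = 0) ->
  (forall y, `|x - y| <= r -> Omega y) ->
  - convol Omega v (partial i eta) x = convol Omega (fun y => g y ord0 i) eta x.
Proof.
move=> wg se er rO.
have [_ De _] := smooth_C1dir i se.
have cl : closure [set y : E | eta (y - x) != 0] `<=` [set y | `|x - y| <= r].
  have /closure_id -> : closed [set y | `|x - y| <= r].
    apply: compact_closed; [exact: norm_hausdorff|exact: closed_ball_rV_compact].
  apply: closure_subset => y /=; apply: contraNT; rewrite -ltNge distrC => ry.
  by rewrite er// ltW.
have tf : test_function Omega (fun y : E => eta (y - x)).
  split.
  - by move=> k; apply: Ck_shift; exact: se.
  - by apply: subclosed_compact cl; [exact: closed_closure|exact: closed_ball_rV_compact].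
  - by move=> y /cl; exact: rO.
have := wg _ i tf; rewrite /convol => H.
apply/eqP; rewrite eqr_oppLR; apply/eqP; rewrite -H.
by apply: eq_Rintegral => y _; rewrite partial_shift.
Qed.

Lemma kernel_average D f eta (a : E) (r c t : R) : measurable D ->
  continuous eta -> (forall x, 0 <= eta x) -> (forall y, r <= `|y| -> eta y = 0) ->
  \int[mu]_x eta x = 1 -> (forall y, `|a - y| < r -> D y) ->
  mu.-integrable D (EFin \o (fun y => f y * eta (y - a))) ->
  (forall y, `|a - y| < r -> `|f y - c| <= t) ->
  `|convol D f eta a - c| <= t.
Proof.
move=> mD ce e0 er e1 rD If fc.
have be : bounded_support eta by exists r => y /ltW; exact: er.
have [cs bs] := shift_Cc a ce be.
have [Is Es] := Rintegral_shift (- a) (integrable_Cc ce be).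
have Ise : mu.-integrable D (EFin \o (fun y => eta (y - a))) by exact: integrableS Is.
have E1 : \int[mu]_(y in D) eta (y - a) = 1.
  rewrite -e1 -Es Rintegral_mkcond; apply: eq_Rintegral => y _.
  rewrite patchE; case: ifPn => //; rewrite notin_setE => nD.
  rewrite [LHS](_ : _ = 0)// er// leNgt distrC; apply/negP => /rD; exact: nD.
have Ec : c = \int[mu]_(y in D) (c * eta (y - a)) by rewrite RintegralZl// E1 mulr1.
have Et : t = \int[mu]_(y in D) (t * eta (y - a)) by rewrite RintegralZl// E1 mulr1.
have Ice := integrableZ_fin c mD Ise; have Ite := integrableZ_fin t mD Ise.
rewrite [X in _ - X]Ec /convol -RintegralB// (le_trans (le_normr_Rintegral _ _))//.
  exact: integrableB_fin.
rewrite [leRHS]Et; apply: le_Rintegral => //.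
  by apply: integrable_norm_fin; exact: integrableB_fin.
move=> y Dy; rewrite -mulrBl normrM (ger0_norm (e0 _)).
have [ay|ay] := ltP `|a - y| r; first by rewrite ler_wpM2r// fc.
by rewrite er ?mulr0// distrC.
Qed.

Lemma compact_continuous_unif (K : set E) f : compact K ->
  (forall x, K x -> {for x, continuous f}) ->
  forall e : R, 0 < e -> exists2 r : R, 0 < r &
    forall x y, K x -> `|x - y| < r -> `|f x - f y| < e.
Proof.
move=> cK cf e e0.
have [x Kx|r r0 H] := @compact_uniform R d K (fun r x => forall y, `|x - y| < r -> `|f x - f y| < e) cK.
  have [r r0 h] := (continuous_rVP _ _).1 (cf x Kx) (e / 2) ltac:(by lra).
  exists (r / 2); first lra.
  move=> y s xy /andP[s0 sr] z yz.
  have h1 := h y ltac:(lra).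
  have h2 : `|f x - f z| < e / 2.
    apply: h => //; rewrite (_ : x - z = (x - y) + (y - z)); last by rewrite addrA subrK.
    by rewrite (le_lt_trans (ler_normD _ _))//; lra.
  rewrite (_ : f y - f z = - (f x - f y) + (f x - f z)); last by lra.
  by rewrite (le_lt_trans (ler_normD _ _))// normrN; lra.
exists (r / 2); first lra.
by move=> x y Kx xy; apply: (H (r / 2)) => //; lra.
Qed.

End mollification_calculus.

Section chain_rule.
Variables (R : realType) (d : nat).
Local Notation E := 'rV[R]_d.
Local Notation mu := (lebesgue_rV R d).
Local Notation e_ i := (delta_mx ord0 i : E).
Implicit Types (f g h k v eta V Y : E -> R) (D K Omega : set E).

Lemma compact_rV_closed K : compact K -> closed K.
Proof. by apply: compact_closed; exact: norm_hausdorff. Qed.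

Lemma compact_rV_bounded K : compact K -> exists2 M : R, 0 < M & forall x, K x -> `|x| <= M.
Proof.
by move=> /compact_bounded/ex_strict_bound_gt0[M M0 HM]; exists M => // x /HM/ltW.
Qed.

Lemma support_bounded K f : compact K -> (forall x, ~ K x -> f x = 0) -> bounded_support f.
Proof.
move=> /compact_rV_bounded[M _ HM] f0; exists M => x Mx; apply: f0 => /HM.
by rewrite leNgt Mx.
Qed.

Lemma partial_support (i : 'I_d) K f : compact K -> (forall x, ~ K x -> f x = 0) ->
  forall x, ~ K x -> partial i f x = 0.
Proof.
move=> /compact_rV_closed/closed_openC oK f0 x nKx.
have H := @partial_locally0 R d i f _ oK f0; exact: H.
Qed.

Lemma cut_continuous Omega K f h : open Omega -> compact K -> K `<=` Omega ->
  (forall x, Omega x -> {for x, continuous f}) -> continuous h ->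
  (forall x, ~ K x -> h x = 0) ->
  continuous (fun x => f x * h x) /\ bounded_support (fun x => f x * h x).
Proof.
move=> oO cK KO cf ch h0; have fh0 x : ~ K x -> f x * h x = 0 by move=> /h0 ->; rewrite mulr0.
split; last exact: support_bounded fh0.
have oK := closed_openC (compact_rV_closed cK).
move=> x; have [Kx|nKx] := pselect (K x).
  by apply: continuousM; [exact/cf/KO | exact: ch].
apply/continuous_rVP => e e0; have [r r0 Hr] := (open_rVP _).1 oK x nKx.
by exists r => // y /Hr nKy; rewrite !fh0// subrr normr0.
Qed.

Lemma Rintegral_support D f : (forall x, ~ D x -> f x = 0) ->
  \int[mu]_(x in D) f x = \int[mu]_x f x.
Proof.
move=> f0; rewrite Rintegral_mkcond; apply: eq_Rintegral => x _.
by rewrite restrictE; case: ifPn => //; rewrite notin_setE => /f0 ->.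
Qed.

(* [v] is mollified: the gradient of the mollification is the mollified [g], and Fubini's
   theorem moves the kernel onto the test function. *)
Lemma chain_rule Omega K v (g : E -> E) V Y (th th' : R -> R) (i : 'I_d) :
  open Omega -> mu.-integrable Omega (EFin \o v) ->
  mu.-integrable Omega (EFin \o (fun x => g x ord0 i)) ->
  (forall x, Omega x -> {for x, continuous v}) -> weak_gradient Omega v g ->
  C1dir i V -> C1dir i Y -> compact K -> K `<=` Omega -> (forall x, ~ K x -> Y x = 0) ->
  (forall s : R, is_derive s 1 th (th' s)) ->
  (forall s t : R, `|th s - th t| <= `|s - t|) ->
  (forall s t : R, `|th' s - th' t| <= `|s - t|) ->
  \int[mu]_(x in Omega) (th (v x - V x) * partial i Y x) =
  - \int[mu]_(x in Omega) (th' (v x - V x) * (g x ord0 i - partial i V x) * Y x).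
Proof.
move=> oO Iv Ig cv wg [cV DV cdV] [cY DY cdY] cK KO Y0 Dth Lth Lth'.
have mO := open_measurable_rV oO.
have cth : continuous th by move=> s; exact: is_derive_continuous1 (Dth s).
have cth' : continuous th'.
  move=> s; apply/cvgrPdist_lt => e e0; near=> t.
  by rewrite (le_lt_trans (Lth' s t))//; near: t; exact: nbhsx_ballx.
have bY := support_bounded cK Y0.
have dY0 := partial_support i cK Y0.
have bdY := support_bounded cK dY0.
have cz x : Omega x -> {for x, continuous (fun x => v x - V x)}.
  by move=> Ox; apply: continuousB; [exact: cv|exact: cV].
have [cH bH] : continuous (fun x => th' (v x - V x) * Y x) /\
    bounded_support (fun x => th' (v x - V x) * Y x).
  apply: (cut_continuous oO cK KO) => // x Ox.
  by apply: (@continuous_comp _ _ _ (fun x => v x - V x) th'); [exact: cz|exact: cth'].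
have [cT bT] : continuous (fun x => th (v x - V x) * partial i Y x) /\
    bounded_support (fun x => th (v x - V x) * partial i Y x).
  apply: (cut_continuous oO cK KO) => // x Ox.
  by apply: (@continuous_comp _ _ _ (fun x => v x - V x) th); [exact: cz|exact: cth].
set H := fun x => th' (v x - V x) * Y x in cH bH *.
set T := fun x => th (v x - V x) * partial i Y x in cT bT *.
have H0 x : ~ K x -> H x = 0 by move=> /Y0 Yx; rewrite /H Yx mulr0.
have T0 x : ~ K x -> T x = 0 by move=> /dY0 Yx; rewrite /T Yx mulr0.
have IH := integrable_Cc cH bH; have IT := integrable_Cc cT bT.
have cHV : continuous (fun x => H x * partial i V x).
  by move=> x; apply: continuousM; [exact: cH|exact: cdV].
have bHV : bounded_support (fun x => H x * partial i V x).
  by apply: (support_bounded cK) => x /H0 ->; rewrite mul0r.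
have IHV := integrable_Cc cHV bHV.
have [BH BH0 HBH] := Cc_bounded cH bH.
have IgH : mu.-integrable Omega (EFin \o (fun x => g x ord0 i * H x)).
  apply: (integrable_mul_bounded (M := BH)) => //.
  by apply: measurable_funTS; exact: continuous_measurable_rV.
have -> : \int[mu]_(x in Omega) T x = \int[mu]_x T x.
  by apply: Rintegral_support => x nO; apply: T0 => /KO.
have -> : \int[mu]_(x in Omega) (th' (v x - V x) * (g x ord0 i - partial i V x) * Y x) =
    \int[mu]_(x in Omega) (g x ord0 i * H x) - \int[mu]_x (H x * partial i V x).
  rewrite -(@Rintegral_support Omega); last by move=> x nO; rewrite H0 ?mul0r// => /KO.
  rewrite -RintegralB//; last exact: integrableS IHV.
  by apply: eq_Rintegral => x _; rewrite /H; ring.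
have [BY BY0 HBY] := Cc_bounded cY bY.
have IdY := integrable_norm_fin (integrable_Cc cdY bdY).
have IgN := integrable_norm_fin Ig.
have cYV : continuous (fun x => Y x * partial i V x).
  by move=> x; apply: continuousM; [exact: cY|exact: cdV].
have bYV : bounded_support (fun x => Y x * partial i V x).
  by apply: (support_bounded cK) => x /Y0 ->; rewrite mul0r.
have IYV := integrable_norm_fin (integrable_Cc cYV bYV).
pose C1 : R := \int[mu]_x `|partial i Y x|.
pose C2 : R := \int[mu]_(x in Omega) `|g x ord0 i|.
pose C3 : R := \int[mu]_x `|Y x * partial i V x|.
have C10 : 0 <= C1 by exact: Rintegral_ge0.
have C20 : 0 <= C2 by exact: Rintegral_ge0.
have C30 : 0 <= C3 by exact: Rintegral_ge0.
(* The errors [e1], [e2], [e3] below are t times C1, (BY + 1) C2 and C3, so that t = e / C bounds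
   their sum by e; the last 1 makes C positive. *)
pose C : R := C1 + (BY + 1) * C2 + C3 + 1.
have BC2 : 0 <= (BY + 1) * C2 by rewrite mulr_ge0// addr_ge0 ?ltW.
have C0 : 0 < C by rewrite /C; lra.
apply/eqP; rewrite -subr_eq0 opprK -normr_le0; apply/ler_addgt0Pr => e e0; rewrite add0r.
pose t := e / C; have t0 : 0 < t by rewrite divr_gt0.
have [r1 r10 Hr1] := compact_open_dist cK oO KO.
have [r2 r20 Hr2] := compact_continuous_unif cK (fun x Kx => cv x (KO x Kx)) t0.
have [r3 r30 Hr3] := Cc_unif_continuous cH bH t0.
(* At scale r the balls around [K] stay in [Omega], and [v] near [K] and [H] everywhere vary by less
   than t. *)
pose r := Num.min (r1 / 2) (Num.min r2 r3).
have r0 : 0 < r by rewrite !lt_min r20 r30 !andbT divr_gt0.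
have rr1 : r < r1 by rewrite gt_min ltr_pdivrMr// ltr_pMr// ltr1n.
have rr2 : r <= r2 by rewrite !ge_min lexx orbT.
have rr3 : r <= r3 by rewrite !ge_min lexx !orbT.
have [eta [se eta0 etar etaN eta1]] := smooth_kernel d r0.
have [ce De cde] := smooth_C1dir i se.
have be : bounded_support eta by exists r => x /ltW; exact: etar.
have bde : bounded_support (partial i eta).
  by exists r; apply: partial_bounded_support => x /ltW; exact: etar.
pose w := convol Omega v eta.
pose dw := fun x => - convol Omega v (partial i eta) x.
have Dw x : is_derive x (e_ i) w (dw x) by exact: conv_derive.
have cw : continuous w by exact: conv_continuous.
have cdw : continuous dw.
  by move=> x; apply: continuousN; exact: conv_continuous.
have KrO x y : K x -> `|x - y| <= r -> Omega y by move=> Kx xy; apply: (Hr1 x) => //; exact: le_lt_trans rr1.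
have dwE x : K x -> dw x = convol Omega (fun y => g y ord0 i) eta x.
  by move=> Kx; apply: (@conv_weak_gradient R d Omega v g eta i x r) => // y; exact: KrO.
have wv x : K x -> `|w x - v x| <= t.
  move=> Kx; apply: (@kernel_average _ _ Omega v eta x r) => //.
  - by move=> y xy; apply: (KrO x) => //; exact: ltW.
  - exact: integrable_conv.
  - by move=> y xy; rewrite distrC; apply/ltW/Hr2 => //; exact: lt_le_trans rr2.
pose He := fun x => th' (w x - V x) * Y x.
pose Te := fun x => th (w x - V x) * partial i Y x.
have cwV : continuous (fun x => w x - V x) by move=> x; apply: continuousB; [exact: cw|exact: cV].
have cthw : continuous (fun x => th (w x - V x)).
  by move=> x; apply: (@continuous_comp _ _ _ (fun x => w x - V x) th); [exact: cwV|exact: cth].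
have cthw' : continuous (fun x => th' (w x - V x)).
  by move=> x; apply: (@continuous_comp _ _ _ (fun x => w x - V x) th'); [exact: cwV|exact: cth'].
have cHe : continuous He by move=> x; apply: continuousM; [exact: cthw'|exact: cY].
have cTe : continuous Te by move=> x; apply: continuousM; [exact: cthw|exact: cdY].
have He0 x : ~ K x -> He x = 0 by move=> /Y0 Yx; rewrite /He Yx mulr0.
have Te0 x : ~ K x -> Te x = 0 by move=> /dY0 Yx; rewrite /Te Yx mulr0.
have bHe := support_bounded cK He0; have bTe := support_bounded cK Te0.
have IHe := integrable_Cc cHe bHe; have ITe := integrable_Cc cTe bTe.
have cHed : continuous (fun x => He x * (dw x - partial i V x)).
  move=> x; apply: continuousM; first exact: cHe.
  by apply: continuousB; [exact: cdw|exact: cdV].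
have cHedw : continuous (fun x => He x * dw x) by move=> x; apply: continuousM; [exact: cHe|exact: cdw].
have cHeV : continuous (fun x => He x * partial i V x) by move=> x; apply: continuousM; [exact: cHe|exact: cdV].
have IHed := integrable_Cc cHed (support_bounded cK (fun x nK =>
  etrans (congr1 (fun z => z * (dw x - partial i V x)) (He0 x nK)) (mul0r _))).
have IHedw := integrable_Cc cHedw (support_bounded cK (fun x nK =>
  etrans (congr1 (fun z => z * dw x) (He0 x nK)) (mul0r _))).
have IHeV := integrable_Cc cHeV (support_bounded cK (fun x nK =>
  etrans (congr1 (fun z => z * partial i V x) (He0 x nK)) (mul0r _))).
have Dwhole x : is_derive x (e_ i) (fun x => th (w x - V x) * Y x)
    (Te x + He x * (dw x - partial i V x)).
  have D1 := is_derive_chain (is_deriveB (Dw x) (derivableP (DV x))) (Dth (w x - V x)).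
  have D2 := is_deriveM D1 (derivableP (DY x)); apply: is_derive_eq D2 _.
  by rewrite /Te /He -!/(partial _ _ _) -![_ *: _]/(_ * _); ring.
(* [Te] and [He] are [T] and [H] with v replaced by its mollification w. The product
   [th (w - V) * Y] is now C^1 along e_i with compact support, so its derivative has integral 0. *)
have zero : \int[mu]_x (Te x + He x * (dw x - partial i V x)) = 0.
  rewrite -[RHS](@Rintegral_partial R d i (fun x => th (w x - V x) * Y x)).
  - by apply: eq_Rintegral => x _; have [_ <-] := Dwhole x.
  - split=> [x|x|x].
    + by apply: continuousM; [exact: cthw|exact: cY].
    + by have [] := Dwhole x.
    + rewrite (_ : partial i _ = fun x => Te x + He x * (dw x - partial i V x)).
        by apply: continuousD; [exact: cTe|exact: cHed].
      by apply/funext => y; have [_ <-] := Dwhole y.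
  - by apply: (support_bounded cK) => x /Y0 ->; rewrite mulr0.
(* On [K] the derivative of w is the mollified g; after Fubini the kernel acts on [He] instead, and
   since the kernel is even [B] is [He] mollified, hence uniformly close to [H]. *)
pose B := fun y => \int[mu]_x (He x * eta (y - x)).
have HeH x : `|He x - H x| <= t * `|Y x|.
  have [Kx|nKx] := pselect (K x); last by rewrite He0// H0// subrr normr0 mulr_ge0// ltW.
  rewrite /He /H -mulrBl normrM ler_wpM2r// (le_trans (Lth' _ _))//.
  by rewrite opprD opprK addrACA addNr addr0 wv.
have BHle y : `|B y - H y| <= t * (BY + 1).
  rewrite (_ : B y = convol setT He eta y); last first.
    by apply: eq_Rintegral => x _; rewrite -etaN opprB.
  apply: (@kernel_average _ _ setT He eta y r) => //.
    exact: integrable_conv.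
  move=> x yx; rewrite -(subrK (H x) (He x)) -addrA.
  rewrite (le_trans (ler_normD _ _))// mulrDr mulr1 lerD//.
    by rewrite (le_trans (HeH x))// ler_wpM2l// ltW.
  by rewrite distrC; apply/ltW/Hr3; exact: lt_le_trans rr3.
have IgB : mu.-integrable Omega (EFin \o (fun y => g y ord0 i * B y)).
  have mB : measurable_fun Omega B.
    apply: measurable_funTS; apply: continuous_measurable_rV.
    rewrite (_ : B = convol setT He eta); first exact: conv_continuous.
    by apply/funext => y; apply: eq_Rintegral => x _; rewrite -etaN opprB.
  apply: (integrable_mul_bounded (M := BH + t * (BY + 1))) => // y _.
  rewrite -(subrK (H y) (B y)) addrC.
  by rewrite (le_trans (ler_normD _ _))// lerD.
have fub : \int[mu]_x (He x * dw x) = \int[mu]_(y in Omega) (g y ord0 i * B y).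
  rewrite -Fubini_convol//; apply: eq_Rintegral => x _.
  by have [Kx|nKx] := pselect (K x); [rewrite dwE|rewrite He0// !mul0r].
have expand : \int[mu]_x (Te x + He x * (dw x - partial i V x)) =
    \int[mu]_x Te x + \int[mu]_(y in Omega) (g y ord0 i * B y) - \int[mu]_x (He x * partial i V x).
  rewrite RintegralD// -addrA -fub -RintegralB//; congr (_ + _).
  by apply: eq_Rintegral => x _; rewrite mulrBr.
have e1 : `|\int[mu]_x T x - \int[mu]_x Te x| <= t * C1.
  rewrite -RintegralB// (le_trans (le_normr_Rintegral _ _))//; first exact: integrableB_fin.
  rewrite /C1 -RintegralZl//; apply: le_Rintegral => //.
  - by apply: integrable_norm_fin; exact: integrableB_fin.
  - exact: integrableZ_fin.
  move=> x _; have [Kx|nKx] := pselect (K x); last by rewrite Te0// T0// subrr normr0 mulr_ge0// ltW.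
  rewrite /T /Te -mulrBl normrM ler_wpM2r// (le_trans (Lth _ _))//.
  by rewrite opprD opprK addrACA addNr addr0 distrC wv.
have e2 : `|\int[mu]_(y in Omega) (g y ord0 i * H y) - \int[mu]_(y in Omega) (g y ord0 i * B y)|
    <= t * (BY + 1) * C2.
  rewrite -RintegralB// (le_trans (le_normr_Rintegral _ _))//; first exact: integrableB_fin.
  rewrite /C2 -RintegralZl//; apply: le_Rintegral => //.
  - by apply: integrable_norm_fin; exact: integrableB_fin.
  - exact: integrableZ_fin.
  by move=> x _; rewrite -mulrBr normrM mulrC ler_wpM2r// distrC.
have e3 : `|\int[mu]_x (H x * partial i V x) - \int[mu]_x (He x * partial i V x)| <= t * C3.
  rewrite -RintegralB// (le_trans (le_normr_Rintegral _ _))//; first exact: integrableB_fin.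
  rewrite /C3 -RintegralZl//; apply: le_Rintegral => //.
  - by apply: integrable_norm_fin; exact: integrableB_fin.
  - exact: integrableZ_fin.
  by move=> x _; rewrite -mulrBl !normrM mulrA ler_wpM2r// distrC.
move: expand; rewrite zero => expand.
set iT := \int[mu]_x T x in e1 *; set iTe := \int[mu]_x Te x in e1 expand *.
set igH := \int[mu]_(x in Omega) (g x ord0 i * H x) in e2 *.
set igB := \int[mu]_(x in Omega) (g x ord0 i * B x) in e2 expand *.
set iHV := \int[mu]_x (H x * partial i V x) in e3 *.
set iHeV := \int[mu]_x (He x * partial i V x) in e3 expand *.
clearbody iT iTe igH igB iHV iHeV C1 C2 C3.
rewrite (_ : iT + _ = (iT - iTe) + (igH - igB) - (iHV - iHeV)); last first.
  by move: expand; clear => expand; lra.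
have teC : t * C = e by rewrite /t divfK ?gt_eqF.
rewrite (le_trans (ler_normB _ _))// -teC /C !mulrDr mulr1 mulrA.
rewrite (le_trans (lerD (ler_normD _ _) (lexx _)))//.
by apply: le_trans (lerD (lerD e1 e2) e3) _; rewrite lerDl ltW.
Unshelve. all: by end_near. Qed.

End chain_rule.

(** * Comparison for minimizers of the p-energy *)

Section ramp_functions.
Variable R : realType.
Implicit Types s t : R.

(** This clips s to [0, 1], and [ramp_int] is its primitive: both are 1-Lipschitz, as [chain_rule]
    demands of a truncation and its derivative. That the derivative lies in [0, 1] makes the
    perturbed gradient of a minimizer a convex combination. *)
Definition ramp s : R := Num.max s 0 - Num.max (s - 1) 0.
Definition ramp_int s : R := (Num.max s 0 ^+ 2 - Num.max (s - 1) 0 ^+ 2) / 2.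

Lemma is_derive_pos_sqr s : is_derive s 1 (fun t => Num.max t 0 ^+ 2) (2 * Num.max s 0).
Proof.
apply: (@is_derive_quadratic _ _ _ _ 1) => h _; rewrite mul1r ler_norml.
by case: (leP s 0) => s0; case: (leP (s + h) 0) => sh0; apply/andP; split; nra.
Qed.

Lemma ramp_int_derive s : is_derive s 1 ramp_int (ramp s).
Proof.
have D1 := is_derive_pos_sqr s.
have D2 := @is_derive1_comp R (fun t => Num.max t 0 ^+ 2) (fun t => t - 1) s _ 1
  (is_derive_pos_sqr (s - 1)).
have D3 : is_derive s 1 (fun t : R => t - 1) 1.
  by apply: is_derive_eq; rewrite subr0.
have D4 := is_deriveM (is_deriveB D1 (D2 D3)) (is_derive_cst (2^-1 : R) s 1).
apply: is_derive_eq D4 _; rewrite /ramp -![_ *: _]/(_ * _) /=; lra.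
Qed.

Lemma ramp_lip s t : `|ramp s - ramp t| <= `|s - t|.
Proof.
rewrite /ramp; case: (leP 0 (s - t)) => st; [rewrite [leRHS]ger0_norm//|rewrite [leRHS]ltr0_norm//];
  rewrite ler_norml;
  case: (leP s 0) => ?; case: (leP t 0) => ?; case: (leP (s - 1) 0) => ?; case: (leP (t - 1) 0) => ?;
  apply/andP; split; lra.
Qed.

Lemma ramp01 s : 0 <= ramp s <= 1.
Proof.
rewrite /ramp; case: (leP s 0) => ?; case: (leP (s - 1) 0) => ?; apply/andP; split; lra.
Qed.

Lemma ramp_int_lip s t : `|ramp_int s - ramp_int t| <= `|s - t|.
Proof.
wlog st : s t / t <= s.
  by move=> H; case: (leP t s) => [/H//|/ltW /H]; rewrite distrC [leRHS]distrC.
rewrite [leRHS]ger0_norm ?subr_ge0// ler_norml /ramp_int.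
by case: (leP s 0) => ?; case: (leP t 0) => ?; case: (leP (s - 1) 0) => ?; case: (leP (t - 1) 0) => ?;
  apply/andP; split; nra.
Qed.

Lemma ramp_int_nondecreasing s t : s <= t -> ramp_int s <= ramp_int t.
Proof.
move=> st; rewrite /ramp_int.
by case: (leP s 0) => ?; case: (leP t 0) => ?; case: (leP (s - 1) 0) => ?; case: (leP (t - 1) 0) => ?;
  nra.
Qed.

Lemma ramp_int_eq0 s : s <= 0 -> ramp_int s = 0.
Proof.
by move=> s0; rewrite /ramp_int !max_r ?expr0n ?subrr ?mul0r//; lra.
Qed.

Lemma ramp_int_ge0 s : 0 <= ramp_int s.
Proof.
case: (leP s 0) => [/ramp_int_eq0 ->//|/ltW s0].
by rewrite -(ramp_int_eq0 (lexx 0)); exact: ramp_int_nondecreasing.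
Qed.

Lemma ramp_int_gt0 s : 0 < s -> 0 < ramp_int s.
Proof.
by move=> s0; rewrite /ramp_int (max_l (ltW s0)); case: (leP (s - 1) 0) => ?; nra.
Qed.

Lemma ramp_int_le s : 0 <= s -> ramp_int s <= s.
Proof.
by move=> s0; rewrite /ramp_int (max_l s0); case: (leP (s - 1) 0) => ?; nra.
Qed.

Lemma ramp_eq0 s : s <= 0 -> ramp s = 0.
Proof. by move=> s0; rewrite /ramp !max_r ?subrr//; lra. Qed.

Lemma ramp_continuous : continuous ramp.
Proof.
move=> s; apply/cvgrPdist_lt => e e0; near=> t.
by rewrite (le_lt_trans (ramp_lip s t))//; near: t; exact: nbhsx_ballx.
Unshelve. all: by end_near. Qed.

End ramp_functions.

(** * The Euclidean norm and convexity of its p-th power *)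

Section euclidean.
Variables (R : realType) (d : nat).
Local Notation E := 'rV[R]_d.
Implicit Types x y z : E.

Definition dot x y : R := \sum_(i < d) x ord0 i * y ord0 i.
Definition sqn x : R := \sum_(i < d) x ord0 i ^+ 2.

Lemma sqn_ge0 x : 0 <= sqn x.
Proof. by apply: sumr_ge0 => i _; rewrite sqr_ge0. Qed.

Lemma sqnE x : dot x x = sqn x.
Proof. by apply: eq_bigr => i _; rewrite expr2. Qed.

Lemma enorm_ge0 x : 0 <= enorm x.
Proof. exact: sqrtr_ge0. Qed.

Lemma enorm_sqr x : enorm x ^+ 2 = sqn x.
Proof. by rewrite sqr_sqrtr// sqn_ge0. Qed.

Lemma sqn_eq0 x : sqn x = 0 -> x = 0.
Proof.
move=> /eqP; rewrite psumr_eq0; last by move=> i _; rewrite sqr_ge0.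
move=> /allP H; apply/rowP => i; rewrite mxE; apply/eqP; rewrite -sqrf_eq0.
by have /implyP/(_ isT) := H i (mem_index_enum i).
Qed.

Lemma sqnD x y : sqn (x + y) = sqn x + 2 * dot x y + sqn y.
Proof.
rewrite /sqn /dot mulr_sumr -!big_split/=; apply: eq_bigr => i _; rewrite !mxE; ring.
Qed.

Lemma sqnZ a x : sqn (a *: x) = a ^+ 2 * sqn x.
Proof. by rewrite /sqn mulr_sumr; apply: eq_bigr => i _; rewrite !mxE exprMn. Qed.

Lemma dotZl a x y : dot (a *: x) y = a * dot x y.
Proof. by rewrite /dot mulr_sumr; apply: eq_bigr => i _; rewrite !mxE mulrA. Qed.

Lemma dotC x y : dot x y = dot y x.
Proof. by apply: eq_bigr => i _; rewrite mulrC. Qed.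

Lemma dotDr x y z : dot x (y + z) = dot x y + dot x z.
Proof. by rewrite /dot -big_split; apply: eq_bigr => i _; rewrite !mxE mulrDr. Qed.

Lemma dotNr x y : dot x (- y) = - dot x y.
Proof. by rewrite /dot -sumrN; apply: eq_bigr => i _; rewrite !mxE mulrN. Qed.

Lemma dotBr x y z : dot x (y - z) = dot x y - dot x z.
Proof. by rewrite dotDr dotNr. Qed.

Lemma cauchy_schwarz x y : dot x y <= enorm x * enorm y.
Proof.
have [y0|y0] := eqVneq (sqn y) 0.
  have -> : dot x y = 0.
    by rewrite (sqn_eq0 y0); apply: big1 => i _; rewrite mxE mulr0.
  by rewrite mulr_ge0// enorm_ge0.
have yp : 0 < sqn y by rewrite lt_def y0 sqn_ge0.
have H : dot x y ^+ 2 <= sqn x * sqn y.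
  have := sqn_ge0 (sqn y *: x + (- dot x y) *: y).
  rewrite sqnD !sqnZ dotZl [dot x (_ *: _)]dotC dotZl [dot y x]dotC.
  have := sqn_ge0 x; nra.
rewrite (le_trans (ler_norm _))// -sqrtr_sqr /enorm -!/(sqn _) -sqrtrM ?sqn_ge0//.
by rewrite ler_sqrt// mulr_ge0 ?sqn_ge0.
Qed.

Lemma enormN x : enorm (- x) = enorm x.
Proof. by rewrite /enorm; congr Num.sqrt; apply: eq_bigr => i _; rewrite mxE sqrrN. Qed.

Lemma enormD x y : enorm (x + y) <= enorm x + enorm y.
Proof.
rewrite -(ler_pXn2r (n := 2))// ?nnegrE ?addr_ge0 ?enorm_ge0//.
rewrite enorm_sqr sqnD sqrrD !enorm_sqr.
by rewrite lerD2r lerD2l mulr_natl ler_pMn2r// cauchy_schwarz.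
Qed.

Lemma enormZ a x : enorm (a *: x) = `|a| * enorm x.
Proof. by rewrite /enorm -!/(sqn _) sqnZ sqrtrM ?sqr_ge0// sqrtr_sqr. Qed.

Lemma enorm0 : enorm (0 : E) = 0.
Proof. by rewrite /enorm big1 ?sqrtr0// => i _; rewrite mxE expr0n. Qed.

Lemma enormB x y : enorm (x - y) = enorm (y - x).
Proof. by rewrite -enormN opprB. Qed.

Lemma norm_le_enorm x : `|x| <= enorm x.
Proof.
apply/norm_rV_le; first exact: enorm_ge0.
move=> i; rewrite -sqrtr_sqr ler_sqrt ?sqn_ge0//.
by rewrite (bigD1 i)//= lerDl sumr_ge0// => j _; rewrite sqr_ge0.
Qed.

Lemma enorm_le_norm x : enorm x <= d%:R * `|x|.
Proof.
rewrite -(ler_pXn2r (n := 2))// ?nnegrE ?mulr_ge0 ?enorm_ge0//.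
rewrite enorm_sqr exprMn (@le_trans _ _ (\sum_(i < d) `|x| ^+ 2))//.
  apply: ler_sum => i _; rewrite -(real_normK (num_real _)) ler_pXn2r ?nnegrE//.
  exact: norm_coord.
rewrite sumr_const card_ord -[leLHS]mulr_natl ler_wpM2r ?sqr_ge0//.
case: d => [|n]; first by rewrite expr0n.
by rewrite expr2 ler_peMl// ler1n.
Qed.

Lemma enorm_eq0 x : enorm x = 0 -> x = 0.
Proof. by move=> H; apply: sqn_eq0; rewrite -enorm_sqr H expr0n. Qed.

Lemma enorm_gt0 x : x != 0 -> 0 < enorm x.
Proof.
by move=> x0; rewrite lt_def enorm_ge0 andbT; apply: contra x0 => /eqP/enorm_eq0 ->.
Qed.

Lemma enorm_sqn_powR x (p : R) : enorm x `^ p = sqn x `^ (p / 2).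
Proof. by rewrite /enorm -/(sqn x) -powR12_sqrt ?sqn_ge0// -powRrM mulrC. Qed.

Lemma powR_mul_self (b q r : R) : 0 < b -> r = q + 1 -> b `^ q * b = b `^ r.
Proof.
move=> b0 ->; rewrite powRD ?(gt_eqF b0) ?implybT//.
by rewrite powRr1// ltW.
Qed.

(** The graph of the p-th power lies above its tangent at b; this is Young's inequality for a and
    b^(p-1) with exponents p and p/(p-1). *)
Lemma powR_tangent (a b p : R) : 0 <= a -> 0 < b -> 1 < p ->
  b `^ p + p * b `^ (p - 1) * (a - b) <= a `^ p.
Proof.
move=> a0 b0 p1.
have p0 : 0 < p by lra.
have q0 : 0 < p / (p - 1) by rewrite divr_gt0// subr_gt0.
have pq : p^-1 + (p / (p - 1))^-1 = 1 by field; rewrite !gt_eqF//; lra.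
have := conjugate_powR a0 (powR_ge0 b (p - 1)) p0 q0 pq.
rewrite -powRrM [(p - 1) * _]mulrC divfK; last by rewrite subr_eq0 gt_eqF.
have -> : b `^ p / (p / (p - 1)) = (b `^ p * (p - 1)) / p by field; rewrite !gt_eqF//; lra.
rewrite -mulrDl ler_pdivlMr// => H.
have -> : p * b `^ (p - 1) * (a - b) = a * b `^ (p - 1) * p - p * (b * b `^ (p - 1)) by ring.
have -> : b * b `^ (p - 1) = b `^ p.
  by rewrite mulrC (powR_mul_self b0 (r := p)) //; ring.
lra.
Qed.

(** Convexity is used twice: along the segment from x to y, which bounds the left side by the
    interpolation of the two end values, and as the tangent inequality at y, which by Cauchy-Schwarz
    bounds the difference of these values by the gradient of the p-th power at y. *)
Lemma enorm_powR_convex (x y : E) (t p : R) : 1 < p -> y != 0 -> 0 <= t <= 1 ->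
  enorm (x - t *: (x - y)) `^ p <=
  enorm x `^ p - t * (p * (sqn y `^ ((p - 2) / 2) * dot y (x - y))).
Proof.
move=> p1 y0 /andP[t0 t1].
have a0 := enorm_ge0 x; have b0 := enorm_gt0 y0.
have -> : x - t *: (x - y) = (1 - t) *: x + t *: y.
  by rewrite scalerBl scale1r scalerBr opprB -[RHS]addrA [in RHS](addrC (- _)).
have pw : sqn y `^ ((p - 2) / 2) = enorm y `^ (p - 2) by rewrite enorm_sqn_powR.
rewrite pw dotBr sqnE -enorm_sqr.
have H1 : enorm ((1 - t) *: x + t *: y) `^ p <= (1 - t) * enorm x `^ p + t * enorm y `^ p.
  have H0 : enorm ((1 - t) *: x + t *: y) <= (1 - t) * enorm x + t * enorm y.
    have t1' : 0 <= 1 - t by lra.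
    by rewrite (le_trans (enormD _ _))// !enormZ (ger0_norm t0) (ger0_norm t1').
  apply: (@le_trans _ _ (((1 - t) * enorm x + t * enorm y) `^ p)).
    have p0 : 0 <= p by lra.
    apply: (ge0_ler_powR p0) => //; rewrite nnegrE ?enorm_ge0//.
    have t1' : 0 <= 1 - t by lra.
    by rewrite addr_ge0// mulr_ge0// ltW.
  set a := enorm x in a0 *; set b := enorm y in b0 *.
  have [c0|c0] := leP ((1 - t) * a + t * b) 0.
    have -> : (1 - t) * a + t * b = 0 by apply/eqP; rewrite eq_le c0/=; nra.
    rewrite powR0 ?gt_eqF//; last lra.
    have t1' : 0 <= 1 - t by lra.
    by rewrite addr_ge0// mulr_ge0// powR_ge0.
  have := powR_tangent a0 c0 p1; have := powR_tangent (ltW b0) c0 p1.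
  set c := (1 - t) * a + t * b in c0 *; set K := p * c `^ (p - 1); set C := c `^ p.
  move=> T1 T2.
  have := ler_wpM2l t0 T1; have := ler_wpM2l (ltac:(lra) : 0 <= 1 - t) T2.
  have : K * (1 - t) * (a - c) + K * t * (b - c) = 0 by rewrite /c; ring.
  by move: (a `^ p) (b `^ p) => X Y; clear => *; lra.
have H2 := powR_tangent a0 b0 p1.
have H3 : enorm y `^ (p - 2) * dot y x <= enorm y `^ (p - 1) * enorm x.
  have -> : enorm y `^ (p - 1) = enorm y `^ (p - 2) * enorm y.
    by rewrite (powR_mul_self b0 (r := p - 1)) //; ring.
  by rewrite -mulrA ler_wpM2l ?powR_ge0// cauchy_schwarz.
have H4 : enorm y `^ (p - 2) * enorm y ^+ 2 = enorm y `^ (p - 1) * enorm y.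
  have -> : enorm y `^ (p - 1) = enorm y `^ (p - 2) * enorm y.
    by rewrite (powR_mul_self b0 (r := p - 1)) //; ring.
  by rewrite -mulrA -expr2.
have H5 : enorm y `^ p = enorm y `^ (p - 1) * enorm y.
  by rewrite (powR_mul_self b0 (r := p)) //; ring.
rewrite (le_trans H1)// mulrBr H4 -H5.
have H6 : p * (enorm y `^ (p - 2) * dot y x) <= p * (enorm y `^ (p - 1) * enorm x).
  by rewrite ler_wpM2l// (le_trans ler01 (ltW p1)).
have H8 : enorm y `^ p + (p * (enorm y `^ (p - 2) * dot y x) - p * enorm y `^ p) <= enorm x `^ p.
  by apply: le_trans H2; rewrite lerD2l mulrBr -!mulrA -H5 lerD2r.
move: H8; move: (enorm x `^ p) (enorm y `^ p) (_ * dot y x) => X Y D H8.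
rewrite -subr_ge0 (_ : _ - _ = t * (X - (Y + (p * D - p * Y)))); last ring.
by rewrite mulr_ge0// subr_ge0.
Qed.

End euclidean.

(** * Smooth cutoffs *)

Section cutoffs.
Variables (R : realType) (d : nat).
Local Notation E := 'rV[R]_d.
Local Notation e_ i := (delta_mx ord0 i : E).
Implicit Types (f g : E -> R) (U W K : set E).

Lemma CkV (k : nat) U f : open U -> (forall x, U x -> f x != 0) -> Ck k U f ->
  Ck k U (fun x => (f x)^-1).
Proof.
move=> oU f0; elim: k => [|k IH] Kf.
  split => //; case: Kf => /(within_open_continuousP _ oU) cf _.
  by apply/within_open_continuousP => // x Ux; apply: continuousV; [exact: f0|exact: cf].
have cf := Ck_continuous Kf; have [_ Hf] := Kf; split.
  have /(within_open_continuousP _ oU) cf' := cf.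
  by apply/within_open_continuousP => // x Ux; apply: continuousV; [exact: f0|exact: cf'].
move=> i; have [Df Cf] := Hf i; split=> [x Ux|].
  by apply: derivableV; [exact: f0|exact: Df].
have K1 := IH (CkS Kf).
apply: (eq_Ck oU _ (CkN oU (CkM oU (CkM oU K1 K1) Cf))) => x Ux.
rewrite /partial deriveV ?f0//; last exact: Df.
by rewrite -[RHS]/(_ * _) mulNr -exprVn expr2.
Qed.

Lemma Ck_setU (k : nat) U W f : open U -> open W -> Ck k U f -> Ck k W f -> Ck k (U `|` W) f.
Proof.
move=> oU oW; have oUW := openU oU oW.
have C (h : E -> R) : {within U, continuous h} -> {within W, continuous h} ->
    {within U `|` W, continuous h}.
  move=> /(within_open_continuousP _ oU) cU /(within_open_continuousP _ oW) cW.
  by apply/within_open_continuousP => // x [/cU|/cW].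
elim: k f => [|k IH] f [cU HU] [cW HW]; split => //; try exact: C.
move=> i; have [DU CU] := HU i; have [DW CW] := HW i; split; last exact: IH.
by move=> x [/DU|/DW].
Qed.

Lemma Ck_cut (k : nat) U K f chi : open U -> compact K -> K `<=` U ->
  smooth setT chi -> (forall x, ~ K x -> chi x = 0) -> Ck k U f ->
  Ck k setT (fun x => chi x * f x).
Proof.
move=> oU cK KU schi chi0 Kf.
have oK := closed_openC (compact_rV_closed cK).
have -> : [set: E] = U `|` ~` K.
  by apply/esym/seteqP; split => // x _; have [/KU|] := pselect (K x); [left|right].
apply: Ck_setU => //.
  by apply: CkM => //; apply: Ck_subset (schi k).
by apply: (eq_Ck oK _ (Ck_cst k 0 oK)) => x /chi0 ->; rewrite mul0r.
Qed.

Lemma Ck1_C1dir f i : Ck 1 setT f -> C1dir i f.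
Proof.
have oT : open [set: E] by exact: openT.
move=> [ce /(_ i)[De [cde _]]]; split.
- by move=> x; have /(within_open_continuousP _ oT) := ce; exact.
- by move=> x; exact: De.
- by move=> x; have /(within_open_continuousP _ oT) := cde; exact.
Qed.

Lemma cutoff (a : E) (r1 r2 : 'I_d -> R) : (forall i, 0 < r1 i < r2 i) ->
  exists chi : E -> R,
  [/\ smooth setT chi, forall x : E, 0 <= chi x <= 1,
      forall x : E, (forall i, `|x ord0 i - a ord0 i| <= r1 i) -> chi x = 1 &
      forall (x : E) i, r2 i <= `|x ord0 i - a ord0 i| -> chi x = 0].
Proof.
move=> r12.
pose N i (t : R) := flat 0 (r2 i - t).
pose M i (t : R) := flat 0 (t - r1 i).
pose c i t := N i t / (N i t + M i t).
have NM i t : 0 < N i t + M i t.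
  have /andP[r0 r1r2] := r12 i.
  have [tr|tr] := ltP t (r2 i).
    by rewrite ltr_pwDl ?flat0_ge0// flat0_gt0// subr_gt0.
  by rewrite ltr_wpDl ?flat0_ge0// flat0_gt0// subr_gt0 (lt_le_trans r1r2).
have c01 i t : 0 <= c i t <= 1.
  by rewrite /c divr_ge0 ?flat0_ge0 ?(ltW (NM _ _))//= ler_pdivrMr// mul1r lerDl flat0_ge0.
have c1 i t : t <= r1 i -> c i t = 1.
  move=> tr; have /andP[r0 r1r2] := r12 i.
  have M0 : M i t = 0 by rewrite /M flat_eq0// subr_le0.
  by have := NM i t; rewrite /c M0 addr0 => /gt_eqF/negbT; exact: divff.
have c0 i t : r2 i <= t -> c i t = 0.
  by move=> tr; rewrite /c /N flat_eq0 ?mul0r// subr_le0.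
have oT : open [set: E] by exact: openT.
have Kaff k (A B : R) (i : 'I_d) : Ck k setT (fun x : E => A + B * x ord0 i).
  by apply: CkD => //; [exact: Ck_cst|apply: CkM => //; [exact: Ck_cst|exact: Ck_coord]].
have KN k (f : E -> R) : Ck k setT f -> Ck k setT (fun x => flat 0 (f x)).
  by move=> Kf; apply: (@Ck_comp R d k setT f (@flat R)) => // n x _ _; exact: flat_derive.
have Kc k i (f : E -> R) : Ck k setT f -> Ck k setT (fun x => c i (f x)).
  move=> Kf.
  have K1 : Ck k setT (fun x => N i (f x)).
    by apply: KN; apply: CkB => //; exact: Ck_cst.
  have K2 : Ck k setT (fun x => M i (f x)).
    by apply: KN; apply: CkB => //; exact: Ck_cst.
  apply: CkM => //; apply: CkV => //; first by move=> x _; rewrite gt_eqF.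
  exact: CkD.
(* The absolute value is not smooth, so the one-sided cutoff is taken at a number and at its
   opposite; one of the two factors is always 1. *)
exists (fun x => \prod_(i < d) (c i (x ord0 i - a ord0 i) * c i (a ord0 i - x ord0 i))); split.
- move=> k; apply: Ck_prod => // i; apply: CkM => //; apply: Kc.
    by apply: CkB => //; [exact: Ck_coord|exact: Ck_cst].
  by apply: CkB => //; [exact: Ck_cst|exact: Ck_coord].
- move=> x; have H i : 0 <= c i (x ord0 i - a ord0 i) * c i (a ord0 i - x ord0 i) <= 1.
    have /andP[h1 h2] := c01 i (x ord0 i - a ord0 i).
    have /andP[h3 h4] := c01 i (a ord0 i - x ord0 i).
    by rewrite mulr_ge0//= mulr_ile1.
  apply/andP; split; first by apply: prodr_ge0 => i _; have /andP[] := H i.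
  by apply: prodr_ile1 => i _; exact: H.
- move=> x H; apply: big1 => i _; have := H i; rewrite ler_norml => /andP[h1 h2].
  by rewrite !c1 ?mulr1//; lra.
- move=> x i H; rewrite (bigD1 i)//= (_ : c i _ * c i _ = 0) ?mul0r//.
  have [x0|x0] := leP 0 (x ord0 i - a ord0 i).
    by rewrite ger0_norm// in H; rewrite c0 ?mul0r.
  rewrite ltr0_norm// in H; rewrite [X in _ * X]c0 ?mulr0//; lra.
Qed.

Lemma ball_cutoff (a : E) (r1 r2 : R) : 0 < r1 < r2 ->
  exists chi : E -> R,
  [/\ smooth setT chi, forall x, 0 <= chi x <= 1,
      forall x, `|a - x| <= r1 -> chi x = 1 &
      forall x, r2 <= `|a - x| -> chi x = 0].
Proof.
move=> r12; have /andP[r0 r1r2] := r12.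
have [chi [s c01 c1 c0]] := @cutoff a (fun=> r1) (fun=> r2) (fun=> r12).
exists chi; split => //.
  move=> x /(norm_rV_le _ (ltW r0)) H; apply: c1 => i.
  by have := H i; rewrite !mxE distrC.
move=> x; rewrite leNgt => /negP H.
have [i ri] : exists i, r2 <= `|x ord0 i - a ord0 i|.
  apply: contrapT => Hn; apply: H; apply/norm_rV_lt; first by lra.
  move=> i; rewrite !mxE distrC ltNge; apply/negP => ri; apply: Hn; by exists i.
exact: c0 ri.
Qed.

End cutoffs.

Section comparison.
Variables (R : realType) (d : nat).
Local Notation E := 'rV[R]_d.
Local Notation mu := (lebesgue_rV R d).
Local Notation e_ i := (delta_mx ord0 i : E).
Implicit Types (f h v psi V Y : E -> R) (D K O Omega : set E) (g Dpsi : E -> E).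

Definition grad V (x : E) : E := \row_i partial i V x.

(** The i-th component of |DV|^(p-2) DV, whose divergence is the p-Laplacian. It is a power of the
    squared norm, which is C^1 when V is C^2. *)
Definition p_field (p : R) V (i : 'I_d) (x : E) : R :=
  sqn (grad V x) `^ ((p - 2) / 2) * partial i V x.

Lemma gradE V x i : grad V x ord0 i = partial i V x.
Proof. by rewrite mxE. Qed.

Lemma extend0_continuous O K f : open O -> compact K -> K `<=` O ->
  (forall x, O x -> {for x, continuous f}) -> (forall x, O x -> ~ K x -> f x = 0) ->
  continuous (f \_ O) /\ forall x, ~ K x -> (f \_ O) x = 0.
Proof.
move=> oO cK KO cf f0.
have H x : ~ K x -> (f \_ O) x = 0.
  move=> nKx; rewrite restrictE; case: ifPn => //.
  by rewrite inE => Ox; exact: f0.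
split=> // x; have [Kx|nKx] := pselect (K x).
  have Ox := KO x Kx; apply/continuous_rVP => e e0.
  have [r r0 Hr] := (continuous_rVP _ _).1 (cf x Ox) e e0.
  have [s s0 Hs] := (open_rVP _).1 oO x Ox.
  exists (Num.min r s); first by rewrite lt_min r0.
  move=> y; rewrite lt_min => /andP[xyr xys].
  by rewrite !restrictE !mem_set//; [exact: Hr|exact: Hs].
apply/continuous_rVP => e e0.
have [r r0 Hr] := (open_rVP _).1 (closed_openC (compact_rV_closed cK)) x nKx.
by exists r => // y /Hr nKy; rewrite !H// subrr normr0.
Qed.

Lemma Ck1_pointwise O f x i : open O -> Ck 1 O f -> O x ->
  [/\ {for x, continuous f}, derivable f x (e_ i) & {for x, continuous (partial i f)}].
Proof.
move=> oO [cf /(_ i)[Df [cdf _]]] Ox; split; last first.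
- by have /(within_open_continuousP _ oO) := cdf; apply.
- exact: Df.
- by have /(within_open_continuousP _ oO) := cf; apply.
Qed.

Lemma measurable_comp_rV D g (F : E -> R) : measurable_fun D g -> measurable_fun setT F ->
  measurable_fun D (fun x => F (g x)).
Proof. by move=> mg mF; exact: (measurableT_comp mF mg). Qed.

Lemma measurable_enorm : measurable_fun setT (@enorm R d).
Proof.
apply: (@measurableT_comp _ _ _ _ _ _ (@Num.sqrt R)).
  apply: continuous_measurable_fun; exact: sqrt_continuous.
rewrite (_ : (fun x : E => _) = (fun x : E => \sum_(i <- index_enum _) (x ord0 i) ^+ 2))//.
apply: measurable_sum => i; apply: measurable_funX; exact: measurable_coord.
Qed.

Lemma measurable_energy_density D (p : R) g : measurable_fun D g ->
  measurable_fun D (fun x => enorm (g x) `^ p).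
Proof.
move=> mg; apply: (measurable_comp_rV (F := fun y => enorm y `^ p) mg).
apply: (@measurableT_comp _ _ _ _ _ _ (@powR R ^~ p)); first exact: measurable_powR.
exact: measurable_enorm.
Qed.

Lemma p_energy_integrable D (p : R) g : measurable D -> measurable_fun D g ->
  (p_energy D p g < +oo)%E -> mu.-integrable D (EFin \o (fun x => enorm (g x) `^ p)).
Proof.
move=> mD mg fin; apply/integrableP; split.
  by apply/measurable_EFinP; exact: measurable_energy_density.
rewrite (_ : (fun x => _) = (fun x => (enorm (g x) `^ p)%:E))//.
by apply/funext => x /=; rewrite ger0_norm ?powR_ge0.
Qed.

Lemma measurable_row D (F : 'I_d -> E -> R) : measurable D ->
  (forall i, measurable_fun D (F i)) -> measurable_fun D (fun x => \row_i F i x).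
Proof.
move=> mD mF _ A mA.
have H : measurable_fun [set: E] (fun x => \row_i ((F i \_ D) x)).
  apply: measurable_fun_rV => i; under eq_fun do rewrite mxE.
  exact: ((measurable_restrictT (F i) mD).1 (mF i)).
have := H measurableT A mA; rewrite setTI => H2.
rewrite (_ : D `&` _ = D `&` (fun x => \row_i ((F i \_ D) x)) @^-1` A).
  exact: measurableI.
apply/seteqP; split=> x [Dx /= Ax]; split => //=; move: Ax;
  by congr (A _); apply/rowP => i; rewrite !mxE restrictE mem_set.
Qed.

Lemma measurable_rV_fun D g : measurable D ->
  (forall i, measurable_fun D (fun x => g x ord0 i)) -> measurable_fun D g.
Proof.
move=> mD mg; have := measurable_row mD mg.
rewrite (_ : (fun x => _) = g)//; apply/funext => x; apply/rowP => i; by rewrite mxE.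
Qed.

Lemma powR_add_le (a b p : R) : 0 <= a -> 0 <= b -> 0 <= p ->
  (a + b) `^ p <= 2 `^ p * (a `^ p + b `^ p).
Proof.
move=> a0 b0 p0.
have H (s t : R) : 0 <= s -> s <= t -> (s + t) `^ p <= 2 `^ p * t `^ p.
  move=> s0 st; rewrite -powRM//; last by apply: le_trans st.
  apply: (ge0_ler_powR p0); rewrite ?nnegrE; try lra; nra.
case: (leP a b) => ab.
  rewrite (le_trans (H _ _ a0 ab))// ler_wpM2l ?powR_ge0//.
  by rewrite lerDr powR_ge0.
rewrite addrC (le_trans (H _ _ b0 (ltW ab)))// ler_wpM2l ?powR_ge0//.
by rewrite lerDl powR_ge0.
Qed.

End comparison.

Section comparison_core.
Variables (R : realType) (d : nat).
Local Notation E := 'rV[R]_d.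
Local Notation mu := (lebesgue_rV R d).
Local Notation e_ i := (delta_mx ord0 i : E).
Implicit Types (f h v psi V Y : E -> R) (D K O Omega : set E) (g Dpsi : E -> E).

Lemma dist_continuous (a : E) : continuous (fun x : E => `|a - x|).
Proof.
move=> y; apply: (@continuous_comp _ _ _ (fun x : E => a - x) (fun z : E => `|z|)).
  by apply: continuousB; [exact: cst_continuous | exact: cvg_id].
exact: norm_continuous.
Qed.

Lemma open_ball_rV (a : E) (r : R) : open [set x : E | `|a - x| < r].
Proof.
apply: (@open_comp _ _ (fun y : E => `|a - y|) [set z | z < r]); last exact: open_lt.
by move=> y _; exact: dist_continuous.
Qed.

Lemma open_ballC_rV (a : E) (r : R) : open [set x : E | r < `|a - x|].
Proof.
apply: (@open_comp _ _ (fun y : E => `|a - y|) [set z | r < z]); last exact: open_gt.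
by move=> y _; exact: dist_continuous.
Qed.

Lemma Rintegral_sum D (I : Type) (s : seq I) (f : I -> E -> R) : measurable D ->
  (forall i, mu.-integrable D (EFin \o f i)) ->
  mu.-integrable D (EFin \o (fun x => \sum_(i <- s) f i x)) /\
  \int[mu]_(x in D) (\sum_(i <- s) f i x) = \sum_(i <- s) \int[mu]_(x in D) f i x.
Proof.
move=> mD If; elim: s => [|j s [IH1 IH2]].
  split.
    rewrite (_ : (fun x => _) = fun=> 0); first exact: integrable0.
    by apply/funext => x; rewrite big_nil.
  rewrite big_nil (_ : (fun x => _) = fun=> 0); last by apply/funext => x; rewrite big_nil.
  by rewrite Rintegral_cst// mul0r.
split.
  rewrite (_ : (fun x => _) = fun x => f j x + \sum_(i <- s) f i x).
    exact: integrableD_fin.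
  by apply/funext => x; rewrite big_cons.
rewrite big_cons -IH2 -RintegralD//.
by apply: eq_Rintegral => x _; rewrite big_cons.
Qed.

Lemma p_energy_lty D (p : R) g f : measurable D -> measurable_fun D g ->
  (forall x, D x -> enorm (g x) `^ p <= f x) -> mu.-integrable D (EFin \o f) ->
  (p_energy D p g < +oo)%E.
Proof.
move=> mD mg gf If.
have /integrableP[_] : mu.-integrable D (EFin \o (fun x => enorm (g x) `^ p)).
  apply: (integrable_le (g := f)) => //; first exact: measurable_energy_density.
  by move=> x Dx; rewrite ger0_norm ?powR_ge0// gf.
apply: le_lt_trans; rewrite /p_energy le_eqVlt; apply/orP; left; apply/eqP.
by apply: eq_integral => x _ /=; rewrite ger0_norm ?powR_ge0.
Qed.

Lemma half_close (A B : R) : `|A - B| < A / 2 -> A / 2 <= B.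
Proof. by rewrite ltr_distlC => /andP[]; lra. Qed.

(* Minimality is tested with [psi], the truncation [ramp_int (v - V)] on the ball: by convexity
   and integration by parts the energy would decrease by the integral of [psi] against the
   (negative) divergence of the p-field of [V]. *)
Lemma comparison_core Omega v g V (p : R) (a : E) (r1 r2 M0 : R) :
  let B := [set x | `|a - x| < r2] in
  open Omega -> (forall x, Omega x -> `|x| <= M0) ->
  mu.-integrable Omega (EFin \o v) -> measurable_fun Omega g ->
  (p_energy Omega p g < +oo)%E ->
  (forall i, mu.-integrable Omega (EFin \o (fun x => g x ord0 i))) ->
  (forall x, Omega x -> {for x, continuous v}) -> weak_gradient Omega v g ->
  1 < p -> 0 < r1 < r2 -> B `<=` Omega ->
  Ck 1 B V -> (forall i, Ck 1 B (p_field p V i)) -> (forall x, B x -> grad V x != 0) ->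
  (forall x, B x -> \sum_(i < d) partial i (p_field p V i) x < 0) ->
  (forall x, B x -> r1 < `|a - x| -> v x <= V x) ->
  (forall psi Dpsi, continuous psi -> (forall x, r1 < `|a - x| -> psi x = 0) ->
    measurable_fun Omega Dpsi -> (p_energy Omega p Dpsi < +oo)%E ->
    weak_gradient Omega psi Dpsi -> (forall x, 0 <= psi x) ->
    (forall x, psi x != 0 -> B x /\ psi x <= v x - V x) ->
    (p_energy Omega p g <= p_energy Omega p (fun x => g x - Dpsi x)%R)%E) ->
  forall x, B x -> v x <= V x.
Proof.
move=> B oO OM Iv mg Eg Ig cv wg p1 /andP[r10 r12] BO KV KX gV0 dX vV min x1 Bx1.
have mO := open_measurable_rV oO.
have oB : open B by exact: open_ball_rV.
rewrite leNgt; apply/negP => Vv.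
(* Radii r1 < r1' < rc < ra < rb < r2. The cutoff [chi], equal to 1 up to ra and to 0 from rb on,
   extends V to [W]; [chi2], equal to 1 up to r1' and to 0 from rc on, localizes the function tested
   against. Thus [W] is V wherever [chi2] lives, and [chi2] is 1 near the support of [psi]. *)
pose r1' := (7 * r1 + r2) / 8; pose rc := (3 * r1 + r2) / 4.
pose ra := (r1 + r2) / 2; pose rb := (r1 + 3 * r2) / 4.
have r11' : r1 < r1' by rewrite /r1'; lra.
have r1'c : r1' < rc by rewrite /r1' /rc; lra.
have rca : rc < ra by rewrite /rc /ra; lra.
have rab : ra < rb by rewrite /ra /rb; lra.
have rb2 : rb < r2 by rewrite /rb; lra.
clearbody r1' rc ra rb.
have [chi [schi chi01 chi1 chi0]] := @ball_cutoff R d a ra rb ltac:(by apply/andP; split; lra).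
have [chi2 [schi2 chi201 chi21 chi20]] := @ball_cutoff R d a r1' rc ltac:(by apply/andP; split; lra).
pose cb (r : R) : set E := [set x | `|a - x| <= r].
have ccb r : compact (cb r) by exact: closed_ball_rV_compact.
have cbB r : r < r2 -> cb r `<=` B by move=> rr x /= xr; exact: le_lt_trans rr.
have nchi x : ~ cb rb x -> chi x = 0 by move=> /negP; rewrite -ltNge => /ltW/chi0.
have nchi2 x : ~ cb rc x -> chi2 x = 0 by move=> /negP; rewrite -ltNge => /ltW/chi20.
pose W := fun x => chi x * V x.
have KW : Ck 1 setT W := Ck_cut oB (ccb rb) (cbB _ rb2) schi nchi KV.
have WV x : `|a - x| <= ra -> W x = V x by move=> xr; rewrite /W chi1// mul1r.
have dWV i x : `|a - x| < ra -> partial i W x = partial i V x.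
  by move=> xr; apply: (eq_partial i (@open_ball_rV a ra)) => // y /ltW; exact: WV.
pose psi := (fun x => ramp_int (v x - V x)) \_ B.
pose tau := (fun x => ramp (v x - V x)) \_ B.
have vV0 x : B x -> ~ cb r1 x -> v x - V x <= 0.
  by move=> Bx /negP; rewrite -ltNge => xr; rewrite subr_le0 vV.
have r12b : r1 < r2 by [].
have cvV x : B x -> {for x, continuous (fun x => v x - V x)}.
  move=> Bx; apply: continuousB; first by apply: cv; exact: BO.
  by have /(within_open_continuousP _ oB) := Ck_continuous KV; apply.
have [cpsi psi0] : continuous psi /\ forall x, ~ cb r1 x -> psi x = 0.
  apply: extend0_continuous => //; first exact: cbB.
    move=> x Bx; apply: (@continuous_comp _ _ _ (fun x => v x - V x) (@ramp_int R)); first exact: cvV.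
    exact: is_derive_continuous1 (ramp_int_derive _).
  by move=> x Bx nK; apply: ramp_int_eq0; exact: vV0.
have [ctau tau0] : continuous tau /\ forall x, ~ cb r1 x -> tau x = 0.
  apply: extend0_continuous => //; first exact: cbB.
    move=> x Bx; apply: (@continuous_comp _ _ _ (fun x => v x - V x) (@ramp R)); first exact: cvV.
    exact: ramp_continuous.
  by move=> x Bx nK; apply: ramp_eq0; exact: vV0.
have psiE x : B x -> psi x = ramp_int (v x - V x) by move=> Bx; rewrite /psi restrictE mem_set.
have tauE x : B x -> tau x = ramp (v x - V x) by move=> Bx; rewrite /tau restrictE mem_set.
have tau01 x : 0 <= tau x <= 1.
  by rewrite /tau restrictE; case: ifP => _; [exact: ramp01|rewrite lexx ler01].
(* Used for two kinds of f: test functions, which shows that [Dpsi] is the weak gradient of [psi],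
   and the components of the p-field of V. *)
have key f i : Ck 1 B f -> \int[mu]_(x in Omega) (psi x * partial i f x) =
    - \int[mu]_(x in Omega) (tau x * (g x ord0 i - partial i W x) * f x).
  move=> Kf.
  have KY : Ck 1 setT (fun x => chi2 x * f x).
    by apply: (Ck_cut oB (ccb rc) (cbB _ _) schi2 nchi2 Kf); lra.
  have Y0 x : ~ cb rc x -> chi2 x * f x = 0 by move=> /nchi2 ->; rewrite mul0r.
  have cbO : cb rc `<=` Omega by move=> x /cbB H; apply: BO; apply: H; lra.
  have := chain_rule oO Iv (Ig i) cv wg (Ck1_C1dir i KW) (Ck1_C1dir i KY) (ccb rc) cbO Y0
    (@ramp_int_derive R) (@ramp_int_lip R) (@ramp_lip R).
  have dY x : `|a - x| < r1' -> partial i (fun x => chi2 x * f x) x = partial i f x.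
    move=> xr; apply: (eq_partial i (@open_ball_rV a r1')) => // y /ltW yr.
    by rewrite chi21// mul1r.
  have dY0 x : rc < `|a - x| -> partial i (fun x => chi2 x * f x) x = 0.
    move=> xr; have := @partial_locally0 R d i (fun x => chi2 x * f x) _ (@open_ballC_rV a rc).
    by apply => // y /= yr; apply: Y0; apply/negP; rewrite -ltNge.
  rewrite (_ : \int[mu]_(x in Omega) (ramp_int _ * _) = \int[mu]_(x in Omega) (psi x * partial i f x)).
    move=> ->; congr (- _); apply: eq_Rintegral => x _.
    have [xr1|xr1] := leP `|a - x| r1.
      have Bx : B x by exact: le_lt_trans r12.
      rewrite tauE// WV; last by lra.
      by rewrite chi21 ?mul1r//; lra.
    have -> : tau x = 0 by apply: tau0; apply/negP; rewrite -ltNge.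
    rewrite !mul0r; have [xrc|xrc] := leP `|a - x| rc.
      rewrite WV; last lra.
      have Bx : B x by apply: le_lt_trans xrc _; lra.
      by rewrite (ramp_eq0 (vV0 _ Bx _)) ?mul0r//; apply/negP; rewrite -ltNge.
    by rewrite Y0 ?mulr0//; apply/negP; rewrite -ltNge.
  apply: eq_Rintegral => x _.
  have [xr1|xr1] := leP `|a - x| r1.
    have Bx : B x by exact: le_lt_trans r12.
    rewrite psiE// WV; last by lra.
    by rewrite dY//; lra.
  have -> : psi x = 0 by apply: psi0; apply/negP; rewrite -ltNge.
  rewrite !mul0r; have [xrc|xrc] := leP `|a - x| rc.
    rewrite WV; last lra.
    have Bx : B x by apply: le_lt_trans xrc _; lra.
    by rewrite (ramp_int_eq0 (vV0 _ Bx _)) ?mul0r//; apply/negP; rewrite -ltNge.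
  by rewrite dY0// mulr0.
(* Then g - Dpsi is the convex combination (1 - tau) g + tau DV on the support of [tau], to which
   [enorm_powR_convex] applies pointwise. *)
pose Dpsi x := tau x *: (g x - grad W x).
have cdW i : continuous (partial i W) by have [] := Ck1_C1dir i KW.
have W0 x : ~ cb rb x -> W x = 0 by move=> /nchi; rewrite /W => ->; rewrite mul0r.
have bdW i : bounded_support (partial i W).
  exact: (support_bounded (ccb rb) (partial_support i (ccb rb) W0)).
have mgW i : measurable_fun Omega (fun x => g x ord0 i - partial i W x).
  apply: measurable_funB.
    by apply/measurable_EFinP; apply: (measurable_int mu); exact: Ig.
  by apply: measurable_funTS; exact: continuous_measurable_rV.
have mtau : measurable_fun Omega tau.
  by apply: measurable_funTS; exact: continuous_measurable_rV.
have mDpsi : measurable_fun Omega Dpsi.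
  apply: measurable_rV_fun => // i.
  rewrite (_ : (fun x => _) = fun x => tau x * (g x ord0 i - partial i W x)).
    exact: measurable_funM.
  by apply/funext => x; rewrite !mxE.
have wpsi : weak_gradient Omega psi Dpsi.
  move=> phi i [sphi _ _]; rewrite key; last by apply: Ck_subset (sphi 1%N).
  by congr (- _); apply: eq_Rintegral => x _; rewrite !mxE.
have Ie := p_energy_integrable mO mg Eg.
have EDpsi : (p_energy Omega p Dpsi < +oo)%E.
  have cS : continuous (fun x => sqn (grad W x)).
    have oT : open [set: E] by exact: openT.
    suff [cS _] : Ck 0 setT (fun x => sqn (grad W x)).
      by move=> x; have /(within_open_continuousP _ oT) := cS; apply.
    apply: (eq_Ck (f := fun x => \sum_(i <- index_enum 'I_d) (partial i W x * partial i W x))) => //.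
      by move=> x _; rewrite /sqn; apply: eq_bigr => i _; rewrite mxE expr2.
    by apply: Ck_sum => // i; apply: CkM => //; split => //; exact: continuous_subspaceT.
  have bS : bounded_support (fun x => sqn (grad W x)).
    apply: (support_bounded (ccb rb)) => x nK; apply: big1 => i _.
    by rewrite mxE (partial_support i (ccb rb) W0 nK) expr0n.
  have [M Mp HM] := Cc_bounded cS bS.
  pose N : R := Num.sqrt M.
  have WN x : enorm (grad W x) <= N.
    by rewrite ler_sqrt ?sqn_ge0//; [exact: le_trans (ler_norm _) (HM x)|exact: ltW].
  have N0 : 0 <= N by exact: sqrtr_ge0.
  have p0 : 0 <= p by lra.
  apply: (p_energy_lty (f := fun x => 2 `^ p * (enorm (g x) `^ p + N `^ p))) => //.
    move=> x _; have /andP[t0 t1] := tau01 x.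
    rewrite (le_trans _ (powR_add_le (enorm_ge0 (g x)) N0 p0))//.
    apply: (ge0_ler_powR p0); rewrite ?nnegrE ?enorm_ge0 ?addr_ge0 ?enorm_ge0//.
    rewrite enormZ ger0_norm// (le_trans (ler_piMl (enorm_ge0 _) t1))//.
    by rewrite (le_trans (enormD _ _))// enormN lerD2l.
  apply: (integrableZ_fin _ mO); apply: (integrableD_fin mO Ie).
  apply: (integrable_bounded_on (r := M0) (M := N `^ p) mO _ OM) => //.
  by move=> x _; rewrite ger0_norm ?powR_ge0.
have psi_ge0 x : 0 <= psi x.
  by rewrite /psi restrictE; case: ifP => _ //; exact: ramp_int_ge0.
have psi_le x : psi x != 0 -> B x /\ psi x <= v x - V x.
  rewrite /psi restrictE; case: ifPn => [|_]; last by rewrite eqxx.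
  rewrite inE => Bx nz; split => //; apply: ramp_int_le.
  by rewrite leNgt; apply/negP => /ltW/ramp_int_eq0 h; rewrite h eqxx in nz.
have psi0' x : r1 < `|a - x| -> psi x = 0.
  by move=> xr; apply: psi0; apply/negP; rewrite -ltNge.
have := min psi Dpsi cpsi psi0' mDpsi EDpsi wpsi psi_ge0 psi_le.
pose q i x := tau x * (g x ord0 i - partial i W x) * p_field p V i x.
pose Q x := p * \sum_(i <- index_enum 'I_d) q i x.
have cXtau i : continuous (fun x => p_field p V i x * tau x) /\
    bounded_support (fun x => p_field p V i x * tau x).
  apply: (cut_continuous oB (ccb r1) (cbB _ r12)) => // x Bx.
  by have [] := Ck1_pointwise i oB (KX i) Bx.
have IgW i : mu.-integrable Omega (EFin \o (fun x => g x ord0 i - partial i W x)).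
  apply: integrableB_fin => //; apply: integrableS (integrable_Cc (cdW i) (bdW i)) => //.
have Iq i : mu.-integrable Omega (EFin \o q i).
  have [cX bX] := cXtau i; have [MX _ HMX] := Cc_bounded cX bX.
  rewrite (_ : q i = fun x => (g x ord0 i - partial i W x) * (p_field p V i x * tau x)).
    apply: (integrable_mul_bounded (M := MX)) => //.
    by apply: measurable_funTS; exact: continuous_measurable_rV.
  by apply/funext => x; rewrite /q; ring.
have [Isq Esq] := Rintegral_sum (index_enum 'I_d) mO Iq.
have IQ : mu.-integrable Omega (EFin \o Q) by exact: integrableZ_fin.
have pw x : Omega x -> enorm (g x - Dpsi x) `^ p <= enorm (g x) `^ p - Q x.
  move=> Ox; have [xr1|xr1] := leP `|a - x| r1; last first.
    have t0 : tau x = 0 by apply: tau0; apply/negP; rewrite -ltNge.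
    rewrite /Dpsi /Q t0 scale0r subr0 big1 ?mulr0 ?subr0// => i _.
    by rewrite /q t0 !mul0r.
  have Bx : B x by exact: le_lt_trans r12.
  have gWV : grad W x = grad V x.
    by apply/rowP => i; rewrite !mxE dWV//; lra.
  have := enorm_powR_convex (g x) p1 (gV0 x Bx) (tau01 x).
  rewrite /Dpsi gWV => /le_trans; apply; rewrite lerD2l lerN2.
  rewrite /Q /dot !mulr_sumr le_eqVlt; apply/orP; left; apply/eqP; apply: eq_bigr => i _.
  rewrite /q /p_field dWV ?gradE; last by lra.
  have -> : (g x - grad V x) ord0 i = g x ord0 i - partial i V x by rewrite !mxE.
  ring.
have mgD : measurable_fun Omega (fun x => g x - Dpsi x).
  apply: measurable_rV_fun => // i.
  rewrite (_ : (fun x => _) = fun x => g x ord0 i - Dpsi x ord0 i).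
    apply: measurable_funB.
      by apply/measurable_EFinP; apply: (measurable_int mu); exact: Ig.
    rewrite (_ : (fun x => Dpsi x ord0 i) = fun x => tau x * (g x ord0 i - partial i W x)).
      exact: measurable_funM.
    by apply/funext => x; rewrite !mxE.
  by apply/funext => x; rewrite !mxE.
have IeQ := integrableB_fin mO Ie IQ.
have Ie' : mu.-integrable Omega (EFin \o (fun x => enorm (g x - Dpsi x) `^ p)).
  apply: (integrable_le (g := fun x => enorm (g x) `^ p - Q x)) => //.
    exact: measurable_energy_density.
  by move=> x Ox; rewrite ger0_norm ?powR_ge0// pw.
rewrite /p_energy -(EFin_Rintegral mO Ie) -(EFin_Rintegral mO Ie') lee_fin => min'.
have le' : \int[mu]_(x in Omega) enorm (g x - Dpsi x) `^ p <=
    \int[mu]_(x in Omega) enorm (g x) `^ p - \int[mu]_(x in Omega) Q x.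
  by rewrite -(RintegralB mO Ie IQ); exact: (le_Rintegral mO Ie' IeQ pw).
pose dv x := - \sum_(i <- index_enum 'I_d) partial i (p_field p V i) x.
have cdv x : B x -> {for x, continuous dv}.
  have : Ck 0 B dv.
    apply: CkN => //; apply: Ck_sum => // i.
    by have [_ /(_ i)[]] := KX i.
  by move=> [/(within_open_continuousP _ oB) H _] Bx; exact: H.
have [cdp bdp] := cut_continuous oB (ccb r1) (cbB _ r12) cdv cpsi psi0.
have cpX i : continuous (fun x => partial i (p_field p V i) x * psi x) /\
    bounded_support (fun x => partial i (p_field p V i) x * psi x).
  apply: (cut_continuous oB (ccb r1) (cbB _ r12)) => // x Bx.
  by have [] := Ck1_pointwise i oB (KX i) Bx.
have IpX i : mu.-integrable Omega (EFin \o (fun x => partial i (p_field p V i) x * psi x)).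
  by have [c1 b1] := cpX i; apply: integrableS (integrable_Cc c1 b1).
have [IspX EspX] := Rintegral_sum (index_enum 'I_d) mO IpX.
(* The first-order gain [Q] of the energy, integrated by parts, only sees the divergence of the
   p-field. It is positive because [psi] is positive at [x1]. *)
have QE : \int[mu]_(x in Omega) Q x = p * \int[mu]_(x in Omega) (dv x * psi x).
  rewrite RintegralZl// Esq; congr (_ * _).
  transitivity (\sum_(i <- index_enum 'I_d)
      - \int[mu]_(x in Omega) (partial i (p_field p V i) x * psi x)).
    apply: eq_bigr => i _; rewrite -[LHS]opprK -(key _ i (KX i)); congr (- _).
    by apply: eq_Rintegral => x _; rewrite mulrC.
  rewrite sumrN -EspX -mulN1r -RintegralZl//; apply: eq_Rintegral => x _.
  by rewrite /dv mulN1r mulNr mulr_suml.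
have pos : 0 < \int[mu]_(x in Omega) (dv x * psi x).
  have Wx1 : 0 < dv x1 * psi x1.
    rewrite mulr_gt0//; first by rewrite oppr_gt0; exact: dX.
    by rewrite psiE// ramp_int_gt0// subr_gt0.
  have [s s0 Hs] := (continuous_rVP _ _).1 (cdp x1) (dv x1 * psi x1 / 2) ltac:(by rewrite divr_gt0).
  have [s' s'0 Hs'] := (open_rVP _).1 oO x1 (BO _ Bx1).
  apply: (@Rintegral_gt0 R d Omega _ x1 (Num.min s s' / 2) (dv x1 * psi x1 / 2)) => //.
  - by apply: integrableS (integrable_Cc cdp bdp).
  - move=> x _; have [Bx|nBx] := pselect (B x).
      by rewrite mulr_ge0// oppr_ge0 ltW//; exact: dX.
    have nK : ~ cb r1 x by move=> /(cbB _ r12).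
    by rewrite (psi0 _ nK) mulr0.
  - by rewrite divr_gt0// lt_min s0.
  - by rewrite divr_gt0.
  move=> x xs; have m0 : 0 < Num.min s s' by rewrite lt_min s0.
  have : `|x1 - x| < Num.min s s'.
    by apply: le_lt_trans xs _; rewrite ltr_pdivrMr// ltr_pMr// ltr1n.
  by rewrite lt_min => /andP[/Hs H /Hs' Ox]; split => //; exact: half_close H.
have p0 : 0 < p by exact: lt_trans p1.
have := le_trans min' le'; rewrite QE lerBrDl gerDr leNgt.
by rewrite mulr_gt0.
Qed.

End comparison_core.

(** * The p-Laplacian for large p *)

Section p_laplacian.
Variables (R : realType) (d : nat).
Local Notation E := 'rV[R]_d.
Local Notation e_ i := (delta_mx ord0 i : E).
Implicit Types (V f : E -> R) (O K : set E).

Lemma Ck_powR (k : nat) O f (q : R) : open O -> (forall x, O x -> 0 < f x) -> Ck k O f ->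
  Ck k O (fun x => f x `^ q).
Proof.
move=> oO f0 Kf.
(* Falling factorials: the n-th derivative of s^q is c n s^(q - n). *)
pose c (n : nat) : R := \prod_(j < n) (q - j%:R).
have := @Ck_comp R d k O f (fun n s => c n * s `^ (q - n%:R)) oO Kf.
rewrite /c; under eq_fun do rewrite big_ord0 mul1r subr0.
apply => n x _ Ox.
have D := @is_derive1_powR R (q - n%:R) (f x) (f0 x Ox).
have D2 := is_deriveZ (\prod_(j < n) (q - j%:R)) D; apply: is_derive_eq D2 _.
rewrite -[LHS]/(_ * _) big_ord_recr/= mulrA; congr (_ * _ `^ _).
by rewrite -addrA -opprD -natr1.
Qed.

Lemma sqn_grad_Ck1 O V : open O -> Ck 2 O V -> Ck 1 O (fun x => sqn (grad V x)).
Proof.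
move=> oO [_ KV].
apply: (eq_Ck (f := fun x => \sum_(i <- index_enum 'I_d) (partial i V x * partial i V x)) oO).
  by move=> x _; rewrite /sqn; apply: eq_bigr => i _; rewrite mxE expr2.
by apply: Ck_sum => // i; apply: CkM => //; have [_] := KV i.
Qed.

Lemma sqn_grad_gt0 V x : grad V x != 0 -> 0 < sqn (grad V x).
Proof.
by move=> g0; rewrite lt_def sqn_ge0 andbT; apply: contra g0 => /eqP/sqn_eq0 ->.
Qed.

Lemma p_field_Ck1 O V (p : R) i : open O -> Ck 2 O V -> (forall x, O x -> grad V x != 0) ->
  Ck 1 O (p_field p V i).
Proof.
move=> oO KV g0; apply: CkM => //; last by have [_ /(_ i)[]] := KV.
by apply: Ck_powR => //; [move=> x /g0; exact: sqn_grad_gt0|exact: sqn_grad_Ck1].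
Qed.

Definition laplacian V (x : E) : R := \sum_(i < d) partial i (partial i V) x.

Lemma is_derive_sum_seq (I : Type) (s : seq I) (h : I -> E -> R) (x v : E) (dh : I -> R) :
  (forall i, is_derive x v (h i) (dh i)) ->
  is_derive x v (fun y => \sum_(i <- s) h i y) (\sum_(i <- s) dh i).
Proof.
move=> H; elim: s => [|j s IH].
  rewrite (_ : (fun y => _) = cst 0) ?big_nil; first exact: is_derive_cst.
  by apply/funext => y; rewrite big_nil.
rewrite (_ : (fun y => _) = (h j) + (fun y => \sum_(i <- s) h i y)) ?big_cons.
  exact: is_deriveD.
by apply/funext => y; rewrite big_cons.
Qed.

(** The classical identity: the p-Laplacian is |DV|^(p-4) times |DV|^2 Laplacian + (p - 2) infinity
    Laplacian. *)
Lemma divergence_p_field O V (p : R) (x : E) : open O -> Ck 2 O V -> O x -> grad V x != 0 ->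
  \sum_(i < d) partial i (p_field p V i) x =
  sqn (grad V x) `^ ((p - 2) / 2 - 1) *
    (sqn (grad V x) * laplacian V x + (p - 2) * infinity_laplacian V x).
Proof.
move=> oO KV Ox g0.
set A := sqn (grad V x); have A0 : 0 < A by exact: sqn_grad_gt0.
have DV i j : is_derive x (e_ i) (partial j V) (partial i (partial j V) x).
  by have [_ /(_ j)[_ [_ /(_ i)[D _]]]] := KV; apply: derivableP; exact: D.
have DA i : is_derive x (e_ i) (fun x => sqn (grad V x))
    (\sum_(j < d) 2 * partial j V x * partial i (partial j V) x).
  rewrite (_ : (fun x => _) = fun x => \sum_(j <- index_enum 'I_d) (partial j V x * partial j V x)).
    apply: is_derive_sum_seq => j; have D := is_deriveM (DV i j) (DV i j).
    by apply: is_derive_eq D _; rewrite -![_ *: _]/(_ * _); ring.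
  by apply/funext => y; rewrite /sqn; apply: eq_bigr => j _; rewrite mxE expr2.
set q := (p - 2) / 2.
have Dpow i := is_derive_chain (DA i) (is_derive1_powR q A0).
have term i : partial i (p_field p V i) x =
    A `^ q * partial i (partial i V) x +
    partial i V x * (q * A `^ (q - 1) * \sum_(j < d) 2 * partial j V x * partial i (partial j V) x).
  by have [_] := is_deriveM (Dpow i) (DV i i); rewrite /partial => ->.
transitivity (\sum_(i < d) (A `^ q * partial i (partial i V) x +
    partial i V x * (q * A `^ (q - 1) * \sum_(j < d) 2 * partial j V x * partial i (partial j V) x))).
  by apply: eq_bigr => i _; exact: term.
clear term Dpow DA DV.
transitivity (A `^ q * laplacian V x + \sum_(i < d) \sum_(j < d)
    (A `^ (q - 1) * (p - 2)) *
    (partial j V x * partial i V x * partial i (partial j V) x)).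
  rewrite /laplacian mulr_sumr -big_split; apply: eq_bigr => i _.
  apply: (congr1 (fun z => _ + z)); rewrite mulrA mulr_sumr; apply: eq_bigr => j _.
  by rewrite /q; field.
rewrite [RHS]mulrDr [X in _ = X + _]mulrA (mulrC (A `^ (q - 1)) A).
have -> : A * A `^ (q - 1) = A `^ q.
  by rewrite mulrC (powR_mul_self A0 (r := q)) ?subrK.
apply: (congr1 (fun z => _ + z)).
rewrite exchange_big mulrA /infinity_laplacian mulr_sumr; apply: eq_bigr => i _.
by rewrite mulr_sumr.
Qed.

Lemma Ck0_continuous O f x : open O -> Ck 0 O f -> O x -> {for x, continuous f}.
Proof. by move=> oO [/(within_open_continuousP _ oO) H _]; exact: H. Qed.

Lemma infinity_laplacian_Ck0 O V : open O -> Ck 2 O V -> Ck 0 O (infinity_laplacian V).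
Proof.
move=> oO [_ KV]; apply: Ck_sum => // i; apply: Ck_sum => // j.
have K0 l : Ck 0 O (partial l V) by apply: (@CkS R d 0); have [_] := KV l.
apply: CkM => //; first by apply: CkM.
by have [_ [_ /(_ j)[]]] := KV i.
Qed.

Lemma laplacian_Ck0 O V : open O -> Ck 2 O V -> Ck 0 O (laplacian V).
Proof.
move=> oO [_ KV]; apply: Ck_sum => // i.
by have [_ [_ /(_ i)[]]] := KV i.
Qed.

Lemma grad_neq0_of_infinity_laplacian V x : infinity_laplacian V x != 0 -> grad V x != 0.
Proof.
apply: contra => /eqP g0; apply/eqP; rewrite /infinity_laplacian; apply: big1 => i _.
apply: big1 => j _.
by rewrite -[partial i V x]gradE g0 mxE !mul0r.
Qed.

(** Up to a positive factor the p-Laplacian is (p - 2) times the infinity Laplacian plus a term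
    bounded on [K] independently of p, and on the compact [K] the infinity Laplacian stays below a
    negative constant. Where it is nonzero the gradient does not vanish. *)
Lemma large_p_supersolution O K V : open O -> compact K -> K `<=` O -> Ck 2 O V ->
  (forall x, K x -> infinity_laplacian V x < 0) ->
  exists P : R, forall p, P <= p -> forall x, K x ->
    \sum_(i < d) partial i (p_field p V i) x < 0.
Proof.
move=> oO cK KO KV neg.
have cL x : K x -> {for x, continuous (infinity_laplacian V)}.
  by move=> /KO; apply: Ck0_continuous => //; exact: infinity_laplacian_Ck0.
have [K0|/set0P [x0 Kx0]] := eqVneq K set0.
  by exists 0 => p _ x; rewrite K0.
have KA : Ck 0 O (fun x => sqn (grad V x) * laplacian V x).
  by apply: CkM => //; [apply: CkS; exact: sqn_grad_Ck1|exact: laplacian_Ck0].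
have [M M0 HM] : exists2 M : R, 0 < M & forall x, K x -> `|sqn (grad V x) * laplacian V x| <= M.
  apply: compact_continuous_bounded => //.
  exact: continuous_subspaceW (Ck_continuous KA).
have [y] : exists2 c, c \in K & forall t, t \in K -> infinity_laplacian V t <= infinity_laplacian V c.
  apply: compact_EVT_max => //; first by exists x0.
  exact: continuous_subspaceW (Ck_continuous (infinity_laplacian_Ck0 oO KV)).
rewrite inE => Ky ymax.
have c0 := neg y Ky.
(* With 3 instead of 2 the factor p - 2 strictly exceeds M divided by the absolute value of the
   maximum. *)
exists (3 + M / - infinity_laplacian V y) => p Pp x Kx.
have g0 : grad V x != 0.
  by apply: grad_neq0_of_infinity_laplacian; exact: (ltr0_neq0 (neg x Kx)).
rewrite (divergence_p_field p oO KV (KO x Kx) g0) pmulr_rlt0 ?powR_gt0 ?sqn_grad_gt0//.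
have Lx := ymax x ltac:(by rewrite inE).
have Ax := le_trans (ler_norm _) (HM x Kx).
move: (sqn _ * _) Ax (infinity_laplacian V x) Lx => A Ax L Lx.
set c := infinity_laplacian V y in c0 Lx Pp *; clearbody c.
have hM : 0 < M / - c by rewrite divr_gt0// oppr_gt0.
have h1 : (p - 2) * L <= (p - 2) * c by rewrite ler_wpM2l//; lra.
have h2 : (p - 2) * c < (M / - c) * c by rewrite ltr_nM2r//; lra.
have h3 : M / - c * c = - M by field; rewrite lt_eqF.
lra.
Qed.

End p_laplacian.

(** * Sobolev functions on a bounded open set *)

Section sobolev_theory.
Variables (R : realType) (d : nat).
Local Notation E := 'rV[R]_d.
Local Notation mu := (lebesgue_rV R d).
Local Notation e_ i := (delta_mx ord0 i : E).
Implicit Types (v w psi V F Psi : E -> R) (g h Dpsi : E -> E).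
Variables (Omega : set E) (M0 : R).
Hypothesis oO : open Omega.
Hypothesis OM : forall x, Omega x -> `|x| <= M0.

Let mO : measurable Omega. Proof. exact: open_measurable_rV. Qed.

Lemma powR_ge_linear (t p : R) : 0 <= t -> 1 <= p -> t <= 1 + t `^ p.
Proof.
move=> t0 p1; have [t1|t1] := leP t 1; first by rewrite ler_wpDr// powR_ge0.
by rewrite ler_wpDl// le1r_powR// ltW.
Qed.

Lemma integrable_cst_bounded (c : R) : mu.-integrable Omega (EFin \o (fun=> c)).
Proof. exact: (integrable_bounded_on (r := M0) (M := `|c|)). Qed.

Lemma measurable_normr_powR D (v : E -> R) (p : R) : measurable_fun D v ->
  measurable_fun D (fun x => `|v x| `^ p).
Proof.
move=> mv; apply: (@measurableT_comp _ _ _ _ _ _ (@powR R ^~ p)); first exact: measurable_powR.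
exact: measurableT_comp.
Qed.

Lemma p_mass_integrable (p : R) v : measurable_fun Omega v ->
  (p_mass Omega p v < +oo)%E -> mu.-integrable Omega (EFin \o (fun x => `|v x| `^ p)).
Proof.
move=> mv fin; apply/integrableP; split.
  by apply/measurable_EFinP; exact: measurable_normr_powR.
rewrite (_ : (fun x => _) = (fun x => (`|v x| `^ p)%:E))//.
by apply/funext => x /=; rewrite (ger0_norm (powR_ge0 _ _)).
Qed.

Lemma p_mass_lty (p : R) v f : measurable_fun Omega v ->
  (forall x, Omega x -> `|v x| `^ p <= f x) -> mu.-integrable Omega (EFin \o f) ->
  (p_mass Omega p v < +oo)%E.
Proof.
move=> mv vf If.
have /integrableP[_] : mu.-integrable Omega (EFin \o (fun x => `|v x| `^ p)).
  apply: (integrable_le (g := f)) => //; first exact: measurable_normr_powR.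
  by move=> x Dx; rewrite (ger0_norm (powR_ge0 _ _)) vf.
apply: le_lt_trans; rewrite /p_mass le_eqVlt; apply/orP; left; apply/eqP.
by apply: eq_integral => x _ /=; rewrite (ger0_norm (powR_ge0 _ _)).
Qed.

Lemma measurable_coord_fun g i : measurable_fun Omega g ->
  measurable_fun Omega (fun x => g x ord0 i).
Proof. by move=> mg; exact: (measurableT_comp (measurable_coord i) mg). Qed.

Lemma coord_le_enorm (y : E) i : `|y ord0 i| <= enorm y.
Proof. exact: le_trans (norm_coord _ _) (norm_le_enorm _). Qed.

(** On a bounded set L^p embeds in L^1, by the pointwise bound t <= 1 + t^p. *)
Lemma sobolev_integrable (p : R) v g : 1 < p -> sobolev Omega p v g ->
  mu.-integrable Omega (EFin \o v) /\
  forall i, mu.-integrable Omega (EFin \o (fun x => g x ord0 i)).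
Proof.
move=> p1 [mv mg fv fg _].
have Iv := p_mass_integrable mv fv; have Ig := p_energy_integrable mO mg fg.
split.
  apply: (integrable_le (g := fun x => 1 + `|v x| `^ p)) => //.
    by move=> x _; apply: powR_ge_linear => //; exact: ltW.
  by apply: integrableD_fin => //; exact: integrable_cst_bounded.
move=> i; apply: (integrable_le (g := fun x => 1 + enorm (g x) `^ p)) => //.
- exact: measurable_coord_fun.
- move=> x _; rewrite (le_trans (coord_le_enorm _ _))//.
  by apply: powR_ge_linear; [exact: enorm_ge0|exact: ltW].
- by apply: integrableD_fin => //; exact: integrable_cst_bounded.
Qed.

Lemma test_function_bounded phi : test_function Omega phi ->
  [/\ continuous phi, bounded_support phi &
    forall i, continuous (partial i phi) /\ bounded_support (partial i phi)].
Proof.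
move=> [sphi cK _].
have phi0 x : ~ closure [set x | phi x != 0] x -> phi x = 0.
  move=> nc; apply/eqP; apply: contrapT => /negP nz; apply: nc; exact: subset_closure.
split.
- exact: smooth_continuous.
- exact: support_bounded phi0.
move=> i; have [_ _ cd] := smooth_C1dir i sphi; split => //.
exact: (support_bounded cK (partial_support i cK phi0)).
Qed.

Lemma integrable_mul_Cc v phi : mu.-integrable Omega (EFin \o v) -> continuous phi ->
  bounded_support phi -> mu.-integrable Omega (EFin \o (fun x => v x * phi x)).
Proof.
move=> Iv cp bp; have [M _ HM] := Cc_bounded cp bp.
apply: (integrable_mul_bounded (M := M)) => //.
by apply: measurable_funTS; exact: continuous_measurable_rV.
Qed.

Lemma weak_gradient_addZ (c : R) v w g h :
  mu.-integrable Omega (EFin \o v) -> mu.-integrable Omega (EFin \o w) ->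
  (forall i, mu.-integrable Omega (EFin \o (fun x => g x ord0 i))) ->
  (forall i, mu.-integrable Omega (EFin \o (fun x => h x ord0 i))) ->
  weak_gradient Omega v g -> weak_gradient Omega w h ->
  weak_gradient Omega (fun x => v x + c * w x) (fun x => g x + c *: h x).
Proof.
move=> Iv Iw Ig Ih wv ww phi i tphi.
have [cphi bphi /(_ i)[cd bd]] := test_function_bounded tphi.
have I1 := integrable_mul_Cc Iv cd bd; have I2 := integrable_mul_Cc Iw cd bd.
have I3 := integrable_mul_Cc (Ig i) cphi bphi; have I4 := integrable_mul_Cc (Ih i) cphi bphi.
transitivity (\int[mu]_(x in Omega) (v x * partial i phi x + c * (w x * partial i phi x))).
  by apply: eq_Rintegral => x _; rewrite mulrDl mulrA.
rewrite RintegralD//; last exact: integrableZ_fin.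
rewrite RintegralZl// wv// ww//.
transitivity (- \int[mu]_(x in Omega) (g x ord0 i * phi x + c * (h x ord0 i * phi x))).
  rewrite RintegralD//; last exact: integrableZ_fin.
  by rewrite RintegralZl// mulrN -opprD.
by congr (- _); apply: eq_Rintegral => x _; rewrite !mxE mulrDl mulrA.
Qed.

Lemma sobolev_addZ (p c : R) v w g h : 1 < p -> sobolev Omega p v g -> sobolev Omega p w h ->
  sobolev Omega p (fun x => v x + c * w x) (fun x => g x + c *: h x).
Proof.
move=> p1 sv sw; have p0 : 0 <= p by lra.
have [Iv Ig] := sobolev_integrable p1 sv; have [Iw Ih] := sobolev_integrable p1 sw.
have [mv mg fv fg wv] := sv; have [mw mh fw fh ww] := sw.
have Jv := p_mass_integrable mv fv; have Jw := p_mass_integrable mw fw.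
have Jg := p_energy_integrable mO mg fg; have Jh := p_energy_integrable mO mh fh.
have mvw : measurable_fun Omega (fun x => v x + c * w x).
  by apply: measurable_funD => //; exact: measurable_funM.
have mgh : measurable_fun Omega (fun x => g x + c *: h x).
  apply: measurable_rV_fun => // i.
  rewrite (_ : (fun x => _) = fun x => g x ord0 i + c * h x ord0 i); last first.
    by apply/funext => x; rewrite !mxE.
  apply: measurable_funD; first exact: measurable_coord_fun.
  by apply: measurable_funM => //; exact: measurable_coord_fun.
split; [exact: mvw|exact: mgh| | |exact: weak_gradient_addZ].
- apply: (p_mass_lty (f := fun x => 2 `^ p * (`|v x| `^ p + `|c| `^ p * `|w x| `^ p))) => //.
    move=> x _; rewrite -powRM// -normrM (le_trans _ (powR_add_le _ _ p0))//.
    by apply: (ge0_ler_powR p0); rewrite ?nnegrE ?addr_ge0// ler_normD.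
  exact: (integrableZ_fin _ mO (integrableD_fin mO Jv (integrableZ_fin _ mO Jw))).
- apply: (p_energy_lty (f := fun x => 2 `^ p * (enorm (g x) `^ p + `|c| `^ p * enorm (h x) `^ p))) => //.
    move=> x _; rewrite -powRM ?enorm_ge0// -enormZ.
    rewrite (le_trans _ (powR_add_le (enorm_ge0 _) (enorm_ge0 _) p0))//.
    by apply: (ge0_ler_powR p0); rewrite ?nnegrE ?addr_ge0 ?enorm_ge0// enormD.
  exact: (integrableZ_fin _ mO (integrableD_fin mO Jg (integrableZ_fin _ mO Jh))).
Qed.

Lemma continuous_compact_p_mass (p : R) psi : 0 <= p -> continuous psi -> bounded_support psi ->
  (p_mass Omega p psi < +oo)%E.
Proof.
move=> p0 cp bp; have [M Mp HM] := Cc_bounded cp bp.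
apply: (p_mass_lty (f := fun=> M `^ p)).
- by apply: measurable_funTS; exact: continuous_measurable_rV.
- by move=> x _; apply: (ge0_ler_powR p0); rewrite ?nnegrE// ltW.
- exact: integrable_cst_bounded.
Qed.

End sobolev_theory.

(** * Perturbations of minimizers and comparison on balls *)

Section minimizers.
Variables (R : realType) (d : nat).
Local Notation E := 'rV[R]_d.
Local Notation mu := (lebesgue_rV R d).
Local Notation e_ i := (delta_mx ord0 i : E).
Implicit Types (v w psi V F Psi : E -> R) (g h Dpsi : E -> E).
Variables (Omega : set E) (M0 : R).
Hypothesis oO : open Omega.
Hypothesis OM : forall x, Omega x -> `|x| <= M0.

Let mO : measurable Omega. Proof. exact: open_measurable_rV. Qed.

Lemma boundary_open_notin x : boundary Omega x -> ~ Omega x.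
Proof. by move=> [_ nI] Ox; apply: nI; move: oO; rewrite openE; exact. Qed.

Lemma continuous_closure_interior v x : {within closure Omega, continuous v} -> Omega x ->
  {for x, continuous v}.
Proof.
move=> cv Ox; have /(within_open_continuousP _ oO) H : {within Omega, continuous v}.
  by apply: continuous_subspaceW cv; exact: subset_closure.
exact: H.
Qed.

Lemma sobolev_Cc (p : R) psi Dpsi : 1 < p -> continuous psi -> bounded_support psi ->
  measurable_fun Omega Dpsi -> (p_energy Omega p Dpsi < +oo)%E ->
  weak_gradient Omega psi Dpsi -> sobolev Omega p psi Dpsi.
Proof.
move=> p1 cp bp mD ED wp; split; [|exact: mD| |exact: ED|exact: wp].
  by apply: measurable_funTS; exact: continuous_measurable_rV.
have p0 : 0 <= p by lra.
exact: (continuous_compact_p_mass oO OM p0 cp bp).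
Qed.

(** The approximating sequence of the trace is perturbed by the same multiple of [psi]: its
    differences to v do not change, nor do its boundary values, since [psi] vanishes off a compact
    subset of [Omega]. *)
Lemma admissible_perturb F Psi (p c : R) v g K psi Dpsi : 1 < p ->
  admissible Omega F Psi p v g -> compact K -> K `<=` Omega ->
  continuous psi -> (forall x, ~ K x -> psi x = 0) ->
  measurable_fun Omega Dpsi -> (p_energy Omega p Dpsi < +oo)%E ->
  weak_gradient Omega psi Dpsi ->
  (forall x, Omega x -> Psi x <= v x -> Psi x <= v x + c * psi x) ->
  admissible Omega F Psi p (fun x => v x + c * psi x) (fun x => g x + c *: Dpsi x).
Proof.
move=> p1 [sv tv ov] cK KO cpsi psi0 mD ED wp obs.
have bpsi := support_bounded cK psi0.
have spsi := sobolev_Cc p1 cpsi bpsi mD ED wp.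
split.
- exact: (sobolev_addZ oO OM).
- have [w [h [cw sw nw bw]]] := tv.
  exists (fun k x => w k x + c * psi x), (fun k x => h k x + c *: Dpsi x); split.
  + move=> k; apply: within_continuousD; first exact: cw.
    by apply: continuous_subspaceT => x; apply: continuousM; [exact: cst_continuous|exact: cpsi].
  + by move=> k; exact: (sobolev_addZ oO OM).
  + have -> : (fun k => sobolev_norm Omega p
        ((fun x => w k x + c * psi x) \- (fun x => v x + c * psi x))
        ((fun x => h k x + c *: Dpsi x) \- (fun x => g x + c *: Dpsi x))) =
        (fun k => sobolev_norm Omega p (w k \- v) (h k \- g)).
      apply/funext => k; apply: (f_equal2 (sobolev_norm Omega p)); apply/funext => x /=.
        by rewrite opprD addrACA subrr addr0.
      by rewrite opprD addrACA subrr addr0.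
    exact: nw.
  + have -> : (fun k => \int[@hausdorff_measure R d d.-1]_(x in boundary Omega)
         (`|w k x + c * psi x - F x| `^ p)%:E)%E =
       (fun k => \int[@hausdorff_measure R d d.-1]_(x in boundary Omega)
         (`|w k x - F x| `^ p)%:E)%E.
      apply/funext => k; apply: eq_integral => x; rewrite inE => bx.
      by rewrite psi0 ?mulr0 ?addr0// => /KO; exact: boundary_open_notin.
    exact: bw.
- by apply: filterS ov => x H Ox; apply: obs => //; exact: H.
Qed.

(** The competitor is v - psi. It respects the obstacle because v - psi >= V >= Psi wherever [psi]
    is nonzero. *)
Lemma minimizer_below F Psi (p : R) v V (a : E) (r1 r2 : R) :
  let B := [set x | `|a - x| < r2] in
  1 < p -> obstacle_minimizer Omega F Psi p v -> {within closure Omega, continuous v} ->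
  0 < r1 < r2 -> B `<=` Omega -> Ck 2 B V -> (forall x, B x -> grad V x != 0) ->
  (forall x, B x -> \sum_(i < d) partial i (p_field p V i) x < 0) ->
  (forall x, B x -> Psi x <= V x) ->
  (forall x, B x -> r1 < `|a - x| -> v x <= V x) ->
  forall x, B x -> v x <= V x.
Proof.
move=> B p1 [g [adm min]] cv r12 BO KV gV0 dX PV vV.
have [sv tv ov] := adm; have [Iv Ig] := sobolev_integrable oO OM p1 sv.
have [mv mg fv fg wv] := sv.
have oB : open B by exact: open_ball_rV.
have cv' x : Omega x -> {for x, continuous v} by exact: continuous_closure_interior.
have KX i : Ck 1 B (p_field p V i) by exact: p_field_Ck1.
refine (@comparison_core R d Omega v g V p a r1 r2 M0 oO OM Iv mg fg Ig cv' wv p1 r12 BO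
  (CkS KV) KX gV0 dX vV _).
move=> psi Dpsi cpsi psi0 mD ED wp psi_ge0 psi_le.
have /andP[r10 r1r2] := r12.
have cbO : [set x | `|a - x| <= r1] `<=` Omega.
  by move=> x /= xr; apply: BO; exact: le_lt_trans r1r2.
have psi0' x : ~ [set x | `|a - x| <= r1] x -> psi x = 0.
  by move=> /negP; rewrite -ltNge; exact: psi0.
have := @admissible_perturb F Psi p (-1) v g _ psi Dpsi p1 adm (@closed_ball_rV_compact R d a r1)
  cbO cpsi psi0' mD ED wp.
rewrite (_ : (fun x => g x - Dpsi x) = (fun x => g x + -1 *: Dpsi x)); last first.
  by apply/funext => x; rewrite scaleN1r.
move=> H; apply: min; apply: H => x Ox Pv; rewrite mulN1r.
have [z|/psi_le[Bx]] := eqVneq (psi x) 0; first by rewrite z subr0.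
by rewrite lerBrDl => h; apply: le_trans (PV x Bx) _; rewrite lerBrDr.
Qed.

(** The core lemma is applied to -v, whose competitor -v - psi corresponds to v + psi; raising v
    cannot violate the obstacle. *)
Lemma minimizer_above F Psi (p : R) v V (a : E) (r1 r2 : R) :
  let B := [set x | `|a - x| < r2] in
  1 < p -> obstacle_minimizer Omega F Psi p v -> {within closure Omega, continuous v} ->
  0 < r1 < r2 -> B `<=` Omega -> Ck 2 B V -> (forall x, B x -> grad V x != 0) ->
  (forall x, B x -> \sum_(i < d) partial i (p_field p V i) x < 0) ->
  (forall x, B x -> r1 < `|a - x| -> - v x <= V x) ->
  forall x, B x -> - v x <= V x.
Proof.
move=> B p1 [g [adm min]] cv r12 BO KV gV0 dX vV.
have [sv tv ov] := adm.
have [sn _] : sobolev Omega p (fun x => - v x) (fun x => - g x) /\ true.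
  split => //; have z : sobolev Omega p (cst 0) (cst 0).
    apply: (sobolev_Cc p1) => //.
    - by move=> x; exact: cst_continuous.
    - by exists 0.
    - have p0 : 0 <= p by lra.
      apply: (p_energy_lty (f := fun=> 0 `^ p)) => //; last exact: (integrable_cst_bounded oO OM).
      by move=> x _; rewrite enorm0.
    - move=> phi i _; rewrite [LHS](_ : _ = \int[mu]_(x in Omega) 0); last first.
        by apply: eq_Rintegral => x _; rewrite mul0r.
      rewrite [X in - X](_ : _ = \int[mu]_(x in Omega) 0); last first.
        by apply: eq_Rintegral => x _; rewrite mxE mul0r.
      by rewrite Rintegral_cst// mul0r oppr0.
  have := sobolev_addZ oO OM (-1) p1 z sv.
  rewrite (_ : (fun x => _ + -1 * v x) = fun x => - v x); last first.
    by apply/funext => x; rewrite add0r mulN1r.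
  rewrite (_ : (fun x => _ + -1 *: g x) = fun x => - g x)//.
  by apply/funext => x; rewrite add0r scaleN1r.
have [Iv Ig] := sobolev_integrable oO OM p1 sn.
have [mv mg fv fg wv] := sn.
have oB : open B by exact: open_ball_rV.
have cv' x : Omega x -> {for x, continuous (fun x => - v x)}.
  by move=> Ox; apply: continuousN; exact: continuous_closure_interior.
have KX i : Ck 1 B (p_field p V i) by exact: p_field_Ck1.
refine (@comparison_core R d Omega (fun x => - v x) (fun x => - g x) V p a r1 r2 M0 oO OM
  Iv mg fg Ig cv' wv p1 r12 BO (CkS KV) KX gV0 dX vV _).
move=> psi Dpsi cpsi psi0 mD ED wp psi_ge0 psi_le.
have /andP[r10 r1r2] := r12.
have cbO : [set x | `|a - x| <= r1] `<=` Omega.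
  by move=> x /= xr; apply: BO; exact: le_lt_trans r1r2.
have psi0' x : ~ [set x | `|a - x| <= r1] x -> psi x = 0.
  by move=> /negP; rewrite -ltNge; exact: psi0.
have := @admissible_perturb F Psi p 1 v g _ psi Dpsi p1 adm (@closed_ball_rV_compact R d a r1)
  cbO cpsi psi0' mD ED wp.
have EN (h : E -> E) : p_energy Omega p (fun x => - h x) = p_energy Omega p h.
  by apply: eq_integral => x _; rewrite enormN.
rewrite EN (_ : (fun x => - g x - Dpsi x) = (fun x => - (g x + 1 *: Dpsi x))); last first.
  by apply/funext => x; rewrite scale1r opprD.
rewrite EN => H; apply: min; apply: H => x Ox Pv.
by rewrite mul1r ler_wpDr.
Qed.

End minimizers.

(** * Viscosity limit as p tends to infinity *)

Section viscosity.
Variables (R : realType) (d : nat).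
Local Notation E := 'rV[R]_d.
Local Notation e_ i := (delta_mx ord0 i : E).
Implicit Types (v phi V Psi : E -> R) (U Omega : set E).

Lemma partialN phi i x : derivable phi x (e_ i) ->
  partial i (fun x => - phi x) x = - partial i phi x.
Proof. by move=> D; rewrite /partial -deriveN. Qed.

Lemma infinity_laplacianN U phi x : open U -> Ck 2 U phi -> U x ->
  infinity_laplacian (fun x => - phi x) x = - infinity_laplacian phi x.
Proof.
move=> oU [_ K] Ux; rewrite /infinity_laplacian -sumrN; apply: eq_bigr => i _.
rewrite -sumrN; apply: eq_bigr => j _.
have [Di [_ /(_ j)[Dji _]]] := K i; have [Dj _] := K j.
rewrite (partialN (Di x Ux)) (partialN (Dj x Ux)).
have -> : partial j (partial i (fun x => - phi x)) x = - partial j (partial i phi) x.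
  rewrite -(partialN (Dji x Ux)); apply: (eq_partial j oU _ Ux) => y Uy.
  exact: (partialN (Di y Uy)).
by move: (partial i phi x) (partial j phi x) (partial j _ x) => *; ring.
Qed.

Lemma is_derive_coord (i j : 'I_d) (y x : E) :
  is_derive x (e_ j) (fun z : E => z ord0 i - y ord0 i) ((i == j)%:R).
Proof.
have D := is_deriveB (partial_coord i j x) (is_derive_cst (y ord0 i) x (e_ j)).
by apply: is_derive_eq D _; rewrite subr0.
Qed.

Lemma sqdistE (y x : E) :
  sqn (x - y) = \sum_(i <- index_enum 'I_d) ((x ord0 i - y ord0 i) * (x ord0 i - y ord0 i)).
Proof. by apply: eq_bigr => i _; rewrite !mxE expr2. Qed.

Lemma is_derive_sqdist (j : 'I_d) (y x : E) :
  is_derive x (e_ j) (fun z : E => sqn (z - y)) (2 * (x ord0 j - y ord0 j)).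
Proof.
rewrite (_ : (fun z : E => _) = fun z : E =>
    \sum_(i <- index_enum 'I_d) ((z ord0 i - y ord0 i) * (z ord0 i - y ord0 i))); last first.
  by apply/funext => z; exact: sqdistE.
have D := is_derive_sum_seq (index_enum 'I_d) (fun i =>
  is_deriveM (is_derive_coord i j y x) (is_derive_coord i j y x)).
apply: is_derive_eq D _.
rewrite (bigD1 j)//= big1 ?addr0 => [|i ij].
  by rewrite eqxx -![_ *: _]/(_ * _) mulr1n; ring.
by rewrite (negbTE ij) !scaler0 addr0.
Qed.

Lemma Ck_sqdist (k : nat) U (y : E) : open U -> Ck k U (fun z : E => sqn (z - y)).
Proof.
move=> oU; apply: (eq_Ck oU (f := fun z : E =>
    \sum_(i <- index_enum 'I_d) ((z ord0 i - y ord0 i) * (z ord0 i - y ord0 i)))).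
  by move=> x _; rewrite sqdistE.
have K i : Ck k U (fun z : E => z ord0 i - y ord0 i).
  by apply: CkB => //; [exact: Ck_coord|exact: Ck_cst].
by apply: Ck_sum => // i; exact: CkM.
Qed.

Lemma infinity_laplacian_add_sqdist U phi (a : E) (t c : R) : open U -> Ck 2 U phi -> U a ->
  infinity_laplacian (fun x => phi x + (t * sqn (x - a) + c)) a =
  infinity_laplacian phi a + 2 * t * sqn (grad phi a).
Proof.
move=> oU [_ K] Ua.
have D1 i x : U x -> is_derive x (e_ i) (fun x => phi x + (t * sqn (x - a) + c))
    (partial i phi x + 2 * t * (x ord0 i - a ord0 i)).
  move=> Ux; have [Di _] := K i.
  have D := is_deriveD (derivableP (Di x Ux))
    (is_deriveD (is_deriveZ t (is_derive_sqdist i a x)) (is_derive_cst c x (e_ i))).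
  by apply: is_derive_eq D _; rewrite addr0 -/(partial i phi x) -[t *: _]/(t * _); ring.
have P1 i x : U x -> partial i (fun x => phi x + (t * sqn (x - a) + c)) x =
    partial i phi x + 2 * t * (x ord0 i - a ord0 i).
  by move=> Ux; have [_] := D1 i x Ux; rewrite /partial => ->.
have P2 i j : partial j (partial i (fun x => phi x + (t * sqn (x - a) + c))) a =
    partial j (partial i phi) a + 2 * t * (i == j)%:R.
  rewrite (eq_partial j oU (P1 i) Ua).
  have [_ [_ /(_ j)[Dji _]]] := K i.
  have D := is_deriveD (derivableP (Dji a Ua)) (is_deriveZ (2 * t) (is_derive_coord i j a a)).
  by have [_] := D; rewrite /partial => ->.
have P1a i : partial i (fun x => phi x + (t * sqn (x - a) + c)) a = partial i phi a.
  by rewrite P1// subrr mulr0 addr0.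
rewrite /infinity_laplacian /sqn mulr_sumr -big_split; apply: eq_bigr => i _ /=.
transitivity (\sum_(j < d) (partial i phi a * partial j phi a * partial j (partial i phi) a +
    partial i phi a * partial j phi a * (2 * t * (i == j)%:R))).
  by apply: eq_bigr => j _; rewrite !P1a P2 mulrDr.
rewrite big_split; apply: (congr1 (fun z => _ + z)).
rewrite (bigD1 i)//= big1 ?addr0 => [|j ji].
  by rewrite eqxx gradE mulr1n; ring.
by rewrite eq_sym (negbTE ji) !mulr0.
Qed.

(* If [phi] touched from above with negative infinity Laplacian then, made strict by a quadratic,
   it would be a p-supersolution for large [p], and comparison on a small ball would contradict
   the touching. *)
Lemma visc_core Omega (vk : nat -> E -> R) v Psi (p : nat -> R) (x0 : E) phi :
  open Omega -> Omega x0 ->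
  (forall P : R, exists N, forall k, (N <= k)%N -> P <= p k) ->
  (forall e : R, 0 < e -> exists N, forall k, (N <= k)%N -> forall x, Omega x -> `|vk k x - v x| < e) ->
  {for x0, continuous Psi} -> Psi x0 < v x0 ->
  (exists P0 : R, forall k V r1 r2, P0 <= p k ->
    0 < r1 < r2 -> [set x | `|x0 - x| < r2] `<=` Omega ->
    Ck 2 [set x | `|x0 - x| < r2] V -> (forall x, `|x0 - x| < r2 -> grad V x != 0) ->
    (forall x, `|x0 - x| < r2 -> \sum_(i < d) partial i (p_field (p k) V i) x < 0) ->
    (forall x, `|x0 - x| < r2 -> Psi x <= V x) ->
    (forall x, `|x0 - x| < r2 -> r1 < `|x0 - x| -> vk k x <= V x) ->
    forall x, `|x0 - x| < r2 -> vk k x <= V x) ->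
  C2_near x0 phi -> (\forall z \near x0, v z - phi z <= v x0 - phi x0) ->
  0 <= infinity_laplacian phi x0.
Proof.
move=> oO Ox0 pinf unif cPsi Pv [P0 cmp] [U [oU Ux0] Kphi] /nbhs_rVP[s0 s00 touch].
rewrite leNgt; apply/negP => neg.
pose L := infinity_laplacian phi x0.
pose S := sqn (grad phi x0).
have S0 : 0 <= S by exact: sqn_ge0.
(* At x0 the term t |x - x0|^2 adds 2 t S to the infinity Laplacian, which is at most half of |L|,
   so the sign is kept. *)
pose t : R := - L / (4 * (S + 1)).
have t0 : 0 < t by rewrite divr_gt0// ?oppr_gt0// mulr_gt0// ltr_wpDl.
have Lt : L + 2 * t * S < 0.
  have -> : L + 2 * t * S = L * (S + 2) / (2 * (S + 1)) by rewrite /t; field; rewrite gt_eqF// ltr_wpDl.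
  rewrite pmulr_llt0 ?invr_gt0 ?mulr_gt0// ?ltr_wpDl//.
  by rewrite pmulr_llt0// ltr_wpDl.
pose G c x := phi x + (t * sqn (x - x0) + c).
have KG c : Ck 2 U (G c).
  apply: (CkD oU Kphi); apply: (CkD oU); last exact: Ck_cst.
  by apply: (CkM oU); [exact: Ck_cst|exact: Ck_sqdist].
have GL c : infinity_laplacian (G c) x0 = L + 2 * t * S.
  exact: (infinity_laplacian_add_sqdist t c oU Kphi Ux0).
pose delta := (v x0 - Psi x0) / 2.
have delta0 : 0 < delta by rewrite divr_gt0// subr_gt0.
pose c0 := v x0 - phi x0.
have cphi : {for x0, continuous phi}.
  by have /(within_open_continuousP _ oU) H := Ck_continuous Kphi; exact: H.
have cGL : {for x0, continuous (infinity_laplacian (G 0))}.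
  exact: (Ck0_continuous oU (infinity_laplacian_Ck0 oU (KG 0))).
have [s1 s10 H1] := (continuous_rVP _ _).1 cGL (- (L + 2 * t * S)) ltac:(by rewrite oppr_gt0).
have cW : {for x0, continuous (fun x => phi x - Psi x)} by apply: continuousB.
have [s2 s20 H2] := (continuous_rVP _ _).1 cW delta delta0.
have [s3 s30 H3] := (open_rVP _).1 oU x0 Ux0.
have [s4 s40 H4] := (open_rVP _).1 oO x0 Ox0.
pose r2 := Num.min s0 (Num.min s1 (Num.min s2 (Num.min s3 s4))) / 2.
have r20 : 0 < r2 by rewrite divr_gt0// !lt_min s00 s10 s20 s30.
have r2min : r2 < Num.min s0 (Num.min s1 (Num.min s2 (Num.min s3 s4))).
  by rewrite /r2 ltr_pdivrMr// ltr_pMr ?ltr1n// !lt_min s00 s10 s20 s30.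
move: r2min; rewrite !lt_min => /and5P[r2s0 r2s1 r2s2 r2s3 r2s4].
pose r1 := r2 / 2.
have r10 : 0 < r1 by rewrite divr_gt0.
have r12 : r1 < r2 by rewrite /r1 ltr_pdivrMr// ltr_pMr// ltr1n.
(* The touching function is lowered by eta. The first bound keeps it above [Psi] on the ball; the
   second keeps it above [vk] for |x0 - x| > r1, where the quadratic term gains at least 2 eta and
   uniform closeness costs eta / 2. At x0 it falls below [vk]. *)
pose eta := Num.min delta (t * r1 ^+ 2 / 2).
have eta0 : 0 < eta by rewrite lt_min delta0 divr_gt0// mulr_gt0// exprn_gt0.
have eta1 : eta <= delta by rewrite ge_min lexx.
have eta2 : eta <= t * r1 ^+ 2 / 2 by rewrite ge_min lexx orbT.
clearbody eta.
pose V := G (c0 - eta).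
(* The radius r2 was chosen for [G 0], before eta was known; additive constants do not affect
   derivatives. *)
have Lc c x : U x -> infinity_laplacian (G c) x = infinity_laplacian (G 0) x.
  move=> Ux.
  have P1 i y : partial i (G c) y = partial i (G 0) y.
    have E1 : (fun h : R => h^-1 *: ((G c \o shift y) (h *: e_ i) - G c y)) =
        (fun h : R => h^-1 *: ((G 0 \o shift y) (h *: e_ i) - G 0 y)).
      by apply/funext => h; apply: (congr1 (fun z => _ *: z)); rewrite /G /=; ring.
    by rewrite /partial /derive E1.
  have P1' i : partial i (G c) = partial i (G 0) by apply/funext => y; exact: P1.
  by rewrite /infinity_laplacian; apply: eq_bigr => i _; apply: eq_bigr => j _; rewrite !P1'.
have negV x : [set x | `|x0 - x| <= r2] x -> infinity_laplacian V x < 0.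
  move=> /= xr; have Ux : U x by apply: H3; exact: le_lt_trans r2s3.
  rewrite (Lc _ _ Ux); have := H1 x ltac:(exact: le_lt_trans r2s1).
  by rewrite GL ltr_distlC => /andP[_]; rewrite subrr.
have [P1 HP1] := large_p_supersolution oU (@closed_ball_rV_compact R d x0 r2)
  (fun x xr => H3 x (le_lt_trans xr r2s3)) (KG (c0 - eta)) negV.
have [N1 HN1] := pinf (Num.max P0 P1).
have [N2 HN2] := unif (eta / 2) ltac:(by rewrite divr_gt0).
pose k := maxn N1 N2.
have pk := HN1 k (leq_maxl _ _); have uk := HN2 k (leq_maxr _ _).
move: pk; rewrite ge_max => /andP[pk0 pk1].
have B2O x : `|x0 - x| < r2 -> Omega x by move=> xr; apply: H4; exact: lt_trans r2s4.
have K2 : Ck 2 [set x | `|x0 - x| < r2] V.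
  by apply: Ck_subset (KG _) => x xr; apply: H3; exact: lt_trans r2s3.
have vtouch x : `|x0 - x| < r2 -> v x <= phi x + c0.
  by move=> xr; have := touch x (lt_trans xr r2s0); rewrite lerBlDl addrC.
have := cmp k V r1 r2 pk0 ltac:(by rewrite r10) B2O K2.
move=> /(_ _ _ _ _ x0).
have Vx0 : V x0 = v x0 - eta.
  by rewrite /V /G subrr /sqn big1 ?mulr0 => [|i _]; [rewrite /c0; ring|rewrite mxE expr0n].
have : ~ vk k x0 <= V x0.
  rewrite Vx0; apply/negP; rewrite -ltNge.
  have := uk x0 Ox0; rewrite ltr_distlC => /andP[_ +].
  move: (vk k x0) (v x0) eta0; clear; move=> A B; lra.
move=> nle le; apply: nle; apply: le.
- move=> x xr; apply: grad_neq0_of_infinity_laplacian.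
  by apply: ltr0_neq0; apply: negV; exact: ltW.
- by move=> x xr; apply: HP1 => //; exact: ltW.
- move=> x xr; have := H2 x (lt_trans xr r2s2).
  rewrite ltr_distlC => /andP[+ _].
  have : 0 <= t * sqn (x - x0) by rewrite mulr_ge0 ?sqn_ge0// ltW.
  rewrite /V /G /c0; move: eta1; rewrite /delta.
  move: (t * _) (phi x) (Psi x) (phi x0) (Psi x0) (v x0); clear; move=> *; lra.
- move=> x xr xr1; have := uk x (B2O x xr); rewrite distrC ltr_distlC => /andP[_ h1].
  have h2 := vtouch x xr.
  have h3 : t * r1 ^+ 2 <= t * sqn (x - x0).
    have h4 : r1 <= enorm (x - x0).
      by apply: le_trans (ltW xr1) _; rewrite distrC norm_le_enorm.
    rewrite ler_pM2l// -enorm_sqr !expr2.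
    by apply: ler_pM => //; exact: ltW.
  rewrite /V /G; move: h1 h2 h3 eta2 eta0; rewrite /c0.
  move: (t * sqn _) (t * _) (vk k x) (v x) (phi x) (v x0) (phi x0); clear; move=> *; lra.
- by rewrite subrr normr0.
Qed.

End viscosity.

(** * Comparison for the infinity Laplacian *)

Section infinity_comparison.
Variables (R : realType) (d : nat).
Local Notation E := 'rV[R]_d.
Local Notation e_ i := (delta_mx ord0 i : E).
Implicit Types (u v w phi V : E -> R) (U W A K : set E).

(** The infinity Laplacian is odd, so supersolutions are treated as negatives of subsolutions and
    this one notion serves both. *)
Definition visc_sub u (x : E) := forall phi, C2_near x phi ->
  (\forall z \near x, u z - phi z <= u x - phi x) -> 0 <= infinity_laplacian phi x.

Lemma enorm_continuous : continuous (@enorm R d).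
Proof.
move=> x; apply/continuous_rVP => e e0.
have d1 : 0 < d%:R + 1 :> R by rewrite ltr_wpDl.
exists (e / (d%:R + 1)); first by rewrite divr_gt0.
move=> y xy.
have H (a b : E) : enorm a - enorm b <= enorm (a - b).
  by rewrite lerBlDr -{1}(subrK b a); exact: enormD.
have : `|enorm x - enorm y| <= enorm (x - y).
  by rewrite ler_norml H andbT lerNl opprB enormB H.
move=> /le_lt_trans; apply; apply: (le_lt_trans (enorm_le_norm _)).
move: xy; rewrite ltr_pdivlMr// => xy.
by apply: le_lt_trans xy; rewrite mulrC ler_wpM2l// lerDl.
Qed.

Lemma enorm_dist_continuous (y : E) : continuous (fun x : E => enorm (x - y)).
Proof.
move=> x; apply: (@continuous_comp _ _ _ (fun x : E => x - y) (@enorm R d)).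
  by apply: continuousB; [exact: cvg_id|exact: cst_continuous].
exact: enorm_continuous.
Qed.

(** The profile c + b s - t s^2 of the distance s to y, written through the squared distance, which
    is smooth, so that only s = 0 is singular. *)
Definition cone_test (y : E) (c b t : R) (x : E) : R :=
  c + (b * sqn (x - y) `^ (2^-1) - t * sqn (x - y)).

Lemma cone_testE y c b t x :
  cone_test y c b t x = c + (b * enorm (x - y) - t * enorm (x - y) ^+ 2).
Proof. by rewrite /cone_test enorm_sqr powR12_sqrt ?sqn_ge0. Qed.

Lemma cone_test_continuous y c b t : continuous (cone_test y c b t).
Proof.
have ce := @enorm_dist_continuous y.
have cM (f g : E -> R) : continuous f -> continuous g -> continuous (fun x : E => f x * g x).
  by move=> cf cg x; apply: continuousM; [exact: cf|exact: cg].
have cB (f g : E -> R) : continuous f -> continuous g -> continuous (fun x : E => f x - g x).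
  by move=> cf cg x; apply: continuousB; [exact: cf|exact: cg].
have cD (f g : E -> R) : continuous f -> continuous g -> continuous (fun x : E => f x + g x).
  by move=> cf cg x; apply: continuousD; [exact: cf|exact: cg].
have cc (k : R) : continuous (fun _ : E => k) by move=> x; exact: cst_continuous.
rewrite (_ : cone_test y c b t =
    (fun x : E => c + (b * enorm (x - y) - t * (enorm (x - y) * enorm (x - y))))).
  exact: (cD _ _ (cc c) (cB _ _ (cM _ _ (cc b) ce) (cM _ _ (cc t) (cM _ _ ce ce)))).
by apply/funext => x; rewrite cone_testE expr2.
Qed.

Let pt (y : E) : set E := [set x | 0 < sqn (x - y)].

Let pt_open y : open (pt y).
Proof.
rewrite (_ : pt y = (fun x : E => enorm (x - y)) @^-1` [set r | 0 < r]).
  by apply: open_comp; [move=> x _; exact: enorm_dist_continuous|exact: open_gt].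
by apply/seteqP; split=> x /=; rewrite /pt/= sqrtr_gt0.
Qed.

Lemma sqn_sub_gt0 (x y : E) : x != y -> 0 < sqn (x - y).
Proof.
move=> xy; rewrite lt_def sqn_ge0 andbT; apply: contra xy => /eqP/sqn_eq0/eqP.
by rewrite subr_eq0.
Qed.

Lemma cone_test_C2 y c b t x : x != y -> C2_near x (cone_test y c b t).
Proof.
move=> /sqn_sub_gt0 xy; exists (pt y); first by split; [exact: pt_open|exact: xy].
have oU := @pt_open y; apply: (CkD oU); first exact: Ck_cst.
apply: (CkB oU); apply: (CkM oU); try exact: Ck_cst; last exact: Ck_sqdist.
by apply: (Ck_powR _ oU) => //; exact: Ck_sqdist.
Qed.

(** The radial formula f'(s)^2 f''(s) with f' = b - 2 t s and f'' = - 2 t, expressed in s^2. *)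
Lemma cone_test_laplacian y c b t x : x != y ->
  infinity_laplacian (cone_test y c b t) x =
  - (8 * t * sqn (x - y) * (b / 2 * sqn (x - y) `^ (- 2^-1) - t) ^+ 2).
Proof.
move=> /sqn_sub_gt0 xy; have oU := @pt_open y.
pose s x := sqn (x - y).
(* [h1] and [h2] are the first and second derivatives of the profile with respect to r = s^2. *)
pose h1 r : R := b / 2 * r `^ (- 2^-1) - t.
pose h2 r : R := - (b / 4 * r `^ (- 2^-1 - 1)).
have P1 i z : 0 < s z -> partial i (cone_test y c b t) z = h1 (s z) * (2 * (z ord0 i - y ord0 i)).
  move=> sz; have D1 := is_derive_chain (is_derive_sqdist i y z) (is_derive1_powR 2^-1 sz).
  have D := is_deriveD (is_derive_cst c z (e_ i))
    (is_deriveB (is_deriveZ b D1) (is_deriveZ t (is_derive_sqdist i y z))).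
  have [_] := D; rewrite /partial => ->.
  rewrite /h1 -[b *: _]/(b * _) -[t *: _]/(t * _) (_ : 2^-1 - 1 = - 2^-1 :> R); last by field.
  by field.
have Dh1 i z : 0 < s z -> is_derive z (e_ i) (fun z => h1 (s z))
    (h2 (s z) * (2 * (z ord0 i - y ord0 i))).
  move=> sz; have D1 := is_derive_chain (is_derive_sqdist i y z) (is_derive1_powR (- 2^-1) sz).
  have D := is_deriveB (is_deriveZ (b / 2) D1) (is_derive_cst t z (e_ i)).
  by apply: is_derive_eq D _; rewrite subr0 -[_ *: _]/(_ * _) /h2; field.
have P2 i j : partial j (partial i (cone_test y c b t)) x =
    4 * h2 (s x) * (x ord0 i - y ord0 i) * (x ord0 j - y ord0 j) + 2 * h1 (s x) * (i == j)%:R.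
  rewrite (eq_partial j oU (P1 i) xy).
  have D := is_deriveM (Dh1 j x xy) (is_deriveZ 2 (is_derive_coord i j y x)).
  have [_] := D; rewrite /partial => ->.
  by rewrite -![_ *: _]/(_ * _) /= -[2 *: _]/(2 * _); ring.
have inner i : \sum_(j < d) (partial i (cone_test y c b t) x * partial j (cone_test y c b t) x *
     partial j (partial i (cone_test y c b t)) x) =
     8 * h1 (s x) ^+ 2 * (2 * h2 (s x) * s x + h1 (s x)) * (x ord0 i - y ord0 i) ^+ 2.
  transitivity (\sum_(j < d) (16 * h1 (s x) ^+ 2 * h2 (s x) * (x ord0 i - y ord0 i) ^+ 2 *
       ((x ord0 j - y ord0 j) * (x ord0 j - y ord0 j)) +
       8 * h1 (s x) ^+ 3 * (x ord0 i - y ord0 i) * (x ord0 j - y ord0 j) * (i == j)%:R)).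
    by apply: eq_bigr => j _; rewrite P2 !(P1 _ _ xy); ring.
  rewrite big_split /= -mulr_sumr -sqdistE -/(s x).
  rewrite [X in _ + X](bigD1 i)//= [X in _ + (_ + X)]big1 ?addr0 => [|j ji].
    by rewrite eqxx mulr1n; ring.
  by rewrite eq_sym (negbTE ji) mulr0.
rewrite /infinity_laplacian (eq_bigr _ (fun i _ => inner i)) -mulr_sumr.
rewrite (_ : \sum_(i < d) _ = s x); last first.
  by rewrite /s sqdistE; apply: eq_bigr => i _; rewrite expr2.
have -> : 2 * h2 (s x) * s x + h1 (s x) = - t.
  rewrite /h2 /h1 -(powR_mul_self xy (q := - 2^-1 - 1) (r := - 2^-1)); last by rewrite subrK.
  by rewrite -/(s x); field.
by rewrite /h1 /s; ring.
Qed.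

(** The last condition keeps the slope b - 2 t s positive up to distance rho, so the squared factor
    does not vanish. *)
Lemma cone_test_laplacian_lt0 y c b t x (rho : R) : x != y -> 0 < t -> enorm (x - y) < rho ->
  2 * t * rho <= b -> infinity_laplacian (cone_test y c b t) x < 0.
Proof.
move=> xy t0 xr b0; rewrite cone_test_laplacian// oppr_lt0.
have s0 := sqn_sub_gt0 xy.
rewrite mulr_gt0//; first by rewrite !mulr_gt0.
rewrite exprn_even_gt0//= gt_eqF// subr_gt0.
have e0 : 0 < enorm (x - y) by rewrite sqrtr_gt0.
rewrite powRN powR12_sqrt ?sqn_ge0// -/(enorm (x - y)) ltr_pdivlMr//.
move: xr b0 e0; move: (enorm _) => r xr b0 r0.
have : t * r < t * rho by rewrite ltr_pM2l.
lra.
Qed.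

Lemma compact_enorm_ball (x : E) (r : R) : compact [set y | enorm (y - x) <= r].
Proof.
apply: (subclosed_compact _ (@closed_ball_rV_compact R d x r)).
  apply: (@closed_comp _ _ (fun y : E => enorm (y - x)) [set z | z <= r]); last exact: closed_le.
  by move=> y _; exact: enorm_dist_continuous.
by move=> y /=; apply: le_trans; rewrite distrC norm_le_enorm.
Qed.

(* A cone tilted by a quadratic has negative infinity Laplacian away from its vertex. *)
Lemma cone_comparison u (x0 : E) (rho M : R) : 0 < rho ->
  (forall x, enorm (x - x0) <= rho -> {for x, continuous u}) ->
  (forall x, enorm (x - x0) <= rho -> u x <= M) ->
  (forall x, x != x0 -> enorm (x - x0) < rho -> visc_sub u x) ->
  forall x, enorm (x - x0) <= rho -> u x <= u x0 + (M - u x0) / rho * enorm (x - x0).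
Proof.
move=> rho0 cu uM vu x1 x1r; rewrite leNgt; apply/negP => H.
have u0M : u x0 <= M by apply: uM; rewrite subrr enorm0 ltW.
pose b := (M - u x0) / rho; have b0 : 0 <= b by rewrite divr_ge0 ?subr_ge0// ltW.
pose delta := u x1 - (u x0 + b * enorm (x1 - x0)).
have delta0 : 0 < delta by rewrite subr_gt0.
(* With slope b' = b + 2 t rho the bent cone exceeds the cone of slope b by at most 2 t rho^2 =
   delta / 2, so u still exceeds it at x1; at distance rho its value is at least M + t rho^2, and b'
   >= 2 t rho gives the sign of the infinity Laplacian. *)
pose t := delta / (4 * rho ^+ 2).
have t0 : 0 < t by rewrite divr_gt0// mulr_gt0// exprn_gt0.
have trho : 4 * t * rho ^+ 2 = delta by rewrite /t; field; rewrite gt_eqF.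
pose b' := b + 2 * t * rho.
pose C := cone_test x0 (u x0) b' t.
have cC : continuous C by exact: cone_test_continuous.
pose B := [set x | enorm (x - x0) <= rho].
have [x2] : exists2 z, z \in B & forall y, y \in B -> u y - C y <= u z - C z.
  apply: compact_EVT_max; first by exists x1.
    exact: compact_enorm_ball.
  apply: continuous_in_subspaceT => x; rewrite inE => Bx.
  by apply: continuousB; [exact: cu|exact: cC].
rewrite inE => Bx2 max2.
have pos : 0 < u x2 - C x2.
  apply: lt_le_trans (max2 x1 ltac:(by rewrite inE)).
  rewrite /C cone_testE /b'.
  have r0 := enorm_ge0 (x1 - x0).
  have h : t * rho * enorm (x1 - x0) <= t * rho ^+ 2.
    by rewrite expr2 mulrA ler_wpM2l// mulr_ge0// ltW.
  have h' : 0 <= t * enorm (x1 - x0) ^+ 2 by rewrite mulr_ge0 ?exprn_ge0// ltW.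
  move: delta0 trho h h'; rewrite /delta; move: (enorm _) => r.
  move: (u x1) (u x0) => a1 a0; move: (rho ^+ 2) (r ^+ 2) => r2 rr; clearbody t b; clear; nra.
have x20 : x2 != x0.
  apply/eqP => E0; move: pos; rewrite E0 /C cone_testE subrr enorm0 mulr0 expr0n mulr0 subrr addr0.
  by rewrite subrr ltxx.
have x2rho : enorm (x2 - x0) < rho.
  rewrite lt_neqAle Bx2 andbT; apply/eqP => E0; move: pos; apply/negP; rewrite -leNgt subr_le0.
  rewrite /C cone_testE E0 (le_trans (uM _ Bx2))// /b' mulrDl /b divfK ?gt_eqF// expr2.
  have h : 0 <= t * rho * rho := mulr_ge0 (mulr_ge0 (ltW t0) (ltW rho0)) (ltW rho0).
  have -> : u x0 + (M - u x0 + 2 * t * rho * rho - t * (rho * rho)) = M + t * rho * rho by ring.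
  by rewrite lerDl.
have := vu x2 x20 x2rho C (cone_test_C2 _ _ _ x20).
have /= lt0 := @cone_test_laplacian_lt0 x0 (u x0) b' t x2 rho x20 t0 x2rho ltac:(by rewrite /b' lerDr).
move=> K; have : 0 <= infinity_laplacian C x2; last by rewrite leNgt lt0.
apply: K; apply/nbhs_rVP.
have oB : open [set x : E | enorm (x - x0) < rho].
  apply: (@open_comp _ _ (fun y : E => enorm (y - x0)) [set z | z < rho]); last exact: open_lt.
  by move=> y _; exact: enorm_dist_continuous.
have [r r0 Hr] := (open_rVP _).1 oB x2 x2rho.
by exists r => // y /Hr/ltW By; apply: max2; rewrite inE.
Qed.

End infinity_comparison.

(** * Maxima over small balls *)

Section armstrong_smart.
Variables (R : realType) (d : nat).
Local Notation E := 'rV[R]_d.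
Implicit Types (u v w : E -> R) (W A K N : set E).

Definition nbd A (r : R) : set E := [set x | exists2 a, A a & enorm (x - a) <= r].

Lemma nbd_compact A r : compact A -> compact (nbd A r).
Proof.
move=> cA; have cB := @compact_enorm_ball R d 0 r.
have -> : nbd A r = (fun z : E * E => z.1 + z.2) @` (A `*` [set y | enorm (y - 0) <= r]).
  apply/seteqP; split=> [x [a Aa xa]|_ [[a h] /= [Aa h0] <-]].
    by exists (a, x - a); rewrite /= ?subr0//= addrC subrK.
  by exists a => //; rewrite addrAC subrr add0r -[h]subr0.
apply: continuous_compact; last exact: compact_setX.
apply: continuous_subspaceT => z.
have c1 : {for z, continuous (@fst E E)} by exact: cvg_fst.
have c2 : {for z, continuous (@snd E E)} by exact: cvg_snd.
exact: (continuousD c1 c2).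
Qed.

Lemma nbd_trans A r s x y : nbd A r x -> enorm (y - x) <= s -> nbd A (r + s) y.
Proof.
move=> [a Aa xa] yx; exists a => //.
rewrite -(subrK x y) -addrA; apply: le_trans (enormD _ _) _.
by rewrite [leRHS]addrC; exact: lerD.
Qed.

Lemma nbd_le A r s x : r <= s -> nbd A r x -> nbd A s x.
Proof. by move=> rs [a Aa xa]; exists a => //; exact: le_trans rs. Qed.

Lemma compact_argmax K u : K !=set0 -> compact K ->
  (forall x, K x -> {for x, continuous u}) -> exists2 z, K z & forall y, K y -> u y <= u z.
Proof.
move=> K0 cK cu.
have [z] : exists2 z, z \in K & forall y, y \in K -> u y <= u z.
  apply: compact_EVT_max => //.
  by apply: continuous_in_subspaceT => x; rewrite inE => /cu.
by rewrite inE => Kz H; exists z => // y Ky; apply: H; rewrite inE.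
Qed.

Lemma compact_argmax_within K u : K !=set0 -> compact K ->
  {within K, continuous u} -> exists2 z, K z & forall y, K y -> u y <= u z.
Proof.
move=> K0 cK cu; have [z] := compact_EVT_max K0 cK cu.
by rewrite inE => Kz H; exists z => // y Ky; apply: H; rewrite inE.
Qed.

Lemma compact_superlevel K (f : E -> R) (c : R) : compact K -> {within K, continuous f} ->
  compact [set x | K x /\ c <= f x].
Proof.
move=> cK cf; apply: (subclosed_compact _ cK); last by move=> x [].
move=> x clx.
have Kx : K x.
  by apply: (compact_rV_closed cK); move: clx; apply: closure_subset => y [].
split => //; rewrite leNgt; apply/negP => fx.
have fx0 : 0 < c - f x by rewrite subr_gt0.
have [r rp Hr] := (within_continuous_rVP K f).1 cf x Kx _ fx0.
have [y [Ky cy] xy] := (closure_rVP _ _).1 clx r rp.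
have := Hr y Ky xy; rewrite ltr_distlC => /andP[_].
by rewrite addrC subrK ltNge cy.
Qed.

Section ball_maximum.
Variables (u : E -> R) (A : set E) (r0 e : R).
Hypothesis cA : compact A.
Hypothesis cu : forall x, nbd A r0 x -> {for x, continuous u}.
Hypothesis e0 : 0 < e.
Hypothesis e4 : 4 * e <= r0.

(** A maximizing displacement, with default 0 where there is none. Each operation costs a margin e
    inside [nbd A r0], where 4 e <= r0: maxima are attained at points of [nbd A (3 * e)], [ball_max]
    is continuous on [nbd A (2 * e)], and the midpoint inequality holds on [nbd A e]. *)
Definition ball_argmax (x : E) : E :=
  xget 0 [set h | enorm h <= e /\ forall k, enorm k <= e -> u (x + k) <= u (x + h)].

Definition ball_max (x : E) : R := u (x + ball_argmax x).

Lemma ball_maxP x : nbd A (3 * e) x -> enorm (ball_argmax x) <= e /\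
  forall y, enorm (y - x) <= e -> u y <= ball_max x.
Proof.
move=> Nx; rewrite /ball_max /ball_argmax; case: xgetP => [h _ [he H]|nH].
  split => // y yx; have := H (y - x) yx.
  by rewrite [x + (y - x)]addrC subrK.
exfalso.
have cB := @compact_enorm_ball R d x e.
have B0 : [set y | enorm (y - x) <= e] !=set0 by exists x; rewrite /= subrr enorm0 ltW.
have [|z zB zmax] := @compact_argmax _ u B0 cB.
  move=> y yB; apply: cu; apply: (@nbd_le A (3 * e + e)). - have : 3 * e + e = 4 * e by ring. by move=> ->.
  exact: nbd_trans yB.
apply: (nH (z - x)); split => // k ke.
by rewrite [x + (z - x)]addrC subrK; apply: zmax; rewrite /= addrAC subrr add0r.
Qed.

Lemma ball_max_ge x y : nbd A (3 * e) x -> enorm (y - x) <= e -> u y <= ball_max x.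
Proof. by move=> /ball_maxP[_ H]; exact: H. Qed.

Lemma ball_max_attained x : nbd A (3 * e) x -> exists2 y, enorm (y - x) <= e & ball_max x = u y.
Proof.
move=> /ball_maxP[H _]; exists (x + ball_argmax x) => //.
by rewrite addrAC subrr add0r.
Qed.

Lemma ball_max_continuous : {within nbd A (2 * e), continuous ball_max}.
Proof.
have cN := @nbd_compact A r0 cA.
have cuN : {within nbd A r0, continuous u}.
  by apply: continuous_in_subspaceT => x; rewrite inE => /cu.
apply/within_continuous_rVP => x Nx s s0.
have s2 : 0 < s / 2 by lra.
have [r rp Hr] := compact_unif_continuous cN cuN s2.
exists r => // y Ny xy.
have H (a b : E) : nbd A (2 * e) a -> nbd A (2 * e) b -> `|a - b| < r ->
    ball_max a <= ball_max b + s / 2.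
  move=> Na Nb ab.
  have e23 : 2 * e <= 3 * e by move: (e0) (e4) => *; lra.
  have Na3 : nbd A (3 * e) a by exact: nbd_le Na.
  have Nb3 : nbd A (3 * e) b by exact: nbd_le Nb.
  have [z zx ->] := ball_max_attained Na3.
  have zy : enorm (b + (z - a) - b) <= e by rewrite addrAC subrr add0r.
  apply: le_trans (lerD (ball_max_ge Nb3 zy) (lexx _)).
  rewrite -lerBlDl; apply: le_trans (ler_norm _) _; apply/ltW/Hr.
  - by apply: (@nbd_le A (2 * e + e)); [move: (e0) (e4) => *; lra|exact: nbd_trans zx].
  - by apply: (@nbd_le A (2 * e + e)); [move: (e0) (e4) => *; lra|exact: nbd_trans zy].
  rewrite (_ : z - (b + (z - a)) = a - b)//.
  by rewrite addrCA opprD addrA subrr add0r opprB.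
have h1 := H x y Nx Ny xy; have h2 := H y x Ny Nx ltac:(by rewrite distrC).
rewrite ltr_norml; apply/andP; split; lra.
Qed.

(* [z] is the midpoint between [x] and a maximum point on the ball of radius [2 * e], and
   comparison with cones on that ball bounds [ball_max x]. *)
Lemma ball_max_midpoint x : nbd A e x ->
  (forall y, nbd A r0 y -> visc_sub u y) ->
  exists2 z, enorm (z - x) <= e &
    forall y, enorm (y - x) <= e -> 2 * ball_max x <= ball_max y + ball_max z.
Proof.
move=> Nx vu.
have N3 y : enorm (y - x) <= e -> nbd A (3 * e) y.
  by move=> yx; apply: (@nbd_le A (e + e)); [move: (e0) (e4) => *; lra|exact: nbd_trans yx].
have Nx3 : nbd A (3 * e) x by apply: nbd_le Nx; move: (e0) (e4) => *; lra.
have cB := @compact_enorm_ball R d x (2 * e).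
have NB y : enorm (y - x) <= 2 * e -> nbd A r0 y.
  by move=> yx; apply: (@nbd_le A (e + 2 * e)); [move: (e0) (e4) => *; lra|exact: nbd_trans yx].
have B0 : [set y | enorm (y - x) <= 2 * e] !=set0.
  by exists x; rewrite /= subrr enorm0 mulr_ge0// ltW.
have [z0 z0B z0max] := @compact_argmax _ u B0 cB (fun y yB => cu (NB y yB)).
pose z := x + 2^-1 *: (z0 - x).
have zx : enorm (z - x) <= e.
  rewrite /z addrAC subrr add0r enormZ ger0_norm//.
  by rewrite ler_pdivrMl// z0B.
have z0z : enorm (z0 - z) <= e.
  rewrite /z opprD addrA (_ : z0 - x - 2^-1 *: (z0 - x) = 2^-1 *: (z0 - x)).
    by rewrite enormZ ger0_norm// ler_pdivrMl.
  by rewrite -{1}(scale1r (z0 - x)) -scalerBl; congr (_ *: _); field.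
exists z => // y yx.
have zM : u z0 <= ball_max z by apply: ball_max_ge => //; exact: N3.
have xy : u x <= ball_max y by apply: ball_max_ge; [exact: N3|rewrite enormB].
have [y0 y0x ->] := ball_max_attained Nx3.
have e2 : 0 < 2 * e by rewrite mulr_gt0.
(* At distance e, half the radius, the cone gives u y0 <= (u x + u z0) / 2, while u x and u z0 are
   at most [ball_max y] and [ball_max z]. *)
have cone := @cone_comparison R d u x (2 * e) (u z0) e2 (fun y yB => cu (NB y yB)) z0max
  (fun y _ yB => vu y (NB y (ltW yB))) y0 ltac:(by move: (e0) => ?; apply: le_trans y0x _; lra).
have u0 : 0 <= u z0 - u x by rewrite subr_ge0 z0max//= subrr enorm0 ltW.
have : (u z0 - u x) / (2 * e) * enorm (y0 - x) <= (u z0 - u x) / 2.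
  rewrite (_ : (u z0 - u x) / 2 = (u z0 - u x) / (2 * e) * e); last by field; rewrite gt_eqF.
  by rewrite ler_wpM2l// divr_ge0// ltW.
move: cone zM xy u0; generalize ((u z0 - u x) / (2 * e) * enorm (y0 - x)); move: (ball_max z) (ball_max y) (u z0) (u x) (u y0) => *; lra.
Qed.

End ball_maximum.

(* Armstrong and Smart: on the set where [ball_max u + ball_max w] is maximal and [ball_max u]
   is largest both midpoint inequalities are equalities, so this set contains the balls of
   radius [e] around its points, which is absurd for a point with maximal coordinate. *)
Lemma infinity_comparison (i0 : 'I_d) W A u w (c : R) : open W -> compact A -> A `<=` W ->
  (forall x, W x -> {for x, continuous u}) -> (forall x, W x -> {for x, continuous w}) ->
  (forall x, W x -> visc_sub u x) -> (forall x, W x -> visc_sub w x) ->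
  (forall x, W x -> c < u x + w x -> A x) ->
  forall x, W x -> u x + w x <= c.
Proof.
move=> oW cA AW cu cw vu vw HA a0 Wa0; rewrite leNgt; apply/negP => ca0.
have Aa0 := HA a0 Wa0 ca0.
have [r1 r10 Hr1] := compact_open_dist cA oW AW.
pose r0 := r1 / 2.
have r00 : 0 < r0 by rewrite divr_gt0.
have NW x : nbd A r0 x -> W x.
  move=> [a Aa xa]; apply: (Hr1 a) => //; rewrite distrC.
  by apply: le_lt_trans (le_trans (norm_le_enorm _) xa) _; rewrite /r0; lra.
have cN := @nbd_compact A r0 cA.
have cuN x : nbd A r0 x -> {for x, continuous u} by move=> /NW; exact: cu.
have cwN x : nbd A r0 x -> {for x, continuous w} by move=> /NW; exact: cw.
have cwN' : {within nbd A r0, continuous w}.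
  by apply: continuous_in_subspaceT => x; rewrite inE => /cwN.
pose gap := u a0 + w a0 - c.
have gap0 : 0 < gap by rewrite subr_gt0.
have [dl dl0 Hdl] := compact_unif_continuous cN cwN' gap0.
(* The second bound is for the points where u and w reach their maxima over one ball: they are at
   most 2 e < dl apart, so w varies by less than [gap] between them. *)
pose e := Num.min (r0 / 4) (dl / 4).
have e0 : 0 < e by rewrite lt_min !divr_gt0.
have er : 4 * e <= r0.
  have : e <= r0 / 4 by rewrite ge_min lexx.
  lra.
have ed : 4 * e <= dl.
  have : e <= dl / 4 by rewrite ge_min lexx orbT.
  lra.
clearbody e r0.
pose U := ball_max u e; pose Z := ball_max w e.
have cU := ball_max_continuous cA cuN e0 er.
have cZ := ball_max_continuous cA cwN e0 er.
pose N := nbd A (2 * e); have cN2 : compact N by exact: nbd_compact.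
have Na0 : N a0 by exists a0 => //; rewrite subrr enorm0; lra.
have cS : {within N, continuous (fun x => U x + Z x)} by exact: within_continuousD.
have [x1 Nx1 x1max] := compact_argmax_within (ex_intro _ a0 Na0) cN2 cS.
pose m := U x1 + Z x1.
have N3 x : N x -> nbd A (3 * e) x by apply: nbd_le; move: e0; clear=> ?; lra.
have ma0 : u a0 + w a0 <= m.
  apply: le_trans (x1max a0 Na0); apply: lerD.
    by apply: (ball_max_ge cuN e0 er); [exact: N3|rewrite subrr enorm0 ltW].
  by apply: (ball_max_ge cwN e0 er); [exact: N3|rewrite subrr enorm0 ltW].
pose Em := [set x | N x /\ m <= U x + Z x].
have EmE x : Em x -> U x + Z x = m.
  by move=> [Nx mx]; apply/eqP; rewrite eq_le mx andbT; exact: x1max.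
have cEm : compact Em by exact: compact_superlevel.
have Em1 : Em x1 by split.
have EmA x : Em x -> nbd A e x.
  (* Let u and w attain their maxima over the ball of x at y and z. Then u y + w y > u y + w z - gap
     >= c, so y lies in [A]. *)
  move=> Ex; have [Nx mx] := Ex.
  have [y yx yE] := ball_max_attained cuN e0 er (N3 x Nx).
  have [z zx zE] := ball_max_attained cwN e0 er (N3 x Nx).
  have Ny : nbd A r0 y by apply: (@nbd_le A (2 * e + e)); [move: e0 er; clear=> ? ?; lra|exact: nbd_trans yx].
  have Nz : nbd A r0 z by apply: (@nbd_le A (2 * e + e)); [move: e0 er; clear=> ? ?; lra|exact: nbd_trans zx].
  have zy : `|z - y| < dl.
    apply: le_lt_trans (norm_le_enorm _) _.
    rewrite -(subrK x z) -addrA (le_lt_trans (enormD _ _))//.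
    by move: zx yx; rewrite [enorm (y - x)]enormB; lra.
  have := Hdl z y Nz Ny zy; rewrite ltr_distlC => /andP[wy _].
  exists y; last by rewrite enormB.
  apply: HA; first exact: NW.
  have : u y + w z = m by rewrite -(EmE x Ex) -yE -zE.
  move: ma0 wy; rewrite /gap; move: (u y) (w y) (w z) (u a0) (w a0) (m); clear.
  move=> *; lra.
have cUE : {within Em, continuous U} by apply: continuous_subspaceW cU => x [].
have [x2 Ex2 x2max] := compact_argmax_within (ex_intro _ x1 Em1) cEm cUE.
(* [Fm] is where [U] is largest on [Em]. Among its points x0 has the largest coordinate i0. *)
pose Fm := [set x | Em x /\ U x2 <= U x].
have cFm : compact Fm by exact: compact_superlevel.
have [x0 Fx0 x0max] := @compact_argmax Fm (fun x : E => x ord0 i0) (ex_intro _ x2 (conj Ex2 (lexx _))) cFm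
  (fun x _ => @coord_continuous _ _ _ ord0 i0 x).
have [Ex0 Ux0] := Fx0.
have UE y : Em y -> U y <= U x0 by move=> /x2max Uy; exact: le_trans Uy Ux0.
have Nx0 := EmA x0 Ex0.
have [yp yp1 yp2] := ball_max_midpoint cuN e0 er Nx0 (fun y Ny => vu y (NW y Ny)).
have [zp zp1 zp2] := ball_max_midpoint cwN e0 er Nx0 (fun y Ny => vw y (NW y Ny)).
have NB y : enorm (y - x0) <= e -> N y.
  by move=> yx; apply: (@nbd_le A (e + e)); [move: e0 er; clear=> ? ?; lra|exact: nbd_trans yx].
have mB y : enorm (y - x0) <= e -> U y + Z y <= m by move=> yx; apply: x1max; exact: NB.
have key y : enorm (y - x0) <= e -> U y = U x0 /\ Em y.
  move=> yx.
  (* The inequality for [U] at zp and that for [Z] at yp add up to 2 m on both sides, so yp and zp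
     lie in [Em]. There [U] is at most U x0, which makes U and Z at least their values at x0 on the
     whole ball, and the bound m turns this into equality. *)
  have h1 := yp2 zp zp1; have h2 := zp2 yp yp1.
  have h3 := mB _ yp1; have h4 := mB _ zp1; have h5 := EmE _ Ex0.
  rewrite -!/(U _) -!/(Z _) in h1 h2.
  have Eyp : Em yp by split; [exact: NB|move: h1 h2 h3 h4 h5;
    move: (U _) (U _) (U _) (Z _) (Z _) (Z _) (m); clear; move=> *; lra].
  have Ezp : Em zp by split; [exact: NB|move: h1 h2 h3 h4 h5;
    move: (U _) (U _) (U _) (Z _) (Z _) (Z _) (m); clear; move=> *; lra].
  have h6 := UE _ Eyp; have h7 := UE _ Ezp; have h8 := EmE _ Eyp; have h9 := EmE _ Ezp.
  have h10 := yp2 y yx; have h11 := zp2 y yx; have h12 := mB y yx.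
  rewrite -!/(U _) -!/(Z _) in h10 h11.
  have Ny := NB y yx.
  split; last (split => //); move: h1 h2 h5 h6 h7 h8 h9 h10 h11 h12;
    move: (U x0) (U yp) (U zp) (U y) (Z x0) (Z yp) (Z zp) (Z y) (m); clear; move=> *; lra.
pose h : E := e *: delta_mx ord0 i0.
have hx : enorm (x0 + h - x0) <= e.
  rewrite addrAC subrr add0r enormZ gtr0_norm// ger_pMr//.
  rewrite /enorm (bigD1 i0)//= big1 ?addr0 => [|j ji].
    by rewrite mxE !eqxx expr1n sqrtr1.
  by rewrite mxE (negbTE ji) expr0n.
have [Uh Eh] := key _ hx.
have Fh : Fm (x0 + h) by split => //; rewrite Uh.
have := x0max _ Fh.
rewrite !mxE !eqxx/= mulr1 gerDl leNgt e0//.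
Qed.

End armstrong_smart.

(** * Hausdorff measure of compact sets *)

Section hausdorff_borel.
Variables (R : realType) (d : nat).
Local Notation E := 'rV[R]_d.
Implicit Types (A B C X K : set E).
Local Open Scope ereal_scope.

Definition separated_by (r : R) A B := forall x y, A x -> B y -> (r <= enorm (x - y))%R.

Lemma enorm_le_diam A x y : A x -> A y -> (enorm (x - y))%:E <= diam A.
Proof. by move=> Ax Ay; apply: ereal_sup_ubound; exists (x, y). Qed.

(** A set of diameter less than r cannot meet both A and B, so a fine cover of the union splits into
    covers of A and of B. *)
Lemma hausdorff_separated s (r : R) A B : (0 < r)%R -> separated_by r A B ->
  hausdorff s A + hausdorff s B <= hausdorff s (A `|` B).
Proof.
move=> r0 AB.
suff H (e : R) : (0 < e)%R -> (e < r)%R ->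
    hausdorff_content s e A + hausdorff_content s e B <= hausdorff s (A `|` B).
  have mono (e e' : R) C : (0 < e)%R -> (e <= e')%R ->
      hausdorff_content s e' C <= hausdorff_content s e C.
    move=> e0 ee; apply: ereal_inf_le_tmp => x [G [Ge CG] <-]; exists G => //; split => // k.
    by apply: le_trans (Ge k) _; rewrite lee_fin.
  (* The two measures are suprema over separate scales; monotonicity in the scale reduces to a
     common one below r, and the suprema are then taken one after the other. *)
  have H1 (e e' : R) : (0 < e)%R -> (0 < e')%R ->
      hausdorff_content s e A + hausdorff_content s e' B <= hausdorff s (A `|` B).
    move=> e0 e0'; pose f := Num.min (Num.min e e') (r / 2)%R.
    have f0 : (0 < f)%R by rewrite !lt_min e0 e0' divr_gt0.
    have fr : (f < r)%R.
      by apply: (@le_lt_trans _ _ (r / 2)%R); [rewrite ge_min lexx orbT|rewrite ltr_pdivrMr// ltr_pMr// ltr1n].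
    have fe : (f <= e)%R by rewrite !ge_min lexx.
    have fe' : (f <= e')%R by rewrite !ge_min lexx orbT.
    by apply: le_trans (H f f0 fr); apply: leeD; exact: mono.
  have [Hoo|Hfin] := eqVneq (hausdorff s (A `|` B)) +oo; first by rewrite Hoo leey.
  have Bfin (e' : R) : (0 < e')%R -> hausdorff_content s e' B \is a fin_num.
    move=> e0'; rewrite ge0_fin_numE; last exact: hausdorff_content_ge0.
    apply: (@le_lt_trans _ _ (hausdorff s (A `|` B))); last by rewrite ltey.
    by apply: le_trans (H1 _ _ e0' e0'); apply: leeDr; exact: hausdorff_content_ge0.
  have HA (e' : R) : (0 < e')%R ->
      hausdorff s A + hausdorff_content s e' B <= hausdorff s (A `|` B).
    move=> e0'; rewrite -leeBrDr; last exact: Bfin.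
    by apply: ge_ereal_sup => _ [e e0 <-]; rewrite leeBrDr; [exact: H1|exact: Bfin].
  have Afin : hausdorff s A \is a fin_num.
    rewrite ge0_fin_numE; last exact: hausdorff_ge0.
    apply: (@le_lt_trans _ _ (hausdorff s (A `|` B))); last by rewrite ltey.
    by apply: le_trans (HA 1%R ltr01); apply: leeDl; exact: hausdorff_content_ge0.
  rewrite addeC -leeBrDr//.
  by apply: ge_ereal_sup => _ [e e0 <-]; rewrite leeBrDr// addeC; exact: HA.
move=> e0 er.
apply: (@le_trans _ _ (hausdorff_content s e (A `|` B))); last first.
  by apply: ereal_sup_ubound; exists e.
apply: le_ereal_inf_tmp => _ [G [Ge ABG] <-].
(* Discarded sets become empty rather than being removed: the empty set has gauge 0, also for s = 0,
   so the indexing by naturals is kept. *)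
pose GA k := if `[< G k `&` A !=set0 >] then G k else set0.
pose GB k := if `[< G k `&` A !=set0 >] then set0 else G k.
have g0 : hausdorff_gauge s (@set0 E) = 0 by rewrite /hausdorff_gauge eqxx.
have -> : \sum_(k <oo) hausdorff_gauge s (G k) =
    \sum_(k <oo) hausdorff_gauge s (GA k) + \sum_(k <oo) hausdorff_gauge s (GB k).
  rewrite -nneseriesD => [|k _ _|k _ _]; [|exact: hausdorff_gauge_ge0..].
  apply: eq_eseriesr => k _; rewrite /GA /GB; case: asboolP => _.
    by rewrite g0 adde0.
  by rewrite g0 add0e.
apply: leeD; apply: ereal_inf_lbound.
- exists GA => //; split => [k|x Ax].
    by rewrite /GA; case: asboolP => _; [exact: Ge|rewrite diam_set0 leNye].
  have [k _ Gx] := ABG x (or_introl Ax); exists k => //.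
  by rewrite /GA; case: asboolP => // H; case: H; exists x.
- exists GB => //; split => [k|x Bx].
    by rewrite /GB; case: asboolP => _; [rewrite diam_set0 leNye|exact: Ge].
  have [k _ Gx] := ABG x (or_intror Bx); exists k => //.
  rewrite /GB; case: asboolP => // -[y [Gy Ay]].
  have := le_trans (enorm_le_diam Gy Gx) (Ge k); rewrite lee_fin => H.
  by have := lt_le_trans er (AB _ _ Ay Bx); rewrite ltNge H.
Qed.

(* The set [A k] of points at distance at least [1 / (k + 1)] from [C] and the shell [S (k + 1)]
   are separated, hence the measures of the shells are summable. *)
Lemma closed_hausdorff_measurable s C : closed C -> caratheodory_measurable (@hausdorff R d s) C.
Proof.
move=> cC; apply: le_caratheodory_measurable => X.
suff : hausdorff s (X `&` C) + hausdorff s (X `&` ~` C) <= hausdorff s X by [].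
pose A k := [set x | X x /\ forall c, C c -> (k.+1%:R^-1 <= enorm (x - c))%R].
have Aincr m n x : (m <= n)%N -> A m x -> A n x.
  move=> mn [Xx H]; split => // c Cc; apply: le_trans (H c Cc).
  by rewrite lef_pV2 ?posrE// ler_nat ltnS.
have AX k : A k `<=` X by move=> x [].
have [Xoo|Xfin] := eqVneq (hausdorff s X) +oo; first by rewrite Xoo leey.
have fin (B : set E) : B `<=` X -> hausdorff s B \is a fin_num.
  move=> BX; rewrite ge0_fin_numE; last exact: hausdorff_ge0.
  by apply: le_lt_trans (le_hausdorff s BX) _; rewrite ltey.
pose S k := A k.+1 `\` A k.
have SX k : S k `<=` X by move=> x [/AX].
have step k : hausdorff s (A k) + hausdorff s (S k.+1) <= hausdorff s (A k.+2).
  pose r : R := (k.+1%:R^-1 - k.+2%:R^-1)%R.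
  have r0 : (0 < r)%R by rewrite subr_gt0 ltf_pV2 ?posrE// ltr_nat.
  apply: le_trans (hausdorff_separated s r0 _) (le_hausdorff s _).
  - move=> x y [Xx Hx] [[Xy _] nAy].
    have [c Cc yc] : exists2 c, C c & (enorm (y - c) < k.+2%:R^-1)%R.
      apply: contrapT => H; apply: nAy; split => // c Cc; rewrite leNgt; apply/negP => yc.
      by apply: H; exists c.
    have := Hx c Cc; have := enormD (x - y) (y - c); rewrite addrA subrK => h1 h2.
    by rewrite /r lerBlDr (le_trans h2)// (le_trans h1)// lerD2l ltW.
  - by move=> x [Ax|[]//]; apply: Aincr Ax; rewrite -addn2 leq_addr.
pose a k := fine (hausdorff s (A k)).
pose t k := fine (hausdorff s (S k)).
have aE k : hausdorff s (A k) = (a k)%:E by rewrite fineK//; exact: fin.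
have tE k : hausdorff s (S k) = (t k)%:E by rewrite fineK//; exact: fin.
have xE : hausdorff s X = (fine (hausdorff s X))%:E by rewrite fineK//; exact: fin.
set hX := fine (hausdorff s X) in xE.
have aX k : (a k <= hX)%R by rewrite -lee_fin -aE -xE; exact: le_hausdorff.
have a0 k : (0 <= a k)%R by rewrite -lee_fin -aE; exact: hausdorff_ge0.
have t0 k : (0 <= t k)%R by rewrite -lee_fin -tE; exact: hausdorff_ge0.
have stepR k : (a k + t k.+1 <= a k.+2)%R by have := step k; rewrite !aE tE -EFinD lee_fin.
(* Only shells two indices apart are separated; even and odd shells telescope separately, whence two
   terms on the right. *)
have tsum n : (\sum_(0 <= k < n) t k.+1 <= a n.+1 + a n)%R.
  elim: n => [|n IH]; first by rewrite big_geq// addr_ge0.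
  rewrite big_nat_recr//=; have := stepR n; move: IH; move: (\sum_(_ <= _ < _) _)%R => *; lra.
have tfin : \sum_(0 <= k <oo) (t k)%:E < +oo.
  rewrite nneseries_recl//; last by move=> k _; rewrite lee_fin.
  rewrite lte_add_pinfty ?ltry//.
  apply: (@le_lt_trans _ _ (hX + hX)%:E); last exact: ltry.
  rewrite -(@nneseries_addn _ (fun k => (t k)%:E) 1%N); last by move=> k; rewrite lee_fin.
  apply: lime_le; first by apply: is_cvg_nneseries => n _ _; rewrite lee_fin.
  apply: nearW => n; rewrite sumEFin lee_fin.
  under eq_bigr do rewrite addn1.
  by apply: le_trans (tsum n) _; apply: lerD.
have tail : \sum_(N <= k <oo) (t k)%:E @[N --> \oo] --> 0.
  by apply: nneseries_tail_cvg => // k _; rewrite lee_fin.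
apply/lee_addgt0Pr => e e0.
have [N HN] : exists N, \sum_(N <= k <oo) (t k)%:E <= e%:E.
  have /fine_cvgP[[N1 _ H1] /cvgrPdist_lt /(_ e e0)[N2 _ H2]] := tail.
  exists (maxn N1 N2).
  have := H2 _ (leq_maxr N1 N2); have := H1 _ (leq_maxl N1 N2) => /=.
  move: (\sum_(_ <= _ <oo) _) => z zf; rewrite sub0r normrN => ze.
  by rewrite -(fineK zf) lee_fin; apply: le_trans (ler_norm _) (ltW ze).
have XC : X `&` ~` C `<=` A N `|` \bigcup_k S (k + N)%N.
  move=> x [Xx nCx].
  have [n An] : exists n, A n x.
    have [r r0 Hr] := (open_rVP _).1 (closed_openC cC) x nCx.
    have [n Hn] : exists n : nat, (n.+1%:R^-1 < r)%R.
      exists (Num.truncn r^-1); rewrite invf_plt ?posrE//; apply: truncnS_gt.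
    exists n; split => // c Cc; rewrite leNgt; apply/negP => xc.
    apply: (Hr c) => //; apply: le_lt_trans (norm_le_enorm _) (lt_trans xc Hn).
  elim: n An => [|n IH] An; first by left; apply: Aincr An.
  have [/IH//|nAn] := pselect (A n x).
  have [nN|Nn] := leqP n.+1 N; first by left; apply: Aincr An.
  by right; exists (n - N)%N => //; rewrite subnK.
have HS : hausdorff s (X `&` ~` C) <= hausdorff s (A N) + e%:E.
  apply: le_trans (le_hausdorff s XC) _.
  apply: le_trans (outer_measureU2 (hausdorff s) _ _) _.
  apply: leeD => //; apply: le_trans HN.
  apply: le_trans (outer_measure_sigma_subadditive (hausdorff s) _) _.
  rewrite -(@nneseries_addn _ (fun k => (t k)%:E)); last by move=> k; rewrite lee_fin.
  by apply: lee_nneseries => [k _ _|k _]; [exact: hausdorff_ge0|rewrite -tE].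
apply: le_trans (leeD (lexx _) HS) _.
rewrite addeA; apply: leeD => //.
have r0 : (0 < N.+1%:R^-1 :> R)%R by rewrite invr_gt0 ltr0n.
rewrite addeC; apply: le_trans (hausdorff_separated s r0 _) (le_hausdorff s _).
  by move=> x c [_ H] [_ Cc]; exact: H.
by move=> x [[]|[]].
Qed.

Import HBNNSimple.

(** Chebyshev's inequality read off the integral as a supremum over simple functions, with c times
    the indicator of [K] as competitor; it is simple because closed sets are Caratheodory
    measurable. *)
Lemma hausdorff_chebyshev s D K (f : E -> R) (c : R) : closed K -> K `<=` D ->
  (forall x, 0 <= f x)%R -> (0 <= c)%R -> (forall x, K x -> c <= f x)%R ->
  c%:E * hausdorff s K <= \int[hausdorff_measure R d s]_(x in D) (f x)%:E.
Proof.
move=> cK KD f0 c0 cf.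
have mK : measurable (K : set (caratheodory_type (@hausdorff R d s))).
  exact: closed_hausdorff_measurable.
rewrite ge0_integralE; last by move=> x _; rewrite lee_fin.
apply: ereal_sup_ubound.
pose h := scale_nnsfun (indic_nnsfun R mK) c0.
exists h.
  move=> x; rewrite patchE; change ((c * \1_K x)%:E <= if x \in D then (f x)%:E else 0).
  rewrite indicE; case: (boolP (x \in D)) => [_|xD].
    case: (boolP (x \in K)) => xK; rewrite lee_fin ?mulr1 ?mulr0//; apply: cf; exact: set_mem xK.
  have -> : (x \in K) = false.
    by apply/negP => xK; move/negP: xD; apply; apply/mem_set/KD; exact: set_mem xK.
  by rewrite mulr0.
by rewrite /h sintegralrM; congr (_ * _); rewrite sintegral_indic.
Qed.

(** Each nonempty set of a nearly optimal cover is enlarged to an open ball, at a cost e / 2^(k+1)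
    that sums to less than e; compactness then leaves finitely many balls. *)
Lemma hausdorff_cover s K (e r : R) : compact K -> hausdorff s K < e%:E -> (0 < r)%R ->
  exists l : seq (E * R), [/\ (forall z, z \in l -> 0 < z.2 < r)%R,
    (forall x, K x -> exists2 z, z \in l & `|z.1 - x| < z.2)%R &
    (\sum_(z <- l) z.2 ^+ s < 2 * e)%R].
Proof.
move=> cK Ke r0.
have e0 : (0 < e)%R by rewrite -lte_fin; apply: le_lt_trans Ke; exact: hausdorff_ge0.
have [x [G [Gr KG] <-{x}] Ge] : exists2 x, [set \sum_(k <oo) hausdorff_gauge s (F k) | F in
    [set F : (set E)^nat |
      (forall k, diam (F k) <= (r / 2)%:E) /\ K `<=` \bigcup_k F k]] x & x < e%:E.
  apply: ereal_inf_lt; apply: le_lt_trans Ke.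
  by apply: ereal_sup_ubound; exists (r / 2)%R => //=; rewrite divr_gt0.
have [b Hb] : {b : nat -> E * R & forall k, G k !=set0 -> [/\ (0 < (b k).2 < r)%R,
    G k `<=` [set x | `|(b k).1 - x| < (b k).2]%R &
    ((b k).2 ^+ s)%:E <= hausdorff_gauge s (G k) + (e / 2 ^+ k.+1)%:E]}.
  apply: (@choice _ _ (fun k (z : E * R) => G k !=set0 -> [/\ (0 < z.2 < r)%R,
    G k `<=` [set x | `|z.1 - x| < z.2]%R &
    (z.2 ^+ s)%:E <= hausdorff_gauge s (G k) + (e / 2 ^+ k.+1)%:E])) => k.
  have [[a Ga]|G0] := pselect (G k !=set0); last by exists (0%R, 0%R) => /G0.
  have D0 : 0 <= diam (G k) by apply: le_trans (enorm_le_diam Ga Ga); rewrite lee_fin enorm_ge0.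
  have Dr := Gr k.
  have Df : diam (G k) \is a fin_num.
    by rewrite ge0_fin_numE//; apply: le_lt_trans Dr _; exact: ltry.
  pose D := fine (diam (G k)).
  have DE : diam (G k) = D%:E by rewrite fineK.
  rewrite DE !lee_fin in D0 Dr.
  have e1 : (0 < e / 2 ^+ k.+1)%R by rewrite divr_gt0// exprn_gt0.
  have /cvgrPdist_lt/(_ _ e1)/nbhs_ballP[t0 /= t00 Ht] := @exprn_continuous R s D.
  (* A radius slightly above the diameter D suffices for a ball centred in the set; t0 comes from
     continuity of the s-th power at D, and D <= r / 2 leaves room below r. *)
  pose t := (D + Num.min t0 (r / 2) / 2)%R.
  have m0 : (0 < Num.min t0 (r / 2))%R by rewrite lt_min t00 divr_gt0.
  have mr : (Num.min t0 (r / 2) <= r / 2)%R by rewrite ge_min lexx orbT.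
  have mt : (Num.min t0 (r / 2) <= t0)%R by rewrite ge_min lexx.
  exists (a, t) => _; split => /=.
  - by rewrite /t; apply/andP; split; lra.
  - move=> x Gx /=; apply: le_lt_trans (norm_le_enorm _) _.
    have := enorm_le_diam Ga Gx; rewrite DE lee_fin /t => h; lra.
  rewrite /hausdorff_gauge; case: eqP => [G0|_]; first by move: Ga; rewrite G0.
  rewrite DE -EFin_expe -EFinD lee_fin -lerBlDl; apply: le_trans (ler_norm _) _.
  rewrite distrC; apply/ltW/Ht; rewrite /ball/= /t opprD addrA subrr sub0r normrN gtr0_norm; lra.
have cov : K `<=` \bigcup_(k in [set k | G k !=set0]) [set x | `|(b k).1 - x| < (b k).2]%R.
  move=> x Kx; have [k _ Gx] := KG x Kx.
  have Gk : G k !=set0 by exists x.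
  by exists k => //; have [_ + _] := Hb k Gk; exact.
have := cK; rewrite compact_cover => /(_ _ _ _ _ cov)[|D' D'G KD'].
  by move=> k Gk; exact: open_ball_rV.
pose N := (\max_(i <- finmap.enum_fset D') i).+1.
pose l := [seq b k | k <- iota 0 N & `[< G k !=set0 >]].
have lP z : z \in l -> exists2 k, G k !=set0 & z = b k.
  by move=> /mapP[k]; rewrite mem_filter => /andP[/asboolP Gk _] ->; exists k.
exists l; split.
- by move=> z /lP[k Gk ->]; have [] := Hb k Gk.
- move=> x Kx; have [k kD' xk] := KD' x Kx; exists (b k) => //.
  have := D'G _ kD'; rewrite inE => Gk.
  apply/mapP; exists k => //; rewrite mem_filter mem_iota /= add0n ltnS; apply/andP; split.
    exact/asboolP.
  by apply: leq_bigmax_seq.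
rewrite big_map big_filter.
have half n : (\sum_(0 <= k < n) e / 2 ^+ k.+1 = e * (1 - 2^-1 ^+ n))%R.
  elim: n => [|n IH]; first by rewrite big_geq// expr0 subrr mulr0.
  rewrite big_nat_recr//= IH !exprS invfM -exprVn; move: (2^-1 ^+ n)%R => q; by field.
rewrite -lte_fin -sumEFin.
apply: (@le_lt_trans _ _ (\sum_(k <oo) hausdorff_gauge s (G k) + e%:E)); last first.
  by rewrite mulrDl mul1r EFinD lteD2rE.
apply: (@le_trans _ _ (\sum_(0 <= k < N) (hausdorff_gauge s (G k) + (e / 2 ^+ k.+1)%:E))).
  rewrite big_mkcond /index_iota subn0; apply: lee_sum => k _.
  case: asboolP => [Gk|_]; first by have [] := Hb k Gk.
  rewrite adde_ge0 ?hausdorff_gauge_ge0// lee_fin divr_ge0 ?exprn_ge0//; exact: ltW.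
rewrite big_split/=; apply: leeD.
  by apply: nneseries_lim_ge => k _ _; exact: hausdorff_gauge_ge0.
rewrite sumEFin half lee_fin ger_pMr// gerBl exprn_ge0//.
Qed.

End hausdorff_borel.

(** * Boundary values of functions with a given trace *)

Section plateau.
Variable R : realType.
Implicit Types s t : R.

(** A C^1 step from 0 at t <= 0 to 1 at t >= 2. Its derivative [dstep] is the tent on [0, 2] with
    peak 1. *)
Definition step t : R := ramp_int t - ramp_int (t - 1).
Definition dstep t : R := ramp t - ramp (t - 1).

Lemma step_derive t : is_derive t 1 step (dstep t).
Proof.
apply: is_deriveB; first exact: ramp_int_derive.
have H : is_derive t 1 (fun s : R => s - 1) 1.
  by apply: is_derive_eq; rewrite subr0.
by have := @is_derive1_comp _ _ _ t _ _ (ramp_int_derive (t - 1)) H; rewrite mulr1.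
Qed.

Lemma dstep_continuous : continuous dstep.
Proof.
move=> t; apply: continuousB; first exact: ramp_continuous.
apply: (@continuous_comp _ _ _ (fun s : R => s - 1) (@ramp R)); last exact: ramp_continuous.
by apply: continuousB => //; exact: cst_continuous.
Qed.

Lemma step0 t : t <= 0 -> step t = 0.
Proof. by move=> t0; rewrite /step !ramp_int_eq0 ?subr0//; lra. Qed.

Lemma step1 t : 2 <= t -> step t = 1.
Proof. by move=> t2; rewrite /step /ramp_int !max_l; try lra; field. Qed.

Lemma step01 t : 0 <= step t <= 1.
Proof.
rewrite /step subr_ge0 ramp_int_nondecreasing; last lra.
by have := ramp_int_lip t (t - 1); rewrite (_ : t - (t - 1) = 1) ?normr1 => [/ler_normlW|]; last ring.
Qed.

Lemma dstep0 t : t <= 0 \/ 2 <= t -> dstep t = 0.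
Proof.
move=> [t0|t2]; first by rewrite /dstep !ramp_eq0 ?subrr//; lra.
by rewrite /dstep /ramp !max_l; try lra.
Qed.

Lemma dstep01 t : 0 <= dstep t <= 1.
Proof.
rewrite /dstep /ramp.
by case: (leP t 0) => ?; case: (leP (t - 1) 0) => ?; case: (leP (t - 1 - 1) 0) => ?; lra.
Qed.

Lemma dstep_gt0 t : 2^-1 <= t <= 3 / 2 -> 2^-1 <= dstep t.
Proof.
move=> H; rewrite /dstep /ramp.
by case: (leP t 0) => ?; case: (leP (t - 1) 0) => ?; case: (leP (t - 1 - 1) 0) => ?; lra.
Qed.

(** An even C^1 function, 1 on [-1, 1] and 0 outside [-2, 2]. The explicit derivative gives the
    bound 2, its signs, and the lower bound 1 around -3/2, from which the constants of the boundary
    layer come. *)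
Definition plateau s : R := step (4 - 2 * s) * step (4 + 2 * s).
Definition dplateau s : R :=
  2 * (step (4 - 2 * s) * dstep (4 + 2 * s) - dstep (4 - 2 * s) * step (4 + 2 * s)).

Lemma plateau_derive s : is_derive s 1 plateau (dplateau s).
Proof.
have H1 : is_derive s 1 (fun t : R => 4 - 2 * t) (- 2).
  apply: (@is_derive_quadratic _ _ _ _ 0) => h _.
  by rewrite [X in `|X|](_ : _ = 0) ?normr0 ?mul0r//; ring.
have H2 : is_derive s 1 (fun t : R => 4 + 2 * t) 2.
  apply: (@is_derive_quadratic _ _ _ _ 0) => h _.
  by rewrite [X in `|X|](_ : _ = 0) ?normr0 ?mul0r//; ring.
have D1 := @is_derive1_comp _ _ _ s _ _ (step_derive (4 - 2 * s)) H1.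
have D2 := @is_derive1_comp _ _ _ s _ _ (step_derive (4 + 2 * s)) H2.
apply: is_derive_eq; rewrite /dplateau -![_ *: _]/(_ * _)/=; ring.
Qed.

Lemma dplateau_continuous : continuous dplateau.
Proof.
move=> s; have cs : continuous step by move=> t; exact: is_derive_continuous1 (step_derive t).
have c1 : {for s, continuous (fun t : R => 4 - 2 * t)}.
  by apply: continuousB; [exact: cst_continuous|apply: continuousM => //; exact: cst_continuous].
have c2 : {for s, continuous (fun t : R => 4 + 2 * t)}.
  by apply: continuousD; [exact: cst_continuous|apply: continuousM => //; exact: cst_continuous].
have c3 := @continuous_comp _ _ _ _ _ s c1 (cs _).
have c4 := @continuous_comp _ _ _ _ _ s c2 (@dstep_continuous _).
have c5 := @continuous_comp _ _ _ _ _ s c1 (@dstep_continuous _).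
have c6 := @continuous_comp _ _ _ _ _ s c2 (cs _).
have c7 := continuousB (continuousM c3 c4) (continuousM c5 c6).
have c8 := continuousM (@cst_continuous R R 2 s) c7.
exact: c8.
Qed.

Lemma plateau01 s : 0 <= plateau s <= 1.
Proof.
have /andP[a0 a1] := step01 (4 - 2 * s); have /andP[b0 b1] := step01 (4 + 2 * s).
by rewrite mulr_ge0//= mulr_ile1.
Qed.

Lemma plateau1 s : `|s| <= 1 -> plateau s = 1.
Proof. by rewrite ler_norml => /andP[h1 h2]; rewrite /plateau !step1 ?mulr1//; lra. Qed.

Lemma plateau0 s : 2 <= `|s| -> plateau s = 0.
Proof.
rewrite /plateau; case: (ger0P s) => s0 h; first by rewrite (@step0 (4 - _)) ?mul0r//; lra.
by rewrite (@step0 (4 + _)) ?mulr0//; lra.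
Qed.

Lemma dplateau_neg s : s <= 0 -> dplateau s = 2 * dstep (4 + 2 * s).
Proof.
move=> s0; rewrite /dplateau step1; last lra.
by rewrite (@dstep0 (4 - _)); [rewrite mul0r subr0 mul1r|right; lra].
Qed.

Lemma dplateau_pos s : 0 <= s -> dplateau s = - (2 * dstep (4 - 2 * s)).
Proof.
move=> s0; rewrite /dplateau (@step1 (4 + _)); last lra.
by rewrite (@dstep0 (4 + _)); [rewrite mulr0 sub0r mulr1 mulrN|right; lra].
Qed.

Lemma dplateau_le s : `|dplateau s| <= 2.
Proof.
have [s0|s0] := leP s 0.
  rewrite dplateau_neg//; case/andP: (dstep01 (4 + 2 * s)); move: (dstep _) => q a b.
  by rewrite ger0_norm; lra.
rewrite (dplateau_pos (ltW s0)) normrN; case/andP: (dstep01 (4 - 2 * s)); move: (dstep _) => q a b.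
by rewrite ger0_norm; lra.
Qed.

Lemma dplateau0 s : `|s| <= 1 -> dplateau s = 0.
Proof.
rewrite ler_norml => /andP[h1 h2]; rewrite /dplateau !dstep0; [|by right; lra..].
by rewrite mulr0 mul0r subr0 mulr0.
Qed.

Lemma dplateauN s : dplateau (- s) = - dplateau s.
Proof.
rewrite /dplateau mulrN opprK.
move: (step _) (step _) (dstep _) (dstep _) => *; ring.
Qed.

Lemma dplateau_gt0 s : -(7 / 4) <= s <= -(5 / 4) -> 1 <= dplateau s.
Proof.
move=> H; rewrite dplateau_neg; last lra.
by have := @dstep_gt0 (4 + 2 * s) ltac:(lra); lra.
Qed.

Lemma dplateau_ge0 s : s <= 0 -> 0 <= dplateau s.
Proof. by move=> s0; rewrite dplateau_neg// mulr_ge0//; have /andP[] := dstep01 (4 + 2 * s). Qed.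

End plateau.

(** * C^1 cutoffs on boxes *)

Section C1_cutoffs.
Variables (R : realType) (d : nat).
Local Notation E := 'rV[R]_d.
Local Notation e_ i := (delta_mx ord0 i : E).
Implicit Types (f g : E -> R) (U W K : set E).

Definition C1on (i : 'I_d) U f := forall x, U x ->
  [/\ {for x, continuous f}, derivable f x (e_ i) & {for x, continuous (partial i f)}].

Lemma C1onT i f : C1on i setT f <-> C1dir i f.
Proof.
split=> [H|[cf df cdf] x _]; last by split; [exact: cf|exact: df|exact: cdf].
by split => x; have [] := H x I.
Qed.

Lemma eq_continuous_at U f g x : open U -> U x -> (forall y, U y -> f y = g y) ->
  {for x, continuous f} -> {for x, continuous g}.
Proof.
move=> oU Ux fg /continuous_rVP cf; apply/continuous_rVP => e e0.
have [r r0 Hr] := cf e e0; have [t t0 Ht] := (open_rVP U).1 oU x Ux.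
exists (Num.min r t); first by rewrite lt_min r0.
by move=> y; rewrite lt_min => /andP[xr xt]; rewrite -!fg//; [exact: Hr|exact: Ht].
Qed.

Lemma eq_C1on i U f g : open U -> (forall x, U x -> f x = g x) -> C1on i U f -> C1on i U g.
Proof.
move=> oU fg H x Ux; have [cf df cdf] := H x Ux; split.
- exact: (eq_continuous_at oU Ux fg).
- exact: (eq_derivable oU fg).
- by apply: (eq_continuous_at oU Ux _ cdf) => y Uy; exact: (eq_partial i oU fg).
Qed.

Lemma C1onM i U f g : open U -> C1on i U f -> C1on i U g -> C1on i U (fun x => f x * g x).
Proof.
move=> oU Hf Hg x Ux; have [cf df cdf] := Hf x Ux; have [cg dg cdg] := Hg x Ux; split.
- exact: continuousM.
- by have [] := partialM df dg.
- apply: (@eq_continuous_at U (fun x => f x * partial i g x + g x * partial i f x)) => //.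
    move=> y Uy; have [_ dfy _] := Hf y Uy; have [_ dgy _] := Hg y Uy.
    by have [_ ->] := partialM dfy dgy.
  exact: (continuousD (continuousM cf cdg) (continuousM cg cdf)).
Qed.

Lemma C1on_comp i U f (th dth : R -> R) : open U -> C1on i U f ->
  (forall s : R, is_derive s 1 th (dth s)) -> continuous dth ->
  C1on i U (fun x => th (f x)) /\
  forall x, U x -> partial i (fun x => th (f x)) x = dth (f x) * partial i f x.
Proof.
move=> oU Hf Dth cdth.
have PD x : U x -> derivable (fun x => th (f x)) x (e_ i) /\
    partial i (fun x => th (f x)) x = dth (f x) * partial i f x.
  by move=> Ux; have [_ df _] := Hf x Ux; exact: partial_comp.
split=> [x Ux|x /PD[]//]; have [cf df cdf] := Hf x Ux; split.
- by apply: (continuous_comp cf); exact: is_derive_continuous1 (Dth _).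
- by have [] := PD x Ux.
- apply: (@eq_continuous_at U (fun x => dth (f x) * partial i f x)) => //.
    by move=> y /PD[_ ->].
  by apply: continuousM => //; apply: (continuous_comp cf); exact: cdth.
Qed.

Lemma C1on_cst i U (c : R) : open U -> C1on i U (fun=> c).
Proof.
move=> oU x Ux; split; [exact: cst_continuous|exact: derivable_cst|].
rewrite (_ : partial i _ = fun=> 0); first exact: cst_continuous.
by apply/funext => y; rewrite /partial derive_cst.
Qed.

(* The product with a cutoff vanishing off [K] is [C1] across the whole space. *)
Lemma C1on_cut i U K f chi : open U -> closed K -> K `<=` U -> C1on i setT chi ->
  (forall x, ~ K x -> chi x = 0) -> C1on i U f -> C1on i setT (fun x => chi x * f x).
Proof.
move=> oU cK KU Hchi chi0 Hf x _.
have [Ux|nUx] := pselect (U x).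
  by apply: (C1onM oU _ Hf Ux) => y _; exact: Hchi.
have nKx : ~ K x by move=> /KU.
have oC := closed_openC cK.
apply: (@eq_C1on i (~` K) (fun=> 0)) => // [y nKy|]; first by rewrite chi0// mul0r.
exact: C1on_cst.
Qed.

Definition box_cut (c r : E) (x : E) : R :=
  \prod_(l < d) plateau ((x ord0 l - c ord0 l) / r ord0 l).

Variables (c r : E).
Hypothesis r0 : forall l, 0 < r ord0 l.

Lemma box_cut01 (x : E) : 0 <= box_cut c r x <= 1.
Proof.
apply: (big_ind (fun z : R => 0 <= z <= 1)) => [|u v /andP[u0 u1] /andP[v0 v1]|l _].
- by rewrite ler01 lexx.
- by rewrite mulr_ge0//= mulr_ile1.
- exact: plateau01.
Qed.

Lemma box_cut1 (x : E) : (forall l, `|x ord0 l - c ord0 l| <= r ord0 l) -> box_cut c r x = 1.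
Proof.
move=> H; rewrite /box_cut big1// => l _; apply: plateau1.
by rewrite normrM normfV (gtr0_norm (r0 l)) ler_pdivrMr// mul1r.
Qed.

Lemma box_cut0 (x : E) l : 2 * r ord0 l <= `|x ord0 l - c ord0 l| -> box_cut c r x = 0.
Proof.
move=> H; rewrite /box_cut (bigD1 l)//= plateau0 ?mul0r//.
by rewrite normrM normfV (gtr0_norm (r0 l)) ler_pdivlMr.
Qed.

(** The factors of [box_cut] that do not depend on the i-th coordinate, so that the derivative along
    e_i falls on one plateau only. *)
Definition box_rest (i : 'I_d) (x : E) : R :=
  \prod_(l < d | l != i) plateau ((x ord0 l - c ord0 l) / r ord0 l).

Lemma box_rest01 i (x : E) : 0 <= box_rest i x <= 1.
Proof.
apply: (big_ind (fun z : R => 0 <= z <= 1)) => [|u v /andP[u0 u1] /andP[v0 v1]|l _].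
- by rewrite ler01 lexx.
- by rewrite mulr_ge0//= mulr_ile1.
- exact: plateau01.
Qed.

Lemma box_rest1 i (x : E) : (forall l, l != i -> `|x ord0 l - c ord0 l| <= r ord0 l) -> box_rest i x = 1.
Proof.
move=> H; rewrite /box_rest big1// => l li; apply: plateau1.
by rewrite normrM normfV (gtr0_norm (r0 l)) ler_pdivrMr// mul1r H.
Qed.

Lemma box_rest0 i (x : E) l : l != i -> 2 * r ord0 l <= `|x ord0 l - c ord0 l| -> box_rest i x = 0.
Proof.
move=> li H; rewrite /box_rest (bigD1 l)//= plateau0 ?mul0r//.
by rewrite normrM normfV (gtr0_norm (r0 l)) ler_pdivlMr.
Qed.

Lemma C1on_affine i l : C1on i setT (fun x : E => (x ord0 l - c ord0 l) / r ord0 l) /\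
  forall x, partial i (fun x : E => (x ord0 l - c ord0 l) / r ord0 l) x = (l == i)%:R / r ord0 l.
Proof.
have D x : is_derive x (e_ i) (fun x : E => (x ord0 l - c ord0 l) / r ord0 l) ((l == i)%:R / r ord0 l).
  have := @is_derive_coord R d l i c x => Dc.
  by apply: is_derive_eq; rewrite scaler0 add0r -[_ *: _]/(_ * _) mulrC.
have PE x : partial i (fun x : E => (x ord0 l - c ord0 l) / r ord0 l) x = (l == i)%:R / r ord0 l.
  by have [_ <-] := D x.
split => // x _; split.
- apply: continuousM; last exact: cst_continuous.
  by apply: continuousB; [exact: coord_continuous|exact: cst_continuous].
- by have [] := D x.
- rewrite (_ : partial i _ = fun=> (l == i)%:R / r ord0 l); first exact: cst_continuous.
  exact/funext.
Qed.

Lemma C1on_plateau i l :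
  C1on i setT (fun x : E => plateau ((x ord0 l - c ord0 l) / r ord0 l)) /\
  forall x : E, partial i (fun x : E => plateau ((x ord0 l - c ord0 l) / r ord0 l)) x =
    dplateau ((x ord0 l - c ord0 l) / r ord0 l) * ((l == i)%:R / r ord0 l).
Proof.
have [Ca Pa] := C1on_affine i l.
have [H1 H2] := C1on_comp openT Ca (@plateau_derive R) (@dplateau_continuous R).
by split => // x; rewrite H2// Pa.
Qed.

Lemma C1on_box_rest i : C1on i setT (box_rest i) /\ forall x : E, partial i (box_rest i) x = 0.
Proof.
rewrite /box_rest; elim: (index_enum _) => [|l s [IH1 IH2]].
  under eq_fun do rewrite big_nil.
  by split; [exact: C1on_cst openT|move=> x; rewrite /partial derive_cst].
rewrite (_ : (fun x : E => \prod_(j <- l :: s | j != i) plateau ((x ord0 j - c ord0 j) / r ord0 j)) =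
  if l != i then (fun x : E => plateau ((x ord0 l - c ord0 l) / r ord0 l) *
    \prod_(j <- s | j != i) plateau ((x ord0 j - c ord0 j) / r ord0 j))
  else (fun x : E => \prod_(j <- s | j != i) plateau ((x ord0 j - c ord0 j) / r ord0 j))); last first.
  by apply/funext => x; rewrite big_cons; case: ifP.
case: ifP => li; last by split.
have [C1 P1] := C1on_plateau i l.
split; first exact: (C1onM openT C1 IH1).
move=> x; have [_ d1 _] := C1 x I; have [_ d2 _] := IH1 x I.
by have [_ ->] := partialM d1 d2; rewrite IH2 P1 (negbTE li) mul0r !mulr0 addr0.
Qed.

Lemma C1on_box_cut i : C1on i setT (box_cut c r) /\ forall x : E, partial i (box_cut c r) x =
  dplateau ((x ord0 i - c ord0 i) / r ord0 i) / r ord0 i * box_rest i x.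
Proof.
have E1 : box_cut c r = fun x => plateau ((x ord0 i - c ord0 i) / r ord0 i) * box_rest i x.
  by apply/funext => x; rewrite /box_cut (bigD1 i).
have [C1 P1] := C1on_plateau i i; have [C2 P2] := C1on_box_rest i.
rewrite E1; split; first exact: (C1onM openT C1 C2).
move=> x; have [_ d1 _] := C1 x I; have [_ d2 _] := C2 x I.
have [_ ->] := partialM d1 d2; rewrite P2 P1 eqxx mulr0 add0r mul1r; exact: mulrC.
Qed.

End C1_cutoffs.

(** * Boxes around boundary points *)

Section boundary_layer.
Variables (R : realType) (d : nat).
Local Notation E := 'rV[R]_d.
Local Notation mu := (lebesgue_rV R d).
Local Notation e_ i := (delta_mx ord0 i : E).
Implicit Types (Omega U K S : set E) (rho chi : E -> R).

Lemma line_coord (x : E) i (t : R) l : (x + t *: e_ i) ord0 l = x ord0 l + t * (l == i)%:R.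
Proof. by rewrite !mxE eqxx. Qed.

Lemma segment_ball (y x : E) i (t s r : R) : 0 <= s <= t -> `|y - x| < r ->
  `|y - (x + t *: e_ i)| < r -> `|y - (x + s *: e_ i)| < r.
Proof.
move=> /andP[s0 st] h1 h2; have r0 : 0 < r by exact: le_lt_trans h1.
apply/norm_rV_lt => // l; move/norm_rV_lt: h1 => /(_ r0 l); move/norm_rV_lt: h2 => /(_ r0 l).
rewrite !mxE eqxx /=; case: (l == i); last by rewrite !mulr0.
by rewrite !mulr1 !ltr_norml => /andP[h1 h2] /andP[h3 h4]; apply/andP; split; lra.
Qed.

Lemma partial_pos_increasing rho (y : E) i (sg r : R) :
  (forall x, `|y - x| < r -> derivable rho x (e_ i) /\ 0 < sg * partial i rho x) ->
  forall x (t : R), 0 < t -> `|y - x| < r -> `|y - (x + t *: e_ i)| < r ->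
  sg * rho x < sg * rho (x + t *: e_ i).
Proof.
move=> H x t t0 h1 h2.
have [|s s01 Hs] := @directional_MVT R d rho x (e_ i) t (partial i rho) t0.
  by move=> s s01; apply/derivableP; have [] := H _ (segment_ball s01 h1 h2).
have s01' : 0 <= s <= t by case/andP: s01 => /ltW -> /ltW ->.
have [_ P] := H _ (segment_ball s01' h1 h2).
rewrite -subr_gt0 -mulrBr Hs mulrCA mulr_gt0//.
Qed.

(** A box of half-width 2 b across e_i and 2 a along it, in which rho is monotone along e_i with
    sign sg. By the last two clauses the boundary stays away from both ends of the box: at distance
    a to 2 a, rho is at least q on one side and at most -q on the other. *)
Definition boundary_chart Omega (y : E) U rho i (sg a b q : R) :=
  [/\ [/\ open U, Omega `&` U = [set x | rho x < 0] `&` U & C1on i U rho],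
      [/\ sg = 1 \/ sg = -1, 0 < a, 0 < b & 0 < q],
      (forall x, `|y - x| < 4 * a -> U x /\ 0 < sg * partial i rho x),
      (forall x : E, (forall l, l != i -> `|x ord0 l - y ord0 l| < 2 * b) ->
        a <= sg * (x ord0 i - y ord0 i) <= 2 * a -> q <= rho x) &
      (forall x : E, (forall l, l != i -> `|x ord0 l - y ord0 l| < 2 * b) ->
        a <= sg * (y ord0 i - x ord0 i) <= 2 * a -> rho x <= - q)].

Lemma box_norm_lt (x y : E) i (a b : R) : 0 < a -> 2 * b <= a ->
  (forall l, l != i -> `|x ord0 l - y ord0 l| < 2 * b) ->
  `|x ord0 i - y ord0 i| <= 2 * a -> `|y - x| < 4 * a.
Proof.
move=> a0 ba Hl Hi; apply/norm_rV_lt; first by rewrite mulr_gt0.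
move=> l; rewrite !mxE distrC; have [->|li] := eqVneq l i.
  by apply: le_lt_trans Hi _; rewrite ltr_pM2r// ltr_nat.
apply: lt_le_trans (Hl l li) _; apply: le_trans ba _.
by rewrite ler_peMl ?ler1n// ltW.
Qed.

(* [x] is moved along [e_i] to the face of the box through [y + s *: e_i]. *)
Lemma box_face rho (x y : E) i (sg a b q s tp : R) : 0 < a -> 0 < b -> 2 * b <= a -> 2 * b <= tp ->
  `|s| = a ->
  (forall z (t : R), 0 < t -> `|y - z| < 4 * a -> `|y - (z + t *: e_ i)| < 4 * a ->
    sg * rho z < sg * rho (z + t *: e_ i)) ->
  (forall z, `|y + s *: e_ i - z| < tp -> `|sg * rho (y + s *: e_ i) - sg * rho z| < q) ->
  (forall l, l != i -> `|x ord0 l - y ord0 l| < 2 * b) -> `|x ord0 i - y ord0 i| <= 2 * a ->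
  (y ord0 i + s <= x ord0 i -> sg * rho (y + s *: e_ i) - q < sg * rho x) /\
  (x ord0 i <= y ord0 i + s -> sg * rho x < sg * rho (y + s *: e_ i) + q).
Proof.
move=> a0 b0 ba btp sa mono Hq Hl Hi.
pose t := x ord0 i - (y ord0 i + s); pose z := x - t *: e_ i.
have zc l : z ord0 l = if l == i then y ord0 i + s else x ord0 l.
  rewrite /z -scaleNr line_coord; case: eqP => [->|_]; last by rewrite mulr0 addr0.
  by rewrite mulr1 /t; ring.
have zx : z + t *: e_ i = x by rewrite /z subrK.
have xz : x + (- t) *: e_ i = z by rewrite scaleNr.
have Bx : `|y - x| < 4 * a by exact: (box_norm_lt a0 ba Hl Hi).
have Bz : `|y - z| < 4 * a.
  apply: (box_norm_lt a0 ba (i := i)) => [l li|]; first by rewrite zc (negbTE li) Hl.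
  by rewrite zc eqxx addrAC subrr add0r sa ler_peMl ?ler1n// ltW.
have := Hq z; rewrite ltr_distlC => /(_ _)/andP[].
  apply: lt_le_trans btp; apply/norm_rV_lt; first by rewrite mulr_gt0.
  move=> l; have -> : (y + s *: e_ i - z) ord0 l = (y + s *: e_ i) ord0 l - z ord0 l by rewrite !mxE.
  rewrite zc line_coord; case: eqP => [->|/eqP li].
    by rewrite mulr1 subrr normr0 mulr_gt0.
  by rewrite mulr0 addr0 distrC Hl.
move=> q1 q2; split=> xs.
  apply: lt_le_trans q1 _; have [t0|t0] := eqVneq t 0; first by rewrite -zx t0 scale0r addr0.
  have tp0 : 0 < t by rewrite lt_neqAle eq_sym t0 subr_ge0.
  by have := mono z t tp0 Bz; rewrite zx => /(_ Bx)/ltW.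
apply: le_lt_trans q2; have [t0|t0] := eqVneq t 0; first by rewrite -zx t0 scale0r addr0.
have tp0 : 0 < - t by rewrite oppr_gt0 lt_neqAle t0 subr_le0.
by have := mono x (- t) tp0 Bx; rewrite xz => /(_ Bz)/ltW.
Qed.

(** A nonzero partial derivative keeps its sign near y. As rho vanishes at y, it has opposite signs
    at y + a e_i and y - a e_i; continuity spreads these signs across the two cross-sections and
    monotonicity along e_i to the ends of the box. *)
Lemma boundary_chart_exists Omega (y : E) (r : R) : open Omega -> smooth_boundary Omega ->
  boundary Omega y -> 0 < r ->
  exists U rho i sg a b q, [/\ boundary_chart Omega y U rho i sg a b q, b <= a & 4 * a <= r].
Proof.
move=> oO /(_ y) sb by_ r0; have [U [rho [oU Uy srho [i nz] OU]]] := sb by_.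
have C1 : C1on i U rho by move=> x Ux; exact: (Ck1_pointwise _ oU (srho 1%N) Ux).
(* A positive value would keep points of [Omega] away from y, and a negative one would put y into
   the open set [Omega]. *)
have ry : rho y = 0.
  apply/eqP; rewrite eq_le; apply/andP; split; rewrite leNgt; apply/negP => ry.
    have [cr _ _] := C1 y Uy; have [t t0 Ht] := (continuous_rVP _ _).1 cr _ ry.
    have [t' t'0 Ht'] := (open_rVP U).1 oU y Uy.
    have m0 : 0 < Num.min t t' by rewrite lt_min t0.
    have [z Oz] := (closure_rVP _ _).1 by_.1 _ m0.
    rewrite lt_min => /andP[yz yz'].
    have [rz _] : ([set x | rho x < 0] `&` U) z by rewrite -OU; split => //; exact: Ht'.
    by have := Ht z yz; rewrite ltr_distlC subrr => /andP[+ _]; rewrite ltNge (ltW rz).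
  have [Oy _] : (Omega `&` U) y by rewrite OU.
  exact: (boundary_open_notin oO by_).
pose sg := Num.sg (partial i rho y).
have sgE : sg = 1 \/ sg = -1.
  by rewrite /sg; have [h|h|h] := ltrgt0P (partial i rho y);
    [left; rewrite gtr0_sg|right; rewrite ltr0_sg|rewrite h eqxx in nz].
have sg0 : 0 < sg * partial i rho y by rewrite /sg -normrEsg normr_gt0.
have [R1 R10 HR1] : exists2 R1 : R, 0 < R1 & forall x, `|y - x| < R1 ->
    U x /\ 0 < sg * partial i rho x.
  have [_ _ cp] := C1 y Uy.
  have cs : {for y, continuous (fun x => sg * partial i rho x)}.
    by apply: continuousM => //; exact: cst_continuous.
  have [t t0 Ht] := (continuous_rVP _ _).1 cs _ sg0.
  have [t' t'0 Ht'] := (open_rVP U).1 oU y Uy.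
  exists (Num.min t t'); first by rewrite lt_min t0.
  move=> x; rewrite lt_min => /andP[xt xt']; split; first exact: Ht'.
  by have := Ht x xt; rewrite ltr_distlC subrr => /andP[].
pose a := Num.min R1 r / 4.
have a0 : 0 < a by rewrite divr_gt0// lt_min R10.
have a4 : 4 * a <= R1 by rewrite /a mulrC divfK// ge_min lexx.
have a4r : 4 * a <= r by rewrite /a mulrC divfK// ge_min lexx orbT.
clearbody a sg.
have H4 x : `|y - x| < 4 * a -> U x /\ 0 < sg * partial i rho x.
  by move=> h; apply: HR1; exact: lt_le_trans a4.
have H4d x : `|y - x| < 4 * a -> derivable rho x (e_ i) /\ 0 < sg * partial i rho x.
  by move=> /H4[Ux P]; split => //; have [] := C1 x Ux.
have mono := @partial_pos_increasing rho y i sg (4 * a) H4d.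
have yy : `|y - y| < 4 * a by rewrite subrr normr0 mulr_gt0.
pose yp := y + a *: e_ i; pose ym := y + (- a) *: e_ i.
have ypa : `|y - yp| < 4 * a.
  rewrite /yp opprD addrA subrr sub0r normrN; apply: le_lt_trans (norm_delta_le i a) _.
  by rewrite gtr0_norm// ltr_pMl// ltr1n.
have yma : `|y - ym| < 4 * a.
  rewrite /ym opprD addrA subrr sub0r normrN; apply: le_lt_trans (norm_delta_le i _) _.
  by rewrite normrN gtr0_norm// ltr_pMl// ltr1n.
have ymE : ym + a *: e_ i = y by rewrite /ym scaleNr subrK.
have pos : 0 < sg * rho yp by have := mono y a a0 yy ypa; rewrite ry mulr0.
have neg : sg * rho ym < 0.
  by have := mono ym a a0 yma; rewrite ymE => /(_ yy); rewrite ry mulr0.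
(* The values at the two points are at least 2 q in absolute value; one q is spent on the variation
   of rho across the section. *)
pose q := Num.min (sg * rho yp) (- (sg * rho ym)) / 2.
have q0 : 0 < q by rewrite divr_gt0// lt_min pos oppr_gt0.
have qp : 2 * q <= sg * rho yp by rewrite /q mulrC divfK// ge_min lexx.
have qm : 2 * q <= - (sg * rho ym) by rewrite /q mulrC divfK// ge_min lexx orbT.
clearbody q.
have cs x : U x -> {for x, continuous (fun x => sg * rho x)}.
  move=> Ux; have [cr _ _] := C1 x Ux.
  by apply: continuousM => //; exact: cst_continuous.
have [tp tp0 Htp] := (continuous_rVP _ _).1 (cs yp (H4 _ ypa).1) _ q0.
have [tm tm0 Htm] := (continuous_rVP _ _).1 (cs ym (H4 _ yma).1) _ q0.
pose b := Num.min (Num.min tp tm) a / 2.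
have b0 : 0 < b by rewrite divr_gt0// !lt_min tp0 tm0.
have btp : 2 * b <= tp by rewrite /b mulrC divfK// !ge_min lexx.
have btm : 2 * b <= tm by rewrite /b mulrC divfK// !ge_min lexx orbT.
have ba2 : 2 * b <= a by rewrite /b mulrC divfK// !ge_min lexx orbT.
clearbody b.
have sa : `|a| = a by rewrite gtr0_norm.
have sma : `|- a| = a by rewrite normrN.
have Fp (x : E) : (forall l, l != i -> `|x ord0 l - y ord0 l| < 2 * b) ->
    a <= x ord0 i - y ord0 i <= 2 * a -> q <= sg * rho x.
  move=> Hl /andP[Hi1 Hi2].
  have Hi : `|x ord0 i - y ord0 i| <= 2 * a by rewrite ger0_norm// (le_trans (ltW a0)).
  have Hx : y ord0 i + a <= x ord0 i by rewrite addrC -lerBrDr.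
  have [/(_ Hx) h _] := box_face a0 b0 ba2 btp sa mono Htp Hl Hi.
  apply/ltW; apply: le_lt_trans h.
  by move: qp; rewrite /yp; move: (sg * _) => A; clear => ?; lra.
have Fm (x : E) : (forall l, l != i -> `|x ord0 l - y ord0 l| < 2 * b) ->
    a <= y ord0 i - x ord0 i <= 2 * a -> sg * rho x <= - q.
  move=> Hl /andP[Hi1 Hi2].
  have Hi : `|x ord0 i - y ord0 i| <= 2 * a by rewrite distrC ger0_norm// (le_trans (ltW a0)).
  have Hx : x ord0 i <= y ord0 i - a by rewrite lerBrDr addrC -lerBrDr.
  have [_ /(_ Hx) h] := box_face a0 b0 ba2 btm sma mono Htm Hl Hi.
  apply/ltW; apply: lt_le_trans h _.
  by move: qm; rewrite /ym; move: (sg * _) => A; clear => ?; lra.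
exists U, rho, i, sg, a, b, q; split => //; last by apply: le_trans ba2; rewrite ler_peMl ?ler1n// ltW.
clear -oU OU C1 sgE a0 b0 q0 H4 Fp Fm.
split => // x Hl; case: sgE Fp Fm => -> Fp Fm; rewrite ?mul1r ?mulN1r ?opprB => Hi.
- by have := Fp x Hl Hi; rewrite mul1r.
- by have := Fm x Hl Hi; rewrite mulN1r lerN2.
- by have := Fm x Hl Hi; rewrite mul1r.
- by have := Fp x Hl Hi; rewrite mulN1r lerNr.
Qed.

End boundary_layer.

(** * Layers along the boundary *)

Section layer_profile.
Variable R : realType.
Implicit Types (t q : R) (m : nat).

(** Equal to 1 for t <= -3/(m+1) and to 0 for t >= -1/(m+1). Composed with rho it vanishes already
    before the boundary is reached, so that cut-off products have compact support in [Omega]. *)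
Definition layer m t : R := step (- (m.+1%:R * t) - 1).
Definition dlayer m t : R := - (m.+1%:R * dstep (- (m.+1%:R * t) - 1)).

Lemma layer_derive m t : is_derive t 1 (layer m) (dlayer m t).
Proof.
have H1 : is_derive t 1 (fun s : R => - (m.+1%:R * s) - 1) (- m.+1%:R).
  apply: (@is_derive_quadratic _ _ _ _ 0) => h _.
  by rewrite [X in `|X|](_ : _ = 0) ?normr0 ?mul0r//; ring.
have D1 := @is_derive1_comp _ _ _ t _ _ (step_derive (- (m.+1%:R * t) - 1)) H1.
by apply: is_derive_eq; rewrite /dlayer mulrN mulrC.
Qed.

Lemma dlayer_continuous m : continuous (dlayer m).
Proof.
move=> t.
have c1 : {for t, continuous (fun s : R => - (m.+1%:R * s) - 1)}.
  apply: continuousB; last exact: cst_continuous.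
  by apply: continuousN; apply: continuousM => //; exact: cst_continuous.
have c2 := @continuous_comp _ _ _ _ _ t c1 (@dstep_continuous R _).
exact: (continuousN (continuousM (@cst_continuous R R m.+1%:R t) c2)).
Qed.

Lemma layer01 m t : 0 <= layer m t <= 1. Proof. exact: step01. Qed.

Lemma layer0 m t : - m.+1%:R^-1 <= t -> layer m t = 0.
Proof.
move=> h; rewrite /layer step0// subr_le0 lerNl.
have : m.+1%:R * - m.+1%:R^-1 <= m.+1%:R * t by rewrite ler_pM2l.
by rewrite mulrN divff.
Qed.

Lemma layer1 m t q : 3 <= m.+1%:R * q -> t <= - q -> layer m t = 1 /\ dlayer m t = 0.
Proof.
move=> h3 tq; have : m.+1%:R * t <= m.+1%:R * - q by rewrite ler_pM2l.
rewrite mulrN => h; have h2 : 2 <= - (m.+1%:R * t) - 1 by lra.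
rewrite /layer /dlayer step1// dstep0; last by right.
by rewrite mulr0 oppr0.
Qed.

Lemma dlayer_le0 m t : dlayer m t <= 0.
Proof. by rewrite /dlayer oppr_le0 mulr_ge0//; have /andP[] := dstep01 (- (m.+1%:R * t) - 1). Qed.

Lemma large_mul q : 0 < q -> exists N, forall m, (N <= m)%N -> 3 <= m.+1%:R * q.
Proof.
move=> q0; exists (Num.truncn (3 / q)) => m Nm.
rewrite -ler_pdivrMr//; apply/ltW; apply: lt_le_trans (truncnS_gt _) _.
by rewrite ler_nat ltnS.
Qed.

End layer_profile.

Section boundary_layer.
Variables (R : realType) (d : nat).
Local Notation E := 'rV[R]_d.
Local Notation mu := (lebesgue_rV R d).
Local Notation e_ i := (delta_mx ord0 i : E).
Implicit Types (Omega U K S : set E) (rho chi : E -> R).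

(* [Km m] cuts off a layer of width about [1 / m] along the boundary: near [y],
   [- sg * partial i (Km m)] is nonnegative and concentrates on the boundary, and its integral
   against [chi] stays above [c0]. *)
Definition boundary_layer Omega (y : E) (r : R) i chi (Km : nat -> E -> R) (sg c0 : R) :=
  [/\ [/\ sg = 1 \/ sg = -1, 0 < c0, C1on i setT chi & forall m, C1on i setT (Km m)],
      [/\ forall x, 0 <= chi x <= 1, forall m x, 0 <= Km m x <= 1 &
          forall x, r <= `|y - x| -> chi x = 0],
      (forall m, exists K, [/\ compact K, K `<=` Omega & forall x, ~ K x -> chi x * Km m x = 0]),
      (forall m x, 0 <= - (sg * (chi x * partial i (Km m) x))) /\
      (forall S, compact S -> S `<=` closure Omega ->
        (forall x, S x -> `|y - x| <= r -> ~ boundary Omega x) ->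
        exists N, forall m, (N <= m)%N -> forall x, S x -> chi x * partial i (Km m) x = 0) &
      exists N, forall m, (N <= m)%N ->
        c0 <= sg * \int[mu]_(x in Omega) (partial i chi x * Km m x)].

Lemma dplateau_far (s : R) : 2 <= `|s| -> dplateau s = 0.
Proof.
case: (ger0P s) => s0 h.
  by rewrite dplateau_pos// dstep0 ?mulr0 ?oppr0//; left; lra.
by rewrite dplateau_neg ?ltW// dstep0 ?mulr0//; left; lra.
Qed.

Lemma boundary_layer_exists Omega (y : E) (r : R) : open Omega -> smooth_boundary Omega ->
  boundary Omega y -> 0 < r -> exists i chi Km sg c0, boundary_layer Omega y r i chi Km sg c0.
Proof.
move=> oO sb by_ r0.
have [U [rho [i [sg [a [b [q [[[oU OU C1r] [sgE a0 b0 q0] H4 Fp Fm] ba a4r]]]]]]]] :=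
  boundary_chart_exists oO sb by_ r0.
pose rr : E := \row_l (if l == i then a else b).
have rr0 l : 0 < rr ord0 l by rewrite mxE; case: ifP.
pose chi := box_cut y rr.
have [C1chi Pchi] := C1on_box_cut y rr i.
have chi01 x : 0 <= chi x <= 1 by exact: box_cut01.
have chi0 x : 2 * a <= `|y - x| -> chi x = 0.
  move=> h; apply/eqP; apply: contraTT h => nz; rewrite -ltNge.
  apply/norm_rV_lt; first by rewrite mulr_gt0.
  move=> l; rewrite !mxE distrC ltNge; apply/negP => h.
  move/eqP: nz; apply; apply: (@box_cut0 _ _ y rr rr0 x l); apply: le_trans h.
  by rewrite mxE; case: ifP => // _; rewrite ler_pM2l.
have a23 : 0 < 2 * a < 3 * a by rewrite mulr_gt0//= ltr_pM2r// ltr_nat.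
(* The layer is defined only where rho is meaningful; [xi] extends it by 0 and equals 1 on the
   support of [chi]. *)
have [xi [sxi xi01 xi1 xi0]] := @ball_cutoff R d y (2 * a) (3 * a) a23.
pose Km m x := xi x * layer m (rho x).
have cB : closed [set x : E | `|y - x| <= 3 * a] by apply: compact_rV_closed; exact: closed_ball_rV_compact.
have BU : [set x : E | `|y - x| <= 3 * a] `<=` U.
  by move=> x /= h; apply: (H4 x _).1; apply: le_lt_trans h _; lra.
have xiout x : ~ [set x : E | `|y - x| <= 3 * a] x -> xi x = 0.
  by move=> /negP; rewrite -ltNge => /ltW; exact: xi0.
have C1xi : C1on i setT xi by apply/C1onT/Ck1_C1dir; exact: (sxi 1%N).
have C1lay m := C1on_comp oU C1r (@layer_derive R m) (@dlayer_continuous R m).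
have C1K m : C1on i setT (Km m) := C1on_cut oU cB BU C1xi xiout (C1lay m).1.
have oB2 : open [set x : E | `|y - x| < 2 * a] by exact: open_ball_rV.
have B2U x : `|y - x| < 2 * a -> U x.
  by move=> h; apply: (H4 x _).1; apply: lt_le_trans h _; lra.
have KmE m x : `|y - x| < 2 * a -> Km m x = layer m (rho x).
  by move=> h; rewrite /Km xi1 ?mul1r// ltW.
have dKmE m x : `|y - x| < 2 * a -> partial i (Km m) x = dlayer m (rho x) * partial i rho x.
  move=> h; rewrite -(C1lay m).2; last exact: B2U.
  by apply: (eq_partial i oB2) => // z; exact: KmE.
have Km01 m x : 0 <= Km m x <= 1.
  have /andP[u0 u1] := xi01 x; have /andP[v0 v1] := layer01 m (rho x).
  by rewrite mulr_ge0//= mulr_ile1.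
have cB2 : compact [set x : E | `|y - x| <= 2 * a] by exact: closed_ball_rV_compact.
have crho (S : set E) : S `<=` [set x : E | `|y - x| <= 2 * a] ->
    {within S, continuous rho} /\ {within S, continuous (fun x => - rho x)}.
  move=> SB; split; apply: continuous_in_subspaceT => x; rewrite inE => /SB /= h;
    have Ux : U x by apply: BU; apply: le_trans h _; lra.
    by have [cr _ _] := C1r x Ux.
  by have [cr _ _] := C1r x Ux; exact: continuousN.
have OUx x : U x -> rho x < 0 -> Omega x.
  by move=> Ux rx; have [] : (Omega `&` U) x by rewrite OU.
have OUr x : U x -> Omega x -> rho x < 0.
  by move=> Ux Ox; have [] : ([set x | rho x < 0] `&` U) x by rewrite -OU.
pose f m x := sg * (partial i chi x * Km m x).
have [N HN] := large_mul q0.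
(* [chi] varies along [e_i] only away from the surface, where [Km m] is 0 or 1. *)
have sgd (t : R) : sg * dplateau t = dplateau (sg * t).
  by case: sgE => ->; rewrite ?mul1r// !mulN1r dplateauN.
pose s (x : E) := (x ord0 i - y ord0 i) / a.
have fdef m x : f m x = dplateau (sg * s x) / a * box_rest y rr i x * Km m x.
  by rewrite /f Pchi mxE eqxx -sgd /s; move: (dplateau _) (box_rest _ _ _ _) (Km m x) => *; ring.
have rest_box (x : E) : box_rest y rr i x != 0 -> forall l, l != i -> `|x ord0 l - y ord0 l| < 2 * b.
  move=> nz l li; rewrite ltNge; apply/negP => h; move/eqP: nz; apply.
  by apply: (@box_rest0 _ _ y rr rr0 i x l li); rewrite mxE (negbTE li).
have in_ball (x : E) : (forall l, l != i -> `|x ord0 l - y ord0 l| < 2 * b) ->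
    `|x ord0 i - y ord0 i| < 2 * a -> `|y - x| < 2 * a.
  move=> Hl Hi; apply/norm_rV_lt; first by rewrite mulr_gt0.
  move=> l; rewrite !mxE distrC; have [->//|li] := eqVneq l i.
  by apply: lt_le_trans (Hl l li) _; rewrite ler_pM2l.
have sgs (x : E) : sg * (x ord0 i - y ord0 i) = sg * s x * a by rewrite /s -mulrA divfK ?gt_eqF.
have sgsN (x : E) : sg * (y ord0 i - x ord0 i) = - (sg * s x) * a.
  by rewrite mulNr -sgs -mulrN opprB.
have nsgs (x : E) : `|x ord0 i - y ord0 i| = `|sg * s x| * a.
  have <- : `|sg * s x * a| = `|sg * s x| * a by rewrite normrM (gtr0_norm a0).
  by rewrite -sgs normrM; case: sgE => ->; rewrite ?normrN normr1 mul1r.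
have inner m (x : E) : (N <= m)%N -> (forall l, l != i -> `|x ord0 l - y ord0 l| < 2 * b) ->
    -2 < sg * s x <= -1 -> Km m x = 1 /\ Omega x.
  move=> Nm Hl /andP[h1 h2].
  have xB : `|y - x| < 2 * a.
    apply: in_ball => //; rewrite nsgs ltr_pM2r// ltr_norml.
    by move: h1 h2; move: (sg * s x) => t; clear => *; apply/andP; split; lra.
  have rx : rho x <= - q.
    apply: Fm => //; rewrite sgsN -{1}(mul1r a) !ler_pM2r//.
    by move: h1 h2; move: (sg * s x) => t; clear => *; apply/andP; split; lra.
  rewrite KmE// (layer1 (HN m Nm) rx).1; split => //; apply: OUx; first exact: B2U.
  by apply: le_lt_trans rx _; rewrite oppr_lt0.
(* The integrand does not depend on m from N on, so the integral of [f N] can serve as the constant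
   [c0]. *)
have fE m x : (N <= m)%N -> f m x = f N x /\ 0 <= f N x.
  move=> Nm; rewrite !fdef.
  have [->|nz] := eqVneq (box_rest y rr i x) 0; first by rewrite mulr0 !mul0r.
  have Hl := rest_box x nz.
  have R0 : 0 <= box_rest y rr i x by have /andP[] := box_rest01 y rr i x.
  have [h2|h2] := leP 2 `|sg * s x|; first by rewrite dplateau_far// !mul0r.
  have [h1|h1] := leP `|sg * s x| 1; first by rewrite dplateau0// !mul0r.
  have xB : `|y - x| < 2 * a by apply: in_ball => //; rewrite nsgs ltr_pM2r.
  have [p0|n0] := leP 0 (sg * s x).
    rewrite ger0_norm// in h1 h2.
    have rx : q <= rho x.
      apply: Fp => //; rewrite sgs -{1}(mul1r a) !ler_pM2r//; apply/andP; split; exact: ltW.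
    have rxm m' : - m'.+1%:R^-1 <= rho x.
      by apply: le_trans (le_trans (ltW q0) rx); rewrite oppr_le0 invr_ge0.
    by rewrite !KmE// !layer0// mulr0.
  rewrite ltr0_norm// in h1 h2.
  have h12 : -2 < sg * s x <= -1.
    by move: h1 h2; move: (sg * s x) => t; clear => *; apply/andP; split; lra.
  rewrite (inner m x Nm Hl h12).1 (inner N x (leqnn N) Hl h12).1; split => //.
  by rewrite mulr1 mulr_ge0// divr_ge0 ?dplateau_ge0// ltW.
(* The centre has sg s = -3/2, inside [Omega]; within a / 4 of it sg s lies in [-7/4, -5/4], where
   the plateau has derivative at least 1. *)
have fpos (x : E) : `|y - (sg * (3 / 2) * a) *: e_ i - x| <= Num.min (a / 4) b ->
    Omega x /\ a^-1 <= f N x.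
  have m0 : 0 <= Num.min (a / 4) b by rewrite le_min (ltW b0) andbT divr_ge0// ltW.
  move=> /(norm_rV_le _ m0) h.
  have Hl l : l != i -> `|x ord0 l - y ord0 l| <= b.
    move=> li; have := h l; rewrite !mxE eqxx/= (negbTE li) mulr0 subr0 distrC => h'.
    by apply: le_trans h' _; rewrite ge_min lexx orbT.
  have Hl2 l : l != i -> `|x ord0 l - y ord0 l| < 2 * b.
    by move=> /Hl h'; apply: le_lt_trans h' _; rewrite ltr_pMl// ltr1n.
  have Hi : -(7 / 4) <= sg * s x <= -(5 / 4).
    have := h i; rewrite !mxE !eqxx/= mulr1 => h'.
    have h4 : `|y ord0 i - sg * (3 / 2) * a - x ord0 i| <= a / 4.
      by apply: le_trans h' _; rewrite ge_min lexx.
    have xE : x ord0 i - y ord0 i = s x * a by rewrite /s divfK ?gt_eqF.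
    have {}h4 : `|(sg * s x + 3 / 2) * a| <= a / 4.
      apply: le_trans h4; rewrite (_ : y ord0 i - _ - _ = - ((s x + sg * (3 / 2)) * a)); last first.
        by rewrite [X in _ = - X]mulrDl -xE; ring.
      by rewrite normrN !normrM; case: sgE => ->; rewrite ?mul1r// !mulN1r -normrN opprD opprK.
    move: h4; rewrite normrM (gtr0_norm a0) mulrC ler_pM2l// ler_norml => /andP[].
    by move: (sg * s x) => t; clear => *; apply/andP; split; lra.
  have h12 : -2 < sg * s x <= -1.
    by move: Hi; move: (sg * s x) => t; clear => /andP[] *; apply/andP; split; lra.
  have [KN Ox] := inner N x (leqnn N) Hl2 h12; split => //.
  rewrite fdef KN box_rest1 ?mulr1//; last by move=> l li; rewrite mxE (negbTE li); exact: Hl.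
  by rewrite ler_peMl ?invr_ge0 ?(ltW a0)//; exact: dplateau_gt0.
have fcont m : continuous (f m) /\ bounded_support (f m).
  have [_ _ cdc] := (C1onT i chi).1 C1chi; have [cK _ _] := (C1onT i (Km m)).1 (C1K m).
  split.
    move=> x; apply: (@continuousM R E (fun=> sg) (fun x => partial i chi x * Km m x)).
      exact: cst_continuous.
    exact: (continuousM (cdc x) (cK x)).
  exists (`|y| + 3 * a) => x hx; rewrite /f /Km xi0 ?mul0r ?mulr0//.
  have := ler_normD (y - x) (- y); rewrite addrAC subrr add0r !normrN => h; lra.
have If m : mu.-integrable Omega (EFin \o f m).
  have [cf bf] := fcont m.
  by apply: integrableS (integrable_Cc cf bf) => //; exact: open_measurable_rV.
have Ig m : mu.-integrable Omega (EFin \o (fun x => partial i chi x * Km m x)).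
  have := integrableZ_fin sg (open_measurable_rV oO) (If m).
  rewrite (_ : (fun x => sg * f m x) = (fun x => partial i chi x * Km m x))//.
  by apply/funext => x; rewrite /f mulrA; case: sgE => ->; rewrite ?mul1r// mulN1r opprK mul1r.
have c0 : 0 < \int[mu]_(x in Omega) f N x.
  apply: (Rintegral_gt0 _ (If N) _ _ _ fpos).
  - exact: open_measurable_rV.
  - by move=> x _; have [] := fE N x (leqnn N).
  - by rewrite lt_min b0 andbT divr_gt0.
  - by rewrite invr_gt0.
exists i, chi, Km, sg, (\int[mu]_(x in Omega) f N x).
split.
- by split.
- split; [exact: chi01|exact: Km01|move=> x h; apply: chi0; apply: le_trans h].
  by apply: le_trans a4r; rewrite ler_pM2r// ler_nat.
- move=> m; exists [set x | [set x : E | `|y - x| <= 2 * a] x /\ m.+1%:R^-1 <= - rho x].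
  split.
  + apply: compact_superlevel => //; exact: (crho _ _).2.
  + move=> x [/= h1 h2]; apply: OUx; first by apply: BU; apply: le_trans h1 _; lra.
    by rewrite -oppr_gt0; apply: lt_le_trans h2; rewrite invr_gt0.
  + move=> x nK; have [h|h] := ltP `|y - x| (2 * a); last by rewrite chi0 ?mul0r.
    rewrite KmE// layer0 ?mulr0// lerNl leNgt; apply/negP => h2.
    by apply: nK; split => /=; exact: ltW.
- split=> [m x|S cS SO Sb].
    have [h|h] := ltP `|y - x| (2 * a); last by rewrite chi0// mul0r mulr0 oppr0.
    rewrite dKmE//; have [_ P] := H4 x ltac:(by apply: lt_le_trans h _; lra).
    rewrite (_ : - _ = chi x * (- dlayer m (rho x)) * (sg * partial i rho x)); last ring.
    rewrite mulr_ge0 ?(ltW P)// mulr_ge0 ?oppr_ge0 ?dlayer_le0//.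
    by have /andP[] := chi01 x.
  pose S' := S `&` [set x : E | `|y - x| <= 2 * a].
  have [S0|S'0] := pselect (S' !=set0); last first.
    exists 0%N => m _ x Sx; rewrite chi0 ?mul0r// leNgt; apply/negP => h.
    by apply: S'0; exists x; split => //=; exact: ltW.
  have cS' : compact S'.
    by apply: (subclosed_compact _ cB2); [apply: closedI; exact: compact_rV_closed|move=> x []].
  (* The part of [S] near y avoids the boundary, so rho has a negative maximum on it, and the layer
     is constant there once 3/(m+1) is below its absolute value. *)
  have [z [Sz Bz] zmin] := @compact_argmax_within R d S' rho S0 cS' (crho S' (fun x h => h.2)).1.
  have rz : rho z < 0.
    apply: OUr; first by apply: BU; apply: le_trans Bz _; lra.
    apply: contrapT => nOz; apply: (Sb z Sz); first by apply: le_trans Bz _; lra.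
    by split; [exact: SO|move=> /interior_subset].
  have [N' HN'] := @large_mul R (- rho z) ltac:(by rewrite oppr_gt0).
  exists N' => m /HN' h3 x Sx.
  have [h|h] := ltP `|y - x| (2 * a); last by rewrite chi0 ?mul0r.
  rewrite dKmE// (layer1 h3 _).2 ?mul0r ?mulr0// opprK; apply: zmin; split => //=; exact: ltW.
- exists N => m Nm.
  have mO := open_measurable_rV oO.
  have -> : sg * \int[mu]_(x in Omega) (partial i chi x * Km m x) = \int[mu]_(x in Omega) f m x.
    by rewrite -RintegralZl//; apply: Ig.
  have -> // : f m = f N by apply/funext => x; have [] := fE m x Nm.
Qed.

End boundary_layer.

(** * Integrals against the layer *)

Section layer_estimates.
Variables (R : realType) (d : nat).
Local Notation E := 'rV[R]_d.
Local Notation mu := (lebesgue_rV R d).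
Local Notation e_ i := (delta_mx ord0 i : E).
Implicit Types (K S : set E) (chi phi z : E -> R).
Variables (Omega : set E) (M0 : R).
Hypothesis oO : open Omega.
Hypothesis OM : forall x, Omega x -> `|x| <= M0.

Let mO : measurable Omega. Proof. exact: open_measurable_rV. Qed.

(** Either a <= t, or (a / t)^(p-1) >= 1. Integrated with small t, this bounds the L^1 norm by a
    small constant plus a multiple of the p-mass. *)
Lemma powR_le_scaled (a t p : R) : 0 <= a -> 0 < t -> 1 <= p ->
  a <= t + t `^ (1 - p) * a `^ p.
Proof.
move=> a0 t0 p1; have [at_|ta] := leP a t.
  by apply: le_trans at_ _; rewrite lerDl mulr_ge0 ?powR_ge0.
have a1 : 0 < a by exact: lt_trans ta.
apply: (@le_trans _ _ (t `^ (1 - p) * a `^ p)); last by rewrite lerDr ltW.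
have -> : a `^ p = a `^ (p - 1) * a.
  by rewrite (@powR_mul_self _ a (p - 1) p)//; ring.
rewrite mulrA ler_peMl //.
rewrite (_ : 1 - p = - (p - 1)); last ring.
rewrite powRN ler_pdivlMl ?powR_gt0// mulr1.
by rewrite ge0_ler_powR ?nnegrE ?subr_ge0// ltW.
Qed.

Lemma L1_small (p e : R) : 1 < p -> 0 < e -> exists2 dl : R, 0 < dl &
  forall z, measurable_fun Omega z -> (p_mass Omega p z < dl%:E)%E ->
    \int[mu]_(x in Omega) `|z x| < e.
Proof.
move=> p1 e0; pose A := \int[mu]_(x in Omega) 1.
have A0 : 0 <= A by apply: Rintegral_ge0 => x _; exact: ler01.
pose t := e / (2 * (A + 1)); have t0 : 0 < t by rewrite divr_gt0// mulr_gt0// ltr_wpDl.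
have T0 : 0 < t `^ (1 - p) by rewrite powR_gt0.
exists (e / 2 / t `^ (1 - p)); first by rewrite !divr_gt0.
move=> z mz zd.
have zf : (p_mass Omega p z < +oo)%E by apply: lt_le_trans zd _; exact: leey.
have Ip := p_mass_integrable mz zf.
have I1 : mu.-integrable Omega (EFin \o (fun=> t : R)) by exact: (integrable_cst_bounded oO OM).
have IZ := integrableZ_fin (t `^ (1 - p)) mO Ip.
have Ir := integrableD_fin mO I1 IZ.
have Iz : mu.-integrable Omega (EFin \o z).
  apply: integrable_le Ir => // x _; apply: powR_le_scaled => //; exact: ltW.
apply: (@le_lt_trans _ _ (\int[mu]_(x in Omega) (t + t `^ (1 - p) * `|z x| `^ p))).
  apply: le_Rintegral => //; first exact: integrable_norm_fin.
  by move=> x _; apply: powR_le_scaled => //; exact: ltW.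
rewrite RintegralD// RintegralZl//.
have -> : \int[mu]_(x in Omega) t = t * A by rewrite /A !Rintegral_cst// mul1r.
have mE : \int[mu]_(x in Omega) `|z x| `^ p < e / 2 / t `^ (1 - p).
  by rewrite -lte_fin EFin_Rintegral.
have tA : t * A <= e / 2.
  rewrite /t -mulrA ler_wpM2l ?(ltW e0)// invfM -mulrA ler_piMr ?invr_ge0//.
  by rewrite mulrC ler_pdivrMr ?mul1r ?lerDl// ltr_wpDl.
have : t `^ (1 - p) * \int[mu]_(x in Omega) `|z x| `^ p < e / 2.
  by rewrite mulrC -ltr_pdivlMr.
move: tA; clear => *; lra.
Qed.

Variables (y : E) (r : R) (i : 'I_d) (chi : E -> R) (Km : nat -> E -> R) (sg c0 : R).
Hypothesis layerP : boundary_layer Omega y r i chi Km sg c0.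

(** A nonnegative weight which, heuristically, tends to [sg * chi] times the i-th component of the
    outer normal times surface measure. *)
Definition density (m : nat) (x : E) : R := - (sg * (chi x * partial i (Km m) x)).

Lemma sg_normr (t : R) : `|sg * t| = `|t|.
Proof. by have [[[->|->] _ _ _] _ _ _ _] := layerP; rewrite ?mul1r// mulN1r normrN. Qed.

Lemma chi_support : bounded_support chi.
Proof.
have [_ [_ _ chi0] _ _ _] := layerP; exists (`|y| + r) => x h; apply: chi0.
have := ler_normD (y - x) (- y); rewrite addrAC subrr add0r !normrN; lra.
Qed.

Lemma chi_partial_bounded : exists2 C : R, 0 < C & forall x, `|partial i chi x| <= C.
Proof.
have [[_ _ C1 _] _ _ _ _] := layerP; have [_ _ cd] := (C1onT i chi).1 C1.
apply: Cc_bounded => //; have [M HM] := chi_support.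
by exists M; exact: partial_bounded_support.
Qed.

Lemma density_continuous m : continuous (density m) /\ bounded_support (density m).
Proof.
have [[_ _ C1 C1K] _ _ _ _] := layerP; have [cc _ _] := (C1onT i chi).1 C1.
have [_ _ cd] := (C1onT i (Km m)).1 (C1K m).
split.
  move=> x; exact: (continuousN (continuousM (@cst_continuous E R sg x) (continuousM (cc x) (cd x)))).
by have [M HM] := chi_support; exists M => x /HM h; rewrite /density h mul0r mulr0 oppr0.
Qed.

(* Integration by parts of the compactly supported [chi * phi * Km m]. *)
Lemma layer_test m phi : C1on i setT phi ->
  \int[mu]_(x in Omega) (phi x * density m x) =
  sg * \int[mu]_(x in Omega) (Km m x * partial i (fun x => chi x * phi x) x).
Proof.
move=> C1p; have [[_ _ C1 C1K] _ Hs _ _] := layerP; have [K [cK KO K0]] := Hs m.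
have C1cp : C1on i setT (fun x => chi x * phi x) by exact: (C1onM openT C1 C1p).
have C1Y : C1on i setT (fun x => chi x * phi x * Km m x) by exact: (C1onM openT C1cp (C1K m)).
have Y0 x : ~ K x -> chi x * phi x * Km m x = 0.
  by move=> /K0; rewrite mulrAC => ->; rewrite mul0r.
have bY := support_bounded cK Y0.
have := Rintegral_partial ((C1onT i _).1 C1Y) bY.
have PE x : partial i (fun x => chi x * phi x * Km m x) x =
    chi x * phi x * partial i (Km m) x + Km m x * partial i (fun x => chi x * phi x) x.
  by have [_ d1 _] := C1cp x I; have [_ d2 _] := C1K m x I; have [_ ->] := partialM d1 d2.
have P0 x : ~ Omega x -> partial i (fun x => chi x * phi x * Km m x) x = 0.
  by move=> nO; apply: (partial_support i cK Y0) => /KO.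
rewrite -(Rintegral_support P0).
have [cd bd] := density_continuous m.
have [cph _ _] := (C1onT i _).1 C1p; have [cKm _ _] := (C1onT i _).1 (C1K m).
have [_ _ cdcp] := (C1onT i _).1 C1cp.
have I1 : mu.-integrable Omega (EFin \o (fun x => phi x * density m x)).
  apply: (@integrableS _ _ _ _ setT) => //; apply: integrable_Cc.
    by move=> x; exact: (continuousM (cph x) (cd x)).
  by have [M HM] := bd; exists M => x /HM ->; rewrite mulr0.
have I2 : mu.-integrable Omega (EFin \o (fun x => Km m x * partial i (fun x => chi x * phi x) x)).
  apply: (@integrableS _ _ _ _ setT) => //; apply: integrable_Cc.
    by move=> x; exact: (continuousM (cKm x) (cdcp x)).
  have [M HM] := chi_support; exists M => x Mx.
  rewrite (@partial_bounded_support _ _ i _ M _ x Mx) ?mulr0//.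
  by move=> w /HM ->; rewrite mul0r.
have E1 : \int[mu]_(x in Omega) partial i (fun x => chi x * phi x * Km m x) x =
   \int[mu]_(x in Omega) (Km m x * partial i (fun x => chi x * phi x) x - sg * (phi x * density m x)).
  apply: eq_Rintegral => x _; rewrite PE /density.
  have [[[->|->] _ _ _] _ _ _ _] := layerP; ring.
rewrite E1 RintegralB//; last exact: integrableZ_fin.
rewrite RintegralZl// => /eqP; rewrite subr_eq0 => /eqP ->.
by have [[[->|->] _ _ _] _ _ _ _] := layerP; rewrite ?mul1r// !mulN1r opprK.
Qed.

Lemma integral_ball_le f (c : E) (rho M : R) : 0 <= M -> 0 <= rho ->
  mu.-integrable Omega (EFin \o f) -> (forall x, `|f x| <= M) ->
  (forall x, rho < `|c - x| -> f x = 0) ->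
  `|\int[mu]_(x in Omega) f x| <= M * (2 * rho) ^+ d.
Proof.
move=> M_ge0 rho0 If fM f0; apply: le_trans (le_normr_Rintegral mO If) _.
pose B := [set x : E | `|c - x| <= rho].
have mB : measurable B by exact: measurable_closed_ball_rV.
have IB : mu.-integrable Omega (EFin \o (\1_B : E -> R)).
  apply: (integrable_bounded_on (r := M0) (M := 1)) => //.
  by move=> x _; rewrite indicE; case: (x \in B); rewrite ?normr1 ?normr0.
apply: (@le_trans _ _ (\int[mu]_(x in Omega) (M * \1_B x))).
  apply: le_Rintegral => //; [exact: integrable_norm_fin|exact: integrableZ_fin|].
  move=> x _; rewrite indicE; case: (boolP (x \in B)) => [_|]; first by rewrite mulr1.
  by move=> /negP; rewrite inE /= => /negP; rewrite -ltNge => /f0 ->; rewrite normr0 mulr0.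
rewrite RintegralZl// ler_wpM2l//.
have bE := lebesgue_rV_closed_ball c rho0.
have le1 : (mu (B `&` Omega) <= ((2 * rho) ^+ d)%:E)%E.
  by rewrite -bE; apply: le_measure; rewrite ?inE//; exact: measurableI.
rewrite /Rintegral integral_indic// -lee_fin fineK//.
by rewrite ge0_fin_numE//; apply: le_lt_trans le1 _; exact: ltry.
Qed.

(** Integration by parts removes the derivative from [Km], so the bound is uniform in m: the
    integrand is at most C + 2 / rho, on a cube of volume (4 rho)^d, and rho <= 1 absorbs C rho into
    C. This is the (d-1)-dimensional size of the box, to be compared with the Hausdorff measure. *)
Lemma layer_box_bound C : (0 < d)%N -> (forall x, `|partial i chi x| <= C) ->
  forall m (c : E) (rho : R), 0 < rho <= 1 ->
  `|\int[mu]_(x in Omega) (box_cut c (const_mx rho) x * density m x)| <=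
  (C + 2) * 4 ^+ d * rho ^+ d.-1.
Proof.
move=> d0 HC m c rho /andP[rho0 rho1]; pose phi := box_cut c (const_mx rho).
have rr0 l : 0 < (const_mx rho : E) ord0 l by rewrite mxE.
have [C1p Pp] := C1on_box_cut c (const_mx rho) i.
have C0 : 0 <= C by apply: le_trans (HC 0); exact: normr_ge0.
rewrite layer_test// sg_normr.
have [[_ _ C1 C1K] [chi01 Km01 _] Hs _ _] := layerP.
have C1cp : C1on i setT (fun x => chi x * phi x) by exact: (C1onM openT C1 C1p).
have phi01 x : 0 <= phi x <= 1 by exact: box_cut01.
have phi0 x : 2 * rho < `|c - x| -> phi x = 0.
  move=> h; apply/eqP; apply: contraTT h => nz; rewrite -leNgt.
  apply/norm_rV_le; first by rewrite mulr_ge0// ltW.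
  move=> l; rewrite !mxE distrC leNgt; apply/negP => h.
  by move/eqP: nz; apply; apply: (@box_cut0 _ _ c _ rr0 x l); rewrite mxE ltW.
have cB : compact [set x : E | `|c - x| <= 2 * rho] by exact: closed_ball_rV_compact.
have cp0 x : ~ [set x : E | `|c - x| <= 2 * rho] x -> chi x * phi x = 0.
  by move=> /negP; rewrite -ltNge => /phi0 ->; rewrite mulr0.
have dcp0 x : 2 * rho < `|c - x| -> partial i (fun x => chi x * phi x) x = 0.
  by move=> h; apply: (partial_support i cB cp0) => /=; apply/negP; rewrite -ltNge.
have dphi x : `|partial i phi x| <= 2 / rho.
  rewrite Pp mxE; have := dplateau_le ((x ord0 i - c ord0 i) / rho).
  move: (dplateau _) => q h1; rewrite !normrM normfV (gtr0_norm rho0).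
  have /andP[h2 h3] := box_rest01 c (const_mx rho) i x.
  rewrite (ger0_norm h2); apply: (@le_trans _ _ (2 / rho * 1)); last by rewrite mulr1.
  by apply: ler_pM; [rewrite mulr_ge0// invr_ge0 ltW|exact: h2|rewrite ler_pM2r ?invr_gt0|exact: h3].
have bnd x : `|Km m x * partial i (fun x => chi x * phi x) x| <= C + 2 / rho.
  have [_ d1 _] := C1 x I; have [_ d2 _] := C1p x I; have [_ ->] := partialM d1 d2.
  have /andP[k0 k1] := Km01 m x; have /andP[x0 x1] := chi01 x; have /andP[p0 p1] := phi01 x.
  rewrite normrM (ger0_norm k0) -[leRHS]mul1r; apply: ler_pM => //.
  apply: le_trans (ler_normD _ _) _; rewrite addrC !normrM (ger0_norm x0) (ger0_norm p0).
  by apply: lerD; rewrite -[leRHS]mul1r; apply: ler_pM.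
have [cKm _ _] := (C1onT i _).1 (C1K m); have [_ _ cdcp] := (C1onT i _).1 C1cp.
have I2 : mu.-integrable Omega (EFin \o (fun x => Km m x * partial i (fun x => chi x * phi x) x)).
  apply: (integrable_bounded_on (r := M0) (M := C + 2 / rho)) => //.
  apply: (measurable_funS measurableT) => //; apply: continuous_measurable_rV => x.
  exact: (continuousM (cKm x) (cdcp x)).
apply: le_trans (@integral_ball_le _ c (2 * rho) (C + 2 / rho) _ _ I2 bnd _) _.
- by rewrite addr_ge0// divr_ge0// ltW.
- by rewrite mulr_ge0// ltW.
- by move=> x h; rewrite dcp0// mulr0.
rewrite mulrA (_ : 2 * 2 = 4 :> R); last by rewrite -natrM.
have rd : rho ^+ d = rho * rho ^+ d.-1 by rewrite -exprS prednK.
rewrite exprMn rd.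
have E1 : (C + 2 / rho) * (4 ^+ d * (rho * rho ^+ d.-1)) = (C * rho + 2) * 4 ^+ d * rho ^+ d.-1.
  by field; rewrite gt_eqF.
rewrite E1 ler_wpM2r ?exprn_ge0// ?(ltW rho0)// ler_wpM2r ?exprn_ge0//.
by rewrite lerD2r ler_piMr.
Qed.

(** The chain rule with V = 0 and test function chi * Km moves the derivative from [Km] to [chi] and
    to the truncation of z; the result depends on the W^{1,1} size of z but not on m. *)
Lemma layer_sobolev_bound C m z (G : E -> E) : (forall x, `|partial i chi x| <= C) ->
  mu.-integrable Omega (EFin \o z) -> mu.-integrable Omega (EFin \o (fun x => G x ord0 i)) ->
  (forall x, Omega x -> {for x, continuous z}) -> weak_gradient Omega z G ->
  mu.-integrable Omega (EFin \o (fun x => ramp_int (z x) * density m x)) /\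
  \int[mu]_(x in Omega) (ramp_int (z x) * density m x) <=
  C * \int[mu]_(x in Omega) `|z x| + \int[mu]_(x in Omega) `|G x ord0 i|.
Proof.
move=> HC Iz IG cz wz.
have [[_ _ C1 C1K] [chi01 Km01 _] Hs _ _] := layerP; have [K [cK KO K0]] := Hs m.
have C1Y : C1on i setT (fun x => chi x * Km m x) by exact: (C1onM openT C1 (C1K m)).
have C10 : C1dir i (fun=> 0 : R) by apply/C1onT; exact: C1on_cst openT.
have := chain_rule oO Iz IG cz wz C10 ((C1onT i _).1 C1Y) cK KO K0
  (@ramp_int_derive R) (@ramp_int_lip R) (@ramp_lip R).
have PE x : partial i (fun x => chi x * Km m x) x =
    chi x * partial i (Km m) x + Km m x * partial i chi x.
  by have [_ d1 _] := C1 x I; have [_ d2 _] := C1K m x I; have [_ ->] := partialM d1 d2.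
have P0 x : partial i (fun=> 0 : R) x = 0 :> R by rewrite /partial derive_cst.
have cri : continuous (@ramp_int R) by move=> s; exact: is_derive_continuous1 (ramp_int_derive s).
have rile (s : R) : `|ramp_int s| <= `|s|.
  by have := ramp_int_lip s 0; rewrite (@ramp_int_eq0 R 0)// !subr0.
have wcz : {within Omega, continuous z} by apply/within_open_continuousP.
have mri : measurable_fun Omega (fun x => ramp_int (z x)).
  apply: within_continuous_measurable_rV => //; apply/within_open_continuousP => // x Ox.
  by apply: (continuous_comp (cz x Ox)); exact: cri.
have mr : measurable_fun Omega (fun x => ramp (z x)).
  apply: within_continuous_measurable_rV => //; apply/within_open_continuousP => // x Ox.
  by apply: (continuous_comp (cz x Ox)); exact: ramp_continuous.
have Iri : mu.-integrable Omega (EFin \o (fun x => ramp_int (z x))).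
  by apply: integrable_le (integrable_norm_fin Iz) => // x _; exact: rile.
have [cd bd] := density_continuous m; have [Md _ HMd] := Cc_bounded cd bd.
have mT (f : E -> R) : continuous f -> measurable_fun Omega f.
  by move=> cf; apply: (measurable_funS measurableT) => //; exact: continuous_measurable_rV.
have Id : mu.-integrable Omega (EFin \o (fun x => ramp_int (z x) * density m x)).
  exact: (integrable_mul_bounded mO (mT _ cd) (fun x _ => HMd x) Iri).
have [cchi _ cdchi] := (C1onT i _).1 C1; have [cKm _ _] := (C1onT i _).1 (C1K m).
have cKd : continuous (fun x => Km m x * partial i chi x).
  by move=> x; exact: (continuousM (cKm x) (cdchi x)).
have cY : continuous (fun x => chi x * Km m x).
  by move=> x; exact: (continuousM (cchi x) (cKm x)).
have bKd x : `|Km m x * partial i chi x| <= C.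
  have /andP[k0 k1] := Km01 m x; rewrite normrM (ger0_norm k0) -[leRHS]mul1r.
  exact: ler_pM.
have Ia : mu.-integrable Omega (EFin \o (fun x => ramp_int (z x) * (Km m x * partial i chi x))).
  exact: (integrable_mul_bounded mO (mT _ cKd) (fun x _ => bKd x) Iri).
have bb x : `|ramp (z x) * (chi x * Km m x)| <= 1.
  have /andP[r1 r2] := ramp01 (z x).
  have /andP[k0 k1] := Km01 m x; have /andP[x0 x1] := chi01 x.
  rewrite ger0_norm; last by rewrite !mulr_ge0.
  by rewrite mulr_ile1 ?mulr_ge0// mulr_ile1.
have Ib : mu.-integrable Omega (EFin \o (fun x => G x ord0 i * (ramp (z x) * (chi x * Km m x)))).
  by apply: (integrable_mul_bounded mO _ (fun x _ => bb x) IG); exact: (measurable_funM mr (mT _ cY)).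
have -> : \int[mu]_(x in Omega) (ramp_int (z x - 0) * partial i (fun x => chi x * Km m x) x) =
    \int[mu]_(x in Omega) (ramp_int (z x) * (Km m x * partial i chi x) -
       sg * (ramp_int (z x) * density m x)).
  apply: eq_Rintegral => x _; rewrite subr0 PE /density.
  have [[[->|->] _ _ _] _ _ _ _] := layerP; ring.
have -> : \int[mu]_(x in Omega) (ramp (z x - 0) * (G x ord0 i - partial i (fun=> 0) x) * (chi x * Km m x)) =
    \int[mu]_(x in Omega) (G x ord0 i * (ramp (z x) * (chi x * Km m x))).
  by apply: eq_Rintegral => x _; rewrite P0 !subr0; ring.
rewrite RintegralB//; last exact: integrableZ_fin.
rewrite RintegralZl//.
set T := \int[mu]_(x in Omega) (ramp_int (z x) * density m x).
set X1 := \int[mu]_(x in Omega) (ramp_int _ * (_ * partial _ _ _)).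
set X2 := \int[mu]_(x in Omega) (G _ _ _ * _) => TE; split => //.
have T_le : T <= `|X1| + `|X2|.
  apply: le_trans (ler_norm _) _; rewrite -(sg_normr T).
  have -> : sg * T = X1 + X2 by rewrite -[X2]opprK -TE opprB addrC subrK.
  exact: ler_normD.
apply: le_trans T_le _; apply: lerD.
  apply: le_trans (le_normr_Rintegral mO Ia) _.
  rewrite -RintegralZl//; last exact: integrable_norm_fin.
  apply: le_Rintegral => //; [exact: integrable_norm_fin| |].
    by apply: integrableZ_fin => //; exact: integrable_norm_fin.
  by move=> x _; rewrite normrM mulrC; apply: ler_pM.
apply: le_trans (le_normr_Rintegral mO Ib) _.
apply: le_Rintegral => //; [exact: integrable_norm_fin..|].
move=> x _; rewrite normrM -[leRHS]mulr1; apply: ler_pM => //; exact: bb.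
Qed.

End layer_estimates.

(** * Pointwise values from the trace *)

Section boundary_values.
Variables (R : realType) (d : nat).
Local Notation E := 'rV[R]_d.
Local Notation mu := (lebesgue_rV R d).
Implicit Types (F v w z : E -> R) (g h G : E -> E).
Variables (Omega : set E) (M0 : R).
Hypothesis oO : open Omega.
Hypothesis OM : forall x, Omega x -> `|x| <= M0.

Let mO : measurable Omega. Proof. exact: open_measurable_rV. Qed.

Lemma closure_norm_le x : closure Omega x -> `|x| <= M0.
Proof.
move=> /closure_rVP cx; rewrite leNgt; apply/negP => h.
have e0 : 0 < `|x| - M0 by rewrite subr_gt0.
have [y Oy xy] := cx _ e0; have := OM Oy.
by have := ler_normD (x - y) y; rewrite subrK; lra.
Qed.

Lemma closure_compact : compact (closure Omega).
Proof.
apply: (subclosed_compact _ (@closed_ball_rV_compact R d 0 M0)); first exact: closed_closure.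
by move=> x /closure_norm_le h; rewrite /= sub0r normrN.
Qed.

Lemma boundary_compact : compact (boundary Omega).
Proof.
apply: (subclosed_compact _ closure_compact); last by move=> x [].
rewrite /boundary setDE; apply: closedI; first exact: closed_closure.
by apply: open_closedC; exact: open_interior.
Qed.

Lemma ereal_cvg0_lt (a : (\bar R)^nat) : a @ \oo --> 0%E -> forall e : R, 0 < e ->
  exists N, forall k, (N <= k)%N -> (a k < e%:E)%E.
Proof.
move=> /fine_cvgP[[N1 _ H1] /cvgrPdist_lt H] e e0; have [N2 _ H2] := H e e0.
exists (maxn N1 N2) => k; rewrite geq_max => /andP[k1 k2].
have := H2 _ k2; have := H1 _ k1 => /= zf; rewrite sub0r normrN => ze.
by rewrite -(fineK zf) lte_fin; apply: le_lt_trans (ler_norm _) ze.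
Qed.

Lemma poweR_add_lt (a b : \bar R) (q dl : R) : (0 <= a)%E -> (0 <= b)%E -> 0 <= q -> 0 < dl ->
  ((a + b) `^ q < (dl `^ q)%:E)%E -> (a < dl%:E)%E /\ (b < dl%:E)%E.
Proof.
move=> a0 b0 q0 dl0 H.
have sum_lt : (a + b < dl%:E)%E.
  rewrite ltNge; apply/negP => dle; move: H; rewrite ltNge => /negP; apply.
  rewrite -poweR_EFin; apply: gt0_ler_poweR => //.
    by rewrite in_itv/= lee_fin (ltW dl0) leey.
  by rewrite in_itv/= leey andbT adde_ge0.
by split; apply: le_lt_trans sum_lt; [exact: leeDl|exact: leeDr].
Qed.

Lemma sobolev_norm_lt (p dl : R) z G : 1 < p -> 0 < dl ->
  (sobolev_norm Omega p z G < (dl `^ p^-1)%:E)%E ->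
  (p_mass Omega p z < dl%:E)%E /\ (p_energy Omega p G < dl%:E)%E.
Proof.
move=> p1 dl0; apply: poweR_add_lt => //; last first.
- by rewrite invr_ge0; apply: ltW; apply: lt_trans p1.
- by apply: integral_ge0 => x _; rewrite lee_fin powR_ge0.
- by apply: integral_ge0 => x _; rewrite lee_fin powR_ge0.
Qed.

(** The sign lets v > F and v < F at a boundary point be refuted by one argument. *)
Lemma signed_difference (p : R) v w g h (s : R) : 1 < p -> s = 1 \/ s = -1 ->
  sobolev Omega p v g -> sobolev Omega p w h ->
  exists z G, [/\ sobolev Omega p z G, forall x, z x = s * (v x - w x) &
    forall x, G x = s *: (g x - h x)].
Proof.
move=> p1 sE Sv Sw; case: sE => ->.
  exists (fun x => v x + -1 * w x), (fun x => g x + -1 *: h x).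
  split => [|x|x]; first exact: (sobolev_addZ oO OM (-1) p1 Sv Sw).
    by rewrite mul1r mulN1r.
  by rewrite scale1r scaleN1r.
exists (fun x => w x + -1 * v x), (fun x => h x + -1 *: g x).
split => [|x|x]; first exact: (sobolev_addZ oO OM (-1) p1 Sw Sv).
  by rewrite !mulN1r opprB.
by rewrite !scaleN1r opprB.
Qed.

Lemma coord_p_mass_le (p : R) G i : 0 <= p -> measurable_fun Omega G ->
  (p_mass Omega p (fun x => G x ord0 i) <= p_energy Omega p G)%E.
Proof.
move=> p0 mG.
have m1 : measurable_fun Omega (fun x => `|G x ord0 i| `^ p).
  by apply: measurable_normr_powR; exact: measurable_coord_fun.
have m2 := measurable_energy_density p mG.
apply: ge0_le_integral => //; [exact/measurable_EFinP|exact/measurable_EFinP|].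
move=> x _; rewrite lee_fin ge0_ler_powR ?nnegrE ?enorm_ge0//; exact: coord_le_enorm.
Qed.

Lemma eq_p_mass (p : R) v w : (forall x, `|v x| = `|w x|) -> p_mass Omega p v = p_mass Omega p w.
Proof. by move=> vw; apply: eq_integral => x _; rewrite vw. Qed.

Lemma eq_p_energy (p : R) g h : (forall x, enorm (g x) = enorm (h x)) ->
  p_energy Omega p g = p_energy Omega p h.
Proof. by move=> vw; apply: eq_integral => x _; rewrite vw. Qed.

(* Boundary points where [w k] is far from [F] have small Hausdorff measure; they are covered by
   balls with small sum of [r ^ (d - 1)], which hardly contribute to the boundary layer. On the
   rest of the layer a gap between [v] and [F] bounds [z = +-(v - w k)] from below, which is
   incompatible with [z] being small in W^{1,p}. *)
Lemma trace_boundary_value (p : R) F v g : (0 < d)%N -> smooth_boundary Omega -> 1 < p ->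
  sobolev Omega p v g -> {within closure Omega, continuous v} -> has_trace Omega p v g F ->
  {within boundary Omega, continuous F} ->
  forall y, boundary Omega y -> v y = F y.
Proof.
move=> d0 sb p1 Sv cv [w [h [cw Sw cvgw cvgF]]] cF y by_.
apply: contrapT => /eqP vF; pose s := Num.sg (v y - F y).
have p0 : 0 <= p by apply: ltW; apply: lt_trans p1.
have sE : s = 1 \/ s = -1.
  by rewrite /s; have [H|H|H] := ltrgt0P (v y - F y);
    [left; rewrite gtr0_sg|right; rewrite ltr0_sg|move: vF; rewrite -subr_eq0 H eqxx].
have sn t : `|s * t| = `|t| by case: sE => ->; rewrite ?mul1r// mulN1r normrN.
(* A quarter of the gap: the variations of v and of F near y and the error of w k off the bad set
   cost less than eta each, which leaves z > eta. *)
pose eta := s * (v y - F y) / 4.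
have eta0 : 0 < eta by rewrite divr_gt0// /s -normrEsg normr_gt0 subr_eq0.
have etaE : s * (v y - F y) = 4 * eta by rewrite /eta [RHS]mulrC divfK.
clearbody s eta.
have cl_y : closure Omega y by case: by_.
have [r1 r10 Hr1] := (within_continuous_rVP _ v).1 cv y cl_y _ eta0.
have [r2 r20 Hr2] := (within_continuous_rVP _ F).1 cF y by_ _ eta0.
pose r := Num.min r1 r2 / 2.
have m12 : 0 < Num.min r1 r2 by rewrite lt_min r10.
have r0 : 0 < r by rewrite divr_gt0.
have rr1 : r < r1.
  by apply: (@lt_le_trans _ _ (Num.min r1 r2)); [rewrite ltr_pdivrMr// ltr_pMr// ltr1n|rewrite ge_min lexx].
have rr2 : r < r2.
  by apply: (@lt_le_trans _ _ (Num.min r1 r2)); [rewrite ltr_pdivrMr// ltr_pMr// ltr1n|rewrite ge_min lexx orbT].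
clearbody r.
have [i [chi [Km [sg [c0 LP]]]]] := boundary_layer_exists oO sb by_ r0.
have [C C0 HC] := chi_partial_bounded LP.
have [[sgE c00 C1chi C1K] [chi01 Km01 chir] Hs [dens0 Hlayer] [N1 HN1]] := LP.
(* The constants close the last inequality. The layer has mass at least c0, the boxes take at most
   C4 (2 eps) = c0 / 2 of it, and the rest carries [ramp_int z] >= th; on the other side C e1 + e1
   is exactly th c0 / 2. *)
pose th := ramp_int (eta / 2); have th0 : 0 < th by rewrite ramp_int_gt0// divr_gt0.
pose C4 := (C + 2) * 4 ^+ d; have C40 : 0 < C4 by rewrite mulr_gt0 ?exprn_gt0// addr_gt0.
pose eps := c0 / (4 * C4); have eps0 : 0 < eps by rewrite divr_gt0// mulr_gt0.
pose e1 := th * c0 / (2 * (C + 1)).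
have C1_0 : 0 < C + 1 by rewrite addr_gt0.
have e10 : 0 < e1 by rewrite divr_gt0// mulr_gt0.
have [dl dl0 Hdl] := L1_small oO OM p1 e10.
have dlp0 : 0 < dl `^ p^-1 by rewrite powR_gt0.
have ce0 : 0 < eta `^ p * eps by rewrite mulr_gt0// powR_gt0.
have [k1 Hk1] := ereal_cvg0_lt cvgw dlp0.
have [k2 Hk2] := ereal_cvg0_lt cvgF ce0.
pose k := maxn k1 k2.
have [mk ek] := sobolev_norm_lt p1 dl0 (Hk1 k (leq_maxl _ _)).
have {Hk2} Fk := Hk2 k (leq_maxr _ _).
have [z [G [Sz zE GE]]] := signed_difference p1 sE Sv (Sw k).
have mz : (p_mass Omega p z < dl%:E)%E.
  by rewrite (@eq_p_mass p z (w k \- v)) => // x; rewrite zE sn distrC.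
have eG : (p_energy Omega p G < dl%:E)%E.
  rewrite (@eq_p_energy p G (h k \- g)) => // x; rewrite GE enormZ enormB /=.
  by case: sE => ->; rewrite ?normrN normr1 mul1r.
have [mfz mfG _ _ wz] := Sz.
have Lz : \int[mu]_(x in Omega) `|z x| < e1 by exact: Hdl.
have LG : \int[mu]_(x in Omega) `|G x ord0 i| < e1.
  apply: Hdl; first exact: measurable_coord_fun.
  by apply: le_lt_trans eG; exact: coord_p_mass_le.
have [Iz IG] := sobolev_integrable oO OM p1 Sz.
have czc : {within closure Omega, continuous z}.
  have -> : z = (fun x => (fun=> s) x * (v x - w k x)) by apply/funext.
  apply: within_continuousM; first by apply: continuous_subspaceT => x; exact: cst_continuous.
  by apply: within_continuousB => //; exact: cw.
have czO x : Omega x -> {for x, continuous z} by exact: continuous_closure_interior.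
pose Bk := [set x | boundary Omega x /\ `|y - x| <= r].
have cBk : compact Bk.
  apply: (subclosed_compact _ boundary_compact); last by move=> x [].
  apply: closedI; apply: compact_rV_closed; [exact: boundary_compact|exact: closed_ball_rV_compact].
pose Ek := [set x | Bk x /\ eta <= `|w k x - F x|].
have cEk : compact Ek.
  apply: compact_superlevel => //.
  have cwF : {within Bk, continuous (fun x => w k x - F x)}.
    apply: within_continuousB; first by apply: continuous_subspaceW (cw k) => x [[]].
    by apply: continuous_subspaceW cF => x [].
  apply/within_continuous_rVP => x Bx e e0.
  have [t t0 Ht] := (within_continuous_rVP _ _).1 cwF x Bx e e0.
  by exists t => // x' Bx' xx'; apply: le_lt_trans (ler_dist_dist _ _) (Ht x' Bx' xx').
have HEk : (hausdorff d.-1 Ek < eps%:E)%E.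
  have ep0 : 0 < eta `^ p by rewrite powR_gt0.
  have := @hausdorff_chebyshev R d d.-1 (boundary Omega) Ek (fun x => `|w k x - F x| `^ p) (eta `^ p)
    (compact_rV_closed cEk) (fun x H => H.1.1) (fun x => powR_ge0 _ _) (ltW ep0)
    (fun x H => ge0_ler_powR p0 (ltW eta0) (normr_ge0 _) H.2).
  move=> /le_lt_trans /(_ Fk); rewrite EFinM => H.
  rewrite ltNge; apply/negP => eH; move: H; rewrite ltNge => /negP; apply.
  by apply: lee_wpmul2l => //; rewrite lee_fin ltW.
have [l [lr lcov lsum]] := hausdorff_cover cEk HEk ltr01.
(* The points outside the covering balls where z is not large. This compact set misses the boundary,
   so a thin enough layer puts no weight on it. *)
pose S := [set x | closure Omega x /\ [/\ `|y - x| <= r, z x <= eta / 2 &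
  forall c, c \in l -> c.2 <= `|c.1 - x|]].
have cS : compact S.
  have cCz := closure_compact.
  have -> : S = [set x | closure Omega x /\ - (eta / 2) <= - z x] `&`
      ([set x | `|y - x| <= r] `&` \bigcap_(c in [set` l]) ~` [set x | `|c.1 - x| < c.2]).
    apply/seteqP; split=> x.
      move=> [clx [yx zx H]]; split; first by split => //; rewrite lerN2.
      by split => // c /= cl; apply/negP; rewrite -leNgt; exact: H.
    move=> [[clx zx] [yx H]]; split => //; split => //; first by rewrite -lerN2.
    by move=> c cl; rewrite leNgt; apply/negP; exact: (H c cl).
  have cN : {within closure Omega, continuous (fun x => - z x)}.
    have -> : (fun x => - z x) = (fun x => (fun=> -1) x * z x) by apply/funext => x; rewrite mulN1r.
    by apply: within_continuousM => //; apply: continuous_subspaceT => x; exact: cst_continuous.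
  have cA := @compact_superlevel R d _ _ (- (eta / 2)) cCz cN.
  apply: (subclosed_compact _ cA); last by move=> x [].
  apply: closedI; first exact: compact_rV_closed.
  apply: closedI; first by apply: compact_rV_closed; exact: closed_ball_rV_compact.
  by apply: closed_bigI => c _; apply: open_closedC; exact: open_ball_rV.
have SB x : S x -> `|y - x| <= r -> ~ boundary Omega x.
  move=> [clx [_ zx nl]] xr bx.
  have [wF|wF] := leP eta `|w k x - F x|.
    have [c cl] := lcov x (conj (conj bx xr) wF).
    by rewrite ltNge => /negP; apply; exact: nl.
  have h1 := Hr1 x clx (le_lt_trans xr rr1); have h2 := Hr2 x bx (le_lt_trans xr rr2).
  have : z x = 4 * eta - s * (v y - v x) + s * (F y - F x) - s * (w k x - F x).
    by rewrite zE -etaE; ring.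
  have := ler_norm (s * (v y - v x)); have := ler_norm (- (s * (F y - F x))).
  have := ler_norm (s * (w k x - F x)); rewrite normrN !sn.
  move: zx wF h1 h2 eta0; clear.
  move: (s * _) (s * _) (s * _) (`|_|) (`|_|) (`|_|) => *; lra.
have [N2 HN2] := Hlayer S cS (fun x Sx => Sx.1) SB.
pose m := maxn N1 N2.
pose lam := density i chi Km sg m.
have lam0 x : 0 <= lam x by exact: dens0.
(* In a covering ball the box function is 1 and the left side is at most 0; elsewhere, where the
   density is nonzero, x is outside [S] and z exceeds eta / 2. *)
have pw x : Omega x ->
    th * (lam x - \sum_(c <- l) box_cut c.1 (const_mx c.2) x * lam x) <= ramp_int (z x) * lam x.
  move=> Ox; have [L0|L0] := eqVneq (lam x) 0.
    by rewrite L0 big1 ?subr0 ?mulr0// => c _; rewrite mulr0.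
  have b0 (c : E * R) : c \in l -> 0 <= box_cut c.1 (const_mx c.2) x * lam x.
    by move=> cl; rewrite mulr_ge0//; have /andP[] := box_cut01 c.1 (const_mx c.2) x.
  have bs0 : 0 <= \sum_(c <- l) box_cut c.1 (const_mx c.2) x * lam x.
    by rewrite big_seq; apply: sumr_ge0.
  have [H|H] := pselect (exists2 c, c \in l & `|c.1 - x| < c.2).
    have [c cl xc] := H.
    apply: (@le_trans _ _ 0); last by rewrite mulr_ge0// ramp_int_ge0.
    rewrite pmulr_rle0// subr_le0 (big_rem c)//=.
    have /andP[c20 _] := lr c cl.
    have -> : box_cut c.1 (const_mx c.2) x = 1.
      apply: box_cut1 => q; first by rewrite mxE.
      by rewrite mxE; have := norm_coord (c.1 - x) q; rewrite !mxE distrC => /le_trans; apply; exact: ltW.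
    rewrite mul1r lerDl big_seq; apply: sumr_ge0 => c' /mem_rem; exact: b0.
  have nz : chi x * partial i (Km m) x != 0.
    by apply: contra L0 => /eqP q0; rewrite /lam /density q0 mulr0 oppr0.
  have yx : `|y - x| <= r.
    by rewrite leNgt; apply/negP => xr; move: nz; rewrite chir ?mul0r ?eqxx// ltW.
  have zx : eta / 2 < z x.
    rewrite ltNge; apply/negP => zx; move: nz; rewrite HN2 ?eqxx ?leq_maxr//.
    split; first exact: subset_closure.
    by split => // c cl; rewrite leNgt; apply/negP => xc; apply: H; exists c.
  apply: (@le_trans _ _ (th * lam x)); first by rewrite ler_pM2l// gerBl.
  by rewrite ler_wpM2r// ramp_int_nondecreasing// ltW.
have [Irl upper] := layer_sobolev_bound oO LP m HC Iz (IG i) czO wz.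
have [clam blam] := density_continuous LP m.
have Ilam : mu.-integrable Omega (EFin \o lam).
  by apply: (@integrableS _ _ _ _ setT) => //; exact: integrable_Cc.
have Ibox (c : E * R) : mu.-integrable Omega (EFin \o (fun x => box_cut c.1 (const_mx c.2) x * lam x)).
  have [cb _ _] := (C1onT i _).1 (C1on_box_cut c.1 (const_mx c.2) i).1.
  apply: (@integrableS _ _ _ _ setT) => //; apply: integrable_Cc.
    by move=> x; exact: (continuousM (cb x) (clam x)).
  by have [M HM] := blam; exists M => x /HM H0; rewrite /lam H0 mulr0.
have [Isum sumE] := Rintegral_sum l mO Ibox.
have lower : th * (\int[mu]_(x in Omega) lam x -
    \sum_(c <- l) \int[mu]_(x in Omega) (box_cut c.1 (const_mx c.2) x * lam x)) <=
    \int[mu]_(x in Omega) (ramp_int (z x) * lam x).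
  rewrite -sumE -RintegralB// -RintegralZl//; last exact: integrableB_fin.
  by apply: le_Rintegral => //; apply: integrableZ_fin => //; exact: integrableB_fin.
have lamc0 : c0 <= \int[mu]_(x in Omega) lam x.
  have := layer_test oO LP m (C1on_cst i 1 openT).
  have -> : \int[mu]_(x in Omega) (1 * density i chi Km sg m x) = \int[mu]_(x in Omega) lam x.
    by apply: eq_Rintegral => x _; rewrite mul1r.
  move=> ->; apply: le_trans (HN1 m (leq_maxl _ _)) _.
  rewrite (_ : (fun x => chi x * 1) = chi); last by apply/funext => x; rewrite mulr1.
  by rewrite le_eqVlt; apply/orP; left; apply/eqP; congr (_ * _); apply: eq_Rintegral => x _; rewrite mulrC.
have boxes : \sum_(c <- l) \int[mu]_(x in Omega) (box_cut c.1 (const_mx c.2) x * lam x) <= c0 / 2.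
  apply: (@le_trans _ _ (\sum_(c <- l) C4 * c.2 ^+ d.-1)).
    rewrite big_seq [leRHS]big_seq; apply: ler_sum => c cl; apply: le_trans (ler_norm _) _.
    have /andP[c20 c21] := lr c cl.
    by apply: (layer_box_bound oO OM LP d0 HC); rewrite c20 ltW.
  rewrite -mulr_sumr; apply: (@le_trans _ _ (C4 * (2 * eps))); first by rewrite ler_pM2l// ltW.
  by rewrite /eps le_eqVlt; apply/orP; left; apply/eqP; field; rewrite gt_eqF.
have up2 : C * \int[mu]_(x in Omega) `|z x| + \int[mu]_(x in Omega) `|G x ord0 i| < th * (c0 / 2).
  apply: (@lt_le_trans _ _ (C * e1 + e1)).
    by apply: ler_ltD => //; rewrite ler_pM2l// ltW.
  rewrite /e1 le_eqVlt; apply/orP; left; apply/eqP; by field; rewrite gt_eqF.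
have := lt_le_trans (le_lt_trans (le_trans lower upper) up2) (lexx _).
rewrite ltr_pM2l//.
move: lamc0 boxes; move: (\int[mu]_(x in Omega) lam x) (\sum_(c <- l) _) => A B; clear => *; lra.
Qed.

End boundary_values.

(** * Properties of the limit *)

Section limit_properties.
Variables (R : realType) (d : nat).
Local Notation E := 'rV[R]_d.
Local Notation mu := (lebesgue_rV R d).
Implicit Types (F Psi v w uinf : E -> R) (K Omega : set E).

Lemma bounded_set_norm Omega : bounded_set Omega -> exists M0 : R, forall x, Omega x -> `|x| <= M0.
Proof.
move=> [M [Mr HM]]; exists (M + 1) => x Ox.
by have := HM (M + 1); apply => //; rewrite ltrDl.
Qed.

Lemma uniform_cvg_seq K (f : nat -> E -> R) (g : E -> R) : {uniform K, f @ \oo --> g} ->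
  forall e : R, 0 < e -> exists N, forall k, (N <= k)%N -> forall x, K x -> `|f k x - g x| < e.
Proof.
move=> fg e e0.
have : nbhs (g : {uniform` K -> R}) [set h | forall y, K y -> `|g y - h y| < e].
  apply/uniform_nbhs; exists [set z : R * R | `|z.1 - z.2| < e]; split => //.
  by rewrite -entourage_ballE; exists e.
move=> /fg[N _ HN]; exists N => k Nk x Kx; rewrite distrC; exact: (HN k Nk).
Qed.

Lemma uniform_limit_continuous K (f : nat -> E -> R) (g : E -> R) :
  (forall e : R, 0 < e -> exists N, forall k, (N <= k)%N -> forall x, K x -> `|f k x - g x| < e) ->
  (exists N, forall k, (N <= k)%N -> {within K, continuous (f k)}) ->
  {within K, continuous g}.
Proof.
move=> fg [N1 cf]; apply/within_continuous_rVP => x Kx e e0.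
have e3 : 0 < e / 3 by rewrite divr_gt0.
have [N2 H2] := fg _ e3; pose k := maxn N1 N2.
have [r r0 Hr] := (within_continuous_rVP _ _).1 (cf k (leq_maxl _ _)) x Kx _ e3.
exists r => // y Ky xy.
have h1 := H2 k (leq_maxr _ _) x Kx; have h2 := H2 k (leq_maxr _ _) y Ky.
have h3 := Hr y Ky xy.
move: h1 h2 h3; rewrite !ltr_norml => /andP[? ?] /andP[? ?] /andP[? ?].
by apply/andP; split; lra.
Qed.

(** A strict failure at one point persists on a ball, which has positive measure. *)
Lemma ae_le_continuous Omega v w : open Omega ->
  (forall x, Omega x -> {for x, continuous v}) -> (forall x, Omega x -> {for x, continuous w}) ->
  {ae mu, forall x, Omega x -> w x <= v x} -> forall x, Omega x -> w x <= v x.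
Proof.
move=> oO cv cw [N [mN N0 HN]] x Ox; rewrite leNgt; apply/negP => vw.
have e0 : 0 < (w x - v x) / 2 by rewrite divr_gt0// subr_gt0.
have [r1 r10 H1] := (continuous_rVP _ _).1 (cv x Ox) _ e0.
have [r2 r20 H2] := (continuous_rVP _ _).1 (cw x Ox) _ e0.
have [r3 r30 H3] := (open_rVP _).1 oO x Ox.
pose r := Num.min r1 (Num.min r2 r3) / 2.
have m0 : 0 < Num.min r1 (Num.min r2 r3) by rewrite !lt_min r10 r20.
have r0 : 0 < r by rewrite divr_gt0.
have rm : r < Num.min r1 (Num.min r2 r3) by rewrite ltr_pdivrMr// ltr_pMr// ltr1n.
have BN : [set y | `|x - y| <= r] `<=` N.
  move=> y /= xy; apply: HN => /=.
  have : `|x - y| < Num.min r1 (Num.min r2 r3) by exact: le_lt_trans rm.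
  rewrite !lt_min => /and3P[y1 y2 y3] /(_ (H3 y y3)).
  have := H1 y y1; have := H2 y y2; rewrite !ltr_norml.
  by move=> /andP[? ?] /andP[? ?]; lra.
have := lebesgue_rV_closed_ball x (ltW r0).
have le1 : (mu [set y : E | (`|x - y| <= r)%R] <= mu N)%E.
  by apply: le_measure; rewrite ?inE//; apply: measurable_closed_ball_rV; exact: ltW.
move=> bE; move: le1; rewrite bE N0 lee_fin leNgt => /negP; apply.
by rewrite exprn_gt0// mulr_gt0.
Qed.

Lemma cvg_pinfty_seq (p : R^nat) : p k @[k --> \oo] --> +oo ->
  forall P : R, exists N, forall k, (N <= k)%N -> P <= p k.
Proof. by move=> /cvgryPge H P; have [N _ HN] := H P; exists N => k /HN. Qed.

Lemma lipschitz_boundary_continuous Omega F : lipschitz_boundary Omega F ->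
  {within boundary Omega, continuous F}.
Proof.
move=> [L HL]; apply/within_continuous_rVP => x bx e e0.
pose C := `|L| * d%:R + 1.
have C0 : 0 < C by rewrite ltr_wpDl// mulr_ge0.
exists (e / C); first by rewrite divr_gt0.
move=> y by_ xy; apply: le_lt_trans (HL x y bx by_) _.
apply: (@le_lt_trans _ _ (C * `|x - y|)); last by rewrite mulrC -ltr_pdivlMr.
apply: (@le_trans _ _ (`|L| * enorm (x - y))).
  by rewrite ler_wpM2r ?enorm_ge0// ler_norm.
apply: (@le_trans _ _ (`|L| * (d%:R * `|x - y|))).
  by rewrite ler_wpM2l// enorm_le_norm.
by rewrite mulrA ler_wpM2r// lerDl.
Qed.

Section obstacle_problem.
Variables (Omega : set E) (F Psi : E -> R) (u : R -> E -> R) (uinf : E -> R).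
Hypothesis d_gt0 : (0 < d)%N.
Hypothesis domOmega : bounded_smooth_domain Omega.
Hypothesis lipF : lipschitz_boundary Omega F.
Hypothesis ctsPsi : {within closure Omega, continuous Psi}.
Hypothesis u_min : forall p : R, 1 < p -> obstacle_minimizer Omega F Psi p (u p).
Hypothesis u_cts : forall p : R, d%:R < p -> {within closure Omega, continuous (u p)}.
Hypothesis u_lim : obstacle_limit Omega u uinf.

Lemma obstacle_limit_facts : [/\ {within closure Omega, continuous uinf},
  forall x, boundary Omega x -> uinf x = F x,
  forall x, Omega x -> Psi x <= uinf x,
  forall x, Omega x -> Psi x < uinf x -> visc_sub uinf x &
  forall x, Omega x -> visc_sub (fun x => - uinf x) x].
Proof.
have [_ oO _ bO sb] := domOmega; have [M0 OM] := bounded_set_norm bO.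
have [p [/cvg_pinfty_seq pinf puni _]] := u_lim.
have U := uniform_cvg_seq (puni _ (closure_compact OM) (@subset_refl _ _)).
have UO (e : R) : 0 < e -> exists N, forall k, (N <= k)%N -> forall x, Omega x -> `|u (p k) x - uinf x| < e.
  by move=> /U[N HN]; exists N => k /HN H x /(@subset_closure _ Omega); exact: H.
(* Beyond this exponent both 1 < p and d < p hold, so the minimizer is available and continuous up
   to the boundary. *)
pose P0 : R := d%:R + 2.
have P01 (q : R) : P0 <= q -> 1 < q /\ d%:R < q.
  have d0 : 0 <= d%:R :> R by exact: ler0n.
  by move: d0; rewrite /P0; move: (d%:R : R) => D D0 h; split; lra.
have [N0 HN0] := pinf P0.
have cuinf : {within closure Omega, continuous uinf}.
  apply: uniform_limit_continuous U _.
  by exists N0 => k /HN0/P01[_]; exact: u_cts.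
have cO (v : E -> R) : {within closure Omega, continuous v} -> forall x, Omega x -> {for x, continuous v}.
  by move=> cv x Ox; exact: (continuous_closure_interior oO cv Ox).
split => //.
- move=> x bx; apply/eqP; rewrite -subr_eq0 -normr_le0 leNgt; apply/negP => h.
  have [N HN] := U _ h; pose k := maxn N0 N.
  have [p1 pd] := P01 _ (HN0 k (leq_maxl _ _)).
  have [g [[Sv tr _] _]] := u_min p1.
  have := trace_boundary_value oO OM d_gt0 sb p1 Sv (u_cts pd) tr
    (lipschitz_boundary_continuous lipF) bx => uF.
  by have := HN k (leq_maxr _ _) x bx.1; rewrite uF distrC ltxx.
- move=> x Ox; rewrite leNgt; apply/negP => h.
  have h0 : 0 < Psi x - uinf x by rewrite subr_gt0.
  have [N HN] := U _ h0; pose k := maxn N0 N.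
  have [p1 pd] := P01 _ (HN0 k (leq_maxl _ _)).
  have [g [[_ _ ae] _]] := u_min p1.
  have := ae_le_continuous oO (cO _ (u_cts pd)) (cO _ ctsPsi) ae Ox.
  have := HN k (leq_maxr _ _) x (subset_closure Ox).
  by rewrite ltr_norml => /andP[_]; lra.
- move=> x Ox xP phi.
  apply: (visc_core oO Ox pinf UO (cO _ ctsPsi x Ox) xP).
  exists P0 => k V r1 r2 /P01[p1 pd] r12 BO CV gV dV PV bV.
  exact: (minimizer_below oO OM p1 (u_min p1) (u_cts pd) r12 BO CV gV dV PV bV).
- move=> x Ox phi.
  have UN (e : R) : 0 < e -> exists N, forall k, (N <= k)%N -> forall x, Omega x ->
      `|(fun x => - u (p k) x) x - (fun x => - uinf x) x| < e.
    move=> /UO[N HN]; exists N => k /HN H z /H /=.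
    by rewrite -[X in X < e -> _]normrN opprB opprK addrC.
  (* From above there is no contact to exclude; a constant just below the value -uinf x plays the
     part of the obstacle. *)
  apply: (@visc_core R d Omega (fun k x => - u (p k) x) (fun x => - uinf x)
    (fun=> - uinf x - 1) p x phi oO Ox pinf UN).
  + exact: cst_continuous.
  + by rewrite ltrBlDr ltrDl.
  exists P0 => k V r1 r2 /P01[p1 pd] r12 BO CV gV dV _ bV.
  exact: (minimizer_above oO OM p1 (u_min p1) (u_cts pd) r12 BO CV gV dV bV).
Qed.

End obstacle_problem.
End limit_properties.

(** * The envelope of cones *)

Section cone_envelope.
Variables (R : realType) (d : nat).
Local Notation E := 'rV[R]_d.
Local Notation e_ i := (delta_mx ord0 i : E).
Implicit Types (x y z : E) (K : E -> R).
Variables (Omega : set E) (F Psi uinf : E -> R).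
Hypothesis d_gt0 : (0 < d)%N.
Hypothesis domOmega : bounded_smooth_domain Omega.
Hypothesis lipF : lipschitz_boundary Omega F.
Hypothesis ctsPsi : {within closure Omega, continuous Psi}.
Hypothesis PsiF : sup (Psi @` boundary Omega) < inf (F @` boundary Omega).
Hypothesis cts_uinf : {within closure Omega, continuous uinf}.
Hypothesis uinf_bd : forall x, boundary Omega x -> uinf x = F x.
Hypothesis uinf_Psi : forall x, Omega x -> Psi x <= uinf x.
Hypothesis uinf_sub : forall x, Omega x -> Psi x < uinf x -> visc_sub uinf x.

Let oO : open Omega. Proof. by case: domOmega. Qed.

Let cptO : compact (closure Omega).
Proof. by have [_ _ _ /bounded_set_norm[M0 OM] _] := domOmega; exact: closure_compact OM. Qed.

Let cptB : compact (boundary Omega).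
Proof. by have [_ _ _ /bounded_set_norm[M0 OM] _] := domOmega; exact: boundary_compact OM. Qed.

Lemma closure_cases x : closure Omega x -> Omega x \/ boundary Omega x.
Proof.
move=> clx; have [Ix|nIx] := pselect (Omega° x); last by right.
by left; exact: interior_subset Ix.
Qed.

(* A point of the closure with maximal coordinate is not interior. *)
Lemma boundary_nonempty : boundary Omega !=set0.
Proof.
have [[x0 Ox0] _ _ _ _] := domOmega.
have ne : closure Omega !=set0 by exists x0; exact: subset_closure.
pose i0 : 'I_d := Ordinal d_gt0.
have [z clz zmax] := @compact_argmax R d (closure Omega) (fun x : E => x ord0 i0) ne cptO
  (fun x _ => @coord_continuous _ _ _ ord0 i0 x).
exists z; split => // Iz.
have [e e0 He] := (nbhs_rVP _ _).1 Iz.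
have Oz : closure Omega (z + (e / 2) *: e_ i0).
  apply/subset_closure/He; rewrite opprD addrA subrr sub0r normrN.
  apply: le_lt_trans (norm_delta_le i0 _) _.
  by rewrite gtr0_norm ?divr_gt0// ltr_pdivrMr// ltr_pMr// ltr1n.
have := zmax _ Oz; rewrite line_coord eqxx mulr1 gerDl leNgt => /negP; apply.
by rewrite divr_gt0.
Qed.

Lemma closure_enorm_bounded : exists2 rho : R, 0 < rho &
  forall x y, closure Omega x -> closure Omega y -> enorm (x - y) < rho.
Proof.
have [M M0 HM] := compact_rV_bounded cptO.
exists (d%:R * (M + M) + 1); first by rewrite ltr_wpDl// mulr_ge0// addr_ge0// ltW.
move=> x y clx cly; apply: le_lt_trans (enorm_le_norm _) _.
rewrite ltr_pwDr// ler_wpM2l// (le_trans (ler_normB _ _))//; apply: lerD; exact: HM.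
Qed.

Lemma boundary_data_bounded : exists2 M : R, 0 < M &
  (forall x, boundary Omega x -> `|F x| <= M) /\ (forall x, closure Omega x -> `|Psi x| <= M).
Proof.
have [M1 M10 H1] := compact_continuous_bounded cptB (lipschitz_boundary_continuous lipF).
have [M2 M20 H2] := compact_continuous_bounded cptO ctsPsi.
exists (M1 + M2); first exact: addr_gt0.
split=> x Hx; first by apply: le_trans (H1 x Hx) _; rewrite lerDl ltW.
by apply: le_trans (H2 x Hx) _; rewrite lerDr ltW.
Qed.

(** A cone of slope 0. It shows that the family is not empty and bounds [Kinf] from above. *)
Lemma cone_family_cst M : (forall x, boundary Omega x -> `|F x| <= M) ->
  (forall x, closure Omega x -> `|Psi x| <= M) -> cone_family Omega F Psi (fun=> M).
Proof.
move=> HF HP; have [y by_] := boundary_nonempty.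
exists y, (0, M); split => //.
- by apply/funext => x; rewrite /cone mul0r add0r.
- by move=> x /HF h; apply: le_trans (ler_norm _) h.
- by move=> x /(@subset_closure _ Omega)/HP h; apply: le_trans (ler_norm _) h.
Qed.

(* At a positive maximum of [uinf - K] the obstacle is inactive, and [K] perturbed to
   [b s + eps s - t s^2], s the distance to the vertex, is a strict supersolution. *)
Lemma uinf_le_cone K x : cone_family Omega F Psi K -> closure Omega x -> uinf x <= K x.
Proof.
move=> [y [[b1 b2] [-> /= by_ b10 KF KP]]] clx; rewrite leNgt; apply/negP => Kx.
have [rho rho0 Hrho] := closure_enorm_bounded.
have cly : closure Omega y by case: by_.
pose tau := uinf x - cone y (b1, b2) x.
have tau0 : 0 < tau by rewrite subr_gt0.
(* For distances s < rho the perturbation s (eps - t s) lies between 0 and tau / 2, so a positive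
   excess of [uinf] survives; moreover 2 t rho = eps is at most the new slope. *)
pose eps := tau / (2 * rho); have eps0 : 0 < eps by rewrite divr_gt0// mulr_gt0.
pose t := eps / (2 * rho); have t0 : 0 < t by rewrite divr_gt0// mulr_gt0.
pose T := cone_test y b2 (b1 + eps) t.
have tr : 2 * t * rho = eps by rewrite /t; field; rewrite gt_eqF.
have er : eps * rho = tau / 2 by rewrite /eps; field; rewrite gt_eqF.
clearbody t eps.
have TE z : T z = cone y (b1, b2) z + enorm (z - y) * (eps - t * enorm (z - y)).
  by rewrite /T cone_testE /cone/=; ring.
have KT z : closure Omega z -> cone y (b1, b2) z <= T z <= cone y (b1, b2) z + tau / 2.
  move=> clz; have := Hrho z y clz cly; have := enorm_ge0 (z - y).
  rewrite TE lerDl lerD2l; move: (enorm _) => s s0 sr.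
  have ts : t * s <= t * rho by rewrite ler_pM2l// ltW.
  have tse : t * s <= eps by rewrite -tr -mulrA mulrCA in ts *; nra.
  apply/andP; split; first by rewrite mulr_ge0// subr_ge0.
  rewrite -er mulrC; apply: ler_pM; rewrite ?subr_ge0 ?(ltW sr)//.
  by rewrite gerBl mulr_ge0// ltW.
have cT : {within closure Omega, continuous T}.
  by apply: continuous_subspaceT; exact: cone_test_continuous.
have cuT : {within closure Omega, continuous (fun z => uinf z - T z)} by exact: within_continuousB.
have [z clz zmax] := compact_argmax_within (ex_intro _ x clx) cptO cuT.
have uTz : 0 < uinf z - T z.
  have := zmax x clx; have /andP[_] := KT x clx; rewrite -/tau.
  by move: tau0; rewrite /tau; move: (cone _ _ _) (T x) (T z) (uinf x) (uinf z) => *; lra.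
have /andP[KTz _] := KT z clz.
have [Oz|bz] := closure_cases clz; last first.
  have := KF z bz; move: uTz; rewrite uinf_bd//.
  by move: KTz; move: (cone _ _ _) (T z) (F z) => *; lra.
have Pz : Psi z < uinf z.
  have := KP z Oz; move: uTz KTz; move: (cone _ _ _) (T z) (Psi z) (uinf z) => *; lra.
(* The vertex is a boundary point, so the test function is smooth at the interior maximum. *)
have zy : z != y by apply/eqP => zy; apply: (boundary_open_notin oO by_); rewrite -zy.
have := uinf_sub Oz Pz (cone_test_C2 b2 (b1 + eps) t zy).
have near_max : \forall w \near z, uinf w - cone_test y b2 (b1 + eps) t w <=
    uinf z - cone_test y b2 (b1 + eps) t z.
  have [r r0 Hr] := (open_rVP _).1 oO z Oz.
  by apply/nbhs_rVP; exists r => // w zw; apply: zmax; apply/subset_closure/Hr.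
move=> /(_ near_max); rewrite leNgt => /negP; apply.
apply: cone_test_laplacian_lt0 => //; first exact: (Hrho z y clz cly).
by rewrite tr lerDr.
Qed.

Local Notation Ki := (Kinf Omega F Psi).

Lemma Kinf_nonempty x : [set K x | K in cone_family Omega F Psi] !=set0.
Proof.
have [M M0 [HF HP]] := boundary_data_bounded.
by exists M, (fun=> M) => //; exact: cone_family_cst.
Qed.

Lemma uinf_le_Kinf x : closure Omega x -> uinf x <= Ki x.
Proof.
move=> clx; apply: lb_le_inf; first exact: Kinf_nonempty.
by move=> _ [K CK <-]; exact: uinf_le_cone.
Qed.

(** The real infimum is a lower bound only for a set bounded from below; here [uinf x] supplies the
    bound. *)
Lemma Kinf_le K x : closure Omega x -> cone_family Omega F Psi K -> Ki x <= K x.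
Proof.
move=> clx CK; apply: ge_inf; last by exists K.
by exists (uinf x) => _ [K' CK' <-]; exact: uinf_le_cone.
Qed.

Lemma Kinf_approx x (e : R) : closure Omega x -> 0 < e ->
  exists2 K, cone_family Omega F Psi K & K x < Ki x + e.
Proof.
move=> clx e0.
have hi : has_inf [set K x | K in cone_family Omega F Psi].
  split; first exact: Kinf_nonempty.
  by exists (uinf x) => _ [K' CK' <-]; exact: uinf_le_cone.
by have [_ [K CK <-] h] := inf_adherent e0 hi; exists K.
Qed.

Lemma cone_continuous y (b : R * R) : continuous (cone y b).
Proof.
move=> x; apply: (@continuousD R R E (fun x => b.1 * enorm (x - y)) (fun=> b.2)).
  by apply: continuousM; [exact: cst_continuous|exact: enorm_dist_continuous].
exact: cst_continuous.
Qed.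

(** An infimum of continuous cones is upper semicontinuous up to the boundary, which closes the
    superlevel set. *)
Lemma Kinf_superlevel_compact (c : R) : compact [set x | closure Omega x /\ c <= Ki x - uinf x].
Proof.
apply: (subclosed_compact _ cptO); last by move=> x [].
move=> x clx.
have Kx : closure Omega x.
  by apply: (@closed_closure _ Omega); move: clx; apply: closure_subset => y [].
split => //; rewrite leNgt; apply/negP => h.
pose e := (c - (Ki x - uinf x)) / 3; have e0 : 0 < e by rewrite divr_gt0// subr_gt0.
have [K CK KKi] := Kinf_approx Kx e0.
have [y [b [KE _ _ _ _]]] := CK.
have [r1 r10 H1] := (continuous_rVP _ _).1 (@cone_continuous y b x) _ e0.
have [r2 r20 H2] := (within_continuous_rVP _ _).1 cts_uinf x Kx _ e0.
have r0 : 0 < Num.min r1 r2 by rewrite lt_min r10.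
have [z [clz cz]] := (closure_rVP _ _).1 clx _ r0.
rewrite lt_min => /andP[z1 z2].
have h1 := H1 z z1; have h2 := H2 z clz z2; have h3 := Kinf_le clz CK.
move: h1 h2 h3 cz KKi h; rewrite KE !ltr_norml => /andP[+ _] /andP[_].
have : c = Ki x - uinf x + 3 * e by rewrite /e; field.
move: (Ki x) (Ki z) (uinf x) (uinf z) (cone y b x) (cone y b z) => *; lra.
Qed.

Lemma Kinf_Psi x : Omega x -> Psi x <= Ki x.
Proof.
move=> Ox; apply: lb_le_inf; first exact: Kinf_nonempty.
by move=> _ [K [y [b [-> _ _ _ KP]]] <-]; exact: KP.
Qed.

Lemma Psi_lt_F y : boundary Omega y -> Psi y < F y.
Proof.
move=> by_; have [M M0 [HF HP]] := boundary_data_bounded.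
apply: (@le_lt_trans _ _ (sup (Psi @` boundary Omega))).
  apply: ub_le_sup; last by exists y.
  by exists M => _ [x bx <-]; apply: le_trans (ler_norm _) (HP x bx.1).
apply: lt_le_trans PsiF _; apply: ge_inf; last by exists y.
by exists (- M) => _ [x /HF + <-]; rewrite ler_norml => /andP[].
Qed.

Lemma Kinf_bd y : boundary Omega y -> Ki y = F y.
Proof.
move=> by_; apply/eqP; rewrite eq_le -{2}(uinf_bd by_) uinf_le_Kinf ?andbT; last by case: by_.
have [L HL] := lipF; have [M M0 [HF HP]] := boundary_data_bounded.
have PF0 : 0 < F y - Psi y by rewrite subr_gt0 Psi_lt_F.
have [r r0 Hr] := (within_continuous_rVP _ _).1 ctsPsi y by_.1 _ PF0.
(* The first term beats the Lipschitz constant of [F]; the second lifts the cone by 2 M at distance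
   r from y, above [Psi], while closer to y continuity gives Psi < F y. *)
pose b1 := `|L| + 2 * M / r.
have Mr0 : 0 <= 2 * M / r by rewrite divr_ge0 ?mulr_ge0// ltW.
have CK : cone_family Omega F Psi (cone y (b1, F y)).
  exists y, (b1, F y); split => //=.
  - by rewrite addr_ge0.
  - move=> x bx; rewrite /cone/= -lerBlDr; apply: le_trans (ler_norm _) _.
    apply: le_trans (HL x y bx by_) _; rewrite ler_wpM2r ?enorm_ge0//.
    by apply: le_trans (ler_norm _) _; rewrite lerDl.
  - move=> x Ox; have clx := subset_closure Ox; rewrite /cone/=.
    have b1e : 0 <= b1 * enorm (x - y) by rewrite mulr_ge0 ?enorm_ge0// addr_ge0.
    have [xr|rx] := ltP `|y - x| r.
      have := Hr x clx xr; rewrite ltr_norml => /andP[+ _].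
      by move: b1e; move: (_ * enorm _) (F y) (Psi x) (Psi y) => *; lra.
    have re : r <= enorm (x - y) by rewrite enormB; apply: le_trans (norm_le_enorm _).
    have : 2 * M <= b1 * enorm (x - y).
      apply: (@le_trans _ _ (2 * M / r * enorm (x - y))).
        by rewrite mulrAC ler_pdivlMr// ler_wpM2l// mulr_ge0// ltW.
      by rewrite ler_wpM2r ?enorm_ge0// lerDr.
    have := HF y by_; have := HP x clx; rewrite !ler_norml => /andP[_ +] /andP[+ _].
    by move: (_ * enorm _) (F y) (Psi x) => *; lra.
by have := Kinf_le by_.1 CK; rewrite /cone/= subrr enorm0 mulr0 add0r.
Qed.

(* Cones almost realizing the infimum at distance at least [r / 2] from the boundary
   have bounded slope, as their value at the vertex is at least [inf F]. *)
Lemma Kinf_continuous x : Omega x -> {for x, continuous Ki}.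
Proof.
move=> Ox; have [M M0 [HF HP]] := boundary_data_bounded.
have [r r0 Hr] := (open_rVP _).1 oO x Ox.
have r20 : 0 < r / 2 by rewrite divr_gt0.
(* A bound for the slopes: over a distance at least r / 2 to its vertex the cone rises from at least
   -M to at most M + 1, the error of approximation being capped at 1. *)
pose L := (2 * M + 1) / (r / 2).
have L0 : 0 < L by rewrite divr_gt0// ltr_wpDl// mulr_ge0// ltW.
have half (z w : E) : `|x - z| < r / 2 -> `|x - w| < r / 2 -> Ki w <= Ki z + L * enorm (w - z).
  move=> xz xw; apply/ler_addgt0Pr => e e0.
  have Oz : Omega z by apply: Hr; apply: lt_trans xz _; rewrite ltr_pdivrMr// ltr_pMr// ltr1n.
  have Ow : Omega w by apply: Hr; apply: lt_trans xw _; rewrite ltr_pdivrMr// ltr_pMr// ltr1n.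
  have clz := subset_closure Oz; have clw := subset_closure Ow.
  pose e' := Num.min e 1; have e'0 : 0 < e' by rewrite lt_min e0 ltr01.
  have [K CK Kz] := Kinf_approx clz e'0.
  have KzM : Ki z <= M := Kinf_le clz (cone_family_cst HF HP).
  have ee : e' <= e by rewrite ge_min lexx.
  have e1 : e' <= 1 by rewrite ge_min lexx orbT.
  have KwK := Kinf_le clw CK.
  have [y [[b1 b2] [KE by_ /= b10 KF _]]] := CK.
  have Fy : - M <= b2.
    have := KF y by_; rewrite KE /cone/= subrr enorm0 mulr0 add0r; apply: le_trans.
    by have := HF y by_; rewrite ler_norml => /andP[].
  have yz : r / 2 <= enorm (z - y).
    apply: le_trans (norm_le_enorm _); rewrite leNgt; apply/negP => h.
    apply: (boundary_open_notin oO by_); apply: Hr.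
    by have := ler_normD (x - z) (z - y); rewrite addrA subrK => h'; lra.
  have bL : b1 <= L.
    rewrite ler_pdivlMr//; apply: (@le_trans _ _ (b1 * enorm (z - y))); first by rewrite ler_wpM2l.
    move: Kz KzM Fy e1; rewrite KE /cone/=; move: (_ * enorm _) (Ki z) => *; lra.
  have tri : enorm (w - y) <= enorm (w - z) + enorm (z - y).
    by have := enormD (w - z) (z - y); rewrite addrA subrK.
  have h1 : b1 * enorm (w - y) <= b1 * enorm (w - z) + b1 * enorm (z - y).
    by rewrite -mulrDr ler_wpM2l.
  have h2 : b1 * enorm (w - z) <= L * enorm (w - z) by rewrite ler_wpM2r// enorm_ge0.
  move: Kz KwK h1 h2 ee; rewrite KE /cone/=.
  move: (_ * enorm _) (_ * enorm _) (_ * enorm _) (_ * enorm _) (Ki z) (Ki w) => *; lra.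
have xx : `|x - x| < r / 2 by rewrite subrr normr0.
have L1 : 0 < L * d%:R by rewrite mulr_gt0// ltr0n.
apply/continuous_rVP => e e0; exists (Num.min (r / 2) (e / (L * d%:R))).
  by rewrite lt_min r20 divr_gt0.
move=> z; rewrite lt_min => /andP[xz xze].
have h1 := half x z xx xz; have h2 := half z x xz xx.
have h3 : L * enorm (x - z) < e.
  apply: (@le_lt_trans _ _ (L * (d%:R * `|x - z|))); first by rewrite ler_pM2l// enorm_le_norm.
  by rewrite mulrA mulrC -ltr_pdivlMr.
rewrite enormB in h1.
rewrite ltr_norml; apply/andP; split.
  by move: h1 h3; move: (_ * enorm _) (Ki x) (Ki z) => *; lra.
by move: h2 h3; move: (_ * enorm _) (Ki x) (Ki z) => *; lra.
Qed.

End cone_envelope.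

(** * The limit and the envelope of cones *)

Theorem theorem2p4 (R : realType) (d : nat) (Omega : set 'rV[R]_d)
    (F Psi : 'rV[R]_d -> R) (u : R -> 'rV[R]_d -> R) (uinf : 'rV[R]_d -> R)
    (d_gt0 : (0 < d)%N)
    (domOmega : bounded_smooth_domain Omega)
    (lipF : lipschitz_boundary Omega F)
    (ctsPsi : {within closure Omega, continuous Psi})
    (PsiF : sup (Psi @` boundary Omega) < inf (F @` boundary Omega))
    (u_min : forall p : R, 1 < p -> obstacle_minimizer Omega F Psi p (u p))
    (u_cts : forall p : R, d%:R < p -> {within closure Omega, continuous (u p)})
    (u_lim : obstacle_limit Omega u uinf) :
  (forall x, closure Omega x -> uinf x <= Kinf Omega F Psi x) /\
  ((forall x, closure Omega x -> uinf x = Kinf Omega F Psi x) <->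
   infinity_harmonic (Omega `\` [set x | Kinf Omega F Psi x = Psi x])
     (Kinf Omega F Psi)).
Proof.
have [cu ubd uPsi usub usup] :=
  obstacle_limit_facts d_gt0 domOmega lipF ctsPsi u_min u_cts u_lim.
have [_ oO _ _ _] := domOmega.
have uK x : closure Omega x -> uinf x <= Kinf Omega F Psi x.
  exact: (uinf_le_Kinf d_gt0 domOmega lipF ctsPsi cu ubd usub).
have KPsi x : Omega x -> Psi x <= Kinf Omega F Psi x.
  exact: (Kinf_Psi d_gt0 domOmega lipF ctsPsi).
have Kbd x : boundary Omega x -> Kinf Omega F Psi x = F x.
  exact: (Kinf_bd d_gt0 domOmega lipF ctsPsi PsiF cu ubd usub).
have Kcont x : Omega x -> {for x, continuous (Kinf Omega F Psi)}.
  exact: (Kinf_continuous d_gt0 domOmega lipF ctsPsi cu ubd usub).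
set W := Omega `\` _.
split=> //; split=> [eqK|[_ Ksub _] x clx].
  (* The touching conditions concern neighbourhoods, so agreement at the single point x would not
     transfer them. *)
  have near_eq x : Omega x -> \forall z \near x, uinf z = Kinf Omega F Psi z.
    move=> Ox; have [r r0 Hr] := (open_rVP _).1 oO x Ox.
    by apply/nbhs_rVP; exists r => // z xz; apply/eqK/subset_closure/Hr.
  split.
  - by apply: continuous_in_subspaceT => x; rewrite inE => -[Ox _]; exact: Kcont.
  - move=> x phi [Ox KP] C2 H.
    have Px : Psi x < uinf x.
      rewrite lt_neqAle (uPsi x Ox) andbT; apply/eqP => h; apply: KP.
      exact: (etrans (esym (eqK x (subset_closure Ox))) (esym h)).
    apply: (usub x Ox Px phi C2); near=> z.
    have -> : uinf z = Kinf Omega F Psi z by near: z; exact: near_eq.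
    by rewrite (eqK x (subset_closure Ox)); near: z; exact: H.
  - move=> x phi [Ox KP] [U [oU Ux] CU] H.
    rewrite -oppr_ge0 -(infinity_laplacianN oU CU Ux).
    have C2N : C2_near x (fun z => - phi z) by exists U; [split|exact: CkN].
    refine (usup x Ox (fun z => - phi z) C2N _).
    near=> z; rewrite !opprK !(addrC (- uinf _)) -[leLHS]opprB -[leRHS]opprB lerN2.
    have -> : uinf z = Kinf Omega F Psi z by near: z; exact: near_eq.
    by rewrite (eqK x (subset_closure Ox)); near: z; exact: H.
apply/eqP; rewrite eq_le uK//=.
have [Ox|bx] := closure_cases clx; last by rewrite ubd ?Kbd.
have [->|KP] := eqVneq (Kinf Omega F Psi x) (Psi x); first exact: uPsi.
have Wx : W x by split => //; exact/eqP.
have oW : open W.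
  apply/open_rVP => y [Oy /eqP Py].
  have Py0 : 0 < (Kinf Omega F Psi y - Psi y) / 2.
    by rewrite divr_gt0// subr_gt0 lt_neqAle eq_sym Py KPsi.
  have cP := continuous_closure_interior oO ctsPsi Oy.
  have [r1 r10 H1] := (continuous_rVP _ _).1 (Kcont y Oy) _ Py0.
  have [r2 r20 H2] := (continuous_rVP _ _).1 cP _ Py0.
  have [r3 r30 H3] := (open_rVP _).1 oO y Oy.
  exists (Num.min r1 (Num.min r2 r3)); first by rewrite !lt_min r10 r20.
  move=> z; rewrite !lt_min => /and3P[z1 z2 z3]; split; first exact: H3.
  move=> /= Kz; have := H1 z z1; have := H2 z z2; rewrite Kz !ltr_norml => /andP[+ _] /andP[_].
  by move: (Kinf _ _ _ y) (Psi y) (Psi z) => *; lra.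
(* A level c > 0 gives room. The set where Kinf - uinf >= c cannot reach the boundary, where both
   are [F], nor the coincidence set, where Kinf = Psi <= uinf; it is thus a compact subset of the
   open set [W]. *)
apply/ler_addgt0Pr => c c0; rewrite -lerBlDl.
pose A := [set x | closure Omega x /\ c <= Kinf Omega F Psi x - uinf x].
have cA : compact A by exact: (Kinf_superlevel_compact d_gt0 domOmega lipF ctsPsi cu ubd usub).
have AW : A `<=` W.
  move=> y [cly cy]; have Ky : uinf y < Kinf Omega F Psi y by rewrite -subr_gt0; exact: lt_le_trans cy.
  have [Oy|by_] := closure_cases cly; last by rewrite ubd ?Kbd ?ltxx in Ky.
  by split => //= KPy; move: Ky; rewrite KPy ltNge uPsi.
(* The pair of subsolutions consists of [Kinf] and [- uinf], whose sum is the difference to be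
   bounded by c. *)
refine (@infinity_comparison R d (Ordinal d_gt0) W A (Kinf Omega F Psi) (fun x => - uinf x) c
  oW cA AW _ _ _ _ _ x Wx).
- by move=> y [Oy _]; exact: Kcont.
- by move=> y [Oy _]; apply: continuousN; exact: (continuous_closure_interior oO cu Oy).
- by move=> y Wy phi C2 H; exact: Ksub.
- by move=> y [Oy _]; exact: usup.
- by move=> y [Oy _] /ltW cy; split => //; exact: subset_closure.
Unshelve. all: by end_near.
Qed.
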